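(* Let $(X,d,\mu)$ be a space of homogeneous type satisfying: there are $\epsilon_0>0$ and a constant $C(c,K)$ with $$c^{j\epsilon_0}\mu(B(x,t))\le\mu(B(x,c^jt))\le C(c,K)^j\mu(B(x,t))\quad\text{for all }t>0,\ x\in X,\ j\in\mathbb N.$$ Let $T_{j,1},T_{j,2}$ $(j=1,\dots,m)$ be Calderón–Zygmund operators on $X$ which are bounded on $L^2(X)$, and for a function $b$ let $\mathcal T_b=\sum_{j=1}^m T_{j,1}M_bT_{j,2}$, where $M_b$ is multiplication by $b$. Let $1<p<\infty$. If $g\in L^p(X)$ and $\mathcal T_1(g)=0$, then for any $b\in BMO(X)$ we have $\mathcal T_b(g)\in L^p(X)$. Moreover, $$\|\mathcal T_b(g)\|_{L^p(X)}\le C_p\Big(\sum_{j=1}^m\|T_{j,1}\|\Big)\Big(\sum_{j=1}^m\|T_{j,2}\|\Big)\|g\|_{L^p}\|b\|_*,$$ where $C_p$ is a constant independent of $g$ and $b$.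
   Context: Space of homogeneous type: a locally compact Hausdorff space $X$ with a positive regular Borel measure $\mu$ and a family of basic open sets $\{B(x,r):x\in X,r>0\}$ such that for some constants $c>1,K>1$: (1) $x\in B(x,r)$; (2) $B(x,r_1)\subset B(x,r_2)$ if $0<r_1\le r_2$; (3) $0<\mu(B(x,r))<\infty$; (4) $X=\bigcup_{r>0}B(x,r)$; (5) $\mu(B(x,cr))\le K\mu(B(x,r))$; (6) if $B(x_1,r_1)\cap B(x_2,r_2)\neq\emptyset$ and $r_1\ge r_2$ then $B(x_2,r_2)\subset B(x_1,cr_1)$. Also $\mu(\{x\})=0$ for all $x$. Writing $(X,d,\mu)$ means the structure is given by a quasi-metric $d$, $B(x,r)=\{y:d(x,y)<r\}$. $m_B(f)$ is the mean of $f$ on $B$. $BMO(X)$: $f\in L^1_{\rm loc}(X)$ with $\|f\|_*=\sup_B\frac1{\mu(B)}\int_B|f-m_B(f)|\,d\mu<\infty$ (supremum over all balls). Let $\lambda(x,y)=\mu(B(x,d(x,y)))$. A standard kernel is $K:X\times X\setminus\{x=y\}\to\mathbb C$ such that for some $\epsilon>0$, $0<C<\infty$: $|K(x,y)|\le C/\lambda(x,y)$ for $x\ne y$, and $|K(x,y)-K(x',y)|+|K(y,x)-K(y,x')|\le (d(x,x')/d(x,y))^\epsilon C/\lambda(x,y)$ whenever $d(x,y)\ge c\,d(x,x')$. $\Lambda_\delta$ is the space of Hölder continuous functions of order $\delta$ on $X$ with bounded support, $\Lambda_\delta'$ its dual. A Calderón–Zygmund (singular integral) operator is a continuous linear $T:\Lambda_\delta\to\Lambda_\delta'$,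 for some $\delta>0$, associated to a standard kernel $K$: $K$ is locally integrable off the diagonal and $\langle Tf,g\rangle=\iint K(x,y)f(y)g(x)\,d\mu(y)\,d\mu(x)$ for $f,g\in\Lambda_\delta$ with supports separated by a positive distance; the identity operator is allowed among the $T_{j,i}$. Such operators bounded on $L^2$ are bounded on $L^p$, $1<p<\infty$. $\|T_{j,i}\|$ denotes the operator norm on $L^p(X)$. *)

(* Defs.v *)
From HB Require Import structures.
From mathcomp Require Import all_boot all_order all_algebra.
From mathcomp Require Import complex.
From mathcomp Require Import all_classical all_reals all_analysis.

Set Implicit Arguments.
Unset Strict Implicit.
Unset Printing Implicit Defensive.

Import Order.TTheory GRing.Theory Num.Theory.
Import numFieldNormedType.Exports.

Local Open Scope classical_set_scope.
Local Open Scope ring_scope.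
Local Open Scope complex_scope.

(* MathComp-Analysis integrates (extended) real-valued functions only:
   complex-valued functions are handled through their real and imaginary
   parts, and their modulus is the real number [Normc.normc z]. *)

Section ComplexIntegral.
Context (disp : measure_display) (T : measurableType disp) (R : realType).

Definition cmeasurable (D : set T) (f : T -> R[i]) : Prop :=
  measurable_fun D (fun x => complex.Re (f x)) /\ measurable_fun D (fun x => complex.Im (f x)).

Variable mu : {measure set T -> \bar R}.

Definition cintegrable (D : set T) (f : T -> R[i]) : Prop :=
  mu.-integrable D (fun x => (complex.Re (f x))%:E) /\
  mu.-integrable D (fun x => (complex.Im (f x))%:E).

Definition cint (D : set T) (f : T -> R[i]) : R[i] :=
  (\int[mu]_(x in D) complex.Re (f x)) +i* (\int[mu]_(x in D) complex.Im (f x)).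

Definition cLnorm (p : R) (f : T -> R[i]) : \bar R :=
  Lnorm mu p%:E (fun x => (Normc.normc (f x))%:E).

Definition inLp (p : R) (f : T -> R[i]) : Prop :=
  cmeasurable setT f /\ (cLnorm p f < +oo)%E.

End ComplexIntegral.

Notation borel X := (g_sigma_algebraType (@open X)).

Section HomogeneousType.
Context (R : realType) (X : ptopologicalType).
Variables (d : X -> X -> R) (mu : {measure set (borel X) -> \bar R}).

Definition qball (x : X) (r : R) : set X := [set y | d x y < r].

Definition quasi_metric : Prop :=
  [/\ forall x y, 0 <= d x y,
      forall x y, d x y = 0 <-> x = y,
      forall x y, d x y = d y x &
      exists2 A : R, 1 <= A & forall x y z, d x y <= A * (d x z + d z y)].

Definition regular_borel : Prop :=
  [/\ forall C : set X, compact C -> (mu C < +oo)%E,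
      forall A : set (borel X), measurable A ->
        mu A = ereal_inf [set mu U | U in [set U : set X | open U /\ A `<=` U]] &
      forall A : set (borel X), measurable A ->
        mu A = ereal_sup [set mu C | C in [set C : set X | compact C /\ C `<=` A]]].

Record homogeneous_type (c K : R) : Prop := {
  ht_locally_compact : locally_compact [set: X];
  ht_hausdorff : hausdorff_space X;
  ht_regular : regular_borel;
  ht_quasi_metric : quasi_metric;
  ht_c_gt1 : 1 < c;
  ht_K_gt1 : 1 < K;
  ht_open : forall x r, 0 < r -> open (qball x r);
  ht_basis : forall x (U : set X), nbhs x U ->
    exists2 r, 0 < r & qball x r `<=` U;
  ht_center : forall x r, 0 < r -> qball x r x;
  ht_mono : forall x r1 r2, 0 < r1 -> r1 <= r2 -> qball x r1 `<=` qball x r2;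
  ht_finite : forall x r, 0 < r ->
    (0 < mu (qball x r))%E /\ (mu (qball x r) < +oo)%E;
  ht_cover : forall x, \bigcup_(r in [set r : R | 0 < r]) qball x r = [set: X];
  ht_doubling : forall x r, 0 < r ->
    (mu (qball x (c * r)) <= K%:E * mu (qball x r))%E;
  ht_engulf : forall x1 x2 r1 r2, 0 < r2 -> r2 <= r1 ->
    qball x1 r1 `&` qball x2 r2 !=set0 ->
    qball x2 r2 `<=` qball x1 (c * r1);
  ht_no_atom : forall x, mu [set x] = 0%E
}.

Definition loc_integrable (f : X -> R[i]) : Prop :=
  forall x r, 0 < r -> cintegrable mu (qball x r) f.

Definition ball_mean (f : X -> R[i]) (x : X) (r : R) : R[i] :=
  cint mu (qball x r) f / (fine (mu (qball x r)))%:C.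

Definition oscillation (f : X -> R[i]) (x : X) (r : R) : \bar R :=
  (((fine (mu (qball x r)))^-1)%:E *
   \int[mu]_(y in qball x r) (Normc.normc (f y - ball_mean f x r))%:E)%E.

Definition bmo_norm (f : X -> R[i]) : \bar R :=
  ereal_sup [set oscillation f z.1 z.2 | z in [set z : X * R | 0 < z.2]].

Definition bmo (f : X -> R[i]) : Prop :=
  loc_integrable f /\ (bmo_norm f < +oo)%E.

Definition lam (x y : X) : R := fine (mu (qball x (d x y))).

Definition standard_kernel (c : R) (k : X -> X -> R[i]) : Prop :=
  exists eps C : R, [/\ 0 < eps, 0 < C,
    forall x y, x <> y -> Normc.normc (k x y) <= C / lam x y &
    forall x x' y, x <> y -> c * d x x' <= d x y ->
      Normc.normc (k x y - k x' y) + Normc.normc (k y x - k y x')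
        <= (d x x' / d x y) `^ eps * (C / lam x y)].

Definition bounded_supp (f : X -> R[i]) : Prop :=
  exists x r, forall y, ~ qball x r y -> f y = 0.

Definition holder_bound (delta M : R) (f : X -> R[i]) : Prop :=
  forall x y, Normc.normc (f x - f y) <= M * d x y `^ delta.

Definition Lambda (delta : R) (f : X -> R[i]) : Prop :=
  (exists M, holder_bound delta M f) /\ bounded_supp f.

(* A linear map T from Lambda_delta to its dual is given by the bilinear form
   [T f g] = <Tf, g>; only its values on Lambda_delta matter. *)
Definition cz_form := (X -> R[i]) -> (X -> R[i]) -> R[i].

Definition bilinear_form (delta : R) (T : cz_form) : Prop :=
  (forall (a : R[i]) f f' g, Lambda delta f -> Lambda delta f' ->
     Lambda delta g -> T (fun x => a * f x + f' x) g = a * T f g + T f' g) /\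
  (forall (a : R[i]) f g g', Lambda delta f -> Lambda delta g ->
     Lambda delta g' -> T f (fun x => a * g x + g' x) = a * T f g + T f g').

(* Continuity from Lambda_delta to its dual, where Lambda_delta is the inductive
   limit, over all balls B, of the Banach spaces of functions of Lambda_delta
   vanishing outside B, normed by the sup norm and the Hoelder constant. *)
Definition continuous_form (delta : R) (T : cz_form) : Prop :=
  forall x r x' r', exists M : R, forall f g (a b : R),
    (forall y, ~ qball x r y -> f y = 0) ->
    (forall y, ~ qball x' r' y -> g y = 0) ->
    (forall y, Normc.normc (f y) <= a) -> holder_bound delta a f ->
    (forall y, Normc.normc (g y) <= b) -> holder_bound delta b g ->
    Normc.normc (T f g) <= M * a * b.

Definition loc_integrable_offdiag (k : X -> X -> R[i]) : Prop :=
  cmeasurable (T := (borel X * borel X)%type) [set z | z.1 <> z.2]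
    (fun z => k z.1 z.2) /\
  forall A : set (X * X), compact A -> (forall x, ~ A (x, x)) ->
    (\int[mu]_x \int[mu]_(y in [set y | A (x, y)]) (Normc.normc (k x y))%:E
       < +oo)%E.

Definition separated_supp (f g : X -> R[i]) : Prop :=
  exists2 eta : R, 0 < eta &
    forall x y, f x <> 0 -> g y <> 0 -> eta <= d x y.

Definition associated (delta : R) (T : cz_form) (k : X -> X -> R[i]) : Prop :=
  forall f g, Lambda delta f -> Lambda delta g -> separated_supp f g ->
    T f g = cint mu setT (fun x => cint mu setT (fun y => k x y * f y) * g x).

(* For large delta the space Lambda_delta may reduce to 0 (in R^n with delta > 1
   for instance), and a form on Lambda_delta then does not determine an operator
   on L^2.  An exponent is admissible when Lambda_delta contains cut-off
   functions of all balls, which makes Lambda_delta dense in every L^p,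
   1 <= p < oo; all small enough exponents are admissible. *)
Definition admissible_exponent (delta : R) : Prop :=
  0 < delta /\
  exists2 A : R, 1 <= A & forall x r, 0 < r -> exists2 phi, Lambda delta phi &
    (forall y, qball x r y -> phi y = 1) /\
    (forall y, ~ qball x (A * r) y -> phi y = 0).

(* The identity operator, <f, g> = \int f g, is an instance, with kernel 0. *)
Definition calderon_zygmund (c delta : R) (T : cz_form) : Prop :=
  [/\ admissible_exponent delta, bilinear_form delta T,
      continuous_form delta T &
      exists k, [/\ standard_kernel c k, loc_integrable_offdiag k &
                    associated delta T k]].

Definition represents (delta : R) (T : cz_form) (f u : X -> R[i]) : Prop :=
  forall g, Lambda delta g -> T f g = cint mu setT (fun x => u x * g x).

Definition bounded_L2 (delta : R) (T : cz_form) : Prop :=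
  exists C : R, forall f, Lambda delta f ->
    exists u, [/\ inLp mu 2 u, represents delta T f u &
                  (cLnorm mu 2 u <= C%:E * cLnorm mu 2 f)%E].

(* u is (a version of) the image of f under the extension by density of T
   to L^p. *)
Definition Lp_image (p delta : R) (T : cz_form) (f u : X -> R[i]) : Prop :=
  [/\ inLp mu p f, inLp mu p u &
      exists f_ u_ : nat -> X -> R[i],
        [/\ forall n, Lambda delta (f_ n),
            forall n, inLp mu p (u_ n) /\ represents delta T (f_ n) (u_ n),
            cLnorm mu p (fun x => f_ n x - f x) @[n --> \oo] --> 0%E &
            cLnorm mu p (fun x => u_ n x - u x) @[n --> \oo] --> 0%E]].

Definition Lp_opnorm (p delta : R) (T : cz_form) : \bar R :=
  ereal_sup [set cLnorm mu p fu.2 | fu in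
    [set fu : (X -> R[i]) * (X -> R[i]) |
       Lp_image p delta T fu.1 fu.2 /\ (cLnorm mu p fu.1 <= 1)%E]].

Definition transpose_image (delta : R) (T : cz_form) (phi psi : X -> R[i]) : Prop :=
  inLp mu 2 psi /\
  forall f, Lambda delta f -> T f phi = cint mu setT (fun x => f x * psi x).

(* If h is in L^p and b in BMO, then b h need not be in any L^q.  The image of
   f = b h under T is understood by duality, <Tf, phi> = \int f (T^t phi) for
   phi in Lambda_delta, where the right-hand side is required to converge
   absolutely; T f is then a locally integrable function.  For f in L^p this
   gives back the extension by density. *)
Definition dual_image (delta : R) (T : cz_form) (f u : X -> R[i]) : Prop :=
  loc_integrable u /\
  forall phi, Lambda delta phi -> exists2 psi, transpose_image delta T phi psi &
    cintegrable mu setT (fun x => f x * psi x) /\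
    cint mu setT (fun x => u x * phi x) = cint mu setT (fun x => f x * psi x).

(* F is (a version of) \sum_j T1_j (b * T2_j g). *)
Definition Tb_image (p : R) (m : nat) (delta1 delta2 : 'I_m -> R)
    (T1 T2 : 'I_m -> cz_form) (b g F : X -> R[i]) : Prop :=
  exists h u : 'I_m -> X -> R[i],
    [/\ forall j, Lp_image p (delta2 j) (T2 j) g (h j),
        forall j, dual_image (delta1 j) (T1 j) (fun x => b x * h j x) (u j) &
        forall x, F x = \sum_(j < m) u j x].

End HomogeneousType.

(* Main.v *)
(* If T_1 g = sum_j T_{j,1} h_j = 0 with h_j = T_{j,2} g, then T_b g = sum_j [T_{j,1}, b] h_j, so that the theorem
   reduces to the bound |[T, b] h|_p <= C |b|_* |h|_p of Coifman, Rochberg and Weiss.  By the Fefferman-Stein sharp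
   maximal inequality it suffices to compare [T, b] h with a constant on each ball B; there it is the sum of
   T ((b - b_B) h 1_{cB}), of T ((b - b_B) h 1_{X \ cB}), constant up to the regularity of the kernel, and of
   (b_B - b) T h, and the John-Nirenberg inequality bounds the three by |b|_* (M_s h + M_s (T h)) with 1 < s < p.
   The growth of the measure of balls makes mu X infinite, hence gives Whitney balls, and puts b T h in all L^q for
   test functions h, which the sharp maximal inequality requires qualitatively.
   A complex operator is split into two operators S on real functions, each with a transpose S'.  As b h need not
   be in any L^q, its image is tested against phi through S' phi. *)
Require Import Defs.
From HB Require Import structures.
From mathcomp Require Import all_boot all_order all_algebra.
From mathcomp Require Import complex finmap.
From mathcomp Require Import all_classical all_reals all_analysis measurable_realfun.
From mathcomp Require Import ring lra.

Set Implicit Arguments.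
Unset Strict Implicit.
Unset Printing Implicit Defensive.

Import Order.TTheory GRing.Theory Num.Theory.
Import numFieldNormedType.Exports.

Local Open Scope classical_set_scope.
Local Open Scope ring_scope.

(** * Nonnegative integrals and Lebesgue spaces *)

(** Images under the operators are relations, determined up to null sets; each is pinned down by its
    integrals against Hoelder functions, which separate locally integrable functions. The operators
    are given only as forms on Hoelder functions: the transposes come from a Riesz representation,
    and transposing twice extends the operators to L^2. The sharp maximal inequality also serves
    before the commutator: it bounds S on L^q for q > 2 through M_2, and duality then gives 1 < q <
    2, with no Calderon-Zygmund decomposition. Test functions form a class stable under
    multiplication by BMO functions, so that S (b h) makes sense in L^2 before any estimate. A
    positive upper bound of the BMO norm, arbitrarily close to it, replaces the norm, which may be
    0. The constants of the commutator estimates depend on the operators and are not compared with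
    their norms: the two sums of norms enter the final inequality through division by a positive
    lower bound of their product. *)

Section nonneg_integral.
Context (dd : measure_display) (T : measurableType dd) (R : realType) (mu : {measure set T -> \bar R}).

Lemma nneseries_le (u : nat -> \bar R) (M : \bar R) : (forall n, 0 <= u n)%E ->
  (forall n, \sum_(0 <= i < n) u i <= M)%E -> (\sum_(0 <= i <oo) u i <= M)%E.
Proof.
move=> u0 uM; apply: lime_le; first by apply: is_cvg_nneseries => n _ _; exact: u0.
by apply: nearW => n; exact: uM.
Qed.

Lemma geometric_sum_le (z : R) n : 0 <= z < 1 -> \sum_(0 <= i < n) z ^+ i <= (1 - z)^-1.
Proof.
move=> /andP[z0 z1]; have z1' : 0 < 1 - z by rewrite subr_gt0.
rewrite big_mkord -[leRHS]mul1r ler_pdivlMr//.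
have h := subrX1 z n.
have -> : (\sum_(i < n) z ^+ i) * (1 - z) = 1 - z ^+ n by rewrite mulrC -opprB mulNr -h opprB.
by rewrite gerBl exprn_ge0.
Qed.

Lemma limn_einf_ge (u : nat -> \bar R) (z : \bar R) N0 :
  (forall n, (N0 <= n)%N -> (z <= u n)%E) -> (z <= limn_einf u)%E.
Proof.
move=> zu; rewrite limn_einf_lim; apply: lime_ge; first exact: is_cvg_einfs.
exists N0 => // n /= Nn; apply: le_ereal_inf_tmp => _ [k /= nk <-].
by apply: zu; exact: leq_trans nk.
Qed.

(** The form of Fatou's lemma that level sums require: they do not converge to the function, they
    only dominate it in the lower limit up to a constant, and their integrals are controlled for
    large indices only. *)
Lemma fatou_einf_le (f_ : nat -> T -> \bar R) (f : T -> \bar R) (M : \bar R) N0 :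
  (forall n, measurable_fun setT (f_ n)) -> (forall n x, 0 <= f_ n x)%E ->
  measurable_fun setT f -> (forall x, 0 <= f x)%E ->
  {ae mu, forall x, (f x <= limn_einf (f_^~ x))%E} ->
  (forall n, (N0 <= n)%N -> (\int[mu]_x f_ n x <= M)%E) -> (\int[mu]_x f x <= M)%E.
Proof.
move=> mf_ f_0 mf f0 fcv fM.
have einf_ge0 x : (0 <= limn_einf (f_^~ x))%E by apply: (@limn_einf_ge _ _ 0).
have meinf : measurable_fun setT (fun x => limn_einf (f_^~ x)).
  apply: (eq_measurable_fun (fun x => - limn_esup (fun n => - f_ n x))%E).
    by move=> x _; rewrite -limn_einfN; congr limn_einf; apply/funext => n /=; rewrite oppeK.
  apply: measurableT_comp => //; apply: measurable_fun_limn_esup => n.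
  exact: measurableT_comp.
apply: (@le_trans _ _ (\int[mu]_x limn_einf (f_^~ x))%E).
  by apply: ae_ge0_le_integral => //; apply: filterS fcv => x fx _.
apply: (le_trans (fatou mu measurableT mf_ (fun n x _ => f_0 n x))).
rewrite limn_einf_lim; apply: lime_le; first exact: is_cvg_einfs.
(* The infimum over the indices from [n] on is compared with the single index [maxn n N0], where the
   bound is available. *)
apply: nearW => n; apply: (le_trans _ (fM (maxn n N0) (leq_maxr _ _))).
by apply: ereal_inf_lbound; exists (maxn n N0) => //=; rewrite leq_maxl.
Qed.

Lemma fatou_le (f_ : nat -> T -> \bar R) (f : T -> \bar R) (M : \bar R) :
  (forall n, measurable_fun setT (f_ n)) -> (forall n x, 0 <= f_ n x)%E ->
  measurable_fun setT f -> (forall x, 0 <= f x)%E ->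
  {ae mu, forall x, f_ n x @[n --> \oo] --> f x} ->
  (forall n, \int[mu]_x f_ n x <= M)%E -> (\int[mu]_x f x <= M)%E.
Proof.
move=> mf_ f_0 mf f0 fcv fM; apply: (@fatou_einf_le f_ f M 0) => //.
by apply: filterS fcv => x fx; rewrite (cvg_limn_einf_sup fx).1.
Qed.

Lemma measurable_set_lt (f g : T -> R) : measurable_fun setT f -> measurable_fun setT g ->
  measurable [set x | f x < g x].
Proof.
move=> mf mg; rewrite -[X in measurable X]setTI.
have := @measurable_lte _ _ _ setT measurableT (EFin \o f) (EFin \o g).
by under [X in _ -> _ -> _ (_ `&` X)]eq_set do rewrite lte_fin; apply; exact/measurable_EFinP.
Qed.

Lemma measurable_lt_nat (f g : T -> R) : measurable_fun setT f -> measurable_fun setT g ->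
  measurable_fun setT (fun x => (f x < g x)%R%:R : R).
Proof.
move=> mf mg; rewrite (_ : (fun x => _) = \1_[set x | f x < g x]).
  by apply: measurable_indic; exact: measurable_set_lt.
by apply/funext => x; rewrite indicE; case h : (_ < _)%R; [rewrite mem_set|rewrite memNset//= h].
Qed.

Lemma ae_fin_of_integral (f : T -> \bar R) : measurable_fun setT f -> (forall x, 0 <= f x)%E ->
  (\int[mu]_x f x < +oo)%E -> {ae mu, forall x, (f x < +oo)%E}.
Proof.
move=> mf f0 fy.
have fint : mu.-integrable setT f.
  by apply/integrableP; split => //; under eq_integral do rewrite gee0_abs//.
by apply: filterS (integrable_ae measurableT fint) => x /(_ I); rewrite ge0_fin_numE.
Qed.

End nonneg_integral.

Lemma powR_injr (R : realType) (p a b : R) : 0 < p -> 0 <= a -> 0 <= b -> a `^ p = b `^ p -> a = b.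
Proof.
move=> p0 a0 b0 /(congr1 (fun z => z `^ p^-1)).
by rewrite -!powRrM mulfV ?gt_eqF// !powRr1.
Qed.

(** The interval of radius [e] around l^p is pulled back by the p-th root, which inverts the power
    on nonnegative numbers only; a nonpositive left end is therefore a separate case. *)
Lemma cvg_powRn (R : realType) (u : nat -> R) (l p : R) : 0 < p -> (forall n, 0 <= u n) -> 0 <= l ->
  u n @[n --> \oo] --> l -> u n `^ p @[n --> \oo] --> l `^ p.
Proof.
move=> p0 u0 l0 ul; apply/cvgrPdist_le => e e0.
have pV : 0 < p^-1 by rewrite invr_gt0.
have K x : 0 <= x -> (x `^ p^-1) `^ p = x by move=> x0; rewrite -powRrM mulVf ?gt_eqF// powRr1.
have lE : l = (l `^ p) `^ p^-1 by rewrite -powRrM mulfV ?gt_eqF// powRr1.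
have lp0 := powR_ge0 l p.
have lb : l < (l `^ p + e) `^ p^-1.
  by rewrite {1}lE gt0_ltr_powR ?nnegrE ?addr_ge0 ?(ltW e0)// ltrDl.
have nb : \forall n \near \oo, u n < (l `^ p + e) `^ p^-1 by apply: (cvgr_lt l).
have na : \forall n \near \oo, l `^ p - e <= u n `^ p.
  have [h|h] := leP (l `^ p - e) 0; first by apply: nearW => n; rewrite (le_trans h) ?powR_ge0.
  have la : (l `^ p - e) `^ p^-1 < l.
    by rewrite {2}lE gt0_ltr_powR ?nnegrE ?(ltW h)// gtrBl.
  have : \forall n \near \oo, (l `^ p - e) `^ p^-1 < u n by apply: (cvgr_gt l).
  apply: filterS => n hn; rewrite -(K _ (ltW h)).
  by apply: ge0_ler_powR; rewrite ?nnegrE ?powR_ge0 ?(ltW p0) ?(ltW hn).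
near=> n; rewrite ler_distlC; apply/andP; split; first by near: n.
rewrite -(K (l `^ p + e)) ?addr_ge0 ?(ltW e0)//.
apply: ge0_ler_powR; rewrite ?nnegrE ?powR_ge0 ?(ltW p0)// ltW//; near: n.
exact: nb.
Unshelve. all: by end_near. Qed.

(** * A discrete layer cake formula *)

Section layer_cake.
Context (dd : measure_display) (T : measurableType dd) (R : realType) (mu : {measure set T -> \bar R}).
Context (L : R) (L_gt1 : 1 < L).

(** The level L^(i - N) with a natural index: for i < 2N the exponents run from -N to N - 1. *)
Definition dlevel N i : R := L ^+ i / L ^+ N.

Lemma dlevel_gt0 N i : 0 < dlevel N i.
Proof. by rewrite divr_gt0 ?exprn_gt0 ?(lt_trans ltr01). Qed.

Lemma powR_gt1 p : 0 < p -> 1 < L `^ p.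
Proof.
move=> p0; have := @gt0_ltr_powR R p p0 1 L; rewrite powR1 !nnegrE; apply => //.
exact: le_trans ler01 (ltW L_gt1).
Qed.

Lemma dlevelS N i : dlevel N i.+1 = L * dlevel N i. Proof. by rewrite /dlevel exprS mulrA. Qed.

Lemma powR_dlevelS p N i : dlevel N i.+1 `^ p = L `^ p * dlevel N i `^ p.
Proof. by rewrite dlevelS powRM// ltW ?dlevel_gt0 ?(lt_trans ltr01). Qed.

(* Discrete layer cake: up to constants, this sum over the levels L^k is t^p once N is large. *)
Definition level_sum p N (t : \bar R) : R := \sum_(i < N.*2) dlevel N i `^ p * ((dlevel N i)%:E < t)%E%:R.

(** Only the levels below [t] count. Their powers form a geometric progression of ratio q = L^p,
    whose sum is at most q / (q - 1) times its last term, itself below t^p. *)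
Lemma level_sum_le p N (t : R) : 0 < p -> 0 <= t -> level_sum p N t%:E <= L `^ p / (L `^ p - 1) * t `^ p.
Proof.
move=> p0 t0; set q := L `^ p.
have q1 : 1 < q by exact: powR_gt1.
have q10 : 0 < q - 1 by rewrite subr_gt0.
have q0 : 0 < q by rewrite (lt_trans ltr01).
(* The induction carries two bounds: when the new level lies below [t], it is the first one, by the
   next level, that yields the second. *)
have key n : \sum_(i < n) dlevel N i `^ p * ((dlevel N i)%:E < t%:E)%E%:R <= dlevel N n `^ p / (q - 1) /\
   \sum_(i < n) dlevel N i `^ p * ((dlevel N i)%:E < t%:E)%E%:R <= q / (q - 1) * t `^ p.
  elim: n => [|n [IH1 IH2]].
    by rewrite big_ord0; split; rewrite ?mulr_ge0 ?powR_ge0 ?invr_ge0 ?(ltW q10) ?(ltW q0).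
  rewrite big_ord_recr/= powR_dlevelS -/q; set S := \sum_(i < n) _ in IH1 IH2 *.
  set l := dlevel N n `^ p in IH1 *; have l0 : 0 <= l := powR_ge0 _ _.
  have lq : l / (q - 1) + l = q * l / (q - 1) by field; rewrite gt_eqF.
  rewrite lte_fin; have [lt|tl] := ltP (dlevel N n) t; rewrite ?mulr1 ?mulr0 ?addr0; split => //.
  - by rewrite -lq lerD2r.
  - apply: (@le_trans _ _ (q * l / (q - 1))); first by rewrite -lq lerD2r.
    rewrite mulrAC; apply: ler_wpM2l; first by rewrite divr_ge0 ?ltW.
    by apply: ge0_ler_powR; rewrite ?nnegrE ?(ltW p0) ?(ltW (dlevel_gt0 _ _))// ltW.
  - by apply: le_trans IH1 _; rewrite -lq lerDl.
exact: (key N.*2).2.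
Qed.

(** The largest level below [A] is at least A / L, so its term alone suffices. A real [A] stands for
    [t], which may be infinite; [N0] makes the levels reach from below [A] up to [A]. *)
Lemma level_sum_ge p (A : R) (t : \bar R) : 0 < p -> 0 < A -> (A%:E <= t)%E ->
  exists N0, forall N, (N0 <= N)%N -> A `^ p <= L `^ p * level_sum p N t.
Proof.
move=> p0 A0 At.
have L0 : 0 < L := lt_trans ltr01 L_gt1.
have bern n : 1 + n%:R * (L - 1) <= L ^+ n.
  elim: n => [|i IH]; first by rewrite mul0r addr0 expr0.
  rewrite exprS -natr1.
  have : 0 <= i%:R * (L - 1) * (L - 1) by rewrite !mulr_ge0// subr_ge0 ltW.
  have : L * (1 + i%:R * (L - 1)) <= L * L ^+ i by rewrite ler_wpM2l// ltW.
  nra.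
have big (M : R) : exists n, M < L ^+ n.
  exists (Num.bound `|M / (L - 1)|); set k := Num.bound _.
  have : M / (L - 1) < k%:R by apply: le_lt_trans (ler_norm _) _; exact: archi_boundP.
  rewrite ltr_pdivrMr ?subr_gt0// => h; have := bern k; lra.
have [n1 h1] := big A; have [n2 h2] := big A^-1.
exists (maxn n1 n2) => N; rewrite geq_max => /andP[n1N n2N].
have hA : A <= dlevel N N.*2.
  rewrite /dlevel -addnn exprD mulfK ?expf_neq0 ?gt_eqF//.
  by apply/ltW/(lt_le_trans h1); rewrite ler_weXn2l// ltW.
have h0 : dlevel N 0 < A.
  rewrite /dlevel expr0 mul1r invf_plt ?posrE ?exprn_gt0//.
  by apply: (lt_le_trans h2); rewrite ler_weXn2l// ltW.
have ex : exists j, A <= dlevel N j by exists N.*2.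
case: (ex_minnP ex) => -[|j] jA jmin; first by move: h0; rewrite ltNge jA.
have jN : (j < N.*2)%N by apply: jmin.
have jl : dlevel N j < A.
  by rewrite ltNge; apply/negP => /jmin; rewrite ltnn.
apply: (@le_trans _ _ (dlevel N j.+1 `^ p)).
  by apply: ge0_ler_powR; rewrite ?nnegrE ?(ltW p0) ?(ltW A0) ?(ltW (dlevel_gt0 _ _)).
rewrite powR_dlevelS; apply: ler_wpM2l; first exact: powR_ge0.
rewrite /level_sum (bigD1 (Ordinal jN))//= (lt_le_trans _ At) ?lte_fin// mulr1 lerDl.
by apply: sumr_ge0 => i _; rewrite mulr_ge0 ?powR_ge0.
Qed.

Lemma level_sum_ge0 p N t : 0 <= level_sum p N t.
Proof. by apply: sumr_ge0 => i _; rewrite mulr_ge0 ?powR_ge0. Qed.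

Lemma measurable_level_sum p N (f : T -> \bar R) : measurable_fun setT f ->
  measurable_fun setT (fun x => (level_sum p N (f x))%:E).
Proof.
move=> mf; apply/measurable_EFinP; apply: measurable_sum => i.
apply: measurable_funM => //.
rewrite (_ : (fun x => _) = \1_[set x | ((dlevel N i)%:E < f x)%E]); last first.
  by apply/funext => x; rewrite indicE; case h : (_ < _)%E; [rewrite mem_set|rewrite memNset//= h].
apply: measurable_indic; rewrite -[X in measurable X]setTI.
by apply: measurable_lte.
Qed.

Lemma integral_level_sum p N (f : T -> \bar R) : measurable_fun setT f ->
  (\int[mu]_x (level_sum p N (f x))%:E = \sum_(i < N.*2) (dlevel N i `^ p)%:E * mu [set x | (dlevel N i)%:E < f x])%E.
Proof.
move=> mf.
have mS i : measurable [set x | ((dlevel N i)%:E < f x)%E].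
  by rewrite -[X in measurable X]setTI; apply: measurable_lte.
have E i x : ((dlevel N i)%:E < f x)%E%:R = \1_[set x | ((dlevel N i)%:E < f x)%E] x :> R.
  by rewrite indicE; case h : (_ < _)%E; [rewrite mem_set|rewrite memNset//= h].
under eq_integral do rewrite /level_sum -sumEFin.
rewrite ge0_integral_sum//.
- apply: eq_bigr => i _; under eq_integral do rewrite EFinM E.
  rewrite ge0_integralZl ?lee_fin ?powR_ge0// ?integral_indic ?setIT//.
  by apply/measurable_EFinP; exact: measurable_indic.
- move=> i; apply/measurable_EFinP; apply: measurable_funM => //.
  by under eq_fun do rewrite E; exact: measurable_indic.
- by move=> i x _; rewrite lee_fin mulr_ge0 ?powR_ge0.
Qed.

(** L^p times the level sums dominates f^p in the lower limit, hence the passage through Fatou's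
    lemma. That a bound for large [N] suffices is what allows an error term vanishing as [N]
    grows. *)
Lemma layer_cake_le p (f : T -> \bar R) (M : \bar R) N0 : 0 < p -> measurable_fun setT f ->
  (forall x, 0 <= f x)%E ->
  (forall N, (N0 <= N)%N -> (\sum_(i < N.*2) (dlevel N i `^ p)%:E * mu [set x | (dlevel N i)%:E < f x] <= M)%E) ->
  (\int[mu]_x (f x `^ p) <= (L `^ p)%:E * M)%E.
Proof.
move=> p0 mf f0 H.
apply: (@fatou_einf_le _ _ _ _ (fun N x => ((L `^ p)%:E * (level_sum p N (f x))%:E)%E) _ _ N0).
- by move=> N; apply: measurable_funeM; exact: measurable_level_sum.
- by move=> N x; rewrite -EFinM lee_fin mulr_ge0 ?powR_ge0 ?level_sum_ge0.
- exact: (measurableT_comp (measurable_poweR _)).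
- by move=> x; exact: poweR_ge0.
- apply: nearW => x.
  have key (A : R) : 0 < A -> (A%:E <= f x)%E ->
      ((A `^ p)%:E <= limn_einf (fun N => (L `^ p)%:E * (level_sum p N (f x))%:E))%E.
    move=> A0 /(level_sum_ge p0 A0)[N1 HN]; apply: (@limn_einf_ge _ _ _ N1) => N /HN.
    by rewrite -EFinM lee_fin.
  have := f0 x; case: (f x) key => [r| |] // key r0.
  + rewrite poweR_EFin; move: r0; rewrite lee_fin le_eqVlt => /predU1P[<-|r0]; last exact: key.
    rewrite powR0 ?gt_eqF//; apply: (@limn_einf_ge _ _ _ 0) => n _.
    by rewrite -EFinM lee_fin mulr_ge0 ?powR_ge0 ?level_sum_ge0.
  (* Where f is infinite, a finite lower limit v is contradicted by the level [A] with A^p = |v| +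
     1. *)
  + rewrite poweRyr ?gt_eqF//; rewrite leNgt; apply/negP => h.
    have [/fineK hf|] := boolP (limn_einf (fun N => (L `^ p)%:E * (level_sum p N +oo)%:E)%E \is a fin_num).
      pose A := (`|fine (limn_einf (fun N => (L `^ p)%:E * (level_sum p N +oo)%:E)%E)| + 1) `^ p^-1.
      have A0 : 0 < A by rewrite powR_gt0// ltr_wpDl.
      have := key A A0 (leey _); rewrite -hf lee_fin -powRrM mulVf ?gt_eqF// powRr1 ?addr_ge0//.
      by move=> h2; have := le_trans h2 (ler_norm _); rewrite gerDl ler10.
    by rewrite ge0_fin_numE ?h//; apply: (@limn_einf_ge _ _ _ 0) => n _;
      rewrite -EFinM lee_fin mulr_ge0 ?powR_ge0 ?level_sum_ge0.
- move=> N /H h; rewrite ge0_integralZl//.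
  + by rewrite integral_level_sum//; apply: lee_wpmul2l => //; rewrite lee_fin powR_ge0.
  + exact: measurable_level_sum.
  + by move=> x _; rewrite lee_fin level_sum_ge0.
  + by rewrite lee_fin powR_ge0.
Qed.

Lemma layer_cake_ge p N (f : T -> \bar R) : 0 < p -> measurable_fun setT f -> (forall x, 0 <= f x)%E ->
  (\sum_(i < N.*2) (dlevel N i `^ p)%:E * mu [set x | (dlevel N i)%:E < f x] <=
     (L `^ p / (L `^ p - 1))%:E * \int[mu]_x (f x `^ p))%E.
Proof.
move=> p0 mf f0; have q1 : 1 < L `^ p.
  exact: powR_gt1.
have C0 : 0 < L `^ p / (L `^ p - 1) by rewrite divr_gt0 ?subr_gt0// (lt_trans ltr01).
rewrite -integral_level_sum// -ge0_integralZl ?lee_fin ?(ltW C0)//; first last.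
- by move=> x _; exact: poweR_ge0.
- exact: (measurableT_comp (measurable_poweR _)).
apply: ge0_le_integral => //.
- by move=> x _; rewrite lee_fin level_sum_ge0.
- exact: measurable_level_sum.
- by apply: measurable_funeM; exact: (measurableT_comp (measurable_poweR _)).
- move=> x _; have := f0 x; case: (f x) => [r| |] //.
  + by rewrite lee_fin => r0; rewrite poweR_EFin -EFinM lee_fin level_sum_le.
  + by move=> _; rewrite poweRyr ?gt_eqF// gt0_muley ?lte_fin// leey.
Qed.

End layer_cake.

Lemma powR_invl (R : realType) (a p : R) : 0 <= a -> (a^-1) `^ p = (a `^ p)^-1.
Proof. by move=> a0; rewrite -powR_inv1// -powRrM mulN1r powRN. Qed.

(** * Lebesgue spaces of real functions *)

Section Lp_functions.
Context (dd : measure_display) (T : measurableType dd) (R : realType) (mu : {measure set T -> \bar R}).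
Implicit Types (f g h : T -> R) (p q : R).

Definition Lp p f : Prop := measurable_fun setT f /\ (Lnorm mu p%:E (EFin \o f) < +oo)%E.
(** [fine] sends an infinite norm to 0: a bound on [nrm] is informative only together with
    membership in [Lp], and most lemmas below deliver the two as a pair. *)
Definition nrm p f : R := fine (Lnorm mu p%:E (EFin \o f)).
Definition Ip p f : \bar R := (\int[mu]_x (`|f x| `^ p)%:E)%E.

Lemma Ip_ge0 p f : (0 <= Ip p f)%E.
Proof. by apply: integral_ge0 => x _; rewrite lee_fin powR_ge0. Qed.

Lemma LnormIp p f : p != 0 -> Lnorm mu p%:E (EFin \o f) = (Ip p f `^ p^-1)%E.
Proof. by move=> p0; rewrite unlock /Ip; congr (_ `^ _)%E; apply: eq_integral => x _ /=; rewrite poweR_EFin. Qed.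

Lemma nrm_ge0 p f : 0 <= nrm p f.
Proof. by rewrite fine_ge0// Lnorm_ge0. Qed.

Lemma measurable_powRn p f : measurable_fun setT f ->
  measurable_fun setT (fun x => (`|f x| `^ p)%:E).
Proof.
move=> mf; apply/measurable_EFinP.
apply: (measurableT_comp (measurable_powR p)) => //.
exact: measurableT_comp.
Qed.

Lemma nrm_fin p f : Lp p f -> (nrm p f)%:E = Lnorm mu p%:E (EFin \o f).
Proof. by move=> [_ h]; rewrite fineK// ge0_fin_numE// Lnorm_ge0. Qed.

Lemma IpE p f : 0 < p -> Lp p f -> Ip p f = (nrm p f `^ p)%:E.
Proof.
move=> p0 fp; rewrite -poweR_EFin (nrm_fin fp) LnormIp ?gt_eqF//.
by rewrite -poweRrM mulVf ?gt_eqF// poweRe1// Ip_ge0.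
Qed.

(** Norm estimates usually go through this criterion: the integral of |f|^p is bounded in the
    extended reals, where nothing has to be known to be finite in advance. *)
Lemma LpP p f c : 0 < p -> measurable_fun setT f -> 0 <= c -> (Ip p f <= (c `^ p)%:E)%E ->
  Lp p f /\ nrm p f <= c.
Proof.
move=> p0 mf c0 fc.
have h : (Lnorm mu p%:E (EFin \o f) <= c%:E)%E.
  rewrite LnormIp ?gt_eqF//.
  have : (Ip p f `^ p^-1 <= (c `^ p)%:E `^ p^-1)%E.
    apply: gt0_ler_poweR => //; rewrite ?invr_ge0 ?ltW// in_itv/= ?leey ?andbT ?Ip_ge0//.
    by rewrite lee_fin powR_ge0.
  by rewrite poweR_EFin -powRrM mulfV ?gt_eqF// powRr1.
have fp : Lp p f by split => //; rewrite (le_lt_trans h) ?ltry.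
by split => //; rewrite -lee_fin nrm_fin.
Qed.

Lemma LpIp p f : 0 < p -> Lp p f <-> measurable_fun setT f /\ (Ip p f < +oo)%E.
Proof.
move=> p0; split => [fp|[mf fy]]; first by split; [case: fp|rewrite IpE// ltry].
pose c := fine (Ip p f) `^ p^-1.
have cE : (c `^ p)%:E = Ip p f.
  by rewrite -powRrM mulVf ?gt_eqF// powRr1 ?fine_ge0 ?Ip_ge0// fineK// ge0_fin_numE// Ip_ge0.
by have [] := @LpP p f c p0 mf (powR_ge0 _ _); first by rewrite -/(powR _ _) cE.
Qed.

Lemma Lp_ae_le p f g : 0 < p -> measurable_fun setT f -> Lp p g ->
  {ae mu, forall x, `|f x| <= `|g x|} -> Lp p f /\ nrm p f <= nrm p g.
Proof.
move=> p0 mf gp fg; apply: LpP => //; first exact: nrm_ge0.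
rewrite -(IpE p0 gp); apply: ae_ge0_le_integral => //.
- exact: measurable_powRn.
- by apply: measurable_powRn; case: gp.
- apply: filterS fg => x h _; rewrite lee_fin; apply: ge0_ler_powR => //; rewrite ?nnegrE//; exact: ltW.
Qed.

Lemma Lp_le p f g : 0 < p -> measurable_fun setT f -> Lp p g ->
  (forall x, `|f x| <= `|g x|) -> Lp p f /\ nrm p f <= nrm p g.
Proof. by move=> p0 mf gp fg; apply: Lp_ae_le => //; apply: nearW. Qed.

Lemma nrm_ae_eq p f g : 0 < p -> Lp p g -> measurable_fun setT f ->
  {ae mu, forall x, f x = g x} -> Lp p f /\ nrm p f = nrm p g.
Proof.
move=> p0 gp mf fg.
have [fp fg'] := @Lp_ae_le p f g p0 mf gp (filterS (fun x (e : f x = g x) => eq_ind_r (fun z => `|z| <= _) (lexx _) e) fg).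
have [_ gf'] := @Lp_ae_le p g f p0 gp.1 fp (filterS (fun x (e : f x = g x) => eq_ind_r (fun z => _ <= `|z|) (lexx _) e) fg).
by split => //; apply/eqP; rewrite eq_le fg'.
Qed.

Lemma nrm0 p : 0 < p -> Lp p (fun=> 0) /\ nrm p (fun=> 0) = 0.
Proof.
move=> p0; have h := @Lnorm0 _ T R mu p%:E.
split; [split => //|]; rewrite /nrm (_ : EFin \o (fun _ : T => 0) = cst 0%E)// h//;
  by rewrite eqe gt_eqF.
Qed.

Lemma nrm_eq0 p f : 0 < p -> Lp p f -> nrm p f = 0 -> {ae mu, forall x, f x = 0}.
Proof.
move=> p0 fp f0.
have mf : measurable_fun setT (EFin \o f) by apply/measurable_EFinP; case: fp.
have := @Lnorm_eq0_eq0 _ _ _ mu (EFin \o f) p%:E mf.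
rewrite lte_fin p0 -nrm_fin// f0 => /(_ isT erefl).
by apply: filterS => x /= /(_ I) [].
Qed.

Lemma LpD p f g : 1 <= p -> Lp p f -> Lp p g ->
  Lp p (fun x => f x + g x) /\ nrm p (fun x => f x + g x) <= nrm p f + nrm p g.
Proof.
move=> p1 fp gp; have := minkowski_EFin mu fp.1 gp.1 p1.
rewrite -nrm_fin// -nrm_fin// -EFinD => h.
have fgp : Lp p (fun x => f x + g x).
  by split; [apply: measurable_funD; [case: fp|case: gp]|rewrite (le_lt_trans h) ?ltry].
by split => //; rewrite -lee_fin nrm_fin.
Qed.

Lemma LpZ p f a : 0 < p -> Lp p f -> Lp p (fun x => a * f x) /\ nrm p (fun x => a * f x) = `|a| * nrm p f.
Proof.
move=> p0 fp.
have mZ : measurable_fun setT (fun x => a * f x) by apply: measurable_funM => //; case: fp.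
have IZ : Ip p (fun x => a * f x) = ((`|a| * nrm p f) `^ p)%:E.
  rewrite powRM ?normr_ge0 ?nrm_ge0// EFinM -IpE// -ge0_integralZl//.
  - by apply: eq_integral => x _; rewrite -EFinM normrM powRM.
  - by apply: measurable_powRn; case: fp.
have [Zp _] := @LpP p (fun x => a * f x) (`|a| * nrm p f) p0 mZ (mulr_ge0 (normr_ge0 _) (nrm_ge0 _ _)) (eq_ind_r (fun z => (z <= _)%E) (lexx _) IZ).
split => //; move: IZ; rewrite IpE// => -[].
by apply: powR_injr; rewrite ?mulr_ge0 ?nrm_ge0.
Qed.

Lemma LpN p f : 0 < p -> Lp p f -> Lp p (fun x => - f x) /\ nrm p (fun x => - f x) = nrm p f.
Proof.
move=> p0 fp; have [] := LpZ (-1) p0 fp.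
have -> : (fun x => -1 * f x) = (fun x => - f x) by apply/funext => x; rewrite mulN1r.
by rewrite normrN normr1 mul1r.
Qed.

Lemma LpB p f g : 1 <= p -> Lp p f -> Lp p g ->
  Lp p (fun x => f x - g x) /\ nrm p (fun x => f x - g x) <= nrm p f + nrm p g.
Proof.
move=> p1 fp gp; have p0 := lt_le_trans ltr01 p1.
have [gp' ge] := LpN p0 gp.
by have := LpD p1 fp gp'; rewrite ge.
Qed.

Lemma nrm_subC p f g : nrm p (fun x => f x - g x) = nrm p (fun x => g x - f x).
Proof.
rewrite /nrm -[in RHS](oppe_Lnorm mu); congr (fine (Lnorm _ _ _)); apply/funext => x /=.
by rewrite opprB.
Qed.

Lemma nrm_triangle p f g h : 1 <= p -> Lp p f -> Lp p g -> Lp p h ->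
  nrm p (fun x => f x - h x) <= nrm p (fun x => f x - g x) + nrm p (fun x => g x - h x).
Proof.
move=> p1 fp gp hp; have := (LpD p1 (LpB p1 fp gp).1 (LpB p1 gp hp).1).2.
by under eq_fun do rewrite addrA subrK.
Qed.

Lemma Lp_bdM p f g (M : R) : 0 < p -> measurable_fun setT g -> (forall x, `|g x| <= M) -> Lp p f ->
  Lp p (fun x => g x * f x) /\ nrm p (fun x => g x * f x) <= M * nrm p f.
Proof.
move=> p0 mg gM fp.
(* A negative [M] forces [T] to be empty, and then every function on [T] equals 0. *)
have [M0|M0] := leP 0 M; last first.
  have E (F : T -> R) : F = (fun=> 0).
    by apply/funext => x; have := lt_le_trans (le_lt_trans (gM x) M0) (normr_ge0 (g x)); rewrite ltxx.
  rewrite (E f) (E (fun x => g x * _)); have [? ->] := nrm0 p0; split => //.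
  by rewrite mulr0.
have [Mp ME] := LpZ M p0 fp.
have -> : M * nrm p f = nrm p (fun x => M * f x) by rewrite ME ger0_norm.
apply: Lp_le => //.
  by apply: measurable_funM => //; case: fp.
by move=> x; rewrite !normrM (ger0_norm M0) ler_wpM2r.
Qed.

Lemma Lp1P f : Lp 1 f <-> mu.-integrable setT (EFin \o f).
Proof.
rewrite LpIp ?ltr01//; split => [[mf h]|/integrableP[/measurable_EFinP mf h]].
  apply/integrableP; split; first exact/measurable_EFinP.
  by move: h; rewrite /Ip; under eq_integral do rewrite powRr1//.
by split => //; rewrite /Ip; under eq_integral do rewrite powRr1//.
Qed.

Lemma hoelder_Lp p q f g : 0 < p -> 0 < q -> p^-1 + q^-1 = 1 -> Lp p f -> Lp q g ->
  Lp 1 (fun x => f x * g x) /\ nrm 1 (fun x => f x * g x) <= nrm p f * nrm q g.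
Proof.
move=> p0 q0 pq fp gq; have := hoelder mu fp.1 gq.1 p0 q0 pq.
rewrite -nrm_fin// -nrm_fin// -EFinM => h.
have fg1 : Lp 1 (fun x => f x * g x).
  by split; [apply: measurable_funM; [case: fp|case: gq]|rewrite (le_lt_trans h) ?ltry].
by split => //; rewrite -lee_fin nrm_fin.
Qed.

Lemma nrm1E f : Lp 1 f -> nrm 1 f = (\int[mu]_x `|f x|)%R.
Proof.
move=> f1; have := IpE ltr01 f1; rewrite powRr1 ?nrm_ge0// => h.
apply/EFin_inj; rewrite -h /Ip /Rintegral fineK.
  by apply: eq_integral => x _; rewrite powRr1.
rewrite ge0_fin_numE ?integral_ge0//.
move: (ltry (nrm 1 f)); rewrite -h /Ip.
by under eq_integral do rewrite powRr1//.
Qed.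

Lemma Lp_indic p (E : set T) : 0 < p -> measurable E -> (mu E < +oo)%E -> Lp p (\1_E).
Proof.
move=> p0 mE Ey; apply/(LpIp _ p0); split; first exact: measurable_indic.
have -> : Ip p (\1_E) = (\int[mu]_x (\1_E x)%:E)%E; last by rewrite integral_indic ?setIT.
apply: eq_integral => x _; rewrite indicE; case: (_ \in _); rewrite ?normr1 ?powR1//.
by rewrite normr0 powR0// gt_eqF.
Qed.

Lemma normr_int_le f : Lp 1 f -> `|\int[mu]_x f x| <= nrm 1 f.
Proof. by move=> f1; rewrite nrm1E//; apply: le_normr_Rintegral => //; apply/Lp1P. Qed.

Lemma hoelder_int p q f g : 0 < p -> 0 < q -> p^-1 + q^-1 = 1 -> Lp p f -> Lp q g ->
  `|\int[mu]_x (f x * g x)| <= nrm p f * nrm q g.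
Proof. by move=> p0 q0 pq fp gq; have [h1 h2] := hoelder_Lp p0 q0 pq fp gq; apply: le_trans (normr_int_le h1) _. Qed.

Lemma Lp_Lp f p q (r : R) : 0 < p -> 0 < q -> 0 < r -> q = p * r -> Lp q f ->
  Lp p (fun x => `|f x| `^ r) /\ nrm p (fun x => `|f x| `^ r) = nrm q f `^ r.
Proof.
move=> p0 q0 r0 qpr fq.
have mr : measurable_fun setT (fun x => `|f x| `^ r).
  by apply/measurable_EFinP/measurable_powRn; case: fq.
have E : Ip p (fun x => `|f x| `^ r) = ((nrm q f `^ r) `^ p)%:E.
  rewrite -powRrM mulrC -qpr -(IpE q0 fq); apply: eq_integral => x _.
  by rewrite ger0_norm ?powR_ge0// -powRrM mulrC -qpr.
have [h1 _] := @LpP p _ (nrm q f `^ r) p0 mr (powR_ge0 _ _) (eq_ind_r (fun z => (z <= _)%E) (lexx _) E).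
split => //; move: E; rewrite IpE// => -[].
by apply: powR_injr; rewrite ?nrm_ge0 ?powR_ge0.
Qed.

(** Dominated convergence with |f|^p as dominating function. The sets need not increase: each point
    only has to belong to all of them from some index on. *)
Lemma Lp_cut p f (A : nat -> set T) : 0 < p -> Lp p f -> (forall n, measurable (A n)) ->
  (forall x, exists N, forall n, (N <= n)%N -> A n x) ->
  forall e, 0 < e -> exists N, forall n, (N <= n)%N ->
    Lp p (fun x => f x - f x * \1_(A n) x) /\ nrm p (fun x => f x - f x * \1_(A n) x) <= e.
Proof.
move=> p0 fp mA Acv e e0.
have mf : measurable_fun setT f by case: fp.
have mfn n : measurable_fun setT (fun x => f x - f x * \1_(A n) x).
  by apply: measurable_funB => //; apply: measurable_funM => //; exact: measurable_indic.
pose F n x := (`|f x - f x * \1_(A n) x| `^ p)%:E.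
have gint : mu.-integrable setT (fun x => (`|f x| `^ p)%:E).
  apply/integrableP; split; first exact: measurable_powRn.
  have := (LpIp f p0).1 fp => -[_].
  by rewrite /Ip; under [in X in _ -> X]eq_integral do rewrite gee0_abs ?lee_fin ?powR_ge0//.
have FE n x : (F n x <= (`|f x| `^ p)%:E)%E.
  rewrite lee_fin; apply: ge0_ler_powR; rewrite ?nnegrE ?normr_ge0 ?(ltW p0)// indicE.
  by case: (x \in A n); rewrite ?mulr1 ?subrr ?normr0// mulr0 subr0.
have cv : (\int[mu]_x F n x)%E @[n --> \oo] --> (\int[mu]_x (cst 0%E x))%E.
  apply: (@dominated_cvg _ T R mu setT measurableT F (cst 0%E) (fun x => (`|f x| `^ p)%:E)) => //.
  - by move=> n; exact: measurable_powRn.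
  - move=> x _; have [N HN] := Acv x; apply: cvg_near_cst; exists N => // n /= /HN Anx.
    by rewrite /F indicE mem_set// mulr1 subrr normr0 powR0// gt_eqF.
  - by move=> n x _; rewrite gee0_abs ?FE// lee_fin powR_ge0.
rewrite integral0 in cv.
have : \forall n \near \oo, (\int[mu]_x F n x < (e `^ p)%:E)%E.
  apply: (cv [set z | (z < (e `^ p)%:E)%E]); apply: open_nbhs_nbhs; split; last by rewrite /= lte_fin powR_gt0.
  exact: open_ereal_lt_ereal.
case=> N _ HN; exists N => n /HN /= h.
by apply: LpP => //; rewrite ltW.
Qed.

(** Riesz-Fischer. A subsequence with rapidly decreasing differences converges almost everywhere;
    Fatou's lemma, applied to the differences with this subsequence, turns the Cauchy condition into
    convergence in norm of the whole sequence. *)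
Lemma Lp_complete p (v : nat -> T -> R) : 1 <= p -> (forall n, Lp p (v n)) ->
  (forall e, 0 < e -> exists N, forall n m, (N <= n)%N -> (N <= m)%N ->
     nrm p (fun x => v n x - v m x) <= e) ->
  exists2 w, Lp p w & forall e, 0 < e -> exists N, forall n, (N <= n)%N ->
     nrm p (fun x => v n x - w x) <= e.
Proof.
move=> p1 vp vC; have p0 : 0 < p := lt_le_trans ltr01 p1.
(* The ratio 1/4 leaves room for the weights 2^k in [S]: the k-th integral is at most (2^k 4^-k)^p,
   hence at most 2^-k. *)
pose r k : R := 4^-1 ^+ k.
have r0 k : 0 < r k by rewrite exprn_gt0// invr_gt0.
have [N HN] := choice (fun k => vC (r k) (r0 k)).
(* Partial sums make the subsequence monotone, which the ranks [N k] given by [choice] need not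
   be. *)
pose s k := (\sum_(i < k.+1) N i + k)%N.
have sN k : (N k <= s k)%N by rewrite /s big_ord_recr/= -addnA addnCA leq_addr.
have sS k : (s k <= s k.+1)%N by rewrite /s (big_ord_recr k.+1)/= leq_add// leq_addr.
have smono k l : (k <= l)%N -> (s k <= s l)%N by move=> kl; apply: (homo_leq (@leqnn) leq_trans sS kl).
pose D k x := v (s k.+1) x - v (s k) x.
have Dp k : Lp p (D k) by have [] := LpB p1 (vp (s k.+1)) (vp (s k)).
have Dr k : nrm p (D k) <= r k by apply: HN; rewrite ?sN// (leq_trans (sN k)).
pose S x := (\sum_(0 <= k <oo) ((2 ^+ k)%R `^ p * `|D k x| `^ p)%:E)%E.
have mDk k : measurable_fun setT (fun x => ((2 ^+ k)%R `^ p * `|D k x| `^ p)%:E).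
  apply/measurable_EFinP; apply: measurable_funM => //.
  by apply/measurable_EFinP/measurable_powRn; case: (Dp k).
have Dk0 k x : (0 <= ((2 ^+ k)%R `^ p * `|D k x| `^ p)%:E)%E.
  by rewrite lee_fin mulr_ge0 ?powR_ge0.
have S0 x : (0 <= S x)%E by apply: nneseries_ge0.
have mS : measurable_fun setT S by apply: ge0_emeasurable_sum => // k x _ _; exact: Dk0.
have Sint : (\int[mu]_x S x < +oo)%E.
  rewrite /S integral_nneseries//.
  apply: (@le_lt_trans _ _ (1 - 2^-1)^-1%:E); last exact: ltry.
  apply: nneseries_le => [k|n]; first by apply: integral_ge0 => x _; exact: Dk0.
  apply: (@le_trans _ _ (\sum_(0 <= k < n) (2^-1 ^+ k))%:E); last first.
    by rewrite lee_fin geometric_sum_le//; apply/andP; split; lra.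
  rewrite -sumEFin; apply: lee_sum => k _.
  under eq_integral do rewrite EFinM.
  rewrite ge0_integralZl//; last by apply: measurable_powRn; case: (Dp k).
  rewrite -/(Ip p (D k)) (IpE p0 (Dp k)) -EFinM lee_fin -powRM ?nrm_ge0//.
  apply: (@le_trans _ _ ((2^-1 ^+ k) `^ p)).
    apply: ge0_ler_powR; rewrite ?nnegrE ?mulr_ge0 ?nrm_ge0 ?(ltW p0)//.
    apply: le_trans (ler_wpM2l _ (Dr k)) _; first by rewrite exprn_ge0.
    by rewrite /r -exprMn; apply: lerXn2r; rewrite ?nnegrE//; lra.
  rewrite -[leRHS]powRr1 ?exprn_ge0// ?invr_ge0//.
  by apply: ger_powR => //; rewrite exprn_gt0 ?invr_gt0//= exprn_ile1//; lra.
have cvS : {ae mu, forall x, cvgn (fun k => v (s k) x)}.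
  apply: filterS (ae_fin_of_integral mS S0 Sint) => x Sx.
  pose M := (fine (S x)) `^ p^-1.
  have DM k : `|D k x| <= M * 2^-1 ^+ k.
    have : (((2 ^+ k)%R `^ p * `|D k x| `^ p)%:E <= S x)%E.
      apply: le_trans (nneseries_lim_ge k.+1 (fun i _ _ => Dk0 i x)).
      by rewrite big_nat_recr//= leeDr// sume_ge0.
    rewrite -(@fineK _ (S x)) ?ge0_fin_numE// lee_fin -powRM// => h.
    have : ((2 ^+ k * `|D k x|) `^ p) `^ p^-1 <= M.
      by apply: ge0_ler_powR; rewrite ?nnegrE ?invr_ge0 ?(ltW p0) ?powR_ge0 ?fine_ge0.
    rewrite -powRrM mulfV ?gt_eqF// powRr1 ?mulr_ge0// => h2.
    by rewrite exprVn ler_pdivlMr ?exprn_gt0// mulrC.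
  have cvD : cvgn (series (fun k => D k x)).
    apply: normed_cvg; apply: (@series_le_cvg _ _ (geometric M 2^-1)) => //.
    - by move=> k /=; exact: normr_ge0.
    - by move=> k /=; rewrite mulr_ge0 ?powR_ge0 ?exprn_ge0// invr_ge0.
    - apply: is_cvg_geometric_series; rewrite ger0_norm ?invr_ge0//; lra.
  have -> : (fun k => v (s k) x) = (fun k => v (s 0%N) x + series (fun k => D k x) k).
    by apply/funext => k; rewrite (eq_sum_telescope (fun k => v (s k) x) k).
  by apply: is_cvgD => //; exact: is_cvg_cst.
(* The upper limit is measurable everywhere and agrees with the limit wherever the subsequence
   converges. *)
pose w x := fine (limn_esup (fun k => (v (s k) x)%:E)).
have mw : measurable_fun setT w.
  apply: measurableT_comp => //; apply: measurable_fun_limn_esup => k.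
  by apply/measurable_EFinP; case: (vp (s k)).
have wcv : {ae mu, forall x, v (s k) x @[k --> \oo] --> w x}.
  apply: filterS cvS => x cx; rewrite /w.
  have cE : (v (s k) x)%:E @[k --> \oo] --> (limn (fun k => v (s k) x))%:E.
    by apply: cvg_EFin => //; apply: nearW.
  by rewrite (cvg_limn_einf_sup cE).2.
have key e : 0 < e -> exists M, forall n, (M <= n)%N ->
    Lp p (fun x => v n x - w x) /\ nrm p (fun x => v n x - w x) <= e.
  move=> e0; have [M HM] := vC e e0.
  exists M => n Mn; have mvw : measurable_fun setT (fun x => v n x - w x).
    by apply: measurable_funB => //; case: (vp n).
  have Mk k : (M <= s (k + M))%N by rewrite /s addnA leq_addl.
  apply: LpP => //; first exact: ltW.
  apply: (@fatou_le _ _ _ _ (fun k x => (`|v n x - v (s (k + M)%N) x| `^ p)%:E)).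
  - by move=> k; apply: measurable_powRn; apply: measurable_funB; [case: (vp n)|case: (vp (s (k + M)%N))].
  - by move=> k x; rewrite lee_fin powR_ge0.
  - exact: measurable_powRn.
  - by move=> x; rewrite lee_fin powR_ge0.
  - apply: filterS wcv => x wx; apply: cvg_EFin; first exact: nearW.
    have cn : (fun k => `|v n x - v (s (k + M)%N) x|) @ \oo --> `|v n x - w x|.
      apply: cvg_norm; apply: cvgB; first exact: cvg_cst.
      by rewrite (cvg_shiftn M (fun k => v (s k) x)).
    exact: cvg_powRn.
  - move=> k; have [hp _] := LpB p1 (vp n) (vp (s (k + M)%N)).
    rewrite -/(Ip p (fun x => v n x - v (s (k + M)%N) x)) (IpE p0 hp) lee_fin.
    by apply: ge0_ler_powR; rewrite ?nnegrE ?nrm_ge0 ?(ltW p0) ?(ltW e0) ?HM.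
exists w.
  have [M /(_ M (leqnn _)) [hp _]] := key 1 ltr01.
  have [h _] := LpB p1 (vp M) hp.
  by move: h; under eq_fun do rewrite opprB addrC subrK.
by move=> e /key[M HM]; exists M => n /HM[].
Qed.

End Lp_functions.

(** * Coverings by balls *)

Section homogeneous_geometry.
Context (R : realType) (X : ptopologicalType) (d : X -> X -> R)
  (mu : {measure set (borel X) -> \bar R}) (c K : R) (hX : homogeneous_type d mu c K).

Notation B := (qball d).

Definition mB (x : X) (r : R) : R := fine (mu (B x r)).

Lemma c_gt1 : 1 < c. Proof. by case: hX. Qed.
Lemma c_gt0 : 0 < c. Proof. exact: lt_trans ltr01 c_gt1. Qed.
Lemma K_gt1 : 1 < K. Proof. by case: hX. Qed.
Lemma K_gt0 : 0 < K. Proof. exact: lt_trans ltr01 K_gt1. Qed.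

Lemma qball_open x r : 0 < r -> open (B x r). Proof. by case: hX => ? ? ? ? ? ? h ? ? ? ? ? ? ? ?; exact: h. Qed.

Lemma open_borel (U : set X) : open U -> measurable (U : set (borel X)).
Proof. by move=> oU; apply: sub_sigma_algebra. Qed.

Lemma qball_measurable x r : 0 < r -> measurable (B x r : set (borel X)).
Proof. by move=> r0; exact: (open_borel (qball_open x r0)). Qed.

Lemma qball_mE x r : 0 < r -> mu (B x r) = (mB x r)%:E.
Proof.
move=> r0; have [_ h] := ht_finite hX x r0.
by rewrite /mB fineK// ge0_fin_numE.
Qed.

Lemma mB_gt0 x r : 0 < r -> 0 < mB x r.
Proof. by move=> r0; have [h _] := ht_finite hX x r0; rewrite -lte_fin -qball_mE. Qed.

Lemma mB_doubling x r : 0 < r -> mB x (c * r) <= K * mB x r.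
Proof.
move=> r0; have := ht_doubling hX x r0.
by rewrite !qball_mE// ?mulr_gt0 ?c_gt0.
Qed.

Lemma mB_sub x y r s : 0 < r -> 0 < s -> B x r `<=` B y s -> mB x r <= mB y s.
Proof.
move=> r0 s0 h; rewrite -lee_fin -!qball_mE//; apply: le_measure => //; rewrite inE; exact: qball_measurable.
Qed.

Lemma qball_center x r : 0 < r -> B x r x. Proof. exact: (ht_center hX). Qed.

Lemma qball_engulf x1 x2 r1 r2 y : 0 < r2 -> r2 <= r1 -> B x1 r1 y -> B x2 r2 y -> B x2 r2 `<=` B x1 (c * r1).
Proof. by move=> r20 r21 y1 y2; apply: (ht_engulf hX) => //; exists y. Qed.

Lemma qball_sub x r s : 0 < r -> r <= s -> B x r `<=` B x s.
Proof. by move=> r0 rs; exact: (ht_mono hX). Qed.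

Lemma cmul_gt0 r : 0 < r -> 0 < c * r. Proof. by move=> r0; rewrite mulr_gt0// c_gt0. Qed.
Lemma cmul_gt r : 0 < r -> r < c * r. Proof. by move=> r0; rewrite ltr_pMl// c_gt1. Qed.

(** The balls centred at [x] exhaust X, so a large one contains [y] and its c-dilate engulfs the
    given ball. Boundedness of a support thus does not depend on the centre used to express it. *)
Lemma balls_in_ball x y r : 0 < r -> exists2 s, r <= s & B y r `<=` B x s.
Proof.
move=> r0; have : [set: X] y by []. rewrite -(ht_cover hX x) => -[t /= t0 xty].
have mt : 0 < Num.max r t by rewrite lt_max r0.
exists (c * Num.max r t).
  by apply: le_trans (ltW (cmul_gt mt)); rewrite le_max lexx.
apply: (@qball_engulf _ _ _ _ y) => //; rewrite ?le_max ?lexx//; last exact: qball_center.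
by apply: (qball_sub _ _ xty) => //; rewrite le_max lexx orbT.
Qed.

(** Balls are handled as pairs of a centre and a radius, which the underlying set does not
    determine. *)
Definition disjoint_balls (t : seq (X * R)) : Prop :=
  uniq t /\ trivIset [set` t] (fun z => B z.1 z.2).

(** Greedy selection: keep a ball [w] of largest radius, discard the balls that meet it, which lie
    in its c-dilate by the engulfing property, and recurse on the rest [s'], disjoint from [w]. *)
Lemma finite_vitali (s : seq (X * R)) : (forall z, z \in s -> 0 < z.2) ->
  exists t, [/\ {subset t <= s}, disjoint_balls t &
    forall z, z \in s -> exists2 w, w \in t & B z.1 z.2 `<=` B w.1 (c * w.2)].
Proof.
have [n] := ubnP (size s); elim: n s => // n IH s.
case: (eqVneq s [::]) => [-> _ _|sN sn s0].
  by exists [::]; split => //; split => // i j /=.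
have [w ws wmax] : exists2 w, w \in s & forall z, z \in s -> z.2 <= w.2.
  elim: s sN {sn s0} => // a s IHs _; case: (eqVneq s [::]) => [->|/IHs[w ws wm]].
    by exists a; rewrite ?inE// => z; rewrite inE => /eqP->.
  case: (leP a.2 w.2) => aw.
    by exists w; rewrite ?inE ?ws ?orbT// => z; rewrite inE => /predU1P[->//|]; exact: wm.
  by exists a; rewrite ?inE ?eqxx// => z; rewrite inE => /predU1P[->//|/wm h]; rewrite (le_trans h) ?ltW.
have w0 : 0 < w.2 by exact: s0.
pose s' := [seq z <- s | ~~ `[< (B z.1 z.2 `&` B w.1 w.2) !=set0 >]].
have s's z : z \in s' -> z \in s by rewrite mem_filter => /andP[].
have ws' : w \notin s'.
  rewrite mem_filter negb_and negbK; apply/orP; left; apply/asboolP.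
  by exists w.1; split; exact: qball_center.
have sz : (size s' < n)%N.
  apply: leq_trans (_ : (size s <= n)%N) => //; rewrite size_filter.
  rewrite -(count_predC (fun z => ~~ `[< (B z.1 z.2 `&` B w.1 w.2) !=set0 >]) s) -[X in (X < _)%N]addn0 ltn_add2l.
  rewrite -has_count; apply/hasP; exists w => //=; rewrite negbK; apply/asboolP.
  by exists w.1; split; exact: qball_center.
have [t [ts' [ut dt] tV]] := IH s' sz (fun z zs => s0 z (s's z zs)).
have tdis z : z \in t -> forall y, B z.1 z.2 y -> B w.1 w.2 y -> False.
  move=> /ts'; rewrite mem_filter => /andP[/asboolPn h _] y zy wy; apply: h; by exists y.
exists (w :: t); split.
- by move=> z; rewrite inE => /predU1P[->//|/ts'/s's].
- split; first by rewrite /= ut andbT; apply: contra ws' => /ts'.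
  move=> i j /=; rewrite !inE => /predU1P[->|it] /predU1P[->|jt] //.
  + by move=> [y [wy jy]]; case: (tdis _ jt y).
  + by move=> [y [iy wy]]; case: (tdis _ it y).
  + exact: dt.
- move=> z zs; have [zw|zw] := pselect ((B z.1 z.2 `&` B w.1 w.2) !=set0).
    exists w; rewrite ?inE ?eqxx//; case: zw => y [zy wy].
    by apply: (@qball_engulf _ _ _ _ y) => //; [exact: s0|exact: wmax].
  have /tV[v vt vz] : z \in s' by rewrite mem_filter zs andbT; apply/asboolPn.
  by exists v; rewrite // inE vt orbT.
Qed.

Lemma measure_seq_le (I : eqType) (t : seq I) (F : I -> set (borel X)) (A : set (borel X)) :
  (forall i, i \in t -> measurable (F i)) -> measurable A ->
  (A `<=` [set x | exists2 i, i \in t & F i x]) ->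
  (mu A <= \sum_(i <- t) mu (F i))%E.
Proof.
elim: t A => [|i t IH] A mF mA AF.
  rewrite big_nil; have -> : A = set0 by apply/seteqP; split => // x /AF[].
  by rewrite measure0.
rewrite big_cons.
have mFi : measurable (F i) by apply: mF; rewrite inE eqxx.
apply: (@le_trans _ _ (mu (F i) + mu (A `\` F i))%E).
  apply: le_trans (measureU2 _ _ _) => //; last exact: measurableD.
  apply: le_measure; rewrite ?inE//; first by apply: measurableU => //; exact: measurableD.
  by move=> x Ax; have [|] := pselect (F i x); [left|right].
apply: leeD2l; apply: IH.
- by move=> j jt; apply: mF; rewrite inE jt orbT.
- exact: measurableD.
- by move=> x [/AF[j]]; rewrite inE => /predU1P[->|jt] // Fx _; exists j.
Qed.

(* Inner regularity reduces the covering argument to compact sets, hence to the finite Vitali lemma. *)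
Lemma vitali_measure (W : set (borel X)) (FF : X -> R -> Prop) (f : X -> \bar R) :
  measurable W -> measurable_fun setT (f : borel X -> \bar R) -> (forall x, 0 <= f x)%E ->
  (forall x r, FF x r -> 0 < r) ->
  (forall y, W y -> exists x r, FF x r /\ B x r y) ->
  (forall x r, FF x r -> (mu (W `&` B x (c * r)) <= \int[mu]_(y in B x r) f y)%E) ->
  (mu W <= \int[mu]_y f y)%E.
Proof.
move=> mW mf f0 FF0 Wcov WF.
have [_ _ inner] := ht_regular hX; rewrite inner//.
apply: ge_ereal_sup => _ [C [cC CW] <-].
have mC : measurable (C : set (borel X)).
  by rewrite -[C]setCK; apply: measurableC; apply: open_borel; rewrite openC; apply: compact_closed cC; exact: (ht_hausdorff hX).
move: (cC); rewrite compact_cover => /(_ _ [set z : X * R | FF z.1 z.2] (fun z => B z.1 z.2)).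
case=> [z /FF0 z0||D' D'FF CD']; first exact: qball_open.
  by move=> y /CW/Wcov[x [r [xr yr]]]; exists (x, r).
have D'0 z : z \in enum_fset D' -> 0 < z.2.
  by move=> zD; apply: (FF0 z.1); have := D'FF z zD; rewrite inE.
have [t [tD [ut dt] tV]] := finite_vitali D'0.
have tFF z : z \in t -> FF z.1 z.2 by move=> /tD zD; have := D'FF z zD; rewrite inE.
have t0 z : z \in t -> 0 < z.2 by move=> /tFF/FF0.
apply: (@le_trans _ _ (\sum_(z <- t) mu (W `&` B z.1 (c * z.2)))%E).
  apply: measure_seq_le => //.
    by move=> z zt; apply: measurableI => //; exact: (qball_measurable z.1 (cmul_gt0 (t0 z zt))).
  move=> y Cy; have [z /= zD yz] := CD' y Cy.
  by have [w wt zw] := tV z zD; exists w => //; split; [exact: CW|exact: zw].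
(* [G z] is the ball for [z] in [t], and is empty when the radius is not positive: it is measurable
   for every pair. *)
pose G (z : X * R) : set (borel X) := B z.1 z.2 `&` [set _ | 0 < z.2].
have GE z : z \in t -> G z = B z.1 z.2.
  by move=> zt; apply/seteqP; split => [y []//|y yz]; split => //=; exact: t0.
have mG z : measurable (G z).
  have [z0|z0] := ltP 0 z.2.
    by apply: measurableI; [exact: qball_measurable|rewrite (_ : [set _ | _] = setT)//; apply/seteqP; split].
  rewrite (_ : G z = set0)//; apply/seteqP; split => // y [_ /=]; by rewrite ltNge z0.
apply: (@le_trans _ _ (\sum_(z <- t) \int[mu]_(y in G z) f y)%E).
  rewrite big_seq [leRHS]big_seq; apply: lee_sum => z zt.
  by rewrite GE//; exact: (WF _ _ (tFF z zt)).
rewrite -ge0_integral_bigsetU//.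
- by apply: ge0_subset_integral => //; exact: bigsetU_measurable.
- move=> z w zt wt [y [yz yw]]; apply: (dt z w) => //; exists y.
  by split; [case: yz|case: yw].
- exact: measurable_funTS.
Qed.

End homogeneous_geometry.

(** * Maximal functions *)

(** Bernoulli's inequality gives the explicit exponent. *)
Lemma expr_unbounded (R : realType) (a M : R) : 1 < a -> exists j, M < a ^+ j.
Proof.
move=> a1; exists (Num.bound (`|M / (a - 1)|)).
set k := Num.bound _; have q1 : 0 < a - 1 by rewrite subr_gt0.
have h1 : M < k%:R * (a - 1) by rewrite -ltr_pdivrMr//; apply: le_lt_trans (ler_norm _) _; exact: archi_boundP.
suff h2 : 1 + k%:R * (a - 1) <= a ^+ k by lra.
elim: (k) => [|i IH]; first by rewrite mul0r addr0 expr0.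
rewrite exprS -natr1.
have : 0 <= i%:R * (a - 1) * (a - 1) by rewrite !mulr_ge0// ltW.
have : a * (1 + i%:R * (a - 1)) <= a * a ^+ i by rewrite ler_wpM2l//; lra.
nra.
Qed.

Section maximal_function.
Context (R : realType) (X : ptopologicalType) (d : X -> X -> R)
  (mu : {measure set (borel X) -> \bar R}) (c K : R) (hX : homogeneous_type d mu c K).
Context (q0 : R) (q0_gt1 : 1 < q0)
  (growth : forall x t j, 0 < t -> q0 ^+ j * mB d mu x t <= mB d mu x (c ^+ j * t)).

Notation B := (qball d).
Notation mB := (mB d mu).
Notation mfun f := (measurable_fun setT (f : borel X -> _)).

Lemma cX_gt0 j r : 0 < r -> 0 < c ^+ j * r.
Proof. by move=> r0; rewrite mulr_gt0// exprn_gt0// (c_gt0 hX). Qed.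

Lemma mB_unbounded x t (M : R) : 0 < t -> exists j, M < mB x (c ^+ j * t).
Proof.
move=> t0; have m0 := mB_gt0 hX x t0.
have [j hj] := expr_unbounded (M / mB x t) q0_gt1.
exists j; apply: lt_le_trans (growth x j t0).
by rewrite -ltr_pdivrMr.
Qed.

(** The dilates of a small ball around [x] have unbounded measure by the growth condition, while E
    has finite measure: the last dilate before the first one to leave E is the ball wanted. *)
Lemma whitney_ball (E : set X) x : open E -> (mu E < +oo)%E -> E x ->
  exists r, [/\ 0 < r, B x r `<=` E & ~ (B x (c * r) `<=` E)].
Proof.
move=> oE Ey Ex.
have [t t0 tE] := ht_basis hX (open_nbhs_nbhs (conj oE Ex)).
have E0 : (0 <= mu E)%E by [].
have [j0 hj0] := mB_unbounded x (fine (mu E)) t0.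
have ex : exists j, `[< ~ (B x (c ^+ j * t) `<=` E) >].
  exists j0; apply/asboolP => h; move: hj0; apply/negP; rewrite -leNgt -lee_fin.
  have pj : 0 < c ^+ j0 * t := cX_gt0 j0 t0.
  rewrite -(qball_mE hX)// fineK ?ge0_fin_numE//.
  apply: le_measure => //; rewrite inE; first exact: (qball_measurable hX).
  exact: open_borel.
case: (ex_minnP ex) => -[|j] /asboolP jE jmin; first by move: jE; rewrite expr0 mul1r.
exists (c ^+ j * t); split; first exact: cX_gt0.
- apply: contrapT => h; have /jmin : `[< ~ (B x (c ^+ j * t) `<=` E) >] by apply/asboolP.
  by rewrite ltnn.
- by rewrite mulrA -exprS.
Qed.

(** From a local to a global estimate: Whitney balls centred in W cover W, and the disjoint balls
    selected by Vitali's lemma all lie in E, so that their measures add up to at most that of E. *)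
Lemma whitney_measure (E : set X) (W : set (borel X)) (eta : R) : open E -> (mu E < +oo)%E ->
  measurable W -> W `<=` E -> 0 <= eta ->
  (forall x r, W x -> 0 < r -> B x r `<=` E -> ~ (B x (c * r) `<=` E) ->
     (mu (W `&` B x (c * r)) <= eta%:E * mu (B x r))%E) ->
  (mu W <= eta%:E * mu E)%E.
Proof.
move=> oE Ey mW WE eta0 H.
have mE : measurable (E : set (borel X)) by exact: open_borel.
have -> : (eta%:E * mu E = \int[mu]_y (eta * \1_E y)%:E)%E.
  under eq_integral do rewrite EFinM.
  by rewrite ge0_integralZl ?lee_fin// ?integral_indic ?setIT//; apply/measurable_EFinP; exact: measurable_indic.
have mI : measurable_fun setT (fun y : borel X => (eta * \1_E y)%:E).
  by apply/measurable_EFinP; apply: measurable_funM => //; exact: measurable_indic.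
apply: (vitali_measure hX (FF := fun x r => [/\ W x, 0 < r, B x r `<=` E & ~ (B x (c * r) `<=` E)])) => //.
- by move=> y; rewrite lee_fin mulr_ge0.
- by move=> x r [].
- move=> y Wy; have [r [r0 rE rnE]] := whitney_ball oE Ey (WE _ Wy).
  by exists y, r; split; [split|exact: (qball_center hX y r0)].
- move=> x r [Wx r0 rE rnE]; apply: le_trans (H x r Wx r0 rE rnE) _.
  have mBx := qball_measurable hX x r0.
  rewrite (eq_integral (fun=> eta%:E)) ?integral_cst// => y; rewrite inE => /rE Ey'.
  by rewrite indicE mem_set// mulr1.
Qed.

Definition avg (f : X -> \bar R) x r : \bar R := ((mB x r)^-1%:E * \int[mu]_(y in B x r) f y)%E.

(** All the balls that contain [y] compete, not only those centred at [y]: the sets where [maxfun]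
    exceeds a level are then open, hence measurable. *)
Definition maxfun (f : X -> \bar R) y : \bar R :=
  ereal_sup [set avg f z.1 z.2 | z in [set z : X * R | 0 < z.2 /\ B z.1 z.2 y]].

Lemma avg_ge0 f x r : (forall y, 0 <= f y)%E -> 0 < r -> (0 <= avg f x r)%E.
Proof.
move=> f0 r0; apply: mule_ge0; first by rewrite lee_fin invr_ge0 ltW// (mB_gt0 hX).
exact: integral_ge0.
Qed.

Lemma avgE f x r : 0 < r -> ((mB x r)%:E * avg f x r = \int[mu]_(y in B x r) f y)%E.
Proof.
by move=> r0; rewrite /avg muleA -EFinM mulfV ?mul1e// gt_eqF// (mB_gt0 hX).
Qed.

Lemma avg_le_maxf f x r y : 0 < r -> B x r y -> (avg f x r <= maxfun f y)%E.
Proof. by move=> r0 xy; apply: ereal_sup_ubound; exists (x, r). Qed.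

Lemma maxf_gtP f y (a : \bar R) : (a < maxfun f y)%E -> exists x r, [/\ 0 < r, B x r y & (a < avg f x r)%E].
Proof. by move=> /ereal_sup_gt[_ [[x r] [/= r0 xy] <-]] h; exists x, r. Qed.

Lemma maxf_le f y (a : \bar R) : (forall (x : X) (r : R), 0 < r -> B x r y -> (avg f x r <= a)%E) -> (maxfun f y <= a)%E.
Proof. by move=> h; apply: ge_ereal_sup => _ [[x r] [/= r0 xy] <-]; exact: h. Qed.

Lemma maxf_ge0 f y : (forall y, 0 <= f y)%E -> (0 <= maxfun f y)%E.
Proof.

by move=> f0; apply: le_trans (avg_ge0 y f0 ltr01) _; apply: avg_le_maxf => //; exact: (qball_center hX).
Qed.

Lemma open_maxf f a : open [set y | (a < maxfun f y)%E].
Proof.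
rewrite openE => y /maxf_gtP[x [r [r0 xy h]]]; rewrite /interior.
apply: filterS (open_nbhs_nbhs (conj (qball_open hX x r0) xy)) => z xz /=.
exact: lt_le_trans h (avg_le_maxf f r0 xz).
Qed.

Lemma measurable_maxf f : mfun (maxfun f).
Proof.
move=> mT; apply: (measurability _ (ErealGenOInfty.measurableE R)) => //.
move=> _ [_ [a ->] <-]; rewrite setTI preimage_itvoy.
exact: (open_borel (open_maxf f a%:E)).
Qed.

Lemma avg_le f g x r : mfun f -> mfun g -> (forall y, 0 <= f y)%E -> (forall y, f y <= g y)%E ->
  0 < r -> (avg f x r <= avg g x r)%E.
Proof.
move=> mf mg f0 fg r0; apply: lee_wpmul2l; first by rewrite lee_fin invr_ge0 ltW// (mB_gt0 hX).
have mBx := qball_measurable hX x r0.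
by apply: ge0_le_integral => //; exact: measurable_funTS.
Qed.

Lemma le_maxf f g y : mfun f -> mfun g -> (forall y, 0 <= f y)%E -> (forall y, f y <= g y)%E ->
  (maxfun f y <= maxfun g y)%E.
Proof.
move=> mf mg f0 fg; apply: maxf_le => x r r0 xy; apply: le_trans (avg_le_maxf g r0 xy); exact: avg_le.
Qed.

Lemma avgD f g x r : mfun f -> mfun g -> (forall y, 0 <= f y)%E -> (forall y, 0 <= g y)%E ->
  0 < r -> (avg (fun y => f y + g y) x r = avg f x r + avg g x r)%E.
Proof.
move=> mf mg f0 g0 r0; have mBx := qball_measurable hX x r0.
rewrite /avg ge0_integralD//; try exact: measurable_funTS.
by rewrite ge0_muleDr//; exact: integral_ge0.
Qed.

Lemma maxfD f g y : mfun f -> mfun g -> (forall y, 0 <= f y)%E -> (forall y, 0 <= g y)%E ->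
  (maxfun (fun y => f y + g y) y <= maxfun f y + maxfun g y)%E.
Proof.
move=> mf mg f0 g0; apply: maxf_le => x r r0 xy; rewrite avgD//.
by apply: leeD; exact: avg_le_maxf.
Qed.

Lemma avg_cst (a : R) x r : 0 < r -> avg (fun=> a%:E) x r = a%:E.
Proof.
move=> r0; have m0 := mB_gt0 hX x r0.
rewrite /avg integral_cst//; last exact: (qball_measurable hX).
by rewrite (qball_mE hX)// -!EFinM mulrCA mulVf ?mulr1// gt_eqF.
Qed.

(** The balls on which the average of f exceeds [a] cover the level set; each has measure at most
    1/a times the integral of f over it, and doubling accounts for the c-dilate, whence the constant
    K / a. *)
Lemma weak_maxfun f (a : R) : mfun f -> (forall y, 0 <= f y)%E -> 0 < a ->
  (mu [set y | a%:E < maxfun f y] <= (K / a)%:E * \int[mu]_y f y)%E.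
Proof.
move=> mf f0 a0.
have Ka : 0 <= K / a by rewrite divr_ge0 ?ltW// (K_gt0 hX).
rewrite -ge0_integralZl ?lee_fin//.
apply: (vitali_measure hX (FF := fun x r => 0 < r /\ (a%:E < avg f x r)%E)) => //.
- exact: (open_borel (open_maxf f a%:E)).
- exact: measurable_funeM.
- by move=> y; rewrite mule_ge0// lee_fin.
- by move=> x r [].
- by move=> y /maxf_gtP[x [r [r0 xy h]]]; exists x, r.
- move=> x r [r0 h]; have mBx := qball_measurable hX x r0.
  have mcB := qball_measurable hX x (cmul_gt0 hX r0).
  rewrite ge0_integralZl ?lee_fin//; last exact: measurable_funTS.
  rewrite -avgE//.
  apply: (@le_trans _ _ (mu (B x (c * r)))).
    apply: le_measure; rewrite ?inE//; first by apply: measurableI => //; exact: (open_borel (open_maxf f a%:E)).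
  rewrite (qball_mE hX) ?(cmul_gt0 hX)//.
  apply: (@le_trans _ _ (K * mB x r)%:E); first by rewrite lee_fin (mB_doubling hX).
  rewrite EFinM EFinM -muleA; apply: lee_wpmul2l; first by rewrite lee_fin ltW// (K_gt0 hX).
  rewrite muleCA -[leLHS]mule1; apply: lee_wpmul2l; first by rewrite lee_fin ltW// (mB_gt0 hX).
  rewrite -(@lee_pmul2l _ a%:E)// ?lte_fin//.
  by rewrite mule1 muleA -EFinM mulfV ?gt_eqF// mul1e ltW.
Qed.

End maximal_function.

(** * Strong maximal inequality, good-lambda inequality and sharp maximal inequality *)

Section fefferman_stein.
Context (R : realType) (X : ptopologicalType) (d : X -> X -> R)
  (mu : {measure set (borel X) -> \bar R}) (c K : R) (hX : homogeneous_type d mu c K).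
Context (q0 : R) (q0_gt1 : 1 < q0)
  (growth : forall x t j, 0 < t -> q0 ^+ j * mB d mu x t <= mB d mu x (c ^+ j * t)).

Notation B := (qball d).
Notation mB := (mB d mu).
Notation avg := (avg d mu).
Notation maxfun := (maxfun d mu).
Notation mfun f := (measurable_fun setT (f : borel X -> _)).

(** The part of f below a/2 contributes at most a/2 to the maximal function, so the part above must
    contribute more than a/2: this is the weak inequality for that part at level a/2. *)
Lemma weak_maxf_cut (f : X -> R) (a : R) : mfun f -> (forall y, 0 <= f y) -> 0 < a ->
  (mu [set y | a%:E < maxfun (EFin \o f) y] <= (2 * K / a)%:E * \int[mu]_y (f y * (a < 2 * f y)%R%:R)%:E)%E.
Proof.
move=> mf f0 a0.
pose g (y : X) := f y * (a < 2 * f y)%R%:R.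
have g0 y : 0 <= g y by rewrite mulr_ge0.
have mg : mfun g.
  apply: measurable_funM => //.
  by apply: measurable_lt_nat => //; apply: measurable_funM.
have mEg : mfun (EFin \o g) by apply/measurable_EFinP.
have a20 : 0 < a / 2 by rewrite divr_gt0.
rewrite (_ : 2 * K / a = K / (a / 2)); last by field; rewrite gt_eqF.
apply: (le_trans _ (weak_maxfun hX mEg (fun y => _) a20)); last by move=> y; rewrite lee_fin.
apply: le_measure; rewrite ?inE; try exact: (open_borel (open_maxf hX _ _)).
move=> y /= h; rewrite -(@lteD2lE _ (a / 2)%:E)// -EFinD -splitr.
apply: (lt_le_trans h).
apply: (@le_trans _ _ (maxfun (fun y => (a / 2)%:E + (g y)%:E) y)%E).
  apply: (le_maxf hX) => //.
  - exact/measurable_EFinP.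
  - by apply: emeasurable_funD.
  - move=> z; rewrite /comp -EFinD lee_fin /g; have [h2|h2] := ltP a (2 * f z); rewrite ?mulr1 ?mulr0; lra.
apply: (le_trans (maxfD hX _ _ _ _ _)) => //; try by move=> z; rewrite lee_fin// ltW.
apply: leeD => //; apply: (maxf_le (a := (a / 2)%:E)) => x r r0 xy.
by rewrite (avg_cst hX).
Qed.

(** Marcinkiewicz interpolation between L^1 and L^oo: at each level the weak inequality is applied
    to the part of f that is large compared with the level, and the levels are summed under the
    integral. *)
Lemma strong_maxfun (p : R) : 1 < p -> exists2 C : R, 0 < C & forall f : X -> R,
  mfun f -> (forall y, 0 <= f y) ->
  (\int[mu]_y (maxfun (EFin \o f) y `^ p) <= C%:E * \int[mu]_y (f y `^ p)%R%:E)%E.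
Proof.
move=> p1; have p0 : 0 < p := lt_trans ltr01 p1.
have p10 : 0 < p - 1 by rewrite subr_gt0.
have L1 : (1 : R) < 2 by rewrite ltr1n.
have K0 := K_gt0 hX.
have q1 := powR_gt1 L1 p10.
set C1 := 2 `^ (p - 1) / (2 `^ (p - 1) - 1).
have C10 : 0 < C1 by rewrite divr_gt0 ?subr_gt0 ?(lt_trans ltr01).
exists (2 `^ p * (2 * K * C1 * 2 `^ (p - 1))).
  by do ?apply: mulr_gt0 => //; rewrite powR_gt0.
move=> f mf f0.
have mfp : mfun (fun y => (f y `^ p)%:E).
  by apply/measurable_EFinP; apply: (measurableT_comp (measurable_powR p)).
rewrite EFinM -muleA; apply: (layer_cake_le L1 (N0 := 0)) => //.
- exact: (measurable_maxf hX).
- by move=> x; apply: (maxf_ge0 hX) => y; rewrite lee_fin.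
move=> N _.
pose t i y := (f y * (dlevel 2 N i < 2 * f y)%R%:R)%:E.
have mt i : mfun (t i).
  apply/measurable_EFinP; apply: measurable_funM => //.
  by apply: measurable_lt_nat => //; apply: measurable_funM.
have t0 i y : (0 <= t i y)%E by rewrite lee_fin mulr_ge0.
apply: (@le_trans _ _ (\sum_(i < N.*2) \int[mu]_y ((2 * K * dlevel 2 N i `^ (p - 1))%:E * t i y))%E).
  apply: lee_sum => i _; have li := dlevel_gt0 L1 N i.
  apply: (@le_trans _ _ ((dlevel 2 N i `^ p)%:E * ((2 * K / dlevel 2 N i)%:E * \int[mu]_y t i y))%E).
    apply: lee_wpmul2l; first by rewrite lee_fin powR_ge0.
    exact: weak_maxf_cut.
  rewrite muleA -EFinM ge0_integralZl//; last by rewrite lee_fin !mulr_ge0 ?powR_ge0 ?ltW.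
  rewrite le_eqVlt; apply/orP; left; apply/eqP; congr (_%:E * _)%E.
  by rewrite -(mulr_powRB1 (ltW li) p0); field; rewrite gt_eqF.
rewrite -ge0_integral_sum//; first last.
- by move=> i y _; rewrite mule_ge0// lee_fin !mulr_ge0 ?powR_ge0 ?ltW.
- by move=> i; apply: measurable_funeM.
rewrite -ge0_integralZl//; first last.
- by rewrite lee_fin; apply/ltW; do ?apply: mulr_gt0 => //; rewrite powR_gt0.
- by move=> y _; rewrite lee_fin powR_ge0.
apply: ge0_le_integral => //.
- by move=> y _; apply: sume_ge0 => i _; rewrite mule_ge0// lee_fin !mulr_ge0 ?powR_ge0 ?ltW.
- by apply: emeasurable_sum => i; apply: measurable_funeM.
- exact: measurable_funeM.
move=> y _.
(* At a fixed point only the levels below 2 f(y) remain; since p - 1 > 0, the sum of their powers of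
   exponent p - 1 is controlled by the last one. *)
have h : level_sum 2 (p - 1) N (2 * f y)%:E <= C1 * (2 * f y) `^ (p - 1).
  by apply: level_sum_le => //; rewrite mulr_ge0.
rewrite (eq_bigr (fun i : 'I_N.*2 => (2 * K * f y * (dlevel 2 N i `^ (p - 1) * ((dlevel 2 N i)%:E < (2 * f y)%:E)%E%:R))%:E)); last first.
  by move=> i _; rewrite /t -EFinM lte_fin; congr EFin; ring.
rewrite sumEFin -mulr_sumr -EFinM lee_fin.
apply: (@le_trans _ _ (2 * K * f y * (C1 * (2 * f y) `^ (p - 1)))).
  by apply: ler_wpM2l => //; rewrite !mulr_ge0// ltW.
rewrite powRM//.
rewrite -(mulr_powRB1 (f0 y) p0).
by rewrite le_eqVlt; apply/orP; left; apply/eqP; ring.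
Qed.

(** On a Whitney ball of the level set [E] that is centred where G is small, the large values of the
    maximal function come from small balls, hence from F - a near the Whitney ball; the weak
    inequality makes them rare. In K + 3, K rules out the large balls and 3 = 1 + 2 leaves room for
    |a| on the small ones. *)
Lemma good_lambda (F : X -> R) (G : X -> \bar R) (lam gam : R) :
  mfun F -> mfun G -> 0 < lam -> 0 < gam <= 1 ->
  (mu [set y | lam%:E < maxfun (fun z => `|F z|%:E) y] < +oo)%E ->
  (forall x r, 0 < r -> exists a : R, forall y, B x r y -> (avg (fun z => `|F z - a|%:E) x r <= G y)%E) ->
  (mu [set y | ((K + 3) * lam)%:E < maxfun (fun z => `|F z|%:E) y] <=
     (K ^+ 3 * gam)%:E * mu [set y | lam%:E < maxfun (fun z => `|F z|%:E) y] +
     mu [set y | (gam * lam)%:E < G y])%E.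
Proof.
move=> mF mG lam0 /andP[gam0 gam1] Efin H; have K0 := K_gt0 hX.
set f : X -> \bar R := fun z => `|F z|%:E; set E := [set y | lam%:E < maxfun f y]%E in Efin *.
have mf : mfun f by apply/measurable_EFinP; apply: measurableT_comp.
have f0 y : (0 <= f y)%E by rewrite lee_fin.
have mmax : mfun (maxfun f) by exact: (measurable_maxf hX).
pose W : set (borel X) := [set y | ((K + 3) * lam)%:E < maxfun f y]%E `&` [set y | G y <= (gam * lam)%:E]%E.
have mG1 : measurable ([set y | (gam * lam)%:E < G y]%E : set (borel X)).
  by rewrite -[X in measurable X]setTI; apply: measurable_lte.
have mM1 : measurable ([set y | ((K + 3) * lam)%:E < maxfun f y]%E : set (borel X)).
  exact: (open_borel (open_maxf hX _ _)).
have mW : measurable W.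
  apply: measurableI => //; rewrite -[X in measurable X]setTI; exact: measurable_lee.
apply: (@le_trans _ _ (mu W + mu ([set y | (gam * lam)%:E < G y]%E))%E).
  apply: le_trans (measureU2 _ _ _) => //; apply: le_measure; rewrite ?inE//.
    exact: measurableU.
  by move=> y yM; have [h|h] := leP (G y) (gam * lam)%:E; [left|right].
apply: leeD2r; apply: (whitney_measure hX q0_gt1 growth) => //.
- exact: (open_maxf hX).
- move=> y [/= h _]; apply: le_lt_trans h; rewrite lee_fin ler_peMl ?(ltW lam0)//; lra.
- by rewrite mulr_ge0 ?exprn_ge0 ?ltW.
move=> x r [/= xM xG] r0 rE rnE.
have cr0 := cmul_gt0 hX r0; have ccr0 := cmul_gt0 hX cr0.
(* The c-dilate of a Whitney ball leaves [E], which provides a nearby point with small maximal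
   function. *)
have [y0 [xy0 y0E]] : exists y0, B x (c * r) y0 /\ (maxfun f y0 <= lam%:E)%E.
  apply: contrapT => h; apply: rnE => y xy; rewrite /E/= ltNge; apply/negP => ?.
  by apply: h; exists y.
have [a Ha] := H x (c * (c * r)) ccr0.
have sub2 : B x (c * r) `<=` B x (c * (c * r)) by apply: (qball_sub hX) => //; exact/ltW/(cmul_gt hX).
pose h z := `|F z - a|%:E.
have mh : mfun h by apply/measurable_EFinP; apply: measurableT_comp => //; apply: measurable_funB.
have h0 z : (0 <= h z)%E by rewrite lee_fin.
have avh : (avg h x (c * (c * r)) <= (gam * lam)%:E)%E.
  apply: le_trans xG; apply: Ha; exact: (qball_center hX).
(* |a| is at most the mean of |F - a| plus that of |F|; the first is bounded through [G x], the
   second by the maximal function at [y0], and gam <= 1. *)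
have a2 : (`|a|%:E <= (2 * lam)%:E)%E.
  rewrite -(avg_cst hX `|a| x ccr0).
  apply: (@le_trans _ _ (avg (fun z => h z + f z) x (c * (c * r)))%E).
    apply: (avg_le hX) => //; first exact: emeasurable_funD.
    by move=> z; rewrite -EFinD lee_fin distrC; have := ler_normD (a - F z) (F z); rewrite subrK.
  rewrite (avgD hX)//.
  apply: (@le_trans _ _ ((gam * lam)%:E + lam%:E)%E).
    apply: leeD => //; apply: le_trans y0E; apply: avg_le_maxf => //; exact: sub2.
  by rewrite -EFinD lee_fin; nra.
pose h' z := (h z * (\1_(B x (c * (c * r))) z)%:E)%E.
have mI : mfun (fun z => (\1_(B x (c * (c * r))) z)%:E : \bar R).
  by apply/measurable_EFinP; apply: measurable_indic; exact: (qball_measurable hX).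
have mh' : mfun h' by exact: emeasurable_funM.
have h'0 z : (0 <= h' z)%E by rewrite mule_ge0 ?lee_fin.
have sub : W `&` B x (c * r) `<=` [set y | lam%:E < maxfun h' y]%E.
  move=> w [[/= wM wG] xw]; have [v [rho [rho0 vw av]]] := maxf_gtP wM.
  (* A large ball has a c-dilate containing [y0], so its average is at most K lam, a contradiction.
     A small ball stays in the c^2-dilate of the Whitney ball, where [h'] is F - a in modulus. *)
  have [rr|rr] := leP (c * r) rho.
    have crho0 := cmul_gt0 hX rho0.
    have vsub : B v rho `<=` B v (c * rho) by apply: (qball_sub hX) => //; exact/ltW/(cmul_gt hX).
    have y0v : B v (c * rho) y0 by apply: (qball_engulf hX cr0 rr vw xw).
    have := le_trans (avg_le_maxf mu f crho0 y0v) y0E.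
    have mv := mB_gt0 hX v rho0; have mcv := mB_gt0 hX v crho0.
    have : ((mB v rho)%:E * avg f v rho <= (mB v (c * rho))%:E * avg f v (c * rho))%E.
      rewrite !(avgE hX)//; apply: ge0_subset_integral => //; try exact: (qball_measurable hX).
      exact: measurable_funTS.
    move=> h1 h2; exfalso; move: av; apply/negP; rewrite -leNgt.
    rewrite -(@lee_pmul2l _ (mB v rho)%:E)// ?lte_fin//.
    apply: (le_trans h1); apply: (@le_trans _ _ ((K * mB v rho)%:E * lam%:E)%E).
      apply: lee_pmul => //; first by rewrite lee_fin ltW.
        exact: (avg_ge0 hX).
      by rewrite lee_fin (mB_doubling hX).
    rewrite -!EFinM lee_fin.
    have : 0 <= mB v rho * lam by rewrite mulr_ge0 ?ltW.
    lra.
  have vsub : B v rho `<=` B x (c * (c * r)) by apply: (qball_engulf hX rho0 (ltW rr) xw vw).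
  rewrite /=; apply: lt_le_trans (avg_le_maxf mu h' rho0 vw).
  have : (avg f v rho <= avg h' v rho + `|a|%:E)%E.
    rewrite -(avg_cst hX `|a| v rho0) -(avgD hX)//.
    have mBv := qball_measurable hX v rho0.
    apply: lee_wpmul2l; first by rewrite lee_fin invr_ge0 ltW// (mB_gt0 hX).
    apply: ge0_le_integral => //; try exact: measurable_funTS.
      by apply: measurable_funTS; apply: emeasurable_funD.
    move=> z vz; rewrite /h' indicE mem_set; last exact: vsub.
    by rewrite mule1 -EFinD lee_fin -{1}(subrK a (F z)) ler_normD.
  move=> h1; have := lt_le_trans av (le_trans h1 (leeD2l _ a2)).
  move=> h2; rewrite ltNge; apply/negP => h3; move: h2; apply/negP.
  rewrite -leNgt; apply: le_trans (leeD2r _ h3) _; rewrite -EFinD lee_fin; have : 0 <= K * lam by rewrite mulr_ge0 ?ltW.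
  lra.
apply: (@le_trans _ _ (mu [set y | lam%:E < maxfun h' y]%E)).
  apply: le_measure => //; rewrite inE; last exact: (open_borel (open_maxf hX _ _)).
  by apply: measurableI => //; exact: (qball_measurable hX).
(* Of the three factors K, one comes from the weak inequality and two from doubling twice. *)
apply: (le_trans (weak_maxfun hX mh' h'0 lam0)).
have -> : (\int[mu]_y h' y = \int[mu]_(y in B x (c * (c * r))) h y)%E.
  rewrite [RHS]integral_mkcond; apply: eq_integral => y _; rewrite /h' patchE indicE.
  by case: ifP => _; rewrite ?mule1 ?mule0.
rewrite -(avgE hX)// (qball_mE hX)//.
apply: (@le_trans _ _ ((K / lam)%:E * ((K * (K * mB x r))%:E * (gam * lam)%:E))%E).
  apply: lee_wpmul2l; first by rewrite lee_fin divr_ge0 ?ltW.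
  apply: lee_pmul => //; [by rewrite lee_fin ltW ?(mB_gt0 hX)|exact: (avg_ge0 hX)|].
  rewrite lee_fin; apply: le_trans (mB_doubling hX _ _) _ => //.
  by apply: ler_wpM2l; [exact: ltW|exact: (mB_doubling hX)].
rewrite -!EFinM lee_fin le_eqVlt; apply/orP; left; apply/eqP.
by field; rewrite gt_eqF.
Qed.

(* Summing the good-lambda inequality over the levels L^k, -N <= k < N, costs only the lowest level,
   which tends to 0 because F is in L^p0 with p0 < p. *)
Lemma sharp_maximal (p p1 : R) : 1 <= p1 -> p1 < p -> exists2 C : R, 0 < C &
  forall (F : X -> R) (G : X -> \bar R), Lp mu p1 F -> mfun G -> (forall y, 0 <= G y)%E ->
  (forall x r, 0 < r -> exists a : R, forall y, B x r y -> (avg (fun z => `|F z - a|%:E) x r <= G y)%E) ->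
  (\int[mu]_y (maxfun (fun z => `|F z|%:E) y `^ p) <= C%:E * \int[mu]_y (G y `^ p))%E.
Proof.
move=> p1_ge1 p1p; have K0 := K_gt0 hX.
have p1_gt0 : 0 < p1 := lt_le_trans ltr01 p1_ge1.
have p0 : 0 < p := lt_trans p1_gt0 p1p.
set L := K + 3; have L1 : 1 < L by rewrite /L; lra.
have L0 : 0 < L by lra.
have Lp1 := powR_gt1 L1 p0; have Lp0 : 0 < L `^ p by lra.
have K30 : 0 < K ^+ 3 by rewrite exprn_gt0.
(* Chosen so that L^p K^3 gam = 1/2: the sum over the levels can then be absorbed. *)
pose gam := (2 * L `^ p * K ^+ 3)^-1.
have K31 : 1 <= K ^+ 3 by rewrite exprn_ege1// ltW// (K_gt1 hX).
have gam0 : 0 < gam by rewrite invr_gt0 !mulr_gt0.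
have gam1 : gam <= 1.
  rewrite invf_le1 ?mulr_gt0//.
  by rewrite -[leLHS](mulr1 1); apply: ler_pM => //; lra.
set C1 := L `^ p / (L `^ p - 1).
have C10 : 0 < C1 by rewrite divr_gt0// subr_gt0.
exists (L `^ p * (2 * L `^ p * C1 * (gam^-1) `^ p)).
  by do ?apply: mulr_gt0 => //; rewrite powR_gt0// invr_gt0.
move=> F G Fp mG G0 H.
have mF : mfun F by case: Fp.
set f : X -> \bar R := fun z => `|F z|%:E.
have mf : mfun f by apply/measurable_EFinP; apply: measurableT_comp.
have f0 y : (0 <= f y)%E by rewrite lee_fin.
have mmax : mfun (maxfun f) by exact: (measurable_maxf hX).
have max0 y : (0 <= maxfun f y)%E by exact: (maxf_ge0 hX).
have [Gy|] := ltP (\int[mu]_y (G y `^ p))%E +oo%E; last first.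
  by rewrite leye_eq => /eqP ->; rewrite gt0_muley ?leey// lte_fin;
    do ?apply: mulr_gt0 => //; rewrite powR_gt0// invr_gt0.
have IG0 : (0 <= \int[mu]_y (G y `^ p))%E by apply: integral_ge0 => y _; exact: poweR_ge0.
pose I := fine (\int[mu]_y (G y `^ p))%E.
have IE : (\int[mu]_y (G y `^ p))%E = I%:E by rewrite fineK// ge0_fin_numE.
have I0 : 0 <= I by exact: fine_ge0.
pose n1 := nrm mu p1 F `^ p1.
have n10 : 0 <= n1 := powR_ge0 _ _.
(* The weak inequality in L^p1 makes the distribution function of the maximal function finite at
   every level, and controls the lowest level. *)
have weak a : 0 < a -> (mu [set y | a%:E < maxfun f y] <= (2 * K * 2 `^ (p1 - 1) * n1 / a `^ p1)%:E)%E.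
  move=> a0; apply: le_trans (weak_maxf_cut (f := fun y => `|F y|) _ _ a0) _ => //.
    exact: measurableT_comp.
  apply: (@le_trans _ _ ((2 * K / a)%:E * ((2 / a) `^ (p1 - 1) * n1)%:E)%E); last first.
    rewrite -EFinM lee_fin powRM ?invr_ge0 ?(ltW a0)// -(mulr_powRB1 (ltW a0) p1_gt0).
    rewrite powR_invl; last exact: ltW.
    rewrite le_eqVlt; apply/orP; left; apply/eqP; field.
    by rewrite !gt_eqF ?powR_gt0.
  apply: lee_wpmul2l; first by rewrite lee_fin !mulr_ge0 ?invr_ge0 ?ltW.
  rewrite EFinM /n1 -(IpE p1_gt0 Fp) /Ip -ge0_integralZl//; first last.
  - by rewrite lee_fin powR_ge0.
  - exact: (measurable_powRn p1 mF).
  apply: ge0_le_integral => //.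
  - apply/measurable_EFinP; apply: measurable_funM; first exact: measurableT_comp.
    by apply: measurable_lt_nat => //; apply: measurable_funM => //; exact: measurableT_comp.
  - by apply: measurable_funeM; exact: (measurable_powRn p1 mF).
  move=> y _; rewrite -EFinM lee_fin; have [h|h] := ltP a (2 * `|F y|); last first.
    by rewrite mulr0 mulr_ge0 ?powR_ge0.
  rewrite mulr1 -(mulr_powRB1 (normr_ge0 (F y)) p1_gt0) mulrCA ler_peMr//.
  have -> : 2 / a = (a / 2)^-1 by rewrite invf_div.
  have a20 : 0 < a / 2 by rewrite divr_gt0.
  rewrite powR_invl; last exact: ltW.
  rewrite mulrC ler_pdivlMr ?powR_gt0// mul1r.
  by apply: ge0_ler_powR; rewrite ?nnegrE ?subr_ge0 ?(ltW a20)//; lra.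
have Efin a : 0 < a -> (mu [set y | a%:E < maxfun f y] < +oo)%E.
  by move=> /weak h; apply: le_lt_trans h (ltry _).
pose aN N i := fine (mu [set y | (dlevel L N i)%:E < maxfun f y]%E).
have aE N i : mu [set y | (dlevel L N i)%:E < maxfun f y]%E = (aN N i)%:E.
  by rewrite fineK// ge0_fin_numE//; apply: Efin; exact: dlevel_gt0.
have aN0 N i : 0 <= aN N i by exact: fine_ge0.
have mGs a : measurable ([set y | a%:E < G y]%E : set (borel X)).
  by rewrite -[X in measurable X]setTI; apply: measurable_lte.
have Gsum N : (\sum_(i < N.*2) (dlevel L N i `^ p)%:E * mu [set y | (gam * dlevel L N i)%:E < G y] <= (C1 * gam^-1 `^ p * I)%:E)%E.
  have := @layer_cake_ge _ _ _ mu L L1 p N (fun y => (gam^-1)%:E * G y)%E p0.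
  have mgG : mfun (fun y => (gam^-1)%:E * G y)%E by exact: measurable_funeM.
  move=> /(_ mgG) h.
  have e N' i : [set y | (gam * dlevel L N' i)%:E < G y]%E = [set y | (dlevel L N' i)%:E < (gam^-1)%:E * G y]%E.
    apply/eq_set => y; by rewrite lte_pdivlMl// -EFinM.
  under eq_bigr do rewrite e.
  apply: (le_trans (h _)); first by move=> y; rewrite mule_ge0// lee_fin invr_ge0 ltW.
  rewrite (eq_integral (fun y : borel X => (gam^-1)%:E `^ p * G y `^ p)%E); last first.
    by move=> y _; rewrite poweRM// lee_fin invr_ge0 ltW.
  rewrite ge0_integralZl//; first last.
  - by rewrite poweR_ge0.
  - by move=> y _; exact: poweR_ge0.
  - exact: (measurableT_comp (measurable_poweR _)).
  by rewrite IE poweR_EFin -!EFinM mulrA.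
apply/lee_addgt0Pr => e e0.
(* At the lowest level L^-N, the weight L^(-N p) times the weak bound L^(N p1) leaves L^((p1 - p)
   N), which tends to 0 because p1 < p. *)
pose bound N := 2 * K * 2 `^ (p1 - 1) * n1 * (L `^ (p1 - p)) ^+ N.
have bcv : bound N @[N --> \oo] --> (0 : R).
  rewrite -[X in _ --> X](mulr0 (2 * K * 2 `^ (p1 - 1) * n1)); apply: cvgM; first exact: cvg_cst.
  apply: cvg_expr; rewrite ger0_norm ?powR_ge0//.
  have := @gt0_ltr_powR R (p - p1); rewrite subr_gt0 => /(_ p1p 1 L).
  rewrite powR1 !nnegrE ler01 (ltW L0) => /(_ isT isT L1).
  by rewrite -(opprB p p1) powRN => h; rewrite invf_lt1// (lt_trans ltr01).
have e' : 0 < e / (2 * L `^ p) by rewrite divr_gt0// mulr_gt0.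
have [N0 _ HN0] : \forall N \near \oo, `|0 - bound N| <= e / (2 * L `^ p).
  by move/cvgrPdist_le : bcv; apply.
apply: (@le_trans _ _ ((L `^ p)%:E * (2 * (e / (2 * L `^ p)) + 2 * L `^ p * (C1 * gam^-1 `^ p * I))%:E)%E); last first.
  rewrite IE -!EFinM -EFinD lee_fin le_eqVlt; apply/orP; left; apply/eqP.
  by field; rewrite gt_eqF.
apply: (layer_cake_le L1 (N0 := N0.+1)) => // N NN0.
have /HN0 : (N0 <= N)%N by exact: ltnW.
rewrite sub0r normrN ger0_norm; last first.
  by rewrite !mulr_ge0 ?exprn_ge0 ?powR_ge0 ?ltW.
move=> bN.
under eq_bigr do rewrite aE -EFinM.
rewrite sumEFin lee_fin.
set S := \sum_(i < _) _.
(* N > 0, so the lowest level can be split off and the others be successors. *)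
have N2 : N.*2 = (N.*2.-1).+1 by rewrite prednK// double_gt0 (leq_trans _ NN0).
pose g i := fine (mu [set y | (gam * dlevel L N i)%:E < G y]%E).
have gfin i : (i < N.*2)%N -> mu [set y | (gam * dlevel L N i)%:E < G y]%E = (g i)%:E.
  move=> iN; rewrite fineK// ge0_fin_numE// ltNge leye_eq; apply/negP => /eqP h.
  have := Gsum N; rewrite (bigD1 (Ordinal iN))//= h gt0_muley; last by rewrite lte_fin powR_gt0// dlevel_gt0.
  rewrite addye; first by rewrite leye_eq.
  by rewrite gt_eqF// (lt_le_trans (ltNyr 0))// sume_ge0// => i' _; rewrite mule_ge0// lee_fin powR_ge0.
have Gs : \sum_(i < N.*2) dlevel L N i `^ p * g i <= C1 * gam^-1 `^ p * I.
  rewrite -lee_fin -sumEFin; apply: le_trans (Gsum N).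
  by apply: lee_sum => i _; rewrite gfin ?ltn_ord.
have g0 i : 0 <= g i by exact: fine_ge0.
have low : dlevel L N 0 `^ p * aN N 0%N <= bound N.
  have := weak _ (dlevel_gt0 L1 N 0); rewrite aE lee_fin => h.
  apply: le_trans (ler_wpM2l (powR_ge0 _ _) h) _.
  rewrite /bound /dlevel expr0 mul1r le_eqVlt; apply/orP; left; apply/eqP.
  have -> : (L ^+ N)^-1 = L `^ (- N%:R) by rewrite powRN powR_mulrn// ltW.
  rewrite -(powR_mulrn N (powR_ge0 L _)) -!powRrM.
  have -> : L `^ ((p1 - p) * N%:R) = L `^ (- N%:R * p) / L `^ (- N%:R * p1).
    rewrite -powRN -powRD; last by rewrite (gt_eqF L0) implybT.
    by congr powR; ring.
  ring.
have step i : (i.+1 < N.*2)%N ->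
    dlevel L N i.+1 `^ p * aN N i.+1 <= 2^-1 * (dlevel L N i `^ p * aN N i) + L `^ p * (dlevel L N i `^ p * g i).
  move=> iN; have li := dlevel_gt0 L1 N i.
  have := @good_lambda F G (dlevel L N i) gam mF mG li.
  rewrite gam0 gam1 => /(_ isT (Efin _ li) H).
  rewrite -dlevelS !aE gfin ?(ltnW iN)// -EFinM -EFinD lee_fin => h.
  rewrite powR_dlevelS//.
  have -> : 2^-1 * (dlevel L N i `^ p * aN N i) = L `^ p * dlevel L N i `^ p * (K ^+ 3 * gam * aN N i).
    by rewrite /gam; field; rewrite !gt_eqF.
  have := ler_wpM2l (mulr_ge0 (ltW Lp0) (powR_ge0 (dlevel L N i) p)) h.
  by rewrite mulrDr -!mulrA.
(* Good-lambda passes from each level to the next; [S] reappears with factor 1/2, and can be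
   subtracted because it is a finite sum of real numbers. *)
have SE : S <= bound N + (2^-1 * S + L `^ p * (C1 * gam^-1 `^ p * I)).
  rewrite {1}/S N2 big_ord_recl /=; apply: lerD => //.
  apply: (@le_trans _ _ (\sum_(i < N.*2.-1) (2^-1 * (dlevel L N i `^ p * aN N i) + L `^ p * (dlevel L N i `^ p * g i)))).
    by apply: ler_sum => i _; apply: step; rewrite [X in (_ < X)%N]N2 ltnS ltn_ord.
  rewrite big_split/= -!mulr_sumr; apply: lerD.
    apply: ler_wpM2l => //; rewrite /S N2 big_ord_recr/= lerDl.
    by rewrite mulr_ge0 ?powR_ge0.
  apply: ler_wpM2l; first exact: ltW.
  apply: le_trans Gs; rewrite N2 big_ord_recr/= lerDl.
  by rewrite mulr_ge0 ?powR_ge0.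
by lra.
Qed.

End fefferman_stein.

(** * Density of Hoelder functions *)

Import HBSimple.

Section density.
Context (R : realType) (X : ptopologicalType) (d : X -> X -> R)
  (mu : {measure set (borel X) -> \bar R}) (c K : R) (hX : homogeneous_type d mu c K).

Notation B := (qball d).
Notation mfun f := (measurable_fun setT (f : borel X -> _)).

Definition bsupp (f : X -> R) : Prop := exists x r, 0 < r /\ forall y, ~ B x r y -> f y = 0.

Lemma bsupp_sub f g : bsupp f -> (forall y, f y = 0 -> g y = 0) -> bsupp g.
Proof. by move=> [x [r [r0 h]]] fg; exists x, r; split => // y /h/fg. Qed.

Lemma bsupp2 f g : bsupp f -> bsupp g -> exists x r, [/\ 0 < r,
  forall y, ~ B x r y -> f y = 0 & forall y, ~ B x r y -> g y = 0].
Proof.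
move=> [x [r [r0 hf]]] [y [s [s0 hg]]]; have [t rt yt] := balls_in_ball hX x y s0.
have mt : 0 < Num.max r t by rewrite lt_max r0.
have [r' rr' h'] : exists2 u, 0 < u & B x r `<=` B x u /\ B y s `<=` B x u.
  exists (Num.max r t) => //; split; first by apply: (qball_sub hX) => //; rewrite le_max lexx.
  apply: subset_trans yt _; apply: (qball_sub hX); first exact: lt_le_trans rt.
  by rewrite le_max lexx orbT.
by exists x, r'; split => // z xz; [apply: hf|apply: hg] => h; apply: xz; [apply: h'.1|apply: h'.2].
Qed.

Lemma bsuppD f g : bsupp f -> bsupp g -> bsupp (fun y => f y + g y).
Proof.
by move=> hf hg; have [x [r [r0 h1 h2]]] := bsupp2 hf hg; exists x, r; split => // y xy; rewrite h1// h2// addr0.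
Qed.

(* Test functions: a class stable under multiplication by BMO functions, which bounded or Hoelder functions are not. *)
Definition test_fun (f : X -> R) : Prop := bsupp f /\ forall q, 1 <= q -> Lp mu q (f : borel X -> R).

Definition ballN n : set X := B point n.+1%:R.

Lemma ballN_cover x : exists N, forall n, (N <= n)%N -> ballN n x.
Proof.
have : [set: X] x by []. rewrite -(ht_cover hX point) => -[r /= r0 xr].
exists (Num.bound r) => n rn; apply: (qball_sub hX _ _ xr) => //.
apply: (@le_trans _ _ (Num.bound r)%:R); first by apply/ltW/archi_boundP/ltW.
by rewrite ler_nat (leq_trans rn).
Qed.

Lemma measurable_ballN n : measurable (ballN n : set (borel X)).
Proof. exact: (qball_measurable hX). Qed.

Lemma bounded_Lp (f : X -> R) (M q : R) x r : mfun f -> 0 < q -> 0 < r -> (forall y, `|f y| <= M) ->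
  (forall y, ~ B x r y -> f y = 0) -> Lp mu q (f : borel X -> R).
Proof.
move=> mf q0 r0 fM f0; apply/(LpIp _ _ q0); split => //.
have mBx := qball_measurable hX x r0.
have M0 : 0 <= M by apply: le_trans (normr_ge0 (f x)) (fM x).
apply: (@le_lt_trans _ _ (\int[mu]_y ((M `^ q) * \1_(B x r) y)%:E)%E).
  apply: ge0_le_integral => //.
  - exact: measurable_powRn.
  - by apply/measurable_EFinP; apply: measurable_funM => //; exact: measurable_indic.
  - move=> y _; rewrite lee_fin indicE; have [h|h] := pselect (B x r y).
      by rewrite mem_set// mulr1; apply: ge0_ler_powR; rewrite ?nnegrE ?(ltW q0).
    by rewrite memNset// f0// normr0 powR0 ?gt_eqF// mulr0.
under eq_integral do rewrite EFinM.
rewrite ge0_integralZl ?lee_fin ?powR_ge0//; last by apply/measurable_EFinP; exact: measurable_indic.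
by rewrite integral_indic// setIT (qball_mE hX)// -EFinM ltry.
Qed.

Lemma bounded_test_fun (f : X -> R) (M : R) : mfun f -> (forall y, `|f y| <= M) -> bsupp f -> test_fun f.
Proof.
move=> mf fM fs; split => // q q1; have [x [r [r0 h]]] := fs.
by apply: (@bounded_Lp f M q x r) => //; exact: lt_le_trans q1.
Qed.

(** Truncation in space and in height at once. The bound [M] is recorded because the density and
    separation arguments below trade L^1 smallness against boundedness. *)
Lemma test_fun_cut (f : X -> R) p e : 1 <= p -> Lp mu p (f : borel X -> R) -> 0 < e ->
  exists (M : R) (S : set X), [/\ 0 < M, measurable (S : set (borel X)),
    forall y, `|f y * \1_S y| <= M, test_fun (fun y => f y * \1_S y) &
    Lp mu p (fun y : borel X => f y - f y * \1_S y) /\ nrm mu p (fun y : borel X => f y - f y * \1_S y) <= e].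
Proof.
move=> p1 fp e0; have p0 : 0 < p := lt_le_trans ltr01 p1.
have mf : mfun f by case: fp.
pose S n : set (borel X) := ballN n `&` [set y | `|f y| < n.+1%:R].
have mS n : measurable (S n).
  apply: measurableI; first exact: measurable_ballN.
  by apply: measurable_set_lt => //; exact: measurableT_comp.
have cS x : exists N, forall n, (N <= n)%N -> S n x.
  have [N HN] := ballN_cover x; exists (maxn N (Num.bound `|f x|)) => n.
  rewrite geq_max => /andP[nN nb]; split; first exact: HN.
  apply: (@lt_le_trans _ _ (Num.bound `|f x|)%:R); first exact: archi_boundP.
  by rewrite ler_nat (leq_trans nb).
have [N HN] := Lp_cut p0 fp mS cS e0.
have bd y : `|f y * \1_(S N) y| <= N.+1%:R.
  rewrite indicE; have [/[dup] Sy [_ /= h]|h] := pselect (S N y); last by rewrite memNset// mulr0 normr0.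
  by rewrite mem_set ?mulr1 ?(ltW h).
exists N.+1%:R, (S N); split => //; last exact: HN.
apply: bounded_test_fun bd _; first by apply: measurable_funM => //; exact: measurable_indic.
exists point, N.+1%:R; split => // y h; rewrite indicE memNset ?mulr0//.
by move=> [].
Qed.

Context (del : R) (del0 : 0 < del).

Definition Lam (f : X -> R) : Prop :=
  (exists M, forall x y, `|f x - f y| <= M * d x y `^ del) /\ bsupp f.

Lemma d_ge0 x y : 0 <= d x y. Proof. by have [h _ _ _] := ht_quasi_metric hX. Qed.

Lemma Lam_continuous f x (e : R) : Lam f -> 0 < e -> exists2 r, 0 < r & forall y, B x r y -> `|f y - f x| <= e.
Proof.
move=> [[M hM] _] e0.
pose M' := Num.max M 1; have M'0 : 0 < M' by rewrite lt_max ltr01 orbT.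
exists ((e / M') `^ del^-1); first by rewrite powR_gt0// divr_gt0.
move=> y xy; rewrite distrC; apply: le_trans (hM _ _) _.
apply: (@le_trans _ _ (M' * d x y `^ del)).
  by rewrite ler_wpM2r ?powR_ge0// le_max lexx.
rewrite mulrC -ler_pdivlMr//.
apply: (@le_trans _ _ (((e / M') `^ del^-1) `^ del)).
  by apply: ge0_ler_powR; rewrite ?nnegrE ?(ltW del0) ?powR_ge0 ?d_ge0// ltW.
by rewrite -powRrM mulVf ?gt_eqF// powRr1// divr_ge0 ?ltW.
Qed.

Lemma Lam_measurable f : Lam f -> mfun f.
Proof.
move=> hf mT; apply: (measurability _ (RGenOpens.measurableE R)) => //.
move=> _ [_ [a [b ->]] <-]; rewrite setTI; set U := [set` _].
have oU : open U by exact: interval_open.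
apply: (open_borel (U := f @^-1` U)).
rewrite openE => x Ux; rewrite /interior.
have /nbhs_ballP[e /= e0 eU] : nbhs (f x) U by move: oU; rewrite openE => /(_ _ Ux).
have e20 : 0 < e / 2 by rewrite divr_gt0.
have [r r0 hr] := Lam_continuous x hf e20.
apply: filterS (open_nbhs_nbhs (conj (qball_open hX x r0) (qball_center hX x r0))) => y /hr h.
apply: eU; rewrite /ball/= distrC; apply: le_lt_trans h _; rewrite ltr_pdivrMr//.
by rewrite ltr_pMr// ltr1n.
Qed.

Lemma Lam_bounded f : Lam f -> exists M, forall y, `|f y| <= M.
Proof.
move=> [[M hM] [x [r [r0 fs]]]].
exists (`|f x| + `|M| * r `^ del) => y.
have [h|/fs ->] := pselect (B x r y); last by rewrite normr0 addr_ge0 ?mulr_ge0 ?powR_ge0.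
rewrite -{1}(subrK (f x) (f y)) addrC; apply: le_trans (ler_normD _ _) _; rewrite lerD2l distrC.
apply: le_trans (hM _ _) _; apply: le_trans (ler_wpM2r (powR_ge0 _ _) (ler_norm M)) _.
apply: ler_wpM2l => //.
by apply: ge0_ler_powR; rewrite ?nnegrE ?(ltW del0) ?d_ge0 ?(ltW r0)// ltW.
Qed.

Lemma Lam_test_fun f : Lam f -> test_fun f.
Proof.
move=> hf; have [M hM] := Lam_bounded hf.
by apply: (bounded_test_fun (M := M)) => //; [exact: Lam_measurable|case: hf].
Qed.

Lemma Lam0 : Lam (fun=> 0).
Proof.
split; first by exists 0 => x y; rewrite subrr normr0 mul0r.
by exists point, 1; split.
Qed.

Lemma LamD f g : Lam f -> Lam g -> Lam (fun x => f x + g x).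
Proof.
move=> [[M hM] sf] [[N hN] sg]; split; last exact: bsuppD.
exists (M + N) => x y; rewrite mulrDl; apply: le_trans (lerD (hM x y) (hN x y)).
by rewrite opprD addrACA ler_normD.
Qed.

Lemma LamZ a f : Lam f -> Lam (fun x => a * f x).
Proof.
move=> [[M hM] sf]; split; last by apply: (bsupp_sub sf) => y ->; rewrite mulr0.
by exists (`|a| * M) => x y; rewrite -mulrBr normrM -mulrA ler_wpM2l.
Qed.

Lemma Lam_lip (g : R -> R) f : (forall a b, `|g a - g b| <= `|a - b|) -> g 0 = 0 -> Lam f -> Lam (g \o f).
Proof.
move=> gl g0 [[M hM] sf]; split; last by apply: (bsupp_sub sf) => y /= ->.
by exists M => x y; apply: le_trans (gl _ _) (hM _ _).
Qed.

Lemma min_lip (a x y : R) : `|Num.min x a - Num.min y a| <= `|x - y|.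
Proof.
have h1 := ler_norm (x - y); have h2 := ler_norm (y - x); rewrite distrC in h2.
by rewrite ler_norml; case: (leP x a) => ?; case: (leP y a) => ?; apply/andP; split; lra.
Qed.

Lemma max_lip (a x y : R) : `|Num.max x a - Num.max y a| <= `|x - y|.
Proof.
have h1 := ler_norm (x - y); have h2 := ler_norm (y - x); rewrite distrC in h2.
by rewrite ler_norml; case: (leP x a) => ?; case: (leP y a) => ?; apply/andP; split; lra.
Qed.

Definition clip (M t : R) := Num.max (Num.min t M) (- M).

Lemma clip_lip M a b : `|clip M a - clip M b| <= `|a - b|.
Proof. by rewrite /clip; apply: le_trans (max_lip _ _ _) (min_lip _ _ _). Qed.

Lemma clip_id M t : `|t| <= M -> clip M t = t.
Proof.
by rewrite ler_norml => /andP[h1 h2]; rewrite /clip min_l// max_l.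
Qed.

Lemma clip_bound M t : 0 <= M -> `|clip M t| <= M.
Proof.
move=> M0; rewrite ler_norml /clip le_max lexx orbT/= ge_max ge_min lexx orbT/=.
by lra.
Qed.

Context (A : R) (A1 : 1 <= A) (cutoff : forall x r, 0 < r -> exists phi, [/\ Lam phi,
   forall y, 0 <= phi y, forall y, B x r y -> phi y = 1 & forall y, ~ B x (A * r) y -> phi y = 0]).

(** Around each point of C there is a ball whose A-dilate lies in U. Finitely many of them cover C;
    the sum of their cut-off functions is at least 1 on C, and truncation at height 1 keeps it
    Hoelder. *)
Lemma urysohn_Lam (C U : set X) : compact C -> open U -> C `<=` U ->
  exists phi, [/\ Lam phi, forall y, 0 <= phi y <= 1, forall y, C y -> phi y = 1 & forall y, ~ U y -> phi y = 0].
Proof.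
move=> cC oU CU; have A0 : 0 < A := lt_le_trans ltr01 A1.
pose D := [set z : X * R | 0 < z.2 /\ B z.1 (A * z.2) `<=` U].
have ex (z : X * R) : exists f, 0 < z.2 -> [/\ Lam f, forall y, 0 <= f y,
    forall y, B z.1 z.2 y -> f y = 1 & forall y, ~ B z.1 (A * z.2) y -> f y = 0].
  have [z0|z0] := pselect (0 < z.2); first by have [f hf] := cutoff z.1 z0; exists f.
  by exists (fun=> 0).
have [phi hphi] := choice ex.
move: (cC); rewrite compact_cover => /(_ _ D (fun z => B z.1 z.2)).
case=> [z [z0 _]||D' D'D CD']; first exact: (qball_open hX).
  move=> y Cy; have [r r0 rU] := ht_basis hX (open_nbhs_nbhs (conj oU (CU _ Cy))).
  exists (y, r / A); last by apply: (qball_center hX); rewrite divr_gt0.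
  by split; rewrite /= ?divr_gt0// mulrCA mulfV ?gt_eqF// mulr1.
have D'z z : z \in D' -> D z by move=> zD; have := D'D z zD; rewrite inE.
pose psi y := \sum_(z <- D') phi z y.
have key (s : seq (X * R)) : (forall z, z \in s -> D z) ->
   [/\ Lam (fun y => \sum_(z <- s) phi z y), forall y, 0 <= \sum_(z <- s) phi z y &
     forall y, ~ U y -> \sum_(z <- s) phi z y = 0].
  elim: s => [|z s IH] sD.
    under eq_fun do rewrite big_nil; split; [exact: Lam0|by move=> y; rewrite big_nil|by move=> y; rewrite big_nil].
  have [h1 h2 h3] : [/\ Lam (fun y => \sum_(z <- s) phi z y), forall y, 0 <= \sum_(z <- s) phi z y &
     forall y, ~ U y -> \sum_(z <- s) phi z y = 0].
    by apply: IH => w ws; apply: sD; rewrite inE ws orbT.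
  have [z0 zU] : D z by apply: sD; rewrite inE eqxx.
  have [p1 p2 p3 p4] := hphi z z0.
  split => [|y|y Uy]; first by under eq_fun do rewrite big_cons; exact: LamD.
    by rewrite big_cons addr_ge0.
  by rewrite big_cons h3// addr0 p4// => /zU.
have [h1 h2 h3] := key D' D'z.
exists (fun y => Num.min (psi y) 1); split.
- apply: (Lam_lip (g := fun t => Num.min t 1)) => //; first exact: min_lip.
  by rewrite min_l.
- by move=> y; rewrite le_min h2 ler01 ge_min lexx orbT.
- move=> y /CD'[z /= zD zy]; apply: min_r.
  have [z0 _] := D'z z zD; have [_ p2 p3 _] := hphi z z0.
  rewrite /psi (big_rem z)//= (p3 _ zy) lerDl big_seq.
  apply: sumr_ge0 => w wr; have /D'z[w0 _] : w \in D' by exact: (mem_rem wr).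
  by have [_ q2 _ _] := hphi w w0.
- by move=> y Uy; rewrite /psi h3// min_l.
Qed.

(** Regularity squeezes E between a compact set and an open set, and a Urysohn function between the
    two errs only on their difference. The open set is intersected with U to keep the support inside
    U. *)
Lemma indic_approx (E : set (borel X)) (U : set X) (e : R) : measurable E -> open U -> E `<=` U ->
  (mu E < +oo)%E -> 0 < e ->
  exists phi, [/\ Lam phi, forall y, 0 <= phi y <= 1, forall y, ~ U y -> phi y = 0 &
    (\int[mu]_y `|\1_E y - phi y|%:E <= e%:E)%E].
Proof.
move=> mE oU EU Ey e0; have e20 : 0 < e / 2 by rewrite divr_gt0.
have [_ outer inner] := ht_regular hX.
have Ef : mu E = (fine (mu E))%:E by rewrite fineK// ge0_fin_numE.
have [V [oV EV] hV] : exists2 V : set X, (open V /\ E `<=` V) & (mu V < mu E + (e / 2)%:E)%E.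
  have : (mu E < mu E + (e / 2)%:E)%E by rewrite lteDl ?lte_fin// Ef.
  by rewrite {1}outer// => /ereal_inf_lt[_ [V VE <-] h]; exists V.
have [C [cC CE] hC] : exists2 C : set X, (compact C /\ C `<=` E) & (mu E - (e / 2)%:E < mu C)%E.
  have : (mu E - (e / 2)%:E < mu E)%E by rewrite Ef -EFinB lte_fin gtrBl.
  by rewrite {2}inner// => /ereal_sup_gt[_ [C CE' <-] h]; exists C.
have mC : measurable (C : set (borel X)).
  by rewrite -[C]setCK; apply: measurableC; apply: open_borel; rewrite openC; apply: compact_closed cC; exact: (ht_hausdorff hX).
pose V' := V `&` U; have oV' : open V' by exact: openI.
have mV' := open_borel oV' : measurable (V' : set (borel X)).
have CV' : C `<=` V' by move=> y /CE Ey'; split; [exact: EV|exact: EU].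
have [phi [p1 p2 p3 p4]] := urysohn_Lam cC oV' CV'.
exists phi; split => //; first by move=> y Uy; apply: p4 => -[].
apply: (@le_trans _ _ (\int[mu]_y (\1_((V' : set (borel X)) `\` C) y)%:E)%E).
  apply: ge0_le_integral => //.
  - apply/measurable_EFinP; apply: measurableT_comp => //; apply: measurable_funB.
      exact: measurable_indic.
    exact: Lam_measurable.
  - by apply/measurable_EFinP; apply: measurable_indic; exact: measurableD.
  - move=> y _; rewrite lee_fin.
    have [Cy|Cy] := pselect (C y).
      by rewrite indicE mem_set ?p3// ?subrr ?normr0//; exact: CE.
    have [Vy|Vy] := pselect (V' y).
      rewrite [leRHS]indicE mem_set//=; have := p2 y; rewrite indicE.
      by case: (y \in E) => /= /andP[? ?]; rewrite ler_norml; apply/andP; split; lra.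
    by rewrite p4// indicE memNset ?subrr ?normr0// => Ey'; apply: Vy; split; [exact: EV|exact: EU].
rewrite integral_indic ?setIT//; last exact: measurableD.
have Cy : (mu C < +oo)%E by apply: le_lt_trans Ey; apply: le_measure; rewrite ?inE.
have VV : (mu V' <= mu V)%E.
  by apply: le_measure; rewrite ?inE//; [exact: open_borel|move=> y []].
rewrite measureD// ?(le_lt_trans VV)// ?(lt_trans hV)//; last by rewrite Ef -EFinD ltry.
rewrite (_ : V' `&` C = C); last by apply/seteqP; split => [y []//|y Cy']; split => //; exact: CV'.
have Cf : mu C = (fine (mu C))%:E by rewrite fineK// ge0_fin_numE.
have Vf : mu V' = (fine (mu V'))%:E.
  by rewrite fineK// ge0_fin_numE//; apply: le_lt_trans VV (lt_trans hV _); rewrite Ef -EFinD ltry.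
move: hC; rewrite Ef Cf -EFinB lte_fin => hC'.
have h2 := le_lt_trans VV hV; rewrite Ef Vf -EFinD lte_fin in h2.
suff : (mu V' - mu C <= e%:E)%E by [].
rewrite Vf Cf -EFinB lee_fin; lra.
Qed.

(** The class [CL] of approximable functions is a closed linear space that contains the indicators
    of the subsets of U of finite measure, hence the simple functions cut to U, and these
    approximate f. *)
Lemma Lam_dense1 (f : X -> R) (U : set X) (e : R) : open U -> Lp mu 1 (f : borel X -> R) -> (forall y, ~ U y -> f y = 0) ->
  0 < e -> exists phi, [/\ Lam phi, forall y, ~ U y -> phi y = 0 & nrm mu 1 (fun y : borel X => f y - phi y) <= e].
Proof.
move=> oU f1 fU e0.
pose CL (g : X -> R) := Lp mu 1 (g : borel X -> R) /\ forall e, 0 < e -> exists phi, [/\ Lam phi,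
   forall y, ~ U y -> phi y = 0 & nrm mu 1 (fun y : borel X => g y - phi y) <= e].
have L1 g : Lam g -> Lp mu 1 (g : borel X -> R) by move=> /Lam_test_fun[_]; exact.
have CL0 : CL (fun=> 0).
  split; first by have [] := @nrm0 _ _ _ mu 1 ltr01.
  move=> e' e'0; exists (fun=> 0); split => //; first exact: Lam0.
  under eq_fun do rewrite subrr.
  by have [_ ->] := @nrm0 _ (borel X) _ mu 1 ltr01; exact: ltW.
have CLD g h : CL g -> CL h -> CL (fun y => g y + h y).
  move=> [g1 Hg] [h1 Hh]; split; first by have [] := LpD (lexx 1) g1 h1.
  move=> e' e'0; have e20 : 0 < e' / 2 by rewrite divr_gt0.
  have [p [p1 p2 p3]] := Hg _ e20; have [q [t1 t2 t3]] := Hh _ e20.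
  exists (fun y => p y + q y); split; first exact: LamD.
    by move=> y Uy; rewrite p2// t2// addr0.
  have [_] := LpD (lexx 1) (LpB (lexx 1) g1 (L1 _ p1)).1 (LpB (lexx 1) h1 (L1 _ t1)).1.
  under [in X in nrm _ _ X <= _ -> _]eq_fun do rewrite addrACA -opprD.
  move=> hh; apply: le_trans hh _; lra.
have CLZ a g : CL g -> CL (fun y => a * g y).
  move=> [g1 Hg]; split; first by have [] := LpZ a ltr01 g1.
  move=> e' e'0; have ea0 : 0 < e' / (`|a| + 1) by rewrite divr_gt0// ltr_wpDl.
  have [p [p1 p2 p3]] := Hg _ ea0.
  exists (fun y => a * p y); split; first exact: LamZ.
    by move=> y Uy; rewrite p2// mulr0.
  have [_ h] := LpZ a ltr01 (LpB (lexx 1) g1 (L1 _ p1)).1.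
  under eq_fun do rewrite -mulrBr.
  rewrite h; apply: (@le_trans _ _ (`|a| * (e' / (`|a| + 1)))); first by rewrite ler_wpM2l.
  by rewrite mulrCA ler_piMr ?(ltW e'0)// ler_pdivrMr ?ltr_wpDl// mul1r lerDl.
have CLI (E : set (borel X)) : measurable E -> E `<=` U -> (mu E < +oo)%E -> CL (\1_E).
  move=> mE EU Ey.
  have E1 : Lp mu 1 (\1_E : borel X -> R) by exact: Lp_indic.
  split => //.
  move=> e' e'0; have [p [p1 p2 p3 p4]] := indic_approx mE oU EU Ey e'0.
  exists p; split => //; rewrite nrm1E.
    rewrite -lee_fin /Rintegral fineK// ge0_fin_numE ?integral_ge0//.
    by apply: le_lt_trans p4 (ltry _).
  by have [] := LpB (lexx 1) E1 (L1 _ p1).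
have CLcl g : Lp mu 1 (g : borel X -> R) -> (forall e, 0 < e -> exists2 h, CL h & nrm mu 1 (fun y : borel X => g y - h y) <= e) -> CL g.
  move=> g1 H; split => // e' e'0; have e20 : 0 < e' / 2 by rewrite divr_gt0.
  have [h [h1 Hh] gh] := H _ e20; have [p [p1 p2 p3]] := Hh _ e20.
  exists p; split => //; apply: le_trans (nrm_triangle (lexx 1) g1 h1 (L1 _ p1)) _; lra.
suff [_ /(_ e e0)] : CL f by [].
apply: CLcl => // e' e'0.
have [g_ [g_int gcv g1cv]] := approximation_sfun_integrable measurableT ((Lp1P _ _).1 f1).
have mU := open_borel oU : measurable (U : set (borel X)).
have : \forall n \near \oo, (\int[mu]_x `|(f x)%:E - (g_ n x)%:E| < e'%:E)%E.
  apply: (g1cv [set z | (z < e'%:E)%E]); apply: open_nbhs_nbhs; split; last by rewrite /= lte_fin.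
  exact: open_ereal_lt_ereal.
case=> n _ /(_ n (leqnn _)) /= hn.
pose g := g_ n; pose gU y := g y * \1_U y.
have gL1 : Lp mu 1 (g : borel X -> R) by apply/Lp1P; exact: g_int.
have gU1 : Lp mu 1 (gU : borel X -> R).
  rewrite /gU; under eq_fun do rewrite mulrC.
  apply: (Lp_bdM ltr01 (M := 1) _ _ gL1).1; first exact: measurable_indic.
  by move=> y; rewrite indicE; case: (_ \in _); rewrite ?normr1 ?normr0.
exists gU.
  pose E (v : R) : set (borel X) := (g @^-1` [set v]) `&` U.
  have mE v : measurable (E v) by apply: measurableI => //; rewrite -[X in measurable X]setTI; exact: measurable_funP.
  have -> : gU = fun y => \sum_(v <- fset_set (range g)) v * \1_(E v) y.
    apply/funext => y; rewrite /gU fimfunE fsbig_finite//= mulr_suml; apply: eq_bigr => v _.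
    by rewrite -mulrA; congr (_ * _); rewrite /E indicI.
  elim: (fset_set (range g) : seq R) => [|v s IH]; first by under eq_fun do rewrite big_nil.
  under eq_fun do rewrite big_cons; apply: CLD => //.
  have [->|v0] := eqVneq v 0; first by under eq_fun do rewrite mul0r.
  apply: CLZ; apply: CLI => //; first by move=> y [].
  have v0' : 0 < `|v| by rewrite normr_gt0.
  (* Chebyshev's inequality: the integrable simple function takes a nonzero value on a set of finite
     measure only. *)
  have : (`|v|%:E * mu (E v) <= \int[mu]_y `|g y|%:E)%E.
    rewrite -[X in (_ * mu X)%E]setIT -integral_indic// -ge0_integralZl//; last by apply/measurable_EFinP; exact: measurable_indic.
    apply: ge0_le_integral => //.
    - by apply: measurable_funeM; apply/measurable_EFinP; exact: measurable_indic.
    - by apply/measurable_EFinP; apply: measurableT_comp => //; case: gL1.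
    - move=> y _; rewrite -EFinM lee_fin indicE; have [h|h] := pselect (E v y).
        by rewrite mem_set// mulr1; case: h => /= ->.
      by rewrite memNset// mulr0.
  have := (integrableP _ _ _ (g_int n)).2 => gy h.
  rewrite ltNge leye_eq; apply/negP => /eqP h2; move: h; rewrite h2 gt0_muley ?lte_fin// leye_eq => /eqP h3.
  by move: gy; rewrite /comp; under eq_integral do rewrite abse_EFin; rewrite h3.
have [fgU1 _] := LpB (lexx 1) f1 gU1.
apply: (@le_trans _ _ (nrm mu 1 (fun y : borel X => f y - g y))).
  apply: (Lp_le ltr01 _ (LpB (lexx 1) f1 gL1).1 _).2; first by case: fgU1.
  move=> y; rewrite /gU indicE; have [h|h] := pselect (U y); first by rewrite mem_set// mulr1.
  by rewrite memNset// mulr0 fU// subrr normr0.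
rewrite nrm1E; last by have [] := LpB (lexx 1) f1 gL1.
rewrite -lee_fin /Rintegral fineK; first exact: ltW.
rewrite ge0_fin_numE ?integral_ge0//; by apply: lt_trans hn (ltry e').
Qed.

End density.

(** * Density in L^q, separation by Hoelder functions, and differentiation *)

Section differentiation.
Context (R : realType) (X : ptopologicalType) (d : X -> X -> R)
  (mu : {measure set (borel X) -> \bar R}) (c K : R) (hX : homogeneous_type d mu c K).
Context (del : R) (del0 : 0 < del).
Context (A : R) (A1 : 1 <= A) (cutoff : forall x r, 0 < r -> exists phi, [/\ Lam d del phi,
   forall y, 0 <= phi y, forall y, qball d x r y -> phi y = 1 & forall y, ~ qball d x (A * r) y -> phi y = 0]).

Notation B := (qball d).
Notation mB := (mB d mu).
Notation mfun f := (measurable_fun setT (f : borel X -> _)).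
Notation Lam := (Lam d del).
Notation maxfun := (maxfun d mu).
Notation LP q f := (Lp mu q (f : borel X -> R)).
Notation NR q f := (nrm mu q (f : borel X -> R)).

Lemma Lam_Lp f q : 1 <= q -> Lam f -> LP q f.
Proof. by move=> q1 /(Lam_test_fun hX del0)[_]; exact. Qed.

(** Clipping at height [M] fixes f and is 1-Lipschitz: it keeps the approximant Hoelder and does not
    increase the error. *)
Lemma Lam_dense1_bd (f : X -> R) (U : set X) (M e : R) : open U -> LP 1 f -> (forall y, ~ U y -> f y = 0) ->
  (forall y, `|f y| <= M) -> 0 < e -> exists phi, [/\ Lam phi, forall y, ~ U y -> phi y = 0,
    forall y, `|phi y| <= M & NR 1 (fun y => f y - phi y) <= e].
Proof.
move=> oU f1 fU fM e0; have M0 : 0 <= M by apply: le_trans (fM point).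
have [phi [p1 p2 p3]] := Lam_dense1 hX del0 A1 cutoff oU f1 fU e0.
have clipphi : Lam (clip M \o phi).
  apply: (Lam_lip _ _ p1); first exact: clip_lip.
  by rewrite clip_id ?normr0.
exists (clip M \o phi); split => //.
- by move=> y Uy /=; rewrite p2// clip_id ?normr0.
- by move=> y /=; exact: clip_bound.
apply: le_trans p3; apply: (Lp_le ltr01 _ (LpB (lexx 1) f1 (Lam_Lp (lexx 1) p1)).1 _).2.
  by have [[]] := LpB (lexx 1) f1 (Lam_Lp (lexx 1) clipphi).
by move=> y /=; rewrite -{1}(clip_id (fM y)); exact: clip_lip.
Qed.

(** For g and phi bounded by [M], |g - phi|^q <= (2M)^(q - 1) |g - phi|, which reduces the
    approximation in L^q of a bounded truncation of f to the one in L^1. *)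
Lemma Lam_dense (f : X -> R) (U : set X) (q e : R) : 1 <= q -> open U -> LP q f -> (forall y, ~ U y -> f y = 0) ->
  0 < e -> exists phi, [/\ Lam phi, forall y, ~ U y -> phi y = 0 & NR q (fun y => f y - phi y) <= e].
Proof.
move=> q1 oU fq fU e0; have q0 : 0 < q := lt_le_trans ltr01 q1.
have e20 : 0 < e / 2 by rewrite divr_gt0.
have [M [S [M0 mS gM gBB [fgq fge]]]] := test_fun_cut hX q1 fq e20.
pose g y := f y * \1_S y.
have gU y : ~ U y -> f y * \1_S y = 0 by move=> h; rewrite fU// mul0r.
have C0 : 0 < (2 * M) `^ (q - 1) by rewrite powR_gt0// mulr_gt0.
have e10 : 0 < (e / 2) `^ q / (2 * M) `^ (q - 1) by rewrite divr_gt0// powR_gt0.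
have [phi [p1 p2 p3 p4]] := Lam_dense1_bd oU (gBB.2 1 (lexx 1)) gU gM e10.
exists phi; split => //.
have gphi : LP 1 (fun y => g y - phi y).
  by have [] := LpB (lexx 1) (gBB.2 1 (lexx 1)) (Lam_Lp (lexx 1) p1).
have [gphiq gphie] : LP q (fun y => g y - phi y) /\ NR q (fun y => g y - phi y) <= e / 2.
  apply: LpP => //; [by case: gphi|exact: ltW|].
  apply: (@le_trans _ _ (((2 * M) `^ (q - 1))%:E * (NR 1 (fun y => g y - phi y))%:E)%E); last first.
    by rewrite -EFinM lee_fin mulrC -ler_pdivlMr.
  rewrite -[X in (_ * X%:E)%E]powRr1 ?nrm_ge0// -(IpE ltr01 gphi) /Ip -ge0_integralZl//; first last.
  - by rewrite lee_fin powR_ge0.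
  - exact: (measurable_powRn 1 gphi.1).
  apply: ge0_le_integral => //.
  - exact: (measurable_powRn q gphi.1).
  - by apply: measurable_funeM; exact: (measurable_powRn 1 gphi.1).
  move=> y _; rewrite -EFinM lee_fin powRr1// -(mulr_powRB1 (normr_ge0 _) q0) mulrC.
  apply: ler_wpM2r => //; apply: ge0_ler_powR; rewrite ?nnegrE ?subr_ge0 ?mulr_ge0 ?(ltW M0)//.
  by apply: le_trans (ler_normB _ _) _; have := gM y; have := p3 y; rewrite /g; lra.
have phiq := Lam_Lp q1 p1; have gq := gBB.2 q q1.
by apply: le_trans (nrm_triangle q1 fq gq phiq) _; lra.
Qed.

Lemma ae_zero_of_ballN (u : X -> R) : (forall n, {ae mu, forall x, u x * \1_(ballN d n) x = 0}) ->
  {ae mu, forall x, u x = 0}.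
Proof.
move=> h; apply: filterS (ae_foralln h) => x hx; have [N HN] := ballN_cover hX x.
by have := hx N; rewrite indicE mem_set ?mulr1//; exact: HN.
Qed.

Lemma Lp1_ball (u : X -> R) x r : mfun u -> 0 < r -> mu.-integrable (B x r) (EFin \o u) -> LP 1 (fun y => u y * \1_(B x r) y).
Proof.
move=> mu_ r0 iu; apply/Lp1P; have mBx := qball_measurable hX x r0.
move/(integrable_mkcond _ mBx): iu; apply: eq_integrable => // y _.
by rewrite patchE /= indicE; case: ifP; rewrite ?mulr1 ?mulr0.
Qed.

(** The L^1 norm of u on a ball is its integral against the sign of u; replacing the sign by a
    bounded Hoelder approximation makes this integral 0, and only the error of approximation has to
    be small. *)
Lemma Lam_separates (u : X -> R) : mfun u -> (forall x r, 0 < r -> mu.-integrable (B x r) (EFin \o u)) ->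
  (forall phi, Lam phi -> \int[mu]_x (u x * phi x) = 0) -> {ae mu, forall x, u x = 0}.
Proof.
move=> mu_ iu H; apply: ae_zero_of_ballN => n.
set Bn := ballN d n; have mBn : measurable (Bn : set (borel X)) := measurable_ballN hX n.
have n0 : (0 : R) < n.+1%:R by [].
pose v y := u y * \1_Bn y.
have v1 : LP 1 v := Lp1_ball mu_ n0 (iu point _ n0).
apply: (nrm_eq0 ltr01 v1); apply/eqP; rewrite eq_le nrm_ge0 andbT.
apply/ler_addgt0Pr => e e0; rewrite add0r.
(* The error is split: sign error at most 2 against a part of [v] of norm e/4, and sign error of
   norm e / (2L) against a part of [v] bounded by [L]; the total is e. *)
have e40 : 0 < e / 4 by rewrite divr_gt0.
have [L [S [L0 mS vL _ [v1S vSe]]]] := test_fun_cut hX (lexx 1) v1 e40.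
have eL0 : 0 < e / (2 * L) by rewrite divr_gt0// mulr_gt0.
pose f y := Num.sg (u y) * \1_Bn y.
have f1 y : `|f y| <= 1.
  rewrite /f normrM indicE; case: (_ \in _); rewrite ?normr0 ?mulr0// normr1 mulr1 normr_sg.
  by case: (u y != 0).
have mf : mfun f.
  apply: measurable_funM; last exact: measurable_indic.
  rewrite (_ : (fun y => _) = fun y => (0 < u y)%R%:R - (u y < 0)%R%:R); last first.
    by apply/funext => y; case: (sgrP (u y)) => h; rewrite ?ltxx ?h ?subrr ?subr0// ?ltNge ?(ltW h)/= ?sub0r.
  by apply: measurable_funB; apply: measurable_lt_nat.
have fU y : ~ Bn y -> f y = 0 by move=> h; rewrite /f indicE memNset// mulr0.
have fL1 : LP 1 f by apply: (@bounded_Lp _ _ _ _ _ _ hX f 1 1 point n.+1%:R).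
have [phi [p1 p2 p3 p4]] := Lam_dense1_bd (qball_open hX point n0) fL1 fU f1 eL0.
have mphi := Lam_measurable hX del0 p1.
have fphi2 y : `|f y - phi y| <= 2.
  by apply: le_trans (ler_normB _ _) _; have := f1 y; have := p3 y; lra.
have mfphi : mfun (fun y => f y - phi y) by exact: measurable_funB.
have fphi1 := (LpB (lexx 1) fL1 (Lam_Lp (lexx 1) p1)).1.
have vphi : LP 1 (fun y => phi y * v y) by exact: (Lp_bdM ltr01 mphi p3 v1).1.
have vf : LP 1 (fun y => f y * v y) by exact: (Lp_bdM ltr01 mf f1 v1).1.
have -> : NR 1 v = \int[mu]_y ((f y - phi y) * v y).
  under eq_Rintegral do rewrite mulrBl.
  rewrite RintegralB//; try exact/Lp1P.
  have -> : \int[mu]_y (phi y * v y) = 0.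
    rewrite -(H _ p1); apply: eq_Rintegral => y _; rewrite /v indicE.
    have [h|h] := pselect (Bn y); first by rewrite mem_set// mulr1 mulrC.
    by rewrite p2// mul0r mulr0.
  rewrite subr0 nrm1E//; apply: eq_Rintegral => y _; rewrite /f /v normrM indicE normrEsg.
  by case: (_ \in _); rewrite ?mulr1 ?normr1 ?mulr0 ?normr0 ?mulr0// mulr1.
have E y : (f y - phi y) * v y = (f y - phi y) * (v y - v y * \1_S y) + (v y * \1_S y) * (f y - phi y) by ring.
under eq_Rintegral do rewrite E.
have [a1 a2] := Lp_bdM ltr01 mfphi fphi2 v1S.
have mvS : mfun (fun y => v y * \1_S y) by apply: measurable_funM; [case: v1|exact: measurable_indic].
have [b1 b2] := Lp_bdM ltr01 mvS vL fphi1.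
rewrite RintegralD//; try exact/Lp1P.
apply: le_trans (lerD (le_trans (ler_norm _) (normr_int_le a1)) (le_trans (ler_norm _) (normr_int_le b1))) _.
apply: le_trans (lerD a2 b2) _.
have : L * NR 1 (fun y => f y - phi y) <= L * (e / (2 * L)) by rewrite ler_wpM2l// ltW.
have -> : L * (e / (2 * L)) = e / 2 by field; rewrite gt_eqF.
lra.
Qed.

Lemma maxf_Lam phi x : Lam phi -> (`|phi x|%:E <= maxfun (fun y => `|phi y|%:E) x)%E.
Proof.
move=> hphi; apply/lee_addgt0Pr => e e0.
have [r r0 hr] := Lam_continuous hX del0 x hphi e0.
rewrite -leeBlDr//; apply: le_trans (avg_le_maxf mu _ r0 (qball_center hX x r0)).
have mphi : mfun (fun y => `|phi y|%:E).
  by apply/measurable_EFinP; apply: measurableT_comp => //; exact: (Lam_measurable hX del0).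
have mBx := qball_measurable hX x r0; have m0 := mB_gt0 hX x r0.
rewrite -(@lee_pmul2l _ (mB x r)%:E)// ?lte_fin// (avgE hX)// -EFinB -EFinM mulrC EFinM -(qball_mE hX)//.
rewrite -integral_cst//.
have [h|h] := leP (`|phi x| - e) 0.
  rewrite integral_cst// (qball_mE hX)// -EFinM; apply: (@le_trans _ _ 0%E); last exact: integral_ge0.
  by rewrite lee_fin mulr_le0_ge0 ?(ltW m0).
apply: ge0_le_integral => //; first by move=> y _; rewrite lee_fin ltW.
  exact: measurable_funTS.
move=> y /hr; rewrite lee_fin distrC => h2; have := ler_normB (phi x - phi y) (- phi y).
by rewrite opprK subrK normrN; lra.
Qed.

(** All that is needed of the Lebesgue differentiation theorem. It is clear for Hoelder functions;
    in general f is approximated in L^1, and the exceptional set is controlled by the weak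
    inequality for the error g and by Chebyshev's inequality. *)
Lemma lebesgue_maxf1 (f : X -> R) : LP 1 f -> {ae mu, forall x, (`|f x|%:E <= maxfun (fun y => `|f y|%:E) x)%E}.
Proof.
move=> f1; have mf : mfun f by case: f1.
have mfa : mfun (fun y => `|f y|%:E) by apply/measurable_EFinP; exact: measurableT_comp.
have mmax := measurable_maxf hX (fun y => `|f y|%:E).
pose N k : set (borel X) := [set x | (maxfun (fun y => `|f y|%:E) x + (2 * k.+1%:R^-1)%:E < `|f x|%:E)%E].
have mN k : measurable (N k).
  rewrite -[X in measurable X]setTI; apply: measurable_lte => //.
  by apply: emeasurable_funD.
have N0 k : mu (N k) = 0%E.
  apply/eqP; rewrite eq_le measure_ge0 andbT; apply/lee_addgt0Pr => e e0; rewrite add0e.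
  set a : R := k.+1%:R^-1; have a0 : 0 < a by rewrite invr_gt0.
  have K0 := K_gt0 hX.
  (* The two exceptional sets have total measure at most (K + 1) / a times the norm of [g], which
     this choice makes at most e. *)
  have dl0 : 0 < e * a / (1 + K) by rewrite divr_gt0 ?mulr_gt0 ?addr_gt0.
  have [phi [p1 _ p3]] := Lam_dense1 hX del0 A1 cutoff openT f1 (fun y (h : ~ setT y) => False_ind _ (h I)) dl0.
  pose g y := f y - phi y.
  have g1 : LP 1 g := (LpB (lexx 1) f1 (Lam_Lp (lexx 1) p1)).1.
  have mg : mfun g by case: g1.
  have mga : mfun (fun y => `|g y|%:E) by apply/measurable_EFinP; exact: measurableT_comp.
  have mphi : mfun (fun y => `|phi y|%:E).
    by apply/measurable_EFinP; apply: measurableT_comp => //; exact: (Lam_measurable hX del0).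
  have Ig : (\int[mu]_y `|g y|%:E = (NR 1 g)%:E)%E.
    rewrite nrm1E// /Rintegral fineK// ge0_fin_numE ?integral_ge0//.
    by have /Lp1P/integrableP[_] := g1.
  pose E1 : set (borel X) := [set x | (a%:E < maxfun (fun y => `|g y|%:E) x)%E].
  pose E2 : set (borel X) := setT `&` [set x | (a%:E <= `|(g x)%:E|)%E].
  have mE1 : measurable E1 := open_borel (open_maxf hX _ _).
  have mE2 : measurable E2.
    by apply: measurable_lee => //; apply: measurableT_comp => //; exact/measurable_EFinP.
  have NE : N k `<=` E1 `|` E2.
    move=> x; rewrite /N /E1 /E2 /= => h.
    have [h1|h1] := ltP a%:E (maxfun (fun y => `|g y|%:E) x); [by left|right; split => //].
    rewrite lee_fin leNgt; apply/negP => h2; move: h; apply/negP; rewrite -leNgt.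
    apply: (@le_trans _ _ (`|g x|%:E + `|phi x|%:E)%E).
      by rewrite -EFinD lee_fin -{1}(subrK (phi x) (f x)) ler_normD.
    apply: (@le_trans _ _ (a%:E + (maxfun (fun y => `|f y|%:E) x + a%:E))%E).
      apply: leeD; first by rewrite lee_fin ltW.
      apply: le_trans (maxf_Lam x p1) _.
      apply: (@le_trans _ _ (maxfun (fun y => `|f y|%:E + `|g y|%:E) x)%E).
        apply: (le_maxf hX) => //; first exact: emeasurable_funD.
        by move=> y; rewrite -EFinD lee_fin -[X in `|X|](subKr (f y)) ler_normB.
      by apply: le_trans (maxfD hX _ _ _ _ _) _ => //; apply: leeD2l.
    by rewrite addeCA; apply: leeD2l; rewrite -EFinD lee_fin -/a; lra.
  apply: (@le_trans _ _ (mu E1 + mu E2)%E).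
    by apply: le_trans (measureU2 _ _ _) => //; apply: le_measure; rewrite ?inE//; exact: measurableU.
  have h1 : (mu E1 <= (K / a)%:E * (NR 1 g)%:E)%E by rewrite -Ig; exact: (weak_maxfun hX).
  have h2 : (mu E2 <= (1 / a)%:E * (NR 1 g)%:E)%E.
    have mEg : mfun (EFin \o g) by exact/measurable_EFinP.
    have := le_integral_abse mu measurableT mEg a0; rewrite -/E2.
    have -> : (\int[mu]_x `|(EFin \o g) x| = (NR 1 g)%:E)%E by rewrite -Ig; apply: eq_integral.
    by rewrite mul1r -lee_pdivrMl ?invr_gt0// invrK.
  apply: le_trans (leeD h1 h2) _; rewrite -!EFinM -EFinD lee_fin -mulrDl -mulrDl.
  rewrite (addrC K) mulrAC ler_pdivrMr// mulrC -ler_pdivlMr ?addr_gt0//.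

suff h : {ae mu, forall x, forall k, ~ N k x}.
  apply: filterS h => x hx; apply/lee_addgt0Pr => e e0.
  have [k hk] : exists k, 2 * k.+1%:R^-1 < e.
    exists (Num.bound (2 / e)); have := archi_boundP (ltW (divr_gt0 (ltr0n R 2) e0)).
    set b := Num.bound _ => hb; rewrite ltr_pdivrMr// mulrC -ltr_pdivrMr//.
    by apply: lt_le_trans hb _; rewrite ler_nat.
  have /negP := hx k; rewrite /N/= -leNgt => h2; apply: le_trans h2 _.
  by apply: leeD2l; rewrite lee_fin ltW.
apply: ae_foralln => k; exists (N k); split => // x /= h; exact: contrapT.
Qed.

(** Localisation: cutting f to a large ball makes it integrable, does not change it at the point,
    and can only decrease its maximal function. *)
Lemma lebesgue_maxf (f : X -> R) : mfun f -> (forall x r, 0 < r -> mu.-integrable (B x r) (EFin \o f)) ->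
  {ae mu, forall x, (`|f x|%:E <= maxfun (fun y => `|f y|%:E) x)%E}.
Proof.
move=> mf iff.
have n0 n : (0 : R) < n.+1%:R by [].
have h n := lebesgue_maxf1 (Lp1_ball mf (n0 n) (iff point _ (n0 n))).
apply: filterS (ae_foralln h) => x hx.
have [N HN] := ballN_cover hX x; have := hx N.
rewrite {1}indicE mem_set ?mulr1; last exact: (HN N).
move/le_trans; apply; apply: (le_maxf hX) => //.
- apply/measurable_EFinP; apply: measurableT_comp => //; apply: measurable_funM => //.
  by apply: measurable_indic; exact: (qball_measurable hX).
- by apply/measurable_EFinP; exact: measurableT_comp.
- by move=> y; rewrite lee_fin indicE; case: (_ \in _); rewrite ?mulr1// mulr0 normr0.
Qed.

End differentiation.

(** * The John-Nirenberg inequality *)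

Section john_nirenberg.
Context (R : realType) (X : ptopologicalType) (d : X -> X -> R)
  (mu : {measure set (borel X) -> \bar R}) (c K : R) (hX : homogeneous_type d mu c K).
Context (q0 : R) (q0_gt1 : 1 < q0)
  (growth : forall x t j, 0 < t -> q0 ^+ j * mB d mu x t <= mB d mu x (c ^+ j * t)).
Context (del : R) (del0 : 0 < del).
Context (A : R) (A1 : 1 <= A) (cutoff : forall x r, 0 < r -> exists phi, [/\ Lam d del phi,
   forall y, 0 <= phi y, forall y, qball d x r y -> phi y = 1 & forall y, ~ qball d x (A * r) y -> phi y = 0]).

Notation B := (qball d).
Notation mB := (mB d mu).
Notation mfun f := (measurable_fun setT (f : borel X -> _)).
Notation maxfun := (maxfun d mu).
Notation avg := (avg d mu).
Notation LP q f := (Lp mu q (f : borel X -> R)).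
Notation NR q f := (nrm mu q (f : borel X -> R)).

Definition ball_avg (b : X -> R) x r : R := (mB x r)^-1 * \int[mu]_(y in B x r) b y.

(** Real functions of BMO norm at most [beta]. An upper bound is used and not the norm: it can be
    taken positive even for functions that are constant. *)
Definition bmoR (beta : R) (b : X -> R) : Prop :=
  [/\ mfun b, forall x r, 0 < r -> mu.-integrable (B x r) (EFin \o b) &
    forall x r, 0 < r -> (avg (fun y => `|b y - ball_avg b x r|%:E) x r <= beta%:E)%E].

Lemma ball_avg_sub_le (b : X -> R) x r (a : R) : 0 < r -> mu.-integrable (B x r) (EFin \o b) ->
  (`|ball_avg b x r - a|%:E <= avg (fun y => `|b y - a|%:E) x r)%E.
Proof.
move=> r0 ib; have m0 := mB_gt0 hX x r0; have mBx := qball_measurable hX x r0.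
have fB : (mu (B x r) < +oo)%E by rewrite (qball_mE hX) ?ltry.
have ia : mu.-integrable (B x r) (EFin \o (fun _ : borel X => a)).
  apply/integrableP; split; first exact: measurable_cst.
  by under eq_integral do rewrite abse_EFin; rewrite integral_cst// (qball_mE hX)// -EFinM ltry.
have iba : mu.-integrable (B x r) (EFin \o (fun y : borel X => b y - a)) by exact: (integrableB mBx ib ia).
have -> : ball_avg b x r - a = (mB x r)^-1 * \int[mu]_(y in B x r) (b y - a).
  by rewrite RintegralB// Rintegral_cst// /ball_avg -/(mB x r) mulrBr; congr (_ - _); field; rewrite gt_eqF.
rewrite /avg normrM ger0_norm ?invr_ge0 ?(ltW m0)// EFinM; apply: lee_wpmul2l.
  by rewrite lee_fin invr_ge0 ltW.
have -> : (\int[mu]_(y in B x r) `|b y - a|%:E = (\int[mu]_(y in B x r) `|b y - a|)%R%:E)%E.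
  rewrite /Rintegral fineK// ge0_fin_numE ?integral_ge0//.
  by have /integrableP[_] := iba.
by rewrite lee_fin; exact: le_normr_Rintegral.
Qed.

Lemma avg_sub (f : X -> \bar R) x r x' r' (D : R) : 0 < r -> 0 < r' -> mfun f -> (forall y, 0 <= f y)%E ->
  B x' r' `<=` B x r -> 0 <= D -> mB x r <= D * mB x' r' -> (avg f x' r' <= D%:E * avg f x r)%E.
Proof.
move=> r0 r'0 mf f0 sub D0 mD; have m0 := mB_gt0 hX x r0; have m'0 := mB_gt0 hX x' r'0.
rewrite -(@lee_pmul2l _ (mB x' r')%:E)// ?lte_fin// (avgE hX)// muleA -EFinM mulrC.
apply: (@le_trans _ _ ((mB x r)%:E * avg f x r)%E).
  rewrite (avgE hX)//; apply: ge0_subset_integral => //; try exact: (qball_measurable hX).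
  exact: measurable_funTS.
by apply: lee_wpmul2r; [exact: (avg_ge0 hX)|rewrite lee_fin].
Qed.

Lemma mfun_bmo (b : X -> R) a : mfun b -> mfun (fun y => `|b y - a|%:E).
Proof. by move=> mb; apply/measurable_EFinP; apply: measurableT_comp => //; apply: measurable_funB. Qed.

Lemma measurable_osc (b : X -> R) x r a a' : mfun b -> 0 < r ->
  measurable ([set y | B x r y /\ a' < `|b y - a|] : set (borel X)).
Proof.
move=> mb r0; have mab : mfun (fun y => `|b y - a|) by apply: measurableT_comp => //; apply: measurable_funB.
exact: (measurableI _ _ (qball_measurable hX x r0) (measurable_set_lt (measurable_cst a') mab)).
Qed.

(* The exceptional set is covered by Whitney balls of {M f > t beta}: on each of them the mean of [b]
   differs from the mean over the initial ball by at most t beta, and the induction applies. *)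
Lemma john_nirenberg (eta : R) : 0 < eta < 1 -> exists2 t, 0 < t &
  forall b beta, 0 < beta -> bmoR beta b -> forall n x r, 0 < r ->
  (mu [set y | B x r y /\ (n%:R * (t * beta) < `|b y - ball_avg b x r|)%R] <= (eta ^+ n)%:E * mu (B x r))%E.
Proof.
move=> /andP[eta0 eta1]; have K0 := K_gt0 hX; have K1 := K_gt1 hX.
(* With this value the weak inequality, applied to an integral of at most (1 + K^2) beta K^2 times
   the measure of the ball, leaves eta / K of that measure for [E]. *)
exists (K ^+ 4 * (1 + K ^+ 2) / eta); first by rewrite divr_gt0// mulr_gt0 ?exprn_gt0// addr_gt0 ?exprn_gt0.
set t := K ^+ 4 * _ / _; have t0 : 0 < t by rewrite divr_gt0// mulr_gt0 ?exprn_gt0// addr_gt0 ?exprn_gt0.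
move=> b beta beta0 [mb ib bb].
elim=> [|n IH] x0 r0 r00.
  have mBx := qball_measurable hX x0 r00.
  rewrite expr0 mul1e; apply: le_measure; rewrite ?inE//; last by move=> y [].
  exact: measurable_osc.
have mB0 := qball_measurable hX x0 r00; have m0 := mB_gt0 hX x0 r00.
have cr0 := cmul_gt0 hX r00; have ccr0 := cmul_gt0 hX cr0.
have m2 : mB x0 (c * (c * r0)) <= K ^+ 2 * mB x0 r0.
  rewrite expr2 -mulrA; apply: le_trans (mB_doubling hX _ cr0) _.
  by apply: ler_wpM2l; [exact: ltW|exact: (mB_doubling hX)].
have sub1 : B x0 r0 `<=` B x0 (c * r0) by apply: (qball_sub hX) => //; exact/ltW/(cmul_gt hX).
have sub2 : B x0 (c * r0) `<=` B x0 (c * (c * r0)) by apply: (qball_sub hX) => //; exact/ltW/(cmul_gt hX).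
(* The c^2-dilate is taken so that it contains the c-dilates of the Whitney balls centred in the
   initial ball, whose radii turn out to be at most [r0]. *)
set Q0 := B x0 (c * (c * r0)); have mQ0 : measurable (Q0 : set (borel X)) := qball_measurable hX x0 ccr0.
set a := ball_avg b x0 r0.
pose f y : \bar R := (`|b y - a| * \1_Q0 y)%:E.
have mf : mfun f.
  by apply/measurable_EFinP; apply: measurable_funM; [apply: measurableT_comp => //; exact: measurable_funB|exact: measurable_indic].
have f0 y : (0 <= f y)%E by rewrite lee_fin mulr_ge0.
have K20 : 0 <= K ^+ 2 by rewrite exprn_ge0// ltW.
have Fint : (\int[mu]_y f y <= ((1 + K ^+ 2) * beta * (K ^+ 2 * mB x0 r0))%:E)%E.
  have -> : (\int[mu]_y f y = \int[mu]_(y in Q0) `|b y - a|%:E)%E.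
    rewrite [RHS]integral_mkcond; apply: eq_integral => y _; rewrite /f patchE indicE.
    by case: ifP => _; rewrite ?mulr1 ?mulr0.
  rewrite -(avgE hX)//.
  set a2 := ball_avg b x0 (c * (c * r0)).
  have av2 := bb x0 _ ccr0.
  have a12 : (`|a - a2|%:E <= (K ^+ 2 * beta)%:E)%E.
    apply: le_trans (ball_avg_sub_le a2 r00 (ib _ _ r00)) _.
    apply: (@le_trans _ _ ((K ^+ 2)%:E * avg (fun y => `|b y - a2|%:E) x0 (c * (c * r0)))%E).
      by apply: avg_sub => //; [exact: mfun_bmo|exact: subset_trans sub2].
    by rewrite (EFinM (K ^+ 2)); apply: lee_wpmul2l; rewrite ?lee_fin.
  have : (avg (fun y => `|b y - a|%:E) x0 (c * (c * r0)) <= ((1 + K ^+ 2) * beta)%:E)%E.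
    apply: (@le_trans _ _ (avg (fun y => `|b y - a2|%:E + `|a - a2|%:E) x0 (c * (c * r0)))%E).
      apply: (avg_le hX) => //; first exact: mfun_bmo.
        by apply: emeasurable_funD => //; exact: mfun_bmo.
      by move=> y; rewrite -EFinD lee_fin (distrC a); have := ler_normD (b y - a2) (a2 - a); rewrite subrKA.
    rewrite (avgD hX)//; last exact: mfun_bmo.
    rewrite (avg_cst hX)// mulrDl mul1r EFinD; exact: leeD.
  move=> h; rewrite [X in (_ <= X%:E)%E]mulrC EFinM; apply: lee_pmul => //; rewrite ?lee_fin ?(ltW (mB_gt0 hX _ ccr0))//; exact: (avg_ge0 hX).
have tb0 : 0 < t * beta by rewrite mulr_gt0.
set E := [set y | ((t * beta)%:E < maxfun f y)%E].
have oE : open E by exact: (open_maxf hX).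
have mE : (mu E <= (eta / K * mB x0 r0)%:E)%E.
  apply: le_trans (weak_maxfun hX mf f0 tb0) _.
  apply: (@le_trans _ _ ((K / (t * beta))%:E * ((1 + K ^+ 2) * beta * (K ^+ 2 * mB x0 r0))%:E)%E).
    by apply: lee_wpmul2l => //; rewrite lee_fin divr_ge0 ?ltW.
  rewrite -EFinM lee_fin /t le_eqVlt; apply/orP; left; apply/eqP; field.
  by rewrite !gt_eqF// addr_gt0// exprn_gt0.
have Efin : (mu E < +oo)%E by apply: le_lt_trans mE (ltry _).
set V := [set y | B x0 r0 y /\ n.+1%:R * (t * beta) < `|b y - a|].
have mV : measurable (V : set (borel X)).
  exact: measurable_osc.
pose W : set (borel X) := V `&` E.
have mW : measurable W by apply: measurableI => //; exact: open_borel.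
(* By differentiation, a point of the initial ball where |b - a| exceeds t beta belongs to [E], up
   to a null set. *)
have VW : (mu V <= mu W)%E.
  have mfr : mfun (fun y => `|b y - a| * \1_Q0 y) by exact/measurable_EFinP.
  have LPfr : LP 1 (fun y => (b y - a) * \1_Q0 y).
    apply/(LpIp _ _ ltr01); split.
      by apply: measurable_funM; [exact: measurable_funB|exact: measurable_indic].
    apply: le_lt_trans (ltry ((1 + K ^+ 2) * beta * (K ^+ 2 * mB x0 r0))); apply: le_trans Fint.
    rewrite /Ip le_eqVlt; apply/orP; left; apply/eqP; apply: eq_integral => y _.
    by rewrite /f powRr1// normrM indicE; case: (_ \in _); rewrite ?normr1 ?normr0.
  have := lebesgue_maxf1 hX del0 A1 cutoff LPfr.
  have -> : (fun y => `|(b y - a) * \1_Q0 y|%:E) = f.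
    by apply/funext => y; rewrite /f normrM indicE; case: (_ \in _); rewrite ?normr1 ?normr0.
  move=> [N [mN N0 HN]].
  have VN : V `<=` W `|` N.
    move=> y Vy; have [h|h] := pselect ((`|(b y - a) * \1_Q0 y|%:E <= maxfun f y)%E); last by right; apply: HN.
    left; split => //; apply: lt_le_trans h; case: Vy => By hy.
    rewrite indicE mem_set; last exact/sub2/sub1.
    rewrite mulr1 lte_fin; apply: le_lt_trans hy.
    by rewrite ler_peMl ?(ltW tb0)// ler1n.
  apply: (@le_trans _ _ (mu (W `|` N))).
    by apply: le_measure; rewrite ?inE//; exact: measurableU.
  by apply: le_trans (measureU2 _ _ _) _ => //; rewrite [X in (_ + X)%E]N0 adde0.
apply: (le_trans VW).
(* The factor K lost in passing to the c-dilates of the Whitney balls is recovered from the factor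
   eta / K gained on [E]. *)
apply: (@le_trans _ _ ((eta ^+ n * K)%:E * mu E)%E); last first.
  apply: (@le_trans _ _ ((eta ^+ n * K)%:E * (eta / K * mB x0 r0)%:E)%E).
    by apply: lee_wpmul2l => //; rewrite lee_fin mulr_ge0 ?exprn_ge0 ?ltW.
  rewrite (qball_mE hX)// -!EFinM lee_fin exprSr le_eqVlt; apply/orP; left; apply/eqP; field.
  by rewrite gt_eqF.
apply: (whitney_measure hX q0_gt1 growth) => //.
- by move=> y [].
- by rewrite mulr_ge0 ?exprn_ge0 ?ltW.
move=> x r [[Bx hx] Ex] rpos rE rnE.
have crp := cmul_gt0 hX rpos.
(* A larger Whitney ball would have a c-dilate containing the initial ball, whose measure would then
   be at most K mu E, hence at most eta times itself. *)
have rr0 : r <= r0.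
  rewrite leNgt; apply/negP => r0r.
  have : B x0 r0 `<=` B x (c * r) by apply: (qball_engulf hX r00 (ltW r0r) (qball_center hX x rpos) Bx).
  move=> /(mB_sub hX r00 crp) h.
  have h2 : mB x r <= eta / K * mB x0 r0.
    rewrite -lee_fin -(qball_mE hX)//; apply: le_trans mE; apply: le_measure; rewrite ?inE//.
      exact: (qball_measurable hX).
    exact: open_borel.
  have := le_trans h (mB_doubling hX x rpos).
  have : K * mB x r <= K * (eta / K * mB x0 r0) by rewrite ler_wpM2l// ltW.
  have -> : K * (eta / K * mB x0 r0) = eta * mB x0 r0 by field; rewrite gt_eqF.
  move=> h3 h4; have := le_trans h4 h3; rewrite leNgt => /negP; apply.
  by rewrite gtr_pMl.
have QQ0 : B x (c * r) `<=` Q0.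
  apply: (qball_engulf hX crp _ (sub1 _ Bx) (qball_center hX x crp)).
  by rewrite ler_wpM2l// ltW// (c_gt0 hX).
have [y0 [xy0 y0E]] : exists y0, B x (c * r) y0 /\ (maxfun f y0 <= (t * beta)%:E)%E.
  apply: contrapT => h; apply: rnE => y xy; rewrite /E/= ltNge; apply/negP => ?.
  by apply: h; exists y.
have mean : `|ball_avg b x (c * r) - a| <= t * beta.
  rewrite -lee_fin; apply: le_trans (ball_avg_sub_le a crp (ib _ _ crp)) _.
  apply: le_trans y0E; apply: le_trans (avg_le_maxf mu f crp xy0).
  have mBcr := qball_measurable hX x crp.
  apply: lee_wpmul2l; first by rewrite lee_fin invr_ge0 ltW// (mB_gt0 hX).
  apply: ge0_le_integral => //.
  - by apply: measurable_funTS; exact: mfun_bmo.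
  - exact: measurable_funTS.
  - by move=> y /QQ0 Qy; rewrite /f indicE mem_set// mulr1.
have mBcr := qball_measurable hX x crp.
apply: (@le_trans _ _ (mu [set y | B x (c * r) y /\ n%:R * (t * beta) < `|b y - ball_avg b x (c * r)|])).
  apply: le_measure; rewrite ?inE.
  - exact: measurableI.
  - exact: measurable_osc.
  - move=> y [[[_ hy] _] Qy]; split => //.
    have := ler_normD (b y - ball_avg b x (c * r)) (ball_avg b x (c * r) - a); rewrite subrKA.
    by move: hy; rewrite -natr1 mulrDl mul1r; lra.
apply: le_trans (IH _ _ crp) _.
rewrite EFinM -muleA; apply: lee_wpmul2l; first by rewrite lee_fin exprn_ge0// ltW.
by rewrite !(qball_mE hX)// -EFinM lee_fin (mB_doubling hX).
Qed.

(** Integration of the exponential decay over the shells where |b - a| lies between n t beta and (n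
    + 1) t beta. *)
Lemma bmo_moment (q : R) : 1 <= q -> exists2 C, 0 < C &
  forall b beta, 0 < beta -> bmoR beta b -> forall x r, 0 < r ->
  LP q (fun y => (b y - ball_avg b x r) * \1_(B x r) y) /\
  NR q (fun y => (b y - ball_avg b x r) * \1_(B x r) y) <= C * beta * mB x r `^ q^-1.
Proof.
move=> q1; have qpos : 0 < q := lt_le_trans ltr01 q1.
(* Then (n + 1)^q eta^n <= 2^(n q) 2^(-n (q + 1)) = 2^-n, which is summable. *)
pose eta : R := 2 `^ (- (q + 1)).
have eta0 : 0 < eta by rewrite powR_gt0.
have eta1 : eta < 1.
  rewrite /eta powRN invf_lt1 ?powR_gt0//; apply: powR_gt1; rewrite ?ltr1n//.
  by rewrite addr_gt0.
have [t t0 Ht] := john_nirenberg (introT andP (conj eta0 eta1)).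
exists (2 * t); first by rewrite mulr_gt0.
move=> b beta beta0 hb x r r0; have [mb ib _] := hb.
set a := ball_avg b x r; have tb0 : 0 < t * beta by rewrite mulr_gt0.
have mBx := qball_measurable hX x r0; have m0 := mB_gt0 hX x r0.
pose S n : set (borel X) := [set y | B x r y /\ n%:R * (t * beta) < `|b y - a|].
have mS n : measurable (S n).
  exact: measurable_osc.
have mv : mfun (fun y => (b y - a) * \1_(B x r) y).
  by apply: measurable_funM; [exact: measurable_funB|exact: measurable_indic].
apply: LpP => //; first by rewrite !mulr_ge0 ?powR_ge0 ?ltW.
pose F n y : \bar R := ((n.+1%:R * (t * beta)) `^ q * \1_(S n) y)%:E.
have mF n : mfun (F n).
  by apply/measurable_EFinP; apply: measurable_funM => //; exact: measurable_indic.
have F0 n y : (0 <= F n y)%E by rewrite lee_fin mulr_ge0 ?powR_ge0.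
apply: (@le_trans _ _ (\int[mu]_y \sum_(0 <= n <oo) F n y)%E).
  apply: ge0_le_integral => //.
  - exact: measurable_powRn.
  - by apply: ge0_emeasurable_sum => // n y _ _; exact: F0.
  move=> y _; have [h|h] := pselect (B x r y /\ b y != a); last first.
    have -> : (b y - a) * \1_(B x r) y = 0.
      rewrite indicE; have [h1|h1] := pselect (B x r y); last by rewrite memNset// mulr0.
      have [->|h2] := eqVneq (b y) a; first by rewrite subrr mul0r.
      by exfalso; apply: h.
    by rewrite normr0 powR0 ?gt_eqF//; apply: nneseries_ge0 => n _ _; exact: F0.
  case: h => By ba; have s0 : 0 < `|b y - a| by rewrite normr_gt0 subr_eq0.
  have ex : exists k, `|b y - a| <= k%:R * (t * beta).
    exists (Num.bound (`|b y - a| / (t * beta))); rewrite -ler_pdivrMr//; apply/ltW/archi_boundP.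
    by rewrite divr_ge0// ltW.
  case: (ex_minnP ex) => -[|k] hk kmin; first by move: hk; rewrite mul0r leNgt s0.
  have hk' : k%:R * (t * beta) < `|b y - a|.
    by rewrite ltNge; apply/negP => /kmin; rewrite ltnn.
  apply: (@le_trans _ _ (F k y)).
    rewrite /F !indicE !mem_set// ?mulr1 lee_fin.
    by apply: ge0_ler_powR; rewrite ?nnegrE ?(ltW qpos) ?mulr_ge0 ?(ltW t0) ?(ltW beta0).
  apply: le_trans (nneseries_lim_ge k.+1 (fun i _ _ => F0 i y)).
  by rewrite big_nat_recr//= leeDr// sume_ge0.
rewrite integral_nneseries//.
apply: nneseries_le => [n|N]; first exact: integral_ge0.
have term n : (\int[mu]_y F n y <= ((t * beta) `^ q * mB x r * (2^-1) ^+ n)%:E)%E.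
  rewrite /F; under eq_integral do rewrite EFinM.
  rewrite ge0_integralZl ?lee_fin ?powR_ge0//; last by apply/measurable_EFinP; exact: measurable_indic.
  rewrite integral_indic// setIT.
  apply: le_trans (lee_wpmul2l _ (Ht b beta beta0 hb n x r r0)) _; first by rewrite lee_fin powR_ge0.
  rewrite (qball_mE hX)// -!EFinM lee_fin powRM// ?(ltW tb0)//.
  have : n.+1%:R `^ q * eta ^+ n <= 2^-1 ^+ n.
    apply: (@le_trans _ _ ((2 ^+ n) `^ q * eta ^+ n)).
      apply: ler_wpM2r; first by rewrite exprn_ge0// ltW.
      apply: ge0_ler_powR; rewrite ?nnegrE ?(ltW qpos) ?exprn_ge0//.
      by rewrite -natrX ler_nat ltn_expl.
    rewrite -powR_mulrn// -powRrM -powR_mulrn ?(ltW eta0)// -powRrM -powRD; last by rewrite pnatr_eq0 implybT.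
    rewrite -powR_mulrn ?invr_ge0// powR_invl// -powRN.
    by rewrite le_eqVlt; apply/orP; left; apply/eqP; congr powR; ring.
  have : 0 <= (t * beta) `^ q * mB x r by rewrite mulr_ge0 ?powR_ge0 ?ltW.
  move=> h1 h2; have := ler_wpM2l h1 h2; lra.
apply: (@le_trans _ _ (\sum_(0 <= n < N) ((t * beta) `^ q * mB x r * (2^-1) ^+ n)%:E)%E).
  by apply: lee_sum => n _.
rewrite sumEFin lee_fin -mulr_sumr.
have h12 : 0 <= (2^-1 : R) < 1 by apply/andP; split; lra.
apply: (@le_trans _ _ ((t * beta) `^ q * mB x r * 2)).
  apply: ler_wpM2l; first by rewrite mulr_ge0 ?powR_ge0 ?ltW.
  have e2 : (1 - 2^-1)^-1 = 2 :> R by field.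
  by rewrite -[leRHS]e2; exact: geometric_sum_le.
have n1 : 0 <= 2 * t * beta by rewrite !mulr_ge0 ?(ltW t0) ?(ltW beta0).
rewrite (powRM _ n1 (powR_ge0 _ _)) -powRrM mulVf ?gt_eqF// powRr1 ?(ltW m0)//.
have -> : 2 * t * beta = 2 * (t * beta) by rewrite mulrA.
rewrite (powRM _ (ler0n R 2) (ltW tb0)) mulrC -[leRHS]mulrA.
apply: ler_wpM2r; first by rewrite mulr_ge0 ?powR_ge0 ?(ltW m0).
by rewrite -[leLHS]powRr1//; apply: ler_powR => //; rewrite ler1n.
Qed.

Lemma ball_avg_chain b beta x r j : 0 < beta -> bmoR beta b -> 0 < r -> `|ball_avg b x (c ^+ j * r) - ball_avg b x r| <= j%:R * K * beta.
Proof.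
move=> beta0 [mb ib bb] r0; have K0 := K_gt0 hX.
elim: j => [|j IH]; first by rewrite expr0 mul1r subrr normr0 !mul0r.
have rj := cX_gt0 hX j r0; have rj1 := cmul_gt0 hX rj.
have -> : c ^+ j.+1 * r = c * (c ^+ j * r) by rewrite exprS mulrA.
have : `|ball_avg b x (c ^+ j * r) - ball_avg b x (c * (c ^+ j * r))| <= K * beta.
  rewrite -lee_fin; apply: le_trans (ball_avg_sub_le _ rj (ib _ _ rj)) _.
  apply: (@le_trans _ _ (K%:E * avg (fun y => `|b y - ball_avg b x (c * (c ^+ j * r))|%:E) x (c * (c ^+ j * r)))%E).
    apply: avg_sub => //; [exact: mfun_bmo| |exact: ltW|exact: (mB_doubling hX)].
    by apply: (qball_sub hX) => //; exact/ltW/(cmul_gt hX).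
  by rewrite EFinM; apply: lee_wpmul2l; [rewrite lee_fin ltW|exact: bb].
rewrite distrC => h1.
have := ler_normD (ball_avg b x (c * (c ^+ j * r)) - ball_avg b x (c ^+ j * r)) (ball_avg b x (c ^+ j * r) - ball_avg b x r).
rewrite subrKA -natr1; lra.
Qed.

Lemma nrm_indic q x r a : 0 < q -> 0 < r -> LP q (fun y => a * \1_(B x r) y) /\
  NR q (fun y => a * \1_(B x r) y) = `|a| * mB x r `^ q^-1.
Proof.
move=> q_0 r0; have mBx := qball_measurable hX x r0; have m0 := mB_gt0 hX x r0.
have i1 : LP q (\1_(B x r)) by apply: Lp_indic => //; rewrite (qball_mE hX)// ltry.
have [h1 h2] := LpZ a q_0 i1; split => //; rewrite h2; congr (_ * _).
apply: (powR_injr q_0); rewrite ?nrm_ge0 ?powR_ge0//.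
apply: EFin_inj; rewrite -(IpE q_0 i1) -powRrM mulVf ?gt_eqF// powRr1 ?(ltW m0)//.
rewrite -(qball_mE hX)// -[X in mu X]setIT -integral_indic//; apply: eq_integral => y _.
by rewrite indicE; case: (_ \in _); rewrite ?normr1 ?powR1// normr0 powR0// gt_eqF.
Qed.

(** Means over consecutive dilates differ by at most K beta, so the oscillation around the mean over
    the small ball grows only linearly in [j]; the decay of the kernel will absorb this. *)
Lemma bmo_dilate (q : R) : 1 <= q -> exists2 C, 0 < C &
  forall b beta, 0 < beta -> bmoR beta b -> forall x r j, 0 < r ->
  LP q (fun y => (b y - ball_avg b x r) * \1_(B x (c ^+ j * r)) y) /\
  NR q (fun y => (b y - ball_avg b x r) * \1_(B x (c ^+ j * r)) y) <= C * j.+1%:R * beta * mB x (c ^+ j * r) `^ q^-1.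
Proof.
move=> q1; have q_0 : 0 < q := lt_le_trans ltr01 q1.
have [C C0 HC] := bmo_moment q1; have K0 := K_gt0 hX.
exists (C + K); first by rewrite addr_gt0.
move=> b beta beta0 hb x r j r0; have rj := cX_gt0 hX j r0.
have [h1 h2] := HC b beta beta0 hb x _ rj.
have [g1 g2] := nrm_indic x (ball_avg b x (c ^+ j * r) - ball_avg b x r) q_0 rj.
have [k1 k2] := LpD q1 h1 g1.
have E : (fun y => (b y - ball_avg b x (c ^+ j * r)) * \1_(B x (c ^+ j * r)) y +
   (ball_avg b x (c ^+ j * r) - ball_avg b x r) * \1_(B x (c ^+ j * r)) y) =
   (fun y => (b y - ball_avg b x r) * \1_(B x (c ^+ j * r)) y) by apply/funext => y; ring.
rewrite E in k1 k2; split => //; apply: (le_trans k2); apply: (le_trans (lerD h2 (lexx _))).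
rewrite g2 -mulrDl; apply: ler_wpM2r; first exact: powR_ge0.
have := ball_avg_chain x j beta0 hb r0; rewrite -natr1.
have : 0 <= C * j%:R * beta by rewrite !mulr_ge0 ?(ltW C0) ?(ltW beta0).
have : 0 <= K * beta by rewrite mulr_ge0 ?ltW.
lra.
Qed.

End john_nirenberg.

(** * Real Calderon-Zygmund operators *)

Section hoelder_general.
Context (dd : measure_display) (T : measurableType dd) (R : realType) (mu : {measure set T -> \bar R}).

(** The case r = 1 applied to |f|^r and |g|^r with the exponents p / r and q / r. *)
Lemma hoelder_Lp_mul (p q r : R) (f g : T -> R) : 0 < p -> 0 < q -> 0 < r -> p^-1 + q^-1 = r^-1 -> Lp mu p f -> Lp mu q g ->
  Lp mu r (fun x => f x * g x) /\ nrm mu r (fun x => f x * g x) <= nrm mu p f * nrm mu q g.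
Proof.
move=> p0 q0 r0 pqr fp gq.
have pr0 : 0 < p / r by rewrite divr_gt0.
have qr0 : 0 < q / r by rewrite divr_gt0.
have e : (p / r)^-1 + (q / r)^-1 = 1.
  by rewrite !invf_div -mulrDr pqr mulfV// gt_eqF.
have [f1 f2] := Lp_Lp pr0 p0 r0 (esym (divfK (negbT (gt_eqF r0)) p)) fp.
have [g1 g2] := Lp_Lp qr0 q0 r0 (esym (divfK (negbT (gt_eqF r0)) q)) gq.
have [h1 h2] := hoelder_Lp pr0 qr0 e f1 g1; rewrite f2 g2 in h2.
have mfg : measurable_fun setT (fun x => f x * g x) by apply: measurable_funM; [case: fp|case: gq].
apply: LpP => //; first by rewrite mulr_ge0 ?nrm_ge0.
rewrite (powRM _ (nrm_ge0 _ _ _) (nrm_ge0 _ _ _)).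
have -> : Ip mu r (fun x => f x * g x) = Ip mu 1 (fun x => `|f x| `^ r * `|g x| `^ r).
  by apply: eq_integral => x _; rewrite powRr1 ?normr_ge0// [in RHS]ger0_norm ?mulr_ge0 ?powR_ge0// -powRM// -normrM.
by rewrite (IpE ltr01 h1) powRr1 ?nrm_ge0// lee_fin.
Qed.

(** Half of the geometric decay is spent on the polynomial factor: with t = max(s, 1/2) and u = t^(1
    / (2q)), (j + 2) u^j is bounded by Bernoulli's inequality, and the square root of t remains as
    ratio. *)
Lemma poly_geometric (q s : R) : 0 < q -> 0 <= s < 1 -> exists2 D : R, 0 < D &
  exists2 z : R, 0 <= z < 1 & forall j, j.+2%:R `^ q * s ^+ j <= D * z ^+ j.
Proof.
move=> q0 /andP[s0 s1].
pose t := Num.max s 2^-1.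
have t0 : 0 < t by rewrite lt_max invr_gt0 ltr0n orbT.
have t1 : t < 1 by rewrite gt_max s1/=; lra.
pose u := t `^ (2 * q)^-1.
have q20 : 0 < (2 * q)^-1 by rewrite invr_gt0 mulr_gt0.
have u0 : 0 < u by rewrite powR_gt0.
have u1 : u < 1.
  have := @gt0_ltr_powR R _ q20 t 1; rewrite powR1 !nnegrE; apply => //; exact: ltW.
pose h := u^-1 - 1.
have h0 : 0 < h by rewrite subr_gt0 invf_gt1.
pose h' := Num.min h 2^-1.
have h'0 : 0 < h' by rewrite lt_min h0 invr_gt0 ltr0n.
have h'h : h' <= h by rewrite ge_min lexx.
have h'2 : h' <= 2^-1 by rewrite ge_min lexx orbT.
have bern j : h' * j.+2%:R <= u^-1 ^+ j.
  elim: j => [|j IH]; first by rewrite expr0; lra.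
  have -> : u^-1 ^+ j.+1 = u^-1 ^+ j + h * u^-1 ^+ j by rewrite exprS /h; ring.
  rewrite -natr1 mulrDr mulr1; apply: lerD => //.
  apply: le_trans h'h _; rewrite ler_peMr ?(ltW h0)// exprn_ege1//.
  by rewrite invf_ge1// ltW.
exists ((h'^-1) `^ q); first by rewrite powR_gt0 ?invr_gt0.
exists (t `^ 2^-1).
  rewrite powR_ge0/=; have := @gt0_ltr_powR R 2^-1; rewrite invr_gt0 ltr0n => /(_ isT t 1).
  rewrite powR1 !nnegrE; apply => //; exact: ltW.
move=> j.
have H : j.+2%:R * u ^+ j <= h'^-1.
  have := bern j; rewrite exprVn => hh; rewrite -ler_pdivlMr ?exprn_gt0//.
  by rewrite ler_pdivlMl.
have tj : s ^+ j <= t ^+ j by apply: lerXn2r; rewrite ?nnegrE ?(ltW t0)// le_max lexx.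
apply: le_trans (ler_wpM2l (powR_ge0 _ _) tj) _.
have -> : t ^+ j = (u ^+ j) `^ q * (t `^ 2^-1) ^+ j.
  rewrite -!powR_mulrn ?powR_ge0 ?(ltW t0)// -!powRrM -powRD; last by rewrite (gt_eqF t0) implybT.
  by congr powR; field; rewrite gt_eqF.
rewrite mulrA; apply: ler_wpM2r; first by rewrite exprn_ge0// powR_ge0.
rewrite -powRM ?exprn_ge0 ?(ltW u0)//.
by apply: ge0_ler_powR; rewrite ?nnegrE ?(ltW q0) ?mulr_ge0 ?exprn_ge0 ?invr_ge0 ?(ltW u0) ?(ltW h'0).
Qed.

Lemma dual_exp (q : R) : 1 < q -> [/\ 1 < q / (q - 1), q^-1 + (q / (q - 1))^-1 = 1 & 0 < q / (q - 1)].
Proof.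
move=> q1; have q10 : 0 < q - 1 by rewrite subr_gt0.
have q0 : 0 < q by rewrite (lt_trans ltr01).
split; first by rewrite ltr_pdivlMr// mul1r gtrBl.
  by field; rewrite !gt_eqF.
by rewrite divr_gt0.
Qed.

Lemma Lp_mulI p (f : T -> R) (E : set T) : 0 < p -> measurable E -> Lp mu p f ->
  Lp mu p (fun x => f x * \1_E x) /\ nrm mu p (fun x => f x * \1_E x) <= nrm mu p f.
Proof.
move=> p0 mE fp; apply: Lp_le => //.
  by apply: measurable_funM; [case: fp|exact: measurable_indic].
by move=> x; rewrite normrM indicE; case: (_ \in _); rewrite ?normr1 ?mulr1// normr0 mulr0.
Qed.

End hoelder_general.

(** * Maximal functions of exponent s, sharp inequality in L^p, and duality *)

Section calderon_zygmund_tools.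
Context (R : realType) (X : ptopologicalType) (d : X -> X -> R)
  (mu : {measure set (borel X) -> \bar R}) (c K : R) (hX : homogeneous_type d mu c K).
Context (q0 : R) (q0_gt1 : 1 < q0)
  (growth : forall x t j, 0 < t -> q0 ^+ j * mB d mu x t <= mB d mu x (c ^+ j * t)).
Context (del : R) (del0 : 0 < del).
Context (A : R) (A1 : 1 <= A) (cutoff : forall x r, 0 < r -> exists phi, [/\ Lam d del phi,
   forall y, 0 <= phi y, forall y, qball d x r y -> phi y = 1 & forall y, ~ qball d x (A * r) y -> phi y = 0]).

Notation B := (qball d).
Notation mB := (mB d mu).
Notation mfun f := (measurable_fun setT (f : borel X -> _)).
Notation maxfun := (maxfun d mu).
Notation avg := (avg d mu).
Notation test_fun := (test_fun d mu).
Notation LP q f := (Lp mu q (f : borel X -> R)).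
Notation NR q f := (nrm mu q (f : borel X -> R)).

Definition Ms (s : R) (f : X -> R) (y : X) : \bar R := (maxfun (fun z => (`|f z| `^ s)%:E) y `^ s^-1)%E.

Lemma Ms_ge0 s f y : (0 <= Ms s f y)%E. Proof. exact: poweR_ge0. Qed.

Lemma measurable_Ms s f : mfun (Ms s f).
Proof. by apply: (measurableT_comp (measurable_poweR _)); exact: (measurable_maxf hX). Qed.

Lemma Ms_strong (s p : R) : 0 < s < p -> exists2 C : R, 0 < C & forall f, mfun f ->
  (\int[mu]_y (Ms s f y `^ p) <= C%:E * Ip mu p f)%E.
Proof.
move=> /andP[s0 sp]; have p0 : 0 < p := lt_trans s0 sp.
have ps1 : 1 < p / s by rewrite ltr_pdivlMr// mul1r.
have [C C0 HC] := strong_maxfun hX ps1; exists C => // f mf.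
have mfs : mfun (fun y => `|f y| `^ s) by apply/measurable_EFinP/measurable_powRn.
have := HC _ mfs (fun y => powR_ge0 _ _).
have -> : (\int[mu]_y ((`|f y| `^ s) `^ (p / s))%R%:E = Ip mu p f)%E.
  by apply: eq_integral => y _; rewrite -powRrM mulrCA mulfV ?mulr1// gt_eqF.
by under [X in _ -> (X <= _)%E]eq_integral do rewrite /Ms -poweRrM mulrC.
Qed.

Lemma nrm_ball_Ms s f x r y : 0 < s -> 0 < r -> B x r y -> LP s (fun z => f z * \1_(B x r) z) -> mfun f ->
  ((NR s (fun z => f z * \1_(B x r) z))%:E <= (mB x r `^ s^-1)%:E * Ms s f y)%E.
Proof.
move=> s0 r0 xy fs mf; have m0 := mB_gt0 hX x r0.
have mBx := qball_measurable hX x r0.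
set N := NR s _; have N0 : 0 <= N := nrm_ge0 _ _ _.
have h : ((N `^ s)%:E <= (mB x r)%:E * maxfun (fun z => (`|f z| `^ s)%:E) y)%E.
  rewrite -(IpE s0 fs) /Ip.
  have -> : (\int[mu]_z (`|f z * \1_(B x r) z| `^ s)%:E = \int[mu]_(z in B x r) (`|f z| `^ s)%:E)%E.
    rewrite [RHS]integral_mkcond; apply: eq_integral => z _; rewrite patchE indicE.
    by case: ifP => _; rewrite ?mulr1// mulr0 normr0 powR0// gt_eqF.
  rewrite -(avgE hX)//; apply: lee_wpmul2l; first by rewrite lee_fin ltW.
  exact: avg_le_maxf.
have M0 : (0 <= maxfun (fun z => (`|f z| `^ s)%:E) y)%E.
  by apply: (maxf_ge0 hX) => z; rewrite lee_fin powR_ge0.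
have -> : N%:E = ((N `^ s)%:E `^ s^-1)%E.
  by rewrite poweR_EFin -powRrM mulfV ?gt_eqF// powRr1.
rewrite -[X in (_ <= X * _)%E]poweR_EFin /Ms -poweRM ?lee_fin ?(ltW m0)//.
apply: gt0_ler_poweR => //; rewrite ?invr_ge0 ?(ltW s0)// in_itv/= leey andbT.
  by rewrite lee_fin powR_ge0.
by rewrite mule_ge0// lee_fin ltW.
Qed.

(** By differentiation |F| is at most its maximal function almost everywhere, so the norm of F
    itself is controlled. *)
Lemma sharp_Lp (p p1 : R) : 1 <= p1 -> p1 < p -> exists2 C : R, 0 < C &
  forall (F : X -> R) (G : X -> \bar R), LP p1 F -> mfun G -> (forall y, 0 <= G y)%E ->
  (forall x r, 0 < r -> exists a : R, forall y, B x r y -> (avg (fun z => `|F z - a|%:E) x r <= G y)%E) ->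
  (Ip mu p F <= C%:E * \int[mu]_y (G y `^ p))%E.
Proof.
move=> p11 p1p; have [C C0 HC] := sharp_maximal hX q0_gt1 growth p11 p1p.
have p1_0 : 0 < p1 := lt_le_trans ltr01 p11.
have p0 : 0 < p := lt_trans p1_0 p1p.
exists C => // F G Fp mG G0 H; apply: le_trans (HC F G Fp mG G0 H).
have mF : mfun F by case: Fp.
have mM : mfun (maxfun (fun z => `|F z|%:E)) by exact: (measurable_maxf hX).
apply: ae_ge0_le_integral => //.
- exact: (measurable_powRn p mF).
- by move=> x _; exact: poweR_ge0.
- exact: (measurableT_comp (measurable_poweR _)).
have iF x r : 0 < r -> mu.-integrable (B x r) (EFin \o F).
  move=> r0; have mBx := qball_measurable hX x r0.
  apply/(integrable_mkcond _ mBx).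
  have : LP 1 (fun y => F y * \1_(B x r) y).
    move: p11; rewrite le_eqVlt => /predU1P[p1E|p11].
      by rewrite -p1E in Fp; have [] := Lp_mulI ltr01 mBx Fp.
    have [e1 e2 e3] := dual_exp p11.
    have I1 : LP (p1 / (p1 - 1)) (\1_(B x r)) by apply: Lp_indic => //; rewrite (qball_mE hX)// ltry.
    by have [] := hoelder_Lp p1_0 e3 e2 Fp I1.
  move/Lp1P; apply: eq_integrable => // y _.
  by rewrite patchE /= indicE; case: ifP; rewrite ?mulr1 ?mulr0.
have h0 := lebesgue_maxf hX del0 A1 cutoff mF iF.
apply: (@filterS (borel X) _ (ae_filter_ringOfSetsType mu) _ _ _ h0) => y h _.
rewrite -poweR_EFin; apply: gt0_ler_poweR => //; rewrite ?(ltW p0)// in_itv/= leey andbT//.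
by apply: le_trans h; rewrite lee_fin.
Qed.

(** Converse of Hoelder's inequality, for a function not known to be in L^q: truncations of u are
    tested against sg(u) |u|^(q - 1), a test function, and the bound passes to u by Fatou's
    lemma. *)
Lemma Lp_dual (q : R) (u : X -> R) (M : R) : 1 < q -> mfun u -> 0 <= M ->
  (forall g, test_fun g -> \int[mu]_y (u y * g y) <= M * NR (q / (q - 1)) g) -> LP q u /\ NR q u <= M.
Proof.
move=> q1 mu_ M0 H; have [e1 e2 e3] := dual_exp q1.
have q_0 : 0 < q := lt_trans ltr01 q1.
set q' := q / (q - 1) in e1 e2 e3 H.
pose S n : set (borel X) := ballN d n `&` [set y | `|u y| < n.+1%:R].
have mS n : measurable (S n).
  apply: measurableI; first exact: (measurable_ballN hX).
  by apply: measurable_set_lt => //; exact: measurableT_comp.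
have cS x : exists N, forall n, (N <= n)%N -> S n x.
  have [N HN] := ballN_cover hX x; exists (maxn N (Num.bound `|u x|)) => n.
  rewrite geq_max => /andP[nN nb]; split; first exact: HN.
  apply: (@lt_le_trans _ _ (Num.bound `|u x|)%:R); first exact: archi_boundP.
  by rewrite ler_nat (leq_trans nb).
have n0 n : (0 : R) < n.+1%:R by [].
have S0 n y : ~ ballN d n y -> \1_(S n) y = 0 :> R.
  by move=> h; rewrite indicE memNset// => -[].
pose un n y := u y * \1_(S n) y.
have unb n y : `|un n y| <= n.+1%:R.
  rewrite /un indicE; have [/[dup] Sy [_ /= h]|h] := pselect (S n y); last by rewrite memNset// mulr0 normr0.
  by rewrite mem_set// mulr1 ltW.
have mun n : mfun (un n) by apply: measurable_funM => //; exact: measurable_indic.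
have key n : (Ip mu q (un n) <= (M `^ q)%:E)%E.
  have unq : LP q (un n).
    apply: (@bounded_Lp _ _ _ _ _ _ hX (un n) n.+1%:R q point n.+1%:R) => // y h.
    by rewrite /un S0// mulr0.
  pose g y := Num.sg (un n y) * `|un n y| `^ (q - 1).
  have mg : mfun g.
    apply: measurable_funM; last by apply/measurable_EFinP/measurable_powRn.
    rewrite (_ : (fun y => _) = fun y => (0 < un n y)%R%:R - (un n y < 0)%R%:R); last first.
      by apply/funext => y; case: (sgrP (un n y)) => h; rewrite ?ltxx ?h ?subrr ?subr0// ?ltNge ?(ltW h)/= ?sub0r.
    by apply: measurable_funB; apply: measurable_lt_nat.
  have gabs y : `|g y| = `|un n y| `^ (q - 1).
    rewrite /g normrM (ger0_norm (powR_ge0 _ _)) normr_sg.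
    have [->|h] := eqVneq (un n y) 0; last by rewrite mul1r.
    by rewrite normr0 powR0 ?mul0r// gt_eqF// subr_gt0.
  have gBB : test_fun g.
    apply: (bounded_test_fun hX (M := n.+1%:R `^ (q - 1))) => //.
      by move=> y; rewrite gabs; apply: ge0_ler_powR; rewrite ?nnegrE ?subr_ge0 ?(ltW q1).
    by exists point, n.+1%:R; split => // y h; rewrite /g /un S0// mulr0 sgr0 mul0r.
  have gq' : LP q' g by apply: gBB.2; exact: ltW.
  have Igq : Ip mu q' g = Ip mu q (un n).
    apply: eq_integral => y _; rewrite gabs -powRrM; congr (_ `^ _)%:E.
    by rewrite /q' mulrCA mulfV ?mulr1// gt_eqF// subr_gt0.
  have uE : \int[mu]_y (u y * g y) = NR q (un n) `^ q.
    apply: EFin_inj; rewrite -(IpE q_0 unq) /Rintegral.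
    have -> : (\int[mu]_y (u y * g y)%:E = Ip mu q (un n))%E.
      apply: eq_integral => y _; congr EFin; rewrite /g.
      have [Sy|Sy] := pselect (S n y); last first.
        have -> : un n y = 0 by rewrite /un indicE memNset// mulr0.
        by rewrite sgr0 mul0r mulr0 normr0 powR0// gt_eqF.
      have -> : u y = un n y by rewrite /un indicE mem_set// mulr1.
      by rewrite mulrA (mulrC (un n y)) -normrEsg mulr_powRB1.
    by rewrite fineK// (IpE q_0 unq).
  have := H g gBB; rewrite uE.
  have -> : NR q' g = NR q (un n) `^ (q - 1).
    apply: (powR_injr e3); rewrite ?nrm_ge0 ?powR_ge0//; apply: EFin_inj.
    rewrite -(IpE e3 gq') Igq (IpE q_0 unq) -powRrM; congr (_ `^ _)%:E.
    by rewrite /q' mulrCA mulfV ?mulr1// gt_eqF// subr_gt0.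
  rewrite (IpE q_0 unq) lee_fin; set N := NR q _; have N0 : 0 <= N := nrm_ge0 _ _ _.
  rewrite -{1}(mulr_powRB1 N0 q_0) => hN.
  have [->|NN] := eqVneq N 0; first by rewrite powR0 ?gt_eqF// powR_ge0.
  have Np : 0 < N by rewrite lt_neqAle eq_sym NN.
  apply: ge0_ler_powR; rewrite ?nnegrE ?(ltW q_0)//.
  by rewrite -(ler_pM2r (powR_gt0 (q - 1) Np)).
apply: LpP => //.
apply: (@fatou_le _ (borel X) _ mu (fun n y => (`|un n y| `^ q)%:E) (fun y => (`|u y| `^ q)%:E)) => //.
- by move=> n; exact: measurable_powRn.
- exact: (measurable_powRn q mu_).
apply: nearW => x; have [N HN] := cS x; apply: cvg_near_cst; exists N => // n /= /HN Snx.
by rewrite /un indicE mem_set// mulr1.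
Qed.

End calderon_zygmund_tools.

Section integrals.
Context (dd : measure_display) (T : measurableType dd) (R : realType) (mu : {measure set T -> \bar R}).

Lemma int1D (f g : T -> R) : Lp mu 1 f -> Lp mu 1 g -> \int[mu]_x (f x + g x) = \int[mu]_x f x + \int[mu]_x g x.
Proof. by move=> /Lp1P f1 /Lp1P g1; rewrite RintegralD. Qed.

Lemma int1B (f g : T -> R) : Lp mu 1 f -> Lp mu 1 g -> \int[mu]_x (f x - g x) = \int[mu]_x f x - \int[mu]_x g x.
Proof. by move=> /Lp1P f1 /Lp1P g1; rewrite RintegralB. Qed.

Lemma int1Z (f : T -> R) a : Lp mu 1 f -> \int[mu]_x (a * f x) = a * \int[mu]_x f x.
Proof. by move=> /Lp1P f1; rewrite RintegralZl. Qed.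

Lemma intC (f g : T -> R) : \int[mu]_x (f x * g x) = \int[mu]_x (g x * f x).
Proof. by apply: eq_Rintegral => x _; rewrite mulrC. Qed.

Lemma inv2D : (2 : R)^-1 + 2^-1 = 1. Proof. by field. Qed.

Lemma hoelder_L2 (f g : T -> R) : Lp mu 2 f -> Lp mu 2 g -> Lp mu 1 (fun x => f x * g x).
Proof. by move=> f2 g2; have [] := hoelder_Lp (ltr0Sn R 1) (ltr0Sn R 1) inv2D f2 g2. Qed.

Lemma measurable_sg (f : T -> R) : measurable_fun setT f -> measurable_fun setT (fun y => Num.sg (f y)).
Proof.
move=> mf; rewrite (_ : (fun y => _) = fun y => (0 < f y)%R%:R - (f y < 0)%R%:R); last first.
  by apply/funext => y; case: (sgrP (f y)) => h; rewrite ?ltxx ?h ?subrr ?subr0// ?ltNge ?(ltW h)/= ?sub0r.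
by apply: measurable_funB; apply: measurable_lt_nat.
Qed.

Lemma pair_cvg p q (u : nat -> T -> R) (w g : T -> R) : 1 <= p -> 0 < q -> p^-1 + q^-1 = 1 ->
  (forall n, Lp mu p (u n)) -> Lp mu p w -> Lp mu q g ->
  (forall e, 0 < e -> exists N, forall n, (N <= n)%N -> nrm mu p (fun x => u n x - w x) <= e) ->
  (\int[mu]_x (u n x * g x)) @[n --> \oo] --> \int[mu]_x (w x * g x).
Proof.
move=> p1 q0 pq up wp gq H; have p0 : 0 < p := lt_le_trans ltr01 p1.
apply/cvgrPdist_le => e e0; have n0 : 0 < nrm mu q g + 1 by rewrite ltr_wpDl ?nrm_ge0.
have [N HN] := H (e / (nrm mu q g + 1)) (divr_gt0 e0 n0).
exists N => // n /= /HN h.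
have [d1 _] := LpB p1 wp (up n).
rewrite -int1B; [|by have [] := hoelder_Lp p0 q0 pq wp gq|by have [] := hoelder_Lp p0 q0 pq (up n) gq].
under eq_Rintegral do rewrite -mulrBl.
apply: le_trans (hoelder_int p0 q0 pq d1 gq) _; rewrite nrm_subC.
apply: le_trans (ler_wpM2r (nrm_ge0 _ _ _) h) _.
rewrite -mulrA ger_pMr// mulrC ler_pdivrMr// mul1r; lra.
Qed.

End integrals.

(** * Boundedness on L^q of real Calderon-Zygmund operators *)

Section calderon_zygmund_operators.
Context (R : realType) (X : ptopologicalType) (d : X -> X -> R)
  (mu : {measure set (borel X) -> \bar R}) (c K : R) (hX : homogeneous_type d mu c K).
Context (q0 : R) (q0_gt1 : 1 < q0)
  (growth : forall x t j, 0 < t -> q0 ^+ j * mB d mu x t <= mB d mu x (c ^+ j * t)).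
Context (del : R) (del0 : 0 < del).
Context (A : R) (A1 : 1 <= A) (cutoff : forall x r, 0 < r -> exists phi, [/\ Lam d del phi,
   forall y, 0 <= phi y, forall y, qball d x r y -> phi y = 1 & forall y, ~ qball d x (A * r) y -> phi y = 0]).

Notation B := (qball d).
Notation mB := (mB d mu).
Notation mfun f := (measurable_fun setT (f : borel X -> _)).
Notation avg := (avg d mu).
Notation test_fun := (test_fun d mu).
Notation bsupp := (bsupp d).
Notation LP q f := (Lp mu q (f : borel X -> R)).
Notation NR q f := (nrm mu q (f : borel X -> R)).
Notation Ms := (Ms d mu).
Notation Lam := (Lam d del).

(* All that is used of the kernel, in a weak form which involves neither its joint measurability nor Fubini:
   [cz_tail] expresses its regularity (it bounds the oscillation on a ball of the image of a function supported
   away from this ball), [cz_decay] its size. *)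
Record czhalf (S : (X -> R) -> (X -> R)) : Prop := {
  cz_L2 : exists2 C, 0 <= C & forall f, LP 2 f -> LP 2 (S f) /\ NR 2 (S f) <= C * NR 2 f;
  cz_tail : exists C th : R, [/\ 0 <= C, 0 <= th < 1 & forall x r f T, 0 < r -> 0 <= T -> LP 2 f -> bsupp f ->
    (forall y, B x (c ^+ 2 * r) y -> f y = 0) ->
    (\sum_(0 <= j <oo) (th ^+ j)%:E * avg (fun y => `|f y|%:E) x (c ^+ j * r) <= T%:E)%E ->
    forall g g', LP 2 g -> LP 2 g' -> (forall y, ~ B x r y -> g y = 0) -> (forall y, ~ B x r y -> g' y = 0) ->
    `|(\int[mu]_y (S f y * g y)) * (\int[mu]_y g' y) - (\int[mu]_y (S f y * g' y)) * (\int[mu]_y g y)|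
       <= C * T * NR 1 g * NR 1 g'];
  cz_decay : exists2 C : R, 0 <= C & forall x r j f g, 0 < r -> (2 <= j)%N -> LP 2 f -> LP 2 g ->
    (forall y, ~ B x r y -> f y = 0) -> (forall y, ~ B x (c ^+ j.+1 * r) y -> g y = 0) ->
    (forall y, B x (c ^+ j * r) y -> g y = 0) ->
    `|\int[mu]_y (S f y * g y)| <= C / mB x (c ^+ j * r) * NR 1 f * NR 1 g }.

Record czpair (S S' : (X -> R) -> (X -> R)) : Prop := {
  cz_l : czhalf S;
  cz_r : czhalf S';
  cz_adj : forall f g, LP 2 f -> LP 2 g -> \int[mu]_y (S f y * g y) = \int[mu]_y (f y * S' g y) }.

Lemma czpair_sym S S' : czpair S S' -> czpair S' S.
Proof.
case=> h h' adj; split => // f g f2 g2.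
by rewrite intC -adj// intC.
Qed.

Lemma Lp_loc q f x r : 1 <= q -> 0 < r -> LP q f -> LP 1 (fun y => f y * \1_(B x r) y).
Proof.
move=> q1 r0 fq; have mBx := qball_measurable hX x r0.
move: q1; rewrite le_eqVlt => /predU1P[qE|q1]; first by rewrite -qE in fq; have [] := Lp_mulI ltr01 mBx fq.
have [e1 e2 e3] := dual_exp q1; have q_0 : 0 < q := lt_trans ltr01 q1.
have I1 : LP (q / (q - 1)) (\1_(B x r)) by apply: Lp_indic => //; rewrite (qball_mE hX)// ltry.
by have [] := hoelder_Lp q_0 e3 e2 fq I1.
Qed.

Lemma ball_integrable (f : X -> R) x r : 0 < r -> LP 1 (fun y => f y * \1_(B x r) y) -> mu.-integrable (B x r) (EFin \o f).
Proof.
move=> r0 /Lp1P h; have mBx := qball_measurable hX x r0; apply/(integrable_mkcond _ mBx).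
move: h; apply: eq_integrable => // y _.
by rewrite patchE /= indicE; case: ifP; rewrite ?mulr1 ?mulr0.
Qed.

Lemma ae_eq_Lam q (u v : X -> R) : 1 <= q -> LP q u -> LP q v ->
  (forall phi, Lam phi -> \int[mu]_y (u y * phi y) = \int[mu]_y (v y * phi y)) -> {ae mu, forall y, u y = v y}.
Proof.
move=> q1 uq vq H; have [w1 _] := LpB q1 uq vq.
have h : {ae mu, forall y, u y - v y = 0}.
  apply: (Lam_separates hX del0 A1 cutoff) => [|x r r0|phi lphi]; first by case: w1.
    by apply: ball_integrable => //; exact: Lp_loc w1.
  have [M HM] := Lam_bounded hX del0 lphi; have [[z [s [s0 hs]]] _] := Lam_test_fun hX del0 lphi.
  have mphi := Lam_measurable hX del0 lphi.
  have L1 (w : X -> R) : LP q w -> LP 1 (fun y => w y * phi y).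
    move=> wq; have [h _] := Lp_bdM ltr01 mphi HM (Lp_loc z q1 s0 wq).
    suff -> : (fun y => w y * phi y) = (fun y => phi y * (w y * \1_(B z s) y)) by [].
    apply/funext => y; rewrite indicE; have [Sy|Sy] := pselect (B z s y); first by rewrite mem_set// mulr1 mulrC.
    by rewrite hs// mulr0 mul0r.
  under eq_Rintegral do rewrite mulrBl.
  by rewrite int1B ?H ?subrr//; apply: L1.
by apply: (@filterS (borel X) _ (ae_filter_ringOfSetsType mu) _ _ _ h) => y /eqP; rewrite subr_eq0 => /eqP.
Qed.

Lemma avg_nrm (f : X -> R) x r : 0 < r -> LP 1 (fun y => f y * \1_(B x r) y) ->
  avg (fun y => `|f y|%:E) x r = ((mB x r)^-1 * NR 1 (fun y => f y * \1_(B x r) y))%:E.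
Proof.
move=> r0 f1; have mBx := qball_measurable hX x r0.
rewrite /avg EFinM; congr (_ * _)%E.
have := IpE ltr01 f1; rewrite powRr1 ?nrm_ge0// => <-.
rewrite integral_mkcond; apply: eq_integral => y _; rewrite patchE indicE powRr1//.
by case: ifP; rewrite ?mulr1// mulr0 normr0.
Qed.

Lemma avg_nrm_le t f x r : 1 <= t -> 0 < r -> LP t (fun z => f z * \1_(B x r) z) ->
  (avg (fun y => `|f y|%:E) x r <= (NR t (fun z => f z * \1_(B x r) z) * mB x r `^ (- t^-1))%:E)%E.
Proof.
move=> t1 r0 ft; have t0 : 0 < t := lt_le_trans ltr01 t1; have m0 := mB_gt0 hX x r0.
have mBx := qball_measurable hX x r0.
have h : LP 1 (fun y => f y * \1_(B x r) y) /\
   NR 1 (fun y => f y * \1_(B x r) y) <= NR t (fun y => f y * \1_(B x r) y) * mB x r `^ (1 - t^-1).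
  move: t1; rewrite le_eqVlt => /predU1P[tE|t1].
    by rewrite -tE in ft *; rewrite invr1 subrr powRr0 mulr1.
  have [e1 e2 e3] := dual_exp t1.
  have [i1 i2] := nrm_indic hX x 1 e3 r0.
  have [g1 g2] := hoelder_Lp t0 e3 e2 ft i1.
  rewrite i2 normr1 mul1r in g2; rewrite (_ : 1 - t^-1 = (t / (t - 1))^-1); last first.
    by apply/eqP; rewrite subr_eq addrC e2.
  have E : (fun y => f y * \1_(B x r) y * (1 * \1_(B x r) y)) = (fun y => f y * \1_(B x r) y); last by rewrite E in g1 g2.
  by apply/funext => y; rewrite indicE mul1r; case: (_ \in _); rewrite ?mulr1 ?mulr0.
case: h => h1 h2; rewrite avg_nrm// lee_fin ler_pdivrMl//; apply: (le_trans h2).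
rewrite mulrCA -[X in _ <= _ * (X * _)](powRr1 (ltW m0)) -powRD ?(gt_eqF m0) ?implybT//.
Qed.

Lemma maxf_le_Ms s f x r y : 1 <= s -> 0 < r -> B x r y -> LP s (fun z => f z * \1_(B x r) z) -> mfun f ->
  (avg (fun y => `|f y|%:E) x r <= Ms s f y)%E.
Proof.
move=> s1 r0 xy fs mf; have s0 : 0 < s := lt_le_trans ltr01 s1; have m0 := mB_gt0 hX x r0.
apply: le_trans (avg_nrm_le s1 r0 fs) _.
have N1 := nrm_ball_Ms hX s0 r0 xy fs mf; have M0 := Ms_ge0 d mu s f y.
move: N1; case: (Ms s f y) M0 => [m m1| |//]; last by move=> *; rewrite leey.
rewrite -EFinM !lee_fin => N1; apply: (le_trans (ler_wpM2r (powR_ge0 _ _) N1)).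
by rewrite mulrAC powRN mulfV ?mul1r// gt_eqF// powR_gt0.
Qed.

Lemma avg_ae_le (f g : X -> \bar R) x r : 0 < r -> mfun f -> mfun g -> (forall y, 0 <= f y)%E -> (forall y, 0 <= g y)%E ->
  {ae mu, forall y, (f y <= g y)%E} -> (avg f x r <= avg g x r)%E.
Proof.
move=> r0 mf mg f0 g0 fg; apply: lee_wpmul2l; first by rewrite lee_fin invr_ge0 ltW// (mB_gt0 hX).
apply: ae_ge0_le_integral => //; [exact: (qball_measurable hX)|exact: measurable_funTS|exact: measurable_funTS|].
by apply: (@filterS (borel X) _ (ae_filter_ringOfSetsType mu) _ _ _ fg) => y h _.
Qed.

Definition loc_mean (f : X -> R) x r : R := (mB x r)^-1 * \int[mu]_y (f y * \1_(B x r) y).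

(** In [cz_tail], [g'] is the indicator of the ball and [g] the sign of S f minus its mean there:
    the left-hand side becomes the measure of the ball times the L^1 norm of that difference. *)
Lemma tail_osc S : czhalf S -> exists C th : R, [/\ 0 <= C, 0 <= th < 1 &
  forall x r f T, 0 < r -> 0 <= T -> LP 2 f -> bsupp f -> (forall y, B x (c ^+ 2 * r) y -> f y = 0) ->
    (\sum_(0 <= j <oo) (th ^+ j)%:E * avg (fun y => `|f y|%:E) x (c ^+ j * r) <= T%:E)%E ->
    (avg (fun y => `|S f y - loc_mean (S f) x r|%:E) x r <= (C * T)%:E)%E].
Proof.
case=> [[C2 C20 HL] [C [th [C0 th1 H]]] _]; exists C, th; split => // x r f T r0 T0 f2 bf f0 fT.
have m0 := mB_gt0 hX x r0; have mBx := qball_measurable hX x r0.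
have [Sf2 _] := HL f f2; have mSf : mfun (S f) by case: Sf2.
set kap := loc_mean _ _ _.
have n20 : (0 : R) < 2 by [].
have [i1 i2] := nrm_indic hX x 1 n20 r0; have [j1 j2] := nrm_indic hX x 1 ltr01 r0.
rewrite normr1 mul1r invr1 powRr1 ?(ltW m0)// in j2.
pose v y := (S f y - kap) * \1_(B x r) y.
have L1 : LP 1 (fun y => S f y * \1_(B x r) y) by apply: (Lp_loc (q := 2)) => //; rewrite ler1n.
have I1 : LP 1 (\1_(B x r)) by apply: Lp_indic => //; rewrite (qball_mE hX)// ltry.
have vE : v = fun y => S f y * \1_(B x r) y - kap * \1_(B x r) y by apply/funext => y; rewrite /v mulrBl.
have [kI _] := LpZ kap ltr01 I1.
have v1 : LP 1 v by rewrite vE; have [] := LpB (lexx 1) L1 kI.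
have mv : mfun v by case: v1.
pose g y := Num.sg (v y) * (1 * \1_(B x r) y).
have gb y : `|Num.sg (v y)| <= 1 by rewrite normr_sg lern1; case: eqP.
have [g2 _] := Lp_bdM n20 (measurable_sg mv) gb i1.
have [g1 g1n] := Lp_bdM ltr01 (measurable_sg mv) gb j1.
rewrite mul1r j2 in g1n.
have := H x r f T r0 T0 f2 bf f0 fT g (fun y => 1 * \1_(B x r) y) g2 i1.
have off y : ~ B x r y -> 1 * \1_(B x r) y = 0 :> R by move=> h; rewrite indicE memNset// mulr0.
move=> /(_ _ off) h; have {}h := h (fun y hy => etrans (congr1 (fun z => _ * z) (off y hy)) (mulr0 _)).
have intI : \int[mu]_y (1 * \1_(B x r) y) = mB x r.
  by rewrite -j2 (nrm1E j1); apply: eq_Rintegral => y _; rewrite ger0_norm// mul1r indicE ler0n.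
rewrite intI in h.
have SI : \int[mu]_y (S f y * (1 * \1_(B x r) y)) = kap * mB x r.
  rewrite /kap /loc_mean mulrAC mulVf ?gt_eqF// mul1r; apply: eq_Rintegral => y _; by rewrite mul1r.
rewrite SI j2 in h.
have gE y : v y * g y = `|v y|.
  rewrite /g; have [Bxy|Bxy] := pselect (B x r y); last by rewrite /v indicE memNset// mulr0 mul0r normr0.
  by rewrite indicE mem_set// !mulr1 mulrC -normrEsg.
have key : (\int[mu]_y (S f y * g y)) * mB x r - kap * mB x r * (\int[mu]_y g y) = NR 1 v * mB x r.
  rewrite mulrAC -mulrBl -(int1Z _ g1); congr (_ * _); rewrite (nrm1E v1).
  rewrite -int1B; last 2 first.
  - by apply: hoelder_L2.
  - by have [] := LpZ kap ltr01 g1.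
  apply: eq_Rintegral => y _; rewrite -gE -mulrBl /v /g.
  by rewrite indicE; case: (_ \in _); rewrite ?mulr1// !mulr0.
rewrite key ger0_norm in h; last by rewrite mulr_ge0 ?nrm_ge0 ?(ltW m0).
have E : (fun y => `|S f y - kap|%:E) = fun y => `|(fun y => S f y - kap) y|%:E by [].
rewrite (avg_nrm (f := fun y => S f y - kap))//.
rewrite lee_fin ler_pdivrMl// mulrC -(ler_pM2r m0); apply: (le_trans h).
rewrite ler_wpM2r ?(ltW m0)//; apply: ler_wpM2l => //; first by rewrite mulr_ge0.
Qed.

(** Linearity is not a field of [czpair]: it follows, almost everywhere, from the adjunction tested
    against Hoelder functions. *)
Lemma cz_linear S S' : czpair S S' -> forall a f g, LP 2 f -> LP 2 g ->
  {ae mu, forall y, S (fun y => a * f y + g y) y = a * S f y + S g y}.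
Proof.
case=> [[[C C0 HL] _ _] [[C' C'0 HL'] _ _] adj] a f g f2 g2.
have n1 : (1 : R) <= 2 by rewrite ler1n.
have n2 : (0 : R) < 2 by [].
have lin (u v : X -> R) : LP 2 u -> LP 2 v -> LP 2 (fun y => a * u y + v y).
  by move=> u2 v2; have [] := LpD n1 (LpZ a n2 u2).1 v2.
have [[f2' _] [g2' _]] := (HL f f2, HL g g2).
apply: (ae_eq_Lam n1); [by have [] := HL _ (lin _ _ f2 g2)|exact: lin|] => phi lphi.
have p2 := Lam_Lp hX del0 n1 lphi; have [p2' _] := HL' _ p2.
have split_ (u v w : X -> R) : LP 2 u -> LP 2 v -> LP 2 w ->
    \int[mu]_y ((a * u y + v y) * w y) = a * \int[mu]_y (u y * w y) + \int[mu]_y (v y * w y).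
  move=> u2 v2 w2; have uw := hoelder_L2 u2 w2.
  rewrite -(int1Z _ uw) -int1D; [|by have [] := LpZ a ltr01 uw|exact: hoelder_L2].
  by apply: eq_Rintegral => y _; rewrite mulrDl mulrA.
by rewrite adj; [|exact: lin|exact: p2]; rewrite !split_// !adj.
Qed.

Definition bounded_on_test (S : (X -> R) -> (X -> R)) t C := forall f, test_fun f -> LP t (S f) /\ NR t (S f) <= C * NR t f.

Lemma test_fun_indic f (E : set X) : measurable (E : set (borel X)) -> test_fun f -> test_fun (fun y => f y * \1_E y).
Proof.
move=> mE [bf Lf]; split; first by apply: (bsupp_sub bf) => y ->; rewrite mul0r.
by move=> q q1; have [] := Lp_mulI (lt_le_trans ltr01 q1) mE (Lf q q1).
Qed.

(* [k] may not depend on [N], which will vary with the point of the ball: the sharp maximal inequality requires one constant per ball. *)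
Lemma local_osc S S' t C1 : czpair S S' -> 1 <= t -> 0 <= C1 -> bounded_on_test S t C1 -> exists2 C2, 0 < C2 &
  forall f x r, test_fun f -> 0 < r -> exists k, forall N, 0 <= N ->
  NR t (fun y => f y * \1_(B x (c ^+ 2 * r)) y) <= N * mB x r `^ t^-1 ->
  (forall j, (avg (fun y => `|f y|%:E) x (c ^+ j * r) <= (N * j.+1%:R)%:E)%E) ->
  (avg (fun y => `|S f y - k|%:E) x r <= (C2 * N)%:E)%E.
Proof.
move=> hS t1 C10 bS; have [C [th [C0 th1 H]]] := tail_osc (cz_l hS).
have [D D0 [z z1 Dz]] := poly_geometric ltr01 th1.
have z10 : 0 < 1 - z by rewrite subr_gt0; case/andP: z1.
have n1 : (1 : R) <= 2 by rewrite ler1n.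
have t0 : 0 < t := lt_le_trans ltr01 t1.
(* The first two terms bound the near and the far part of f; the 1 makes the constant positive. *)
exists (C1 + C * (D / (1 - z)) + 1); first by rewrite ltr_wpDl// addr_ge0// mulr_ge0// divr_ge0 ?ltW.
move=> f x r bf r0.
have mB2 := qball_measurable hX x (cX_gt0 hX 2 r0); have m0 := mB_gt0 hX x r0.
have mC2 : measurable (~` (B x (c ^+ 2 * r)) : set (borel X)) by exact: measurableC.
(* The near part is handled by boundedness on L^t, the far part by the regularity of the kernel, its
   averages growing at most linearly in [j]. *)
pose f1 y := f y * \1_(B x (c ^+ 2 * r)) y; pose f2 y := f y * \1_(~` (B x (c ^+ 2 * r))) y.
have b1 : test_fun f1 by exact: test_fun_indic.
have b2 : test_fun f2 by exact: test_fun_indic.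
exists (loc_mean (S f2) x r) => N N0 h1 h2; set k := loc_mean _ _ _.
have mf : mfun f by have [_ /(_ 1 (lexx _))[]] := bf.
have mf2 : mfun f2 by have [_ /(_ 1 (lexx _))[]] := b2.
have T0 : 0 <= N * (D / (1 - z)) by rewrite mulr_ge0// divr_ge0 ?ltW.
have avg2 : (avg (fun y => `|S f2 y - k|%:E) x r <= (C * (N * (D / (1 - z))))%:E)%E.
  apply: H => //; [exact: b2.2|exact: b2.1|by move=> y hy; rewrite /f2 indicE memNset ?mulr0//; apply|].
  apply: nneseries_le => [j|n].
    apply: mule_ge0; last by apply: (avg_ge0 hX) => //; exact: (cX_gt0 hX).
    by rewrite lee_fin exprn_ge0// (andP th1).1.
  apply: (@le_trans _ _ (\sum_(0 <= i < n) (N * (D * z ^+ i))%:E)%E); last first.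
    rewrite sumEFin lee_fin -!mulr_sumr; do 2 (apply: ler_wpM2l; rewrite ?(ltW D0)//).
    exact: geometric_sum_le.
  apply: lee_sum => j _.
  have hj : (avg (fun y => `|f2 y|%:E) x (c ^+ j * r) <= (N * j.+2%:R)%:E)%E.
    apply: (@le_trans _ _ (N * j.+1%:R)%:E); last by rewrite lee_fin ler_wpM2l// ler_nat.
    apply: le_trans (h2 j); apply: (avg_le hX) => //.
    - by apply/measurable_EFinP; exact: measurableT_comp.
    - by apply/measurable_EFinP; exact: measurableT_comp.
    - by move=> y; rewrite lee_fin /f2 normrM indicE ler_piMr//; case: (_ \in _); rewrite ?normr1// normr0.
    - exact: (cX_gt0 hX).
  apply: le_trans (lee_wpmul2l _ hj) _; first by rewrite lee_fin exprn_ge0// (andP th1).1.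
  by rewrite -EFinM lee_fin mulrCA ler_wpM2l// mulrC; have := Dz j; rewrite powRr1.
have [S1 S1n] := bS _ b1.
have S2 : LP 2 (S f2) by have [Cs _ HL] := cz_L2 (cz_l hS); have [] := HL _ (b2.2 2 n1).
have S0 : LP 2 (S f) by have [Cs _ HL] := cz_L2 (cz_l hS); have [] := HL _ (bf.2 2 n1).
have avg1 : (avg (fun y => `|S f1 y|%:E) x r <= (C1 * N)%:E)%E.
  have [l1 l2] := Lp_mulI t0 (qball_measurable hX x r0) S1.
  apply: le_trans (avg_nrm_le t1 r0 l1) _; rewrite lee_fin powRN ler_pdivrMr ?powR_gt0//.
  apply: (le_trans l2); apply: (le_trans S1n); rewrite -mulrA; exact: ler_wpM2l.
have mk (F : X -> R) a : mfun F -> mfun (fun y => `|F y - a|%:E) by exact: mfun_bmo.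
have m1 : mfun (fun y => `|S f1 y|%:E) by apply/measurable_EFinP; apply: measurableT_comp => //; case: S1.
apply: (@le_trans _ _ (avg (fun y => `|S f1 y|%:E + `|S f2 y - k|%:E)%E x r)).
  apply: avg_ae_le => //.
  - by apply: mk; case: S0.
  - by apply: emeasurable_funD => //; apply: mk; case: S2.
  - by move=> y; rewrite adde_ge0.
  have := cz_linear hS 1 (b1.2 2 n1) (b2.2 2 n1).
  have -> : (fun y => 1 * f1 y + f2 y) = f.
    apply/funext => y; rewrite /f1 /f2 mul1r -mulrDr !indicE in_setC.
    by case: (_ \in _); rewrite ?addr0 ?add0r mulr1.
  apply: (@filterS (borel X) _ (ae_filter_ringOfSetsType mu)) => y ->.
  by rewrite -EFinD lee_fin mul1r -addrA ler_normD.
rewrite (avgD hX)//; last by apply: mk; case: S2.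
apply: le_trans (leeD avg1 avg2) _; rewrite -EFinD lee_fin !mulrDl mul1r.
by rewrite -!mulrA (mulrC N) -!mulrA lerDl.
Qed.

Lemma powR_doubling t m n : 0 < t -> 0 < m -> n <= K ^+ 2 * m -> 1 <= t -> 0 < n -> n `^ t^-1 <= K ^+ 2 * m `^ t^-1.
Proof.
move=> t0 m0 h t1 n0; have K1 := K_gt1 hX; have K0 := K_gt0 hX.
have K2 : 1 <= K ^+ 2 by rewrite exprn_ege1// ltW.
apply: (@le_trans _ _ ((K ^+ 2 * m) `^ t^-1)).
  apply: ge0_ler_powR => //; rewrite ?nnegrE ?invr_ge0 ?(ltW t0) ?(ltW n0)//.
  by rewrite mulr_ge0 ?exprn_ge0 ?(ltW m0) ?(ltW K0).
rewrite powRM ?exprn_ge0 ?(ltW m0) ?(ltW K0)//; apply: ler_wpM2r; first exact: powR_ge0.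
rewrite -[leRHS]powRr1 ?exprn_ge0 ?(ltW K0)//; apply: ler_powR => //.
by rewrite invf_le1.
Qed.

Lemma mB_c2 x r : 0 < r -> mB x (c ^+ 2 * r) <= K ^+ 2 * mB x r.
Proof.
move=> r0; rewrite !expr2 -!mulrA; apply: (le_trans (mB_doubling hX x (cmul_gt0 hX r0))).
by rewrite ler_wpM2l ?(ltW (K_gt0 hX))// (mB_doubling hX).
Qed.

(** Boundedness on L^2 gives the local oscillation bound with t = 2, so the sharp function of S f is
    dominated by M_2 f, which is bounded on L^q exactly because q > 2. The a priori integrability of
    S f is the one in L^2. *)
Lemma cz_Lp_gt2 S S' q : czpair S S' -> 2 < q -> exists2 C, 0 <= C & bounded_on_test S q C.
Proof.
move=> hS q2; have n1 : (1 : R) <= 2 by rewrite ler1n.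
have n0 : (0 : R) < 2 by [].
have q_0 : 0 < q := lt_trans n0 q2.
have [C1 C10 HL] := cz_L2 (cz_l hS).
have b2 : bounded_on_test S 2 C1 by move=> f bf; exact: HL (bf.2 _ n1).
have [C2 C20 Hosc] := local_osc hS n1 C10 b2.
have [C3 C30 Hsh] := sharp_Lp hX q0_gt1 growth del0 A1 cutoff n1 q2.
have [C4 C40 HMs] : exists2 C : R, 0 < C & forall f, mfun f -> (\int[mu]_y (Ms 2 f y `^ q) <= C%:E * Ip mu q f)%E.
  by apply: (Ms_strong hX); rewrite n0.
have K0 := K_gt0 hX; have K20 : 0 < K ^+ 2 by rewrite exprn_gt0.
have k1 : 1 <= K ^+ 2 by rewrite exprn_ege1// ltW// (K_gt1 hX).
pose C5 := C2 * K ^+ 2; have C50 : 0 < C5 by rewrite mulr_gt0.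
pose C6 := C3 * (C5 `^ q * C4).
have C60 : 0 <= C6 by rewrite !mulr_ge0 ?powR_ge0// ltW.
exists (C6 `^ q^-1); first exact: powR_ge0.
move=> f bf; have mf : mfun f by have [_ /(_ 1 (lexx _))[]] := bf.
have [Sf2 _] := b2 f bf; have mSf : mfun (S f) by case: Sf2.
have q1 : 1 <= q by rewrite ltW// (lt_trans _ q2)// ltr1n.
have fq := bf.2 q q1.
apply: LpP => //; first by rewrite mulr_ge0 ?nrm_ge0 ?powR_ge0.
rewrite (powRM _ (powR_ge0 _ _) (nrm_ge0 _ _ _)) -powRrM mulVf ?gt_eqF// powRr1// EFinM -(IpE q_0 fq).
have mMs := measurable_Ms hX 2 f.
apply: le_trans (Hsh (S f) (fun y => (C5%:E * Ms 2 f y)%E) Sf2 _ _ _) _.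
- exact: measurable_funeM.
- by move=> y; rewrite mule_ge0 ?Ms_ge0// lee_fin ltW.
- move=> x r r0; have [k Hk] := Hosc f x r bf r0; exists k => y xy.
  have M0 := Ms_ge0 d mu 2 f y.
  have rj j := cX_gt0 hX j r0.
  have xj j : B x (c ^+ j * r) y.
    by apply: (qball_sub hX r0) xy; rewrite ler_peMl ?(ltW r0)// exprn_ege1// ltW// (c_gt1 hX).
  have fl j : LP 2 (fun z => f z * \1_(B x (c ^+ j * r)) z).
    by have [] := Lp_mulI n0 (qball_measurable hX x (rj j)) (bf.2 2 n1).
  have h1 := nrm_ball_Ms hX n0 (rj 2) (xj 2) (fl 2) mf.
  have h2 j := maxf_le_Ms n1 (rj j) (xj j) (fl j) mf.
  move: M0 h1 h2; case: (Ms 2 f y) => [M M0 h1 h2| |//]; last by move=> *; rewrite gt0_muley ?leey ?lte_fin.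
  rewrite -EFinM /C5 -mulrA; apply: Hk; first by rewrite mulr_ge0// ltW.
    rewrite -EFinM lee_fin in h1; apply: (le_trans h1).
    rewrite [leRHS]mulrAC; apply: ler_wpM2r => //.
    by apply: powR_doubling => //; rewrite ?(mB_gt0 hX)// mB_c2.
  move=> j; apply: (le_trans (h2 j)); rewrite lee_fin -[leLHS]mulr1.
  apply: ler_pM => //; last by rewrite ler1n.
  by rewrite ler_peMl.
rewrite (_ : C6%:E = C3%:E * ((C5 `^ q)%:E * C4%:E))%E; last by rewrite -!EFinM.
rewrite -!muleA; apply: lee_wpmul2l; first by rewrite lee_fin ltW.
have -> : (\int[mu]_y ((C5%:E * Ms 2 f y) `^ q) = (C5 `^ q)%:E * \int[mu]_y (Ms 2 f y `^ q))%E.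
  rewrite -ge0_integralZl//; last 3 first.
  - exact: (measurableT_comp (measurable_poweR _)).
  - by move=> y _; exact: poweR_ge0.
  - by rewrite lee_fin powR_ge0.
  by apply: eq_integral => y _; rewrite poweRM ?Ms_ge0 ?poweR_EFin// lee_fin ltW.
by apply: lee_wpmul2l; [rewrite lee_fin powR_ge0|exact: HMs].
Qed.

(** For q < 2 the dual exponent exceeds 2, where the transpose is bounded; [Lp_dual] brings the
    bound back to S. *)
Lemma cz_Lp S S' q : czpair S S' -> 1 < q -> exists2 C, 0 <= C & bounded_on_test S q C.
Proof.
move=> hS q1; have n1 : (1 : R) <= 2 by rewrite ler1n.
have [q2|q2|qE] := ltgtP 2 q; [exact: cz_Lp_gt2 hS q2| |].
  have [e1 e2 e3] := dual_exp q1; have q_0 : 0 < q := lt_trans ltr01 q1.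
  have q'2 : 2 < q / (q - 1) by rewrite ltr_pdivlMr ?subr_gt0//; lra.
  have [C C0 HC] := cz_Lp_gt2 (czpair_sym hS) q'2; exists C => // f bf.
  have [Cs _ HL] := cz_L2 (cz_l hS).
  apply: (Lp_dual hX) => //; [by have [[]] := HL f (bf.2 2 n1)|by rewrite mulr_ge0 ?nrm_ge0|].
  move=> g bg; rewrite (cz_adj hS) //; [|exact: (bf.2 2 n1)|exact: (bg.2 2 n1)]; have [g1 g2] := HC g bg.
  apply: le_trans (ler_norm _) _; apply: le_trans (hoelder_int q_0 e3 e2 (bf.2 q (ltW q1)) g1) _.
  by rewrite mulrC mulrAC; apply: ler_wpM2r => //; exact: nrm_ge0.
have [C C0 HL] := cz_L2 (cz_l hS); rewrite -qE; exists C => // f bf; exact: HL (bf.2 _ n1).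
Qed.

End calderon_zygmund_operators.

(** * Commutators *)

Section commutators.
Context (R : realType) (X : ptopologicalType) (d : X -> X -> R)
  (mu : {measure set (borel X) -> \bar R}) (c K : R) (hX : homogeneous_type d mu c K).
Context (q0 : R) (q0_gt1 : 1 < q0)
  (growth : forall x t j, 0 < t -> q0 ^+ j * mB d mu x t <= mB d mu x (c ^+ j * t)).
Context (del : R) (del0 : 0 < del).
Context (A : R) (A1 : 1 <= A) (cutoff : forall x r, 0 < r -> exists phi, [/\ Lam d del phi,
   forall y, 0 <= phi y, forall y, qball d x r y -> phi y = 1 & forall y, ~ qball d x (A * r) y -> phi y = 0]).

Notation B := (qball d).
Notation mB := (mB d mu).
Notation mfun f := (measurable_fun setT (f : borel X -> _)).
Notation avg := (avg d mu).
Notation test_fun := (test_fun d mu).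
Notation LP q f := (Lp mu q (f : borel X -> R)).
Notation NR q f := (nrm mu q (f : borel X -> R)).
Notation bmoR := (bmoR d mu).
Notation ball_avg := (ball_avg d mu).
Notation Ms := (Ms d mu).
Notation Lam := (Lam d del).

Notation czhalf := (czhalf d mu c).
Notation czpair := (czpair d mu c).
Notation bounded_on_test := (bounded_on_test d mu).

(** [cz_decay] is tested against the sign of S f on the subset of the shell where the bound fails:
    the excess of |S f| there has zero integral. *)
Lemma cz_pointwise S : czhalf S -> exists2 C, 0 <= C & forall x r f, 0 < r -> LP 2 f ->
  (forall y, ~ B x r y -> f y = 0) -> forall j, (2 <= j)%N ->
  {ae mu, forall y, B x (c ^+ j.+1 * r) y -> ~ B x (c ^+ j * r) y -> `|S f y| <= C / mB x (c ^+ j * r) * NR 1 f}.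
Proof.
case=> [[C2 C20 HL] _ [C C0 H]]; exists C => // x r f r0 f2 f0 j j2.
have rj i := cX_gt0 hX i r0; have mBj i := qball_measurable hX x (rj i).
have [Sf2 _] := HL f f2; have mSf : mfun (S f) by case: Sf2.
set t := _ * NR 1 f; have t0 : 0 <= t by rewrite mulr_ge0 ?nrm_ge0// divr_ge0// ltW// (mB_gt0 hX).
pose E : set (borel X) := (B x (c ^+ j.+1 * r) `\` B x (c ^+ j * r)) `&` [set y | t < `|S f y|].
have mE : measurable E.
  by apply: measurableI; [exact: measurableD|apply: measurable_set_lt => //; exact: measurableT_comp].
have fE : (mu E < +oo)%E.
  apply: (@le_lt_trans _ _ (mu (B x (c ^+ j.+1 * r)))); last by rewrite (qball_mE hX)// ltry.
  by apply: le_measure; rewrite ?inE// => y [[]].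
have n20 : (0 : R) < 2 by [].
have sb y : `|Num.sg (S f y)| <= 1 by rewrite normr_sg lern1; case: eqP.
have msg := measurable_sg mSf.
have I2 : LP 2 (\1_E) by exact: Lp_indic.
have I1 : LP 1 (\1_E) by exact: Lp_indic.
have [g2 _] := Lp_bdM n20 msg sb I2; have [g1 g1n] := Lp_bdM ltr01 msg sb I1.
have := H x r j f (fun y => Num.sg (S f y) * \1_E y) r0 j2 f2 g2 f0.
have off y : ~ E y -> \1_E y = 0 :> R by move=> h; rewrite indicE memNset.
move=> h; have {}h := h _ _.
have {}h : `|\int[mu]_y (S f y * (Num.sg (S f y) * \1_E y))| <= t * NR 1 (fun y => Num.sg (S f y) * \1_E y).
  by apply: h => y hy; rewrite off ?mulr0// => -[[]].
pose v y := (`|S f y| - t) * \1_E y.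
have SE : (fun y => S f y * (Num.sg (S f y) * \1_E y)) = fun y => `|S f y| * \1_E y.
  by apply/funext => y; rewrite mulrA (mulrC (S f y)) -normrEsg.
have S1 : LP 1 (fun y => `|S f y| * \1_E y) by rewrite -SE; exact: hoelder_L2.
have [tI _] := LpZ t ltr01 I1.
have v1 : LP 1 v.
  have [h1 _] := LpB (lexx 1) S1 tI.
  by rewrite (_ : v = fun y => `|S f y| * \1_E y - t * \1_E y)//; apply/funext => y; rewrite /v mulrBl.
have v0 y : 0 <= v y.
  have [Ey|Ey] := pselect (E y); last by rewrite /v off// mulr0.
  by rewrite /v indicE mem_set// mulr1 subr_ge0 ltW//; case: Ey.
have nv : NR 1 v = 0.
  apply/eqP; rewrite eq_le nrm_ge0 andbT (nrm1E v1).
  have -> : \int[mu]_y `|v y| = \int[mu]_y (`|S f y| * \1_E y) - t * \int[mu]_y \1_E y.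
    rewrite -(int1Z _ I1) -(int1B S1 tI); apply: eq_Rintegral => y _.
    by rewrite ger0_norm// /v mulrBl.
  rewrite -SE subr_le0; apply: (le_trans (ler_norm _)); apply: (le_trans h).
  apply: ler_wpM2l => //; apply: (le_trans g1n); rewrite mul1r (nrm1E I1).
  by rewrite (_ : \int[mu]_y `|\1_E y| = \int[mu]_y \1_E y)//; apply: eq_Rintegral => y _; rewrite ger0_norm// indicE.
apply: (@filterS (borel X) _ (ae_filter_ringOfSetsType mu) _ _ _ (nrm_eq0 ltr01 v1 nv)) => y vy b1 b2.
rewrite leNgt; apply/negP => ty; have : v y = `|S f y| - t by rewrite /v indicE mem_set ?mulr1.
by rewrite vy => /esym/eqP; rewrite subr_eq0 gt_eqF.
Qed.

(** The constant depends on b and on the ball: the lemma serves only to establish integrability,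
    never in a final estimate. *)
Lemma bmo_Lp_loc q b beta : 1 <= q -> 0 < beta -> bmoR beta b -> forall x r, 0 < r -> exists2 C, 0 <= C &
  forall j, LP q (fun y => b y * \1_(B x (c ^+ j * r)) y) /\
    NR q (fun y => b y * \1_(B x (c ^+ j * r)) y) <= C * j.+1%:R * mB x (c ^+ j * r) `^ q^-1.
Proof.
move=> q1 beta0 hb x r r0; have [C C0 H] := bmo_dilate hX q0_gt1 growth del0 A1 cutoff q1; have q_0 : 0 < q := lt_le_trans ltr01 q1.
exists (C * beta + `|ball_avg b x r|); first by rewrite addr_ge0// mulr_ge0// ltW.
move=> j; have [h1 h2] := H b beta beta0 hb x r j r0.
have [g1 g2] := nrm_indic hX x (ball_avg b x r) q_0 (cX_gt0 hX j r0).
have [k1 k2] := LpD q1 h1 g1.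
have E : (fun y => (b y - ball_avg b x r) * \1_(B x (c ^+ j * r)) y + ball_avg b x r * \1_(B x (c ^+ j * r)) y) =
   (fun y => b y * \1_(B x (c ^+ j * r)) y) by apply/funext => y; ring.
rewrite E in k1 k2; split => //; apply: (le_trans k2); apply: (le_trans (lerD h2 (lexx _))).
rewrite g2 -mulrDl; apply: ler_wpM2r; first exact: powR_ge0.
by rewrite mulrDl mulrAC lerD2l ler_peMr// ler1n.
Qed.

Lemma mulr_supp (u f : X -> R) x r : (forall y, ~ B x r y -> f y = 0) ->
  (fun y => u y * f y) = (fun y => (u y * \1_(B x r) y) * f y).
Proof.
move=> f0; apply/funext => y; have [h|h] := pselect (B x r y); first by rewrite indicE mem_set// mulr1.
by rewrite f0// !mulr0.
Qed.

(** On the support, b is in L^(2q) by John-Nirenberg and f in L^(2q) by definition, so the product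
    is in L^q for every q. *)
Lemma test_fun_bmo b beta f : 0 < beta -> bmoR beta b -> test_fun f -> test_fun (fun y => b y * f y).
Proof.
move=> beta0 hb bf; split; first by apply: (bsupp_sub bf.1) => y ->; rewrite mulr0.
move=> q q1; have [[x [r [r0 f0]]] Lf] := bf; rewrite (mulr_supp b f0).
have q_0 : 0 < q := lt_le_trans ltr01 q1.
have q2 : 1 <= 2 * q by rewrite (le_trans q1)// ler_peMl ?(ltW q_0)// ler1n.
have q20 : 0 < 2 * q by rewrite mulr_gt0.
have [C C0 H] := bmo_Lp_loc q2 beta0 hb x r0; have := (H 0%N).1; rewrite expr0 mul1r => b2.
have e : (2 * q)^-1 + (2 * q)^-1 = q^-1 by field; rewrite gt_eqF.
by have [] := hoelder_Lp_mul q20 q20 q_0 e b2 (Lf _ q2).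
Qed.

(** Near the support of f, Hoelder's inequality with exponents 2q. On the j-th shell, of outer
    measure comparable to m_j, |S f| is of order 1 / m_j and the norm of b of order j m_j^(1/q): the
    sum of j^q m_j^(1 - q) converges because m_j grows geometrically and q > 1. *)
Lemma cz_bmo_mul S S' q b beta f : czpair S S' -> 1 < q -> 0 < beta -> bmoR beta b -> test_fun f ->
  LP q (fun y => b y * S f y).
Proof.
move=> hS q1 beta0 hb bf; have [[x [r [r0 f0]]] Lf] := bf.
have q_0 : 0 < q := lt_trans ltr01 q1.
have n1 : (1 : R) <= 2 by rewrite ler1n.
have q2 : 1 < 2 * q by rewrite (lt_trans q1)// ltr_pMl// ltr1n.
have q20 : 0 < 2 * q by rewrite mulr_gt0.
have [Cp Cp0 HP] := cz_pointwise (cz_l hS).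
have [Cs _ HL] := cz_L2 (cz_l hS); have [Sf2 _] := HL f (Lf 2 n1); have mSf : mfun (S f) by case: Sf2.
have mb : mfun b by case: hb.
have mbS : mfun (fun y => b y * S f y) by exact: measurable_funM.
have rj j := cX_gt0 hX j r0; have mBj j := qball_measurable hX x (rj j).
pose m j := mB x (c ^+ j * r); have m0 j : 0 < m j by exact: (mB_gt0 hX).
have [Cb Cb0 Hb] := bmo_Lp_loc (ltW q1) beta0 hb x r0.
apply/LpIp => //; split => //.
pose F j : set (borel X) := B x (c ^+ j.+2 * r).
have mF j : measurable (F j) by exact: mBj.
have mDU j : measurable (seqDU F j) by exact: seqDU_measurable.
have UF : \bigcup_j seqDU F j = setT.
  rewrite -seqDU_bigcup_eq; apply/seteqP; split => // y _.
  have [j hj] := expr_unbounded (d x y / r) (c_gt1 hX); exists j => //.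
  rewrite /F /qball /=; apply: lt_le_trans (_ : c ^+ j * r <= _); first by rewrite -ltr_pdivrMr.
  by rewrite ler_wpM2r ?(ltW r0)//; apply: ler_weXn2l; [rewrite ltW// (c_gt1 hX)|rewrite -addn2 leq_addr].
have phi0 y : (0 <= (`|b y * S f y| `^ q)%:E)%E by rewrite lee_fin powR_ge0.
have mphi := measurable_powRn q mbS.
rewrite /Ip -UF ge0_integral_bigcup//; [|by rewrite UF].
(* The ratio by which m_j^(1 - q) decreases according to the growth condition. *)
pose s := q0 `^ (1 - q).
have s1 : 0 <= s < 1.
  rewrite powR_ge0/= /s -opprB powRN invf_lt1 ?powR_gt0 ?(lt_trans ltr01)//.
  by apply: powR_gt1; rewrite ?subr_gt0.
have [D D0 [z z1 Dz]] := poly_geometric q_0 s1.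
have z10 : 0 < 1 - z by rewrite subr_gt0; case/andP: z1.
have z0 : 0 <= z by case/andP: z1.
pose Q := (Cp * NR 1 f * Cb) `^ q * (K * m 0 `^ (1 - q)).
have Q0 : 0 <= Q by rewrite !mulr_ge0 ?powR_ge0// ltW// (K_gt0 hX).
have I0 : LP q (fun y => b y * S f y * \1_(F 0) y).
  have [Cl Cl0 Hl] := bmo_Lp_loc (ltW q2) beta0 hb x r0.
  have [C3 _ HS3] := cz_Lp hX q0_gt1 growth del0 A1 cutoff hS q2.
  have e : (2 * q)^-1 + (2 * q)^-1 = q^-1 by field; rewrite gt_eqF.
  have [h _] := hoelder_Lp_mul q20 q20 q_0 e (Hl 2).1 (HS3 f bf).1.
  by rewrite (_ : (fun y => _) = (fun y => b y * \1_(B x (c ^+ 2 * r)) y * S f y))//; apply/funext => y; rewrite mulrAC.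
have ann j : (\int[mu]_(y in seqDU F j.+1) (`|b y * S f y| `^ q)%:E <= (Q * (D * z ^+ j.+2))%:E)%E.
  pose a := Cp / m j.+2 * NR 1 f.
  have a0 : 0 <= a by rewrite mulr_ge0 ?nrm_ge0// divr_ge0// ltW.
  have [h1 h2] := Hb j.+3; have [g1 g2] := LpZ a q_0 h1.
  apply: (@le_trans _ _ (Ip mu q (fun y => a * (b y * \1_(B x (c ^+ j.+3 * r)) y)))).
    rewrite integral_mkcond; apply: ae_ge0_le_integral => //.
    - by move=> y _; rewrite patchE; case: ifP.
    - by apply/(measurable_restrictT _ (mDU _)); apply: measurable_funTS.
    - by apply: measurable_powRn; case: g1.
    apply: (@filterS (borel X) _ (ae_filter_ringOfSetsType mu) _ _ _ (HP x r f r0 (Lf 2 n1) f0 j.+2 isT)) => y hy _.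
    rewrite patchE; case: ifPn => [|_]; last by rewrite lee_fin powR_ge0.
    rewrite inE => -[Fy nF]; rewrite lee_fin; apply: ge0_ler_powR; rewrite ?nnegrE ?(ltW q_0)//.
    rewrite indicE mem_set// mulr1 (normrM (b y)) (normrM a) (ger0_norm a0) mulrC; apply: ler_wpM2r => //.
    apply: hy => // hFj; apply: nF; rewrite -bigcup_mkord; exists j => //=.
  rewrite (IpE q_0 g1) lee_fin g2 (ger0_norm a0).
  apply: (@le_trans _ _ ((a * (Cb * j.+4%:R * m j.+3 `^ q^-1)) `^ q)).
    have h3 := ler_wpM2l a0 h2.
    apply: ge0_ler_powR h3; rewrite ?nnegrE ?(ltW q_0)//; first exact: mulr_ge0 a0 (nrm_ge0 _ _ _).
    exact: mulr_ge0 a0 (mulr_ge0 (mulr_ge0 Cb0 (ler0n _ _)) (powR_ge0 _ _)).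
  have -> : a * (Cb * j.+4%:R * m j.+3 `^ q^-1) = (Cp * NR 1 f * Cb) * (j.+4%:R * ((m j.+2)^-1 * m j.+3 `^ q^-1)).
    by rewrite /a; ring.
  rewrite (powRM _ (x := Cp * NR 1 f * Cb)) ?mulr_ge0 ?nrm_ge0 ?invr_ge0 ?powR_ge0 ?(ltW (m0 _))//.
  rewrite /Q -!mulrA; apply: ler_wpM2l; first exact: powR_ge0.
  rewrite powRM ?mulr_ge0 ?nrm_ge0 ?invr_ge0 ?powR_ge0 ?(ltW (m0 _))//.
  rewrite powRM ?mulr_ge0 ?nrm_ge0 ?invr_ge0 ?powR_ge0 ?(ltW (m0 _))//.
  rewrite -powRrM mulVf ?gt_eqF// powRr1 ?(ltW (m0 _))//.
  have hm : (m j.+2)^-1 `^ q * m j.+3 <= K * (m 0 `^ (1 - q) * s ^+ j.+2).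
    have k3 : m j.+3 <= K * m j.+2 by rewrite /m exprS -mulrA (mB_doubling hX).
    apply: (le_trans (ler_wpM2l (powR_ge0 _ _) k3)); rewrite mulrCA; apply: ler_wpM2l; first by rewrite ltW// (K_gt0 hX).
    have gr : q0 ^+ j.+2 * m 0%N <= m j.+2 by rewrite /m expr0 mul1r growth.
    have qq0 : 0 < q0 := lt_trans ltr01 q0_gt1.
    rewrite powR_invl ?(ltW (m0 _))// -powRN -[X in _ * X](powRr1 (ltW (m0 _))) -powRD ?(gt_eqF (m0 _)) ?implybT//.
    rewrite /s -powR_mulrn ?powR_ge0// -powRrM mulrC -(mulrC j.+2%:R) powRrM powR_mulrn ?(ltW qq0)//.
    rewrite -powRM ?exprn_ge0 ?(ltW qq0) ?(ltW (m0 _))// addrC -opprB !powRN.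
    have qm0 : 0 < q0 ^+ j.+2 * m 0%N by exact: mulr_gt0 (exprn_gt0 _ qq0) (m0 _).
    rewrite lef_pV2 ?posrE ?powR_gt0//.
    apply: ge0_ler_powR gr; rewrite ?nnegrE ?subr_ge0; first exact: ltW.
      exact: mulr_ge0 (exprn_ge0 _ (ltW qq0)) (ltW (m0 _)).
    exact: ltW.
  apply: (le_trans (ler_wpM2l (powR_ge0 _ _) hm)); rewrite mulrCA; apply: ler_wpM2l; first by rewrite ltW// (K_gt0 hX).
  by rewrite mulrCA; apply: ler_wpM2l; [exact: powR_ge0|exact: Dz].
apply: (@le_lt_trans _ _ ((NR q (fun y => b y * S f y * \1_(F 0) y) `^ q + Q * (D / (1 - z)))%:E)); last by rewrite ltry.
apply: nneseries_le => [j|[|n]]; first by apply: integral_ge0.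
  by rewrite big_nil lee_fin addr_ge0 ?powR_ge0// mulr_ge0// divr_ge0 ?ltW.
rewrite big_nat_recl// EFinD; apply: leeD.
  rewrite -(IpE q_0 I0) integral_mkcond /Ip; apply: ge0_le_integral => //.
  - by move=> y _; rewrite patchE; case: ifP.
  - by apply/(measurable_restrictT _ (mDU _)); apply: measurable_funTS.
  - by apply: measurable_powRn; case: I0.
  move=> y _; rewrite patchE; case: ifPn => [|_]; last by rewrite lee_fin powR_ge0.
  by rewrite inE => -[Fy _]; rewrite indicE mem_set// mulr1.
apply: (@le_trans _ _ (\sum_(0 <= i < n) (Q * (D * z ^+ i))%:E)%E).
  apply: lee_sum => j _; apply: le_trans (ann j) _; rewrite lee_fin; do 2 (apply: ler_wpM2l; rewrite ?(ltW D0)//).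
  by rewrite !exprS mulrA ler_piMl ?exprn_ge0// mulr_ile1// ltW//; case/andP: z1.
rewrite sumEFin lee_fin -!mulr_sumr; do 2 (apply: ler_wpM2l; rewrite ?(ltW D0)//).
exact: geometric_sum_le.
Qed.

Lemma poweRD_le (p : R) (a b : \bar R) : 0 < p -> (0 <= a)%E -> (0 <= b)%E ->
  ((a + b) `^ p <= (2 `^ p)%:E * (a `^ p + b `^ p))%E.
Proof.
move=> p0; wlog ab : a b / (a <= b)%E => [H a0 b0|a0 b0].
  by have [ab|/ltW ba] := leP a b; [exact: H|rewrite addeC (addeC (a `^ p)%E); exact: H].
apply: (@le_trans _ _ ((2%:E * b) `^ p)%E).
  apply: gt0_ler_poweR; rewrite ?(ltW p0)// ?in_itv/= ?leey ?andbT.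
  - exact: adde_ge0.
  - by rewrite mule_ge0.
  - by rewrite mule_natl mule2n leeD2r.
rewrite poweRM// poweR_EFin; apply: lee_wpmul2l; first by rewrite lee_fin powR_ge0.
by rewrite leeDr// poweR_ge0.
Qed.

(** Hoelder's inequality on the dilated ball: the dual exponent falls on b minus its mean, where
    John-Nirenberg applies, and the exponent s on u. *)
Lemma avg_bmo_Ms (s : R) : 1 < s -> exists2 C, 0 < C & forall b beta u x r j y, 0 < beta -> bmoR beta b ->
  LP s u -> 0 < r -> B x (c ^+ j * r) y ->
  (avg (fun z => `|(b z - ball_avg b x r) * u z|%:E) x (c ^+ j * r) <= (C * beta * j.+1%:R)%:E * Ms s u y)%E.
Proof.
move=> s1; have [e1 e2 e3] := dual_exp s1; have s0 : 0 < s := lt_trans ltr01 s1.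
have [C C0 H] := bmo_dilate hX q0_gt1 growth del0 A1 cutoff (ltW e1); exists C => // b beta u x r j y beta0 hb us r0 xy.
have rj := cX_gt0 hX j r0; have m0 := mB_gt0 hX x rj; have mBj := qball_measurable hX x rj.
have [h1 h2] := H b beta beta0 hb x r j r0.
have [u1 u2] := Lp_mulI s0 mBj us.
have mu_ : mfun u by case: us.
have N1 := nrm_ball_Ms hX s0 rj xy u1 mu_; have M0 := Ms_ge0 d mu s u y.
have [g1 g2] := hoelder_Lp s0 e3 e2 u1 h1.
have E : (fun z => u z * \1_(B x (c ^+ j * r)) z * ((b z - ball_avg b x r) * \1_(B x (c ^+ j * r)) z)) =
   (fun z => (b z - ball_avg b x r) * u z * \1_(B x (c ^+ j * r)) z).
  by apply/funext => z; rewrite indicE; case: (_ \in _); rewrite ?mulr1 ?mulr0 // mulrC.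
rewrite E in g1 g2; rewrite (avg_nrm hX (f := fun z => (b z - ball_avg b x r) * u z))//.
have C1 : 0 < C * beta * j.+1%:R by rewrite !mulr_gt0.
move: N1; case: (Ms s u y) M0 => [M M0 N1| |//]; last by move=> *; rewrite gt0_muley ?leey ?lte_fin.
rewrite -EFinM lee_fin in N1; rewrite -EFinM lee_fin ler_pdivrMl//; apply: (le_trans g2).
apply: (le_trans (ler_pM (nrm_ge0 _ _ _) (nrm_ge0 _ _ _) N1 h2)).
rewrite le_eqVlt; apply/orP; left; apply/eqP.
have mE : mB x (c ^+ j * r) = mB x (c ^+ j * r) `^ s^-1 * mB x (c ^+ j * r) `^ (s / (s - 1))^-1.
  by rewrite -powRD ?(gt_eqF m0) ?implybT// e2 powRr1// ltW.
rewrite [X in _ = X * _]mE; ring.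
Qed.

(* On a ball [B], subtract [b_B] from [b]; with [s = t^2 < p] and [t > 1], Hoelder's inequality in L^t with exponents
   [t] and [t'] leaves [h] in L^s, and the oscillation is controlled by [Ms s h + Ms s (S h)]. *)
Lemma cz_commutator_test S S' p : czpair S S' -> 1 < p -> exists2 C, 0 < C & forall b beta h, 0 < beta -> bmoR beta b -> test_fun h ->
  LP p (fun y => S (fun z => b z * h z) y - b y * S h y) /\
  NR p (fun y => S (fun z => b z * h z) y - b y * S h y) <= C * beta * NR p h.
Proof.
move=> hS p1; have p0 : 0 < p := lt_trans ltr01 p1.
have i30 : (0 : R) < 3^-1 by rewrite invr_gt0.
(* With the cube root of p, s t = t^3 = p, so that 1 < t < s < p. *)
pose t := p `^ 3^-1; have t1 : 1 < t by exact: powR_gt1.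
pose s := t * t; have s1 : 1 < s by rewrite (lt_trans t1)// ltr_pMl// (lt_trans ltr01).
have t0 : 0 < t := lt_trans ltr01 t1; have s0 : 0 < s := lt_trans ltr01 s1.
have sp : s < p.
  have -> : p = s * t.
    rewrite /s /t -!powRD ?(gt_eqF p0) ?implybT// (_ : _ + _ = 1) ?powRr1 ?(ltW p0)//; by field.
  by rewrite ltr_pMr.
have tp : t < p by apply: lt_trans sp; rewrite ltr_pMl.
have [C1 C10 S1] := cz_Lp hX q0_gt1 growth del0 A1 cutoff hS t1.
have [C1s C1s0 S1s] := cz_Lp hX q0_gt1 growth del0 A1 cutoff hS s1.
have [C3 C30 S3] := cz_Lp hX q0_gt1 growth del0 A1 cutoff hS p1.
have [C2 C20 Hosc] := local_osc hX del0 A1 cutoff hS (ltW t1) C10 S1.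
have [Csh Csh0 Hsh] := sharp_Lp hX q0_gt1 growth del0 A1 cutoff (ltW t1) tp.
have [C5 C50 HMs] : exists2 C : R, 0 < C & forall f, mfun f -> (\int[mu]_y (Ms s f y `^ p) <= C%:E * Ip mu p f)%E.
  by apply: (Ms_strong hX); rewrite s0.
have [Cb2 Cb20 Hb2] := avg_bmo_Ms s1.
have [e1 e2 e3] := dual_exp t1.
(* The exponent for b in Hoelder's inequality: 1/s + 1/e = 1/t. *)
pose e := t * (t / (t - 1)).
have eE : s^-1 + e^-1 = t^-1 by rewrite /s /e !invfM -mulrDr -invfM e2 mulr1.
have ee1 : 1 <= e by rewrite ltW// (lt_trans t1)// ltr_pMr.
have e0 : 0 < e by rewrite (lt_le_trans ltr01).
have [Cb1 Cb10 Hb1] := bmo_dilate hX q0_gt1 growth del0 A1 cutoff ee1.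
have K0 := K_gt0 hX.
pose C6 := Cb1 * 3 * K ^+ 2 + Cb2.
have C60 : 0 < C6 by rewrite ltr_wpDl// !mulr_ge0 ?exprn_ge0// ltW.
pose C4 := C2 * C6 + Cb2; have C40 : 0 < C4 by rewrite addr_gt0// mulr_gt0.
pose C7 := Csh * (C4 `^ p * (2 `^ p * (C5 * (1 + C3 `^ p)))).
have C70 : 0 < C7 by rewrite !mulr_gt0 ?powR_gt0// ltr_pwDl// powR_ge0.
exists (C7 `^ p^-1); first by rewrite powR_gt0.
move=> b beta h beta0 hb bh; set w := fun y => _ - _.
have n1 : (1 : R) <= 2 by rewrite ler1n.
have bbh := test_fun_bmo beta0 hb bh.
have mh : mfun h by have [_ /(_ 1 (lexx _))[]] := bh.
have mb : mfun b by case: hb.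
(* Membership in L^t is the a priori integrability required by the sharp maximal inequality; no
   bound is kept from here. *)
have wq q : 1 < q -> LP q w.
  move=> q1; have [Cq _ Sq] := cz_Lp hX q0_gt1 growth del0 A1 cutoff hS q1.
  have [k1 _] := Sq _ bbh.
  by have [] := LpB (ltW q1) k1 (cz_bmo_mul hS q1 beta0 hb bh).
have wp := wq p p1; have wt := wq t t1.
have mw : mfun w by case: wt.
have hp := bh.2 p (ltW p1).
have [Shp Shpn] := S3 h bh; have [Shs _] := S1s h bh.
have mSh : mfun (S h) by case: Shp.
apply: LpP => //; first by rewrite !mulr_ge0 ?nrm_ge0 ?powR_ge0// ltW.
pose G y := ((C4 * beta)%:E * (Ms s h y + Ms s (S h) y))%E.
have mM f : mfun (Ms s f) := measurable_Ms hX s f.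
have C4b : 0 < C4 * beta by rewrite mulr_gt0.
have M0 f y : (0 <= Ms s f y)%E := Ms_ge0 d mu s f y.
apply: le_trans (Hsh w G wt _ _ _) _.
- by apply: measurable_funeM; exact: emeasurable_funD.
- by move=> y; rewrite mule_ge0 ?adde_ge0// lee_fin ltW.
- move=> x r r0; set a := ball_avg b x r.
  have m0 := mB_gt0 hX x r0; have rj j := cX_gt0 hX j r0.
  (* Written as a linear combination so that [cz_linear] applies; S f is then -a S h + S (b h)
     almost everywhere. *)
  pose f y := (- a) * h y + b y * h y.
  have fE : f = fun y => (b y - a) * h y by apply/funext => y; rewrite /f; ring.
  have bf : test_fun f.
    split; last by move=> q q1; have [] := LpD q1 (LpZ (- a) (lt_le_trans ltr01 q1) (bh.2 q q1)).1 (bbh.2 q q1).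
    by apply: (bsupp_sub bh.1) => y; rewrite fE => ->; rewrite mulr0.
  have mf : mfun f by have [_ /(_ 1 (lexx _))[]] := bf.
  have [k Hk] := Hosc f x r bf r0; exists k => y xy.
  have xj j : B x (c ^+ j * r) y.
    by apply: (qball_sub hX r0) xy; rewrite ler_peMl ?(ltW r0)// exprn_ege1// ltW// (c_gt1 hX).
  have G3 : (avg (fun z => `|(b z - a) * S h z|%:E) x r <= (Cb2 * beta)%:E * Ms s (S h) y)%E.
    have := Hb2 b beta (S h) x r 0%N y beta0 hb Shs r0 (xj 0%N).
    by rewrite expr0 mul1r mulr1.
  have G1 : (avg (fun z => `|S f z - k|%:E) x r <= (C2 * C6 * beta)%:E * Ms s h y)%E.
    have h2 j : (avg (fun z => `|f z|%:E) x (c ^+ j * r) <= (Cb2 * beta * j.+1%:R)%:E * Ms s h y)%E.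
      by rewrite fE; exact: Hb2 (bh.2 s (ltW s1)) r0 (xj j).
    have [u1 u2] := Lp_mulI s0 (qball_measurable hX x (rj 2%N)) (bh.2 s (ltW s1)).
    have h3 := nrm_ball_Ms hX s0 (rj 2%N) (xj 2%N) u1 mh.
    have [v1 v2] := Hb1 b beta beta0 hb x r 2%N r0.
    have [_ h1] := hoelder_Lp_mul s0 e0 t0 eE u1 v1.
    have E : (fun z => h z * \1_(B x (c ^+ 2 * r)) z * ((b z - ball_avg b x r) * \1_(B x (c ^+ 2 * r)) z)) =
       (fun z => f z * \1_(B x (c ^+ 2 * r)) z).
      by apply/funext => z; rewrite fE indicE; case: (_ \in _); rewrite ?mulr1 ?mulr0 // mulrC.
    rewrite E in h1; have cc : 0 < C2 * C6 * beta by rewrite !mulr_gt0.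
    move: (M0 h y) h2 h3; case: (Ms s h y) => [M Mp h2 h3| |//]; last by move=> *; rewrite gt0_muley ?leey ?lte_fin.
    rewrite lee_fin in Mp.
    rewrite -EFinM -!mulrA; apply: Hk; first by rewrite !mulr_ge0// ltW.
      apply: (le_trans h1); rewrite -EFinM lee_fin in h3.
      apply: (le_trans (ler_pM (nrm_ge0 _ _ _) (nrm_ge0 _ _ _) h3 v2)).
      set m2 := mB x (c ^+ 2 * r).
      have m20 : 0 < m2 by exact: (mB_gt0 hX).
      have -> : m2 `^ s^-1 * M * (Cb1 * 3 * beta * m2 `^ e^-1) = Cb1 * 3 * (beta * M) * m2 `^ t^-1.
        by rewrite -eE powRD; [ring|rewrite (gt_eqF m20) implybT].
      apply: (@le_trans _ _ (Cb1 * 3 * (beta * M) * (K ^+ 2 * mB x r `^ t^-1))).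
        apply: ler_wpM2l; first by rewrite !mulr_ge0// ltW.
        by apply: (powR_doubling hX) => //; [exact: (mB_c2 hX)|exact: ltW].
      rewrite [leLHS]mulrA; apply: ler_wpM2r; first exact: powR_ge0.
      rewrite [leLHS]mulrAC; apply: ler_wpM2r; first by rewrite mulr_ge0// ltW.
      by rewrite /C6 lerDl ltW.
    move=> j; apply: (le_trans (h2 j)); rewrite -EFinM lee_fin mulrAC; apply: ler_wpM2r => //.
    rewrite -!mulrA; apply: ler_wpM2r; first by rewrite mulr_ge0// ltW.
    by rewrite /C6 lerDr !mulr_ge0 ?exprn_ge0 ?ltW.
  have Sf2 : LP 2 (S f) by have [Cs _ HL] := cz_L2 (cz_l hS); have [] := HL _ (bf.2 2 n1).
  have mSf : mfun (S f) by case: Sf2.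
  have mk (F : X -> R) z : mfun F -> mfun (fun y => `|F y - z|%:E) by exact: mfun_bmo.
  have m3 : mfun (fun z => `|(b z - a) * S h z|%:E).
    by apply/measurable_EFinP; apply: measurableT_comp => //; apply: measurable_funM => //; apply: measurable_funB.
  apply: (@le_trans _ _ (avg (fun z => `|S f z - k|%:E + `|(b z - a) * S h z|%:E)%E x r)).
    apply: (avg_ae_le hX) => //; [exact: mk|by apply: emeasurable_funD => //; exact: mk|by move=> z; rewrite adde_ge0|].
    (* The commutator does not change when b is replaced by b - a: w - k = (S f - k) - (b - a) S
       h. *)
    have := cz_linear hX del0 A1 cutoff hS (- a) (bh.2 2 n1) (bbh.2 2 n1).
    apply: (@filterS (borel X) _ (ae_filter_ringOfSetsType mu)) => z hz.
    rewrite -EFinD lee_fin (_ : w z - k = (S f z - k) - (b z - a) * S h z) ?ler_normB//.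
    by rewrite /w /f hz; ring.
  rewrite (avgD hX)//; last exact: mk.
  apply: le_trans (leeD G1 G3) _; rewrite /G ge0_muleDr//; apply: leeD; apply: lee_wpmul2r => //; rewrite lee_fin.
    by rewrite ler_wpM2r ?(ltW beta0)// /C4 lerDl ltW.
  by rewrite ler_wpM2r ?(ltW beta0)// /C4 lerDr mulr_ge0// ltW.
have nn0 : 0 <= NR p h := nrm_ge0 _ _ _.
have int1 : (\int[mu]_y (G y `^ p) <= ((C4 * beta) `^ p * 2 `^ p)%:E * (\int[mu]_y (Ms s h y `^ p) + \int[mu]_y (Ms s (S h) y `^ p)))%E.
  have mp f : mfun (fun y => (Ms s f y `^ p)%E) by exact: (measurableT_comp (measurable_poweR _)).
  rewrite -ge0_integralD//; [|by move=> *; exact: poweR_ge0..].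
  rewrite -ge0_integralZl//; last 3 first.
  - exact: emeasurable_funD.
  - by move=> y _; rewrite adde_ge0// poweR_ge0.
  - by rewrite lee_fin mulr_ge0// powR_ge0.
  apply: ge0_le_integral => //.
  - by move=> y _; exact: poweR_ge0.
  - by apply: (measurableT_comp (measurable_poweR _)); apply: measurable_funeM; exact: emeasurable_funD.
  - by apply: measurable_funeM; exact: emeasurable_funD.
  move=> y _; rewrite /G poweRM ?adde_ge0//; last by rewrite lee_fin ltW.
  rewrite poweR_EFin EFinM -muleA; apply: lee_wpmul2l; first by rewrite lee_fin powR_ge0.
  exact: poweRD_le.
have int2 : (\int[mu]_y (Ms s h y `^ p) + \int[mu]_y (Ms s (S h) y `^ p) <= (C5 * (1 + C3 `^ p) * NR p h `^ p)%:E)%E.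
  apply: (le_trans (leeD (HMs h mh) (HMs (S h) mSh))).
  rewrite (IpE p0 hp) (IpE p0 Shp) -!EFinM -EFinD lee_fin mulrDr mulr1 mulrDl lerD2l -mulrA.
  apply: ler_wpM2l; first exact: ltW.
  by rewrite -powRM//; apply: ge0_ler_powR => //; rewrite ?nnegrE ?(ltW p0) ?nrm_ge0 ?mulr_ge0.
apply: le_trans (lee_wpmul2l _ int1) _; first by rewrite lee_fin ltW.
apply: le_trans (lee_wpmul2l _ (lee_wpmul2l _ int2)) _; first by rewrite lee_fin ltW.
  by rewrite lee_fin mulr_ge0 ?powR_ge0.
rewrite -!EFinM lee_fin le_eqVlt; apply/orP; left; apply/eqP.
have -> : (C7 `^ p^-1 * beta * NR p h) `^ p = C7 * beta `^ p * NR p h `^ p.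
  rewrite powRM ?mulr_ge0 ?powR_ge0 ?(ltW beta0)// powRM ?powR_ge0 ?(ltW beta0)//.
  by rewrite -powRrM mulVf ?gt_eqF// powRr1// ltW.
by rewrite (powRM _ (ltW C40) (ltW beta0)) /C7; ring.
Qed.

Definition cvgLp p (u : nat -> X -> R) (w : X -> R) :=
  forall e, 0 < e -> exists N, forall n, (N <= n)%N -> NR p (fun x => u n x - w x) <= e.

Lemma test_fun_approx p h : 1 <= p -> LP p h -> exists2 hn, forall n, test_fun (hn n) & cvgLp p hn h.
Proof.
move=> p1 hp.
have /choice[hn H] n : exists g, test_fun g /\ NR p (fun y => h y - g y) <= n.+1%:R^-1.
  have n0 : (0 : R) < n.+1%:R^-1 by rewrite invr_gt0.
  by have [M [E [_ _ _ bE [_ nE]]]] := test_fun_cut hX p1 hp n0; exists (fun y => h y * \1_E y).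
exists hn => [n|e e0]; first by case: (H n).
exists (Num.bound e^-1) => n nN; rewrite nrm_subC; apply: (le_trans (H n).2).
rewrite -[e]invrK lef_pV2 ?posrE ?invr_gt0//; apply: (@le_trans _ _ (Num.bound e^-1)%:R).
  by apply/ltW/archi_boundP; rewrite invr_ge0 ltW.
by rewrite ler_nat ltnW.
Qed.

Lemma test_fun_sub f g : test_fun f -> test_fun g -> test_fun (fun y => f y - g y).
Proof.
move=> [bf Lf] [bg Lg]; split; last by move=> q q1; have [] := LpB q1 (Lf q q1) (Lg q q1).
by apply: (bsuppD hX bf (g := fun y => - g y)); apply: (bsupp_sub bg) => y ->; rewrite oppr0.
Qed.

(** Applied both to S and to its commutator with b, neither of which is linear except up to null
    sets. *)
Lemma test_fun_extend (L : (X -> R) -> X -> R) (C p : R) hn h : 1 <= p -> 0 <= C -> bounded_on_test L p C ->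
  (forall f g, test_fun f -> test_fun g -> {ae mu, forall y, L (fun z => f z - g z) y = L f y - L g y}) ->
  (forall n, test_fun (hn n)) -> LP p h -> cvgLp p hn h ->
  exists v, [/\ LP p v, NR p v <= C * NR p h & cvgLp p (fun n => L (hn n)) v].
Proof.
move=> p1 C0 bL addL bn hp cv; have p0 : 0 < p := lt_le_trans ltr01 p1.
have Lhn n := (bL _ (bn n)).1.
have cauchy e : 0 < e -> exists N, forall n m, (N <= n)%N -> (N <= m)%N -> NR p (fun x => L (hn n) x - L (hn m) x) <= e.
  move=> e0; have C1 : 0 < C + 1 by rewrite ltr_wpDl.
  have [N HN] := cv (e / (C + 1) / 2) (divr_gt0 (divr_gt0 e0 C1) (ltr0Sn R 1)).
  exists N => n m nN mN; have bnm := test_fun_sub (bn n) (bn m).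
  have [l1 l2] := bL _ bnm; have [s1 _] := LpB p1 (Lhn n) (Lhn m).
  rewrite -(nrm_ae_eq p0 s1 l1.1 (addL _ _ (bn n) (bn m))).2; apply: (le_trans l2).
  have := nrm_triangle p1 ((bn n).2 p p1) hp ((bn m).2 p p1); rewrite [X in _ + X]nrm_subC.
  have := HN n nN; have := HN m mN; set a := NR p _; set b := NR p _; set d_ := NR p _ => h1 h2 h3.
  have h4 : d_ <= e / (C + 1) by apply: (le_trans h3); rewrite [leRHS]splitr; exact: lerD.
  apply: (le_trans (ler_wpM2l C0 h4)); rewrite mulrCA ger_pMr// ler_pdivrMr// mul1r; lra.
have [v vp cvv] := Lp_complete p1 Lhn cauchy; exists v; split => //.
apply/ler_addgt0Pr => e e0; have C1 : 0 < C + 1 by rewrite ltr_wpDl.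
have e'0 : 0 < e / (C + 1) by exact: divr_gt0.
have [N1 H1] := cv _ e'0; have [N2 H2] := cvv _ e'0.
pose n := maxn N1 N2; have {}H1 := H1 n (leq_maxl _ _); have {}H2 := H2 n (leq_maxr _ _).
have [d1 _] := LpB p1 vp (Lhn n); have [_ t1] := LpD p1 d1 (Lhn n).
have [d2 _] := LpB p1 ((bn n).2 p p1) hp; have [_ t2] := LpD p1 d2 hp.
have E1 : (fun x => v x - L (hn n) x + L (hn n) x) = v by apply/funext => x; rewrite subrK.
have E2 : (fun x => hn n x - h x + h x) = hn n by apply/funext => x; rewrite subrK.
rewrite E1 nrm_subC in t1; rewrite E2 in t2; apply: (le_trans t1).
apply: (le_trans (lerD H2 (bL _ (bn n)).2)).
apply: (le_trans (lerD (lexx _) (ler_wpM2l C0 (le_trans t2 (lerD H1 (lexx _)))))).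
rewrite mulrDr addrA addrC lerD2l -[X in X + _]mul1r -mulrDl addrC.
by rewrite mulrCA mulfV ?mulr1// gt_eqF.
Qed.

Lemma cz_sub S S' f g : czpair S S' -> LP 2 f -> LP 2 g ->
  {ae mu, forall y, S (fun z => f z - g z) y = S f y - S g y}.
Proof.
move=> hS f2 g2; have := cz_linear hX del0 A1 cutoff hS (-1) g2 f2.
apply: (@filterS (borel X) _ (ae_filter_ringOfSetsType mu)) => y.
rewrite (_ : (fun z => -1 * g z + f z) = fun z => f z - g z) => [->|]; first by ring.
by apply/funext => z; ring.
Qed.

(** [v] extends S to h, and [w] extends the commutator. The last identity is the weak form of S (b
    h) = w + b v: it is obtained for test functions and passed to the limit, all factors that
    multiply h or v being in the dual space. *)
Lemma cz_extension S S' p : czpair S S' -> 1 < p -> exists2 C, 0 < C & forall h, LP p h -> exists v,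
  [/\ LP p v, NR p v <= C * NR p h,
   forall phi, test_fun phi -> \int[mu]_y (v y * phi y) = \int[mu]_y (h y * S' phi y) &
   forall b beta, 0 < beta -> bmoR beta b -> exists w, [/\ LP p w, NR p w <= C * beta * NR p h &
     forall phi, test_fun phi -> [/\ LP 1 (fun y => b y * h y * S' phi y), LP 1 (fun y => b y * v y * phi y) &
       \int[mu]_y (w y * phi y) = \int[mu]_y (b y * h y * S' phi y) - \int[mu]_y (b y * v y * phi y)]]].
Proof.
move=> hS p1; have [e1 e2 e3] := dual_exp p1; have p0 : 0 < p := lt_trans ltr01 p1.
have n1 : (1 : R) <= 2 by rewrite ler1n.
have [C1 C10 S1] := cz_Lp hX q0_gt1 growth del0 A1 cutoff hS p1.
have [C2 C20 Hc] := cz_commutator_test hS p1.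
have [C3 C30 S3] := cz_Lp hX q0_gt1 growth del0 A1 cutoff (czpair_sym hS) e1.
exists (C1 + C2); first by rewrite ltr_wpDl.
move=> h hp; have [hn bn cvh] := test_fun_approx (ltW p1) hp.
have [v [vp vn cvv]] := test_fun_extend (ltW p1) C10 S1 (fun f g bf bg => cz_sub hS (bf.2 2 n1) (bg.2 2 n1)) bn hp cvh.
exists v; split => //.
- by apply: (le_trans vn); rewrite ler_wpM2r ?nrm_ge0// lerDl ltW.
- move=> phi bphi; have pq := bphi.2 _ (ltW e1).
  apply: (@cvg_unique _ (@Rhausdorff R) _ _ _ _ (pair_cvg (ltW p1) e3 e2 (fun n => (S1 _ (bn n)).1) vp pq cvv)).
  have := pair_cvg (ltW p1) e3 e2 (fun n => (bn n).2 p (ltW p1)) hp (S3 _ bphi).1 cvh.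
  by under eq_fun do rewrite -(cz_adj hS ((bn _).2 2 n1) (bphi.2 2 n1)).
move=> b beta beta0 hb; have Cb0 : 0 <= C2 * beta by rewrite mulr_ge0 ?ltW.
pose L f y := S (fun z => b z * f z) y - b y * S f y.
have addL f g : test_fun f -> test_fun g -> {ae mu, forall y, L (fun z => f z - g z) y = L f y - L g y}.
  move=> bf bg; have a1 := cz_sub hS (bf.2 2 n1) (bg.2 2 n1).
  have a2 := cz_sub hS ((test_fun_bmo beta0 hb bf).2 2 n1) ((test_fun_bmo beta0 hb bg).2 2 n1).
  apply: (@filterS2 (borel X) _ (ae_filter_ringOfSetsType mu) _ _ _ _ a1 a2) => y h1 h2.
  rewrite /L h1 (_ : (fun z => b z * (f z - g z)) = fun z => b z * f z - b z * g z) ?h2; first by ring.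
  by apply/funext => z; ring.
have [w [wp wn cvw]] := test_fun_extend (ltW p1) Cb0 (fun f bf => Hc b beta f beta0 hb bf) addL bn hp cvh.
exists w; split => //.
  by apply: (le_trans wn); rewrite !ler_wpM2r ?nrm_ge0 ?(ltW beta0)// lerDr.
move=> phi bphi; have pq := bphi.2 _ (ltW e1).
have bphi' := test_fun_bmo beta0 hb bphi; have bpq := bphi'.2 _ (ltW e1).
have bSq := cz_bmo_mul (czpair_sym hS) e1 beta0 hb bphi.
have E1 f : (fun y => b y * f y * S' phi y) = (fun y => f y * (b y * S' phi y)) by apply/funext => y; ring.
have E2 f : (fun y => b y * f y * phi y) = (fun y => f y * (b y * phi y)) by apply/funext => y; ring.
rewrite E1 E2; split; [by have [] := hoelder_Lp p0 e3 e2 hp bSq|by have [] := hoelder_Lp p0 e3 e2 vp bpq|].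
apply: (@cvg_unique _ (@Rhausdorff R) _ _ _ _ (pair_cvg (ltW p1) e3 e2 (fun n => (Hc b beta _ beta0 hb (bn n)).1) wp pq cvw)).
have c1 := pair_cvg (ltW p1) e3 e2 (fun n => (bn n).2 p (ltW p1)) hp bSq cvh.
have c2 := pair_cvg (ltW p1) e3 e2 (fun n => (S1 _ (bn n)).1) vp bpq cvv.
suff <- : (fun n => \int[mu]_y (hn n y * (b y * S' phi y)) - \int[mu]_y (S (hn n) y * (b y * phi y))) =
   (fun n => \int[mu]_y (L (hn n) y * phi y)) by exact: cvgB.
apply/funext => n; have bbn := test_fun_bmo beta0 hb (bn n); have [Cs _ HL] := cz_L2 (cz_l hS).
have i1 := hoelder_L2 (HL _ (bbn.2 2 n1)).1 (bphi.2 2 n1).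
have i2 := hoelder_L2 (HL _ ((bn n).2 2 n1)).1 (bphi'.2 2 n1).
rewrite -E1 -(cz_adj hS (bbn.2 2 n1) (bphi.2 2 n1)) -(int1B i1 i2).
by apply: eq_Rintegral => y _; rewrite /L; ring.
Qed.

End commutators.

(** * Operators with a standard kernel *)

Section riesz.
Context (dd : measure_display) (T : measurableType dd) (R : realType) (mu : {measure set T -> \bar R}).
Notation LP2 f := (Lp mu 2 f).
Notation N2 f := (nrm mu 2 f).

Definition ip (f g : T -> R) := \int[mu]_x (f x * g x).

Lemma le12 : (1 : R) <= 2. Proof. by rewrite ler1n. Qed.
Lemma lt02 : (0 : R) < 2. Proof. by []. Qed.

Lemma ip_nrm f : LP2 f -> ip f f = N2 f ^+ 2.
Proof.
move=> f2; apply: EFin_inj; rewrite -powR_mulrn ?nrm_ge0// -(IpE lt02 f2) /ip /Rintegral.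
have E : (\int[mu]_x (f x * f x)%:E = Ip mu 2 f)%E.
  by apply: eq_integral => x _; rewrite powR_mulrn// -normrX ger0_norm ?sqr_ge0.
by rewrite fineK E// (IpE lt02 f2).
Qed.

Lemma ip_le f g : LP2 f -> LP2 g -> `|ip f g| <= N2 f * N2 g.
Proof. exact: hoelder_int lt02 lt02 (inv2D R). Qed.

Lemma L2lin f g (a b : R) : LP2 f -> LP2 g -> LP2 (fun x => a * f x + b * g x).
Proof. by move=> f2 g2; have [] := LpD le12 (LpZ a lt02 f2).1 (LpZ b lt02 g2).1. Qed.

Lemma ip_lin f g h (a b : R) : LP2 f -> LP2 g -> LP2 h ->
  ip (fun x => a * f x + b * g x) h = a * ip f h + b * ip g h.
Proof.
move=> f2 g2 h2; have i1 := hoelder_L2 f2 h2; have i2 := hoelder_L2 g2 h2.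
rewrite /ip -(int1Z _ i1) -(int1Z _ i2) -int1D.
- by apply: eq_Rintegral => x _; ring.
- by have [] := LpZ a ltr01 i1.
- by have [] := LpZ b ltr01 i2.
Qed.

Lemma ipC f g : ip f g = ip g f. Proof. exact: intC. Qed.

Lemma ip_sq f g (a b : R) : LP2 f -> LP2 g ->
  ip (fun x => a * f x + b * g x) (fun x => a * f x + b * g x) =
  a ^+ 2 * ip f f + 2 * (a * b) * ip f g + b ^+ 2 * ip g g.
Proof.
move=> f2 g2; have s2 := L2lin a b f2 g2.
by rewrite ip_lin// (ipC f) (ipC g) !ip_lin// (ipC g f); ring.
Qed.

(* [u] is the limit of a minimizing sequence of |v|^2 - 2 l(v) on [V]: no density or closedness of [V] is needed. *)
Lemma riesz (V : (T -> R) -> Prop) (l : (T -> R) -> R) (M : R) : V (fun=> 0) -> (forall f, V f -> LP2 f) ->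
  (forall a b f g, V f -> V g -> V (fun x => a * f x + b * g x)) ->
  (forall a b f g, V f -> V g -> l (fun x => a * f x + b * g x) = a * l f + b * l g) ->
  0 <= M -> (forall f, V f -> `|l f| <= M * N2 f) ->
  exists u, [/\ LP2 u, N2 u <= M & forall f, V f -> l f = ip u f].
Proof.
move=> V0 VL Vlin llin M0 lM.
pose Q v := ip v v - 2 * l v.
have Qge v : V v -> - M ^+ 2 <= Q v.
  move=> Vv; rewrite /Q (ip_nrm (VL v Vv)); have := lM v Vv; have := ler_norm (l v).
  have := sqr_ge0 (N2 v - M); nra.
have hinf : has_inf [set Q v | v in V].
  split; first by exists (Q (fun=> 0)), (fun=> 0).
  by exists (- M ^+ 2) => _ [v Vv <-]; exact: Qge.
pose m := inf [set Q v | v in V].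
have mQ v : V v -> m <= Q v by move=> Vv; apply: ge_inf; [case: hinf|exists v].
have /choice[v Hv] n : exists v, V v /\ Q v < m + n.+1%:R^-1.
  have n0 : (0 : R) < n.+1%:R^-1 by rewrite invr_gt0.
  by have [_ [v Vv <-] h] := inf_adherent n0 hinf; exists v.
have Vv n := (Hv n).1; have v2 n := VL _ (Vv n).
have Qexp f g a b : V f -> V g -> Q (fun x => a * f x + b * g x) =
    a ^+ 2 * ip f f + 2 * (a * b) * ip f g + b ^+ 2 * ip g g - 2 * (a * l f + b * l g).
  move=> Vf Vg; rewrite /Q llin//; have f2 := VL f Vf; have g2 := VL g Vg.
  by rewrite ip_sq.
(* The midpoint of two almost minimizers is again in [V], where [Q] is at least [m]; the
   parallelogram identity then makes them close. *)
have cauchy e : 0 < e -> exists N, forall n k, (N <= n)%N -> (N <= k)%N -> N2 (fun x => v n x - v k x) <= e.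
  move=> e0; have e4 : 0 < e ^+ 2 / 4 by rewrite divr_gt0 ?exprn_gt0.
  exists (Num.bound (e ^+ 2 / 4)^-1).
  have small n : (Num.bound (e ^+ 2 / 4)^-1 <= n)%N -> Q (v n) < m + e ^+ 2 / 4.
    move=> nN; apply: (lt_le_trans (Hv n).2); rewrite lerD2l -[leRHS]invrK lef_pV2 ?posrE ?invr_gt0//.
    apply: (@le_trans _ _ (Num.bound (e ^+ 2 / 4)^-1)%:R); last by rewrite ler_nat ltnW.
    by apply/ltW/archi_boundP; rewrite invr_ge0 ltW.
  move=> n k /small hn /small hk.
  have hm := mQ _ (Vlin 2^-1 2^-1 _ _ (Vv n) (Vv k)).
  have E : (fun x => v n x - v k x) = fun x => 1 * v n x + (- 1) * v k x by apply/funext => x; ring.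
  have nE : N2 (fun x => v n x - v k x) ^+ 2 = ip (v n) (v n) - 2 * ip (v n) (v k) + ip (v k) (v k).
    by rewrite E -ip_nrm ?ip_sq//; [ring|exact: L2lin].
  rewrite -(ler_pXn2r (ltn0Sn 1)) ?nnegrE ?nrm_ge0 ?(ltW e0)// nE.
  by move: hm hn hk; rewrite Qexp// /Q; lra.
have [u u2 cvu] := Lp_complete le12 v2 cauchy.
have ipcv g : LP2 g -> ip (v n) g @[n --> \oo] --> ip u g.
  by move=> g2; exact: (pair_cvg le12 lt02 (inv2D R) v2 u2 g2 cvu).
have lE f : V f -> l f = ip u f.
  move=> Vf; have f2 := VL f Vf; set F := ip f f; have F0 : 0 <= F by rewrite /F ip_nrm// sqr_ge0.
  pose a := ip u f - l f.
  (* Comparison of [Q] at v_n and at v_n + t f, in the limit. A linear term in t bounded by a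
     quadratic one must vanish; t = -a / (F + 1) shows it while allowing F = 0. *)
  have key t : - (2 * t * a) <= t ^+ 2 * F.
    have c1 : - (2 * t * (ip (v n) f - l f)) @[n --> \oo] --> - (2 * t * a).
      exact: (cvgN (cvgM (cvg_cst (2 * t)) (cvgB (ipcv f f2) (cvg_cst (l f))))).
    have c2 : (n.+1%:R^-1 + t ^+ 2 * F) @[n --> \oo] --> 0 + t ^+ 2 * F.
      exact: (cvgD (@cvg_harmonic R) (cvg_cst (t ^+ 2 * F))).
    rewrite -[leRHS]add0r; apply: (ler_cvg_to c1 c2); apply: nearW => n.
    have := mQ _ (Vlin 1 t _ _ (Vv n) Vf); rewrite Qexp// -/F; have := (Hv n).2; rewrite /Q.
    move: (n.+1%:R^-1) (ip (v n) (v n)) (ip (v n) f) (l (v n)) (l f) (F) (m) => z1 z2 z3 z4 z5 z6 z7; lra.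
  have F1 : 0 < F + 1 by rewrite ltr_wpDl.
  have := key (- a / (F + 1)).
  have -> : - (2 * (- a / (F + 1)) * a) = 2 * a ^+ 2 / (F + 1) by ring.
  have -> : (- a / (F + 1)) ^+ 2 * F = (a ^+ 2 * F / (F + 1)) / (F + 1) by ring.
  rewrite ler_pM2r ?invr_gt0// ler_pdivlMr// => h.
  have : a ^+ 2 <= 0 by have := sqr_ge0 a; nra.
  by rewrite le_eqVlt ltNge sqr_ge0 orbF sqrf_eq0 /a subr_eq0 => /eqP.
exists u; split => //.
(* The square of the norm of u is the limit of ip v_n u = l v_n, at most [M] times the norm of v_n;
   it remains to divide by the norm of u. *)
have [->//|u0] := eqVneq (N2 u) 0.
have up : 0 < N2 u by rewrite lt_neqAle eq_sym u0 nrm_ge0.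
rewrite -(ler_pM2r up); rewrite -expr2 -(ip_nrm u2).
apply/ler_addgt0Pr => e e0; have M1 : 0 < M + 1 by rewrite ltr_wpDl.
have [N HN] := cvu (e / (M + 1)) (divr_gt0 e0 M1).
apply: (cvgr_to_le (ipcv u u2)); exists N => // n /= nN.
rewrite ipC -lE//; apply: (le_trans (ler_norm _)); apply: (le_trans (lM _ (Vv n))).
have [d2 _] := LpB le12 (v2 n) u2; have [_ t] := LpD le12 d2 u2.
rewrite (_ : (fun x => _ + u x) = v n) in t; last by apply/funext => x; rewrite subrK.
apply: (le_trans (ler_wpM2l M0 t)); rewrite mulrDr addrC lerD2l.
apply: (le_trans (ler_wpM2l M0 (HN n nN))); rewrite mulrCA ger_pMr// ler_pdivrMr// mul1r; lra.
Qed.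

End riesz.

(** * From kernel estimates to the abstract tail and decay conditions *)

Section kernels.
Context (R : realType) (X : ptopologicalType) (d : X -> X -> R)
  (mu : {measure set (borel X) -> \bar R}) (c K : R) (hX : homogeneous_type d mu c K).
Context (q0 : R) (q0_gt1 : 1 < q0)
  (growth : forall x t j, 0 < t -> q0 ^+ j * mB d mu x t <= mB d mu x (c ^+ j * t)).
Context (del : R) (del0 : 0 < del).
Context (A : R) (A1 : 1 <= A) (cutoff : forall x r, 0 < r -> exists phi, [/\ Lam d del phi,
   forall y, 0 <= phi y, forall y, qball d x r y -> phi y = 1 & forall y, ~ qball d x (A * r) y -> phi y = 0]).

Notation B := (qball d).
Notation mB := (mB d mu).
Notation mfun f := (measurable_fun setT (f : borel X -> _)).
Notation avg := (avg d mu).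
Notation bsupp := (bsupp d).
Notation LP q f := (Lp mu q (f : borel X -> R)).
Notation NR q f := (nrm mu q (f : borel X -> R)).
Notation Lam := (Lam d del).

Notation czhalf := (czhalf d mu c).
Notation czpair := (czpair d mu c).

Lemma continuous_on_measurable (V : set X) (h : X -> R) : open V ->
  (forall y e, V y -> 0 < e -> exists2 r, 0 < r & forall z, B y r z -> `|h z - h y| <= e) ->
  (forall y, ~ V y -> h y = 0) -> mfun h.
Proof.
move=> oV hc h0 mT; apply: (measurability _ (RGenOpens.measurableE R)) => //.
move=> _ [_ [a [b ->]] <-]; rewrite setTI; set U := [set` _].
have oU : open U by exact: interval_open.
have -> : h @^-1` U = (V `&` h @^-1` U) `|` (if pselect (U 0) then ~` V else set0).
  apply/seteqP; split => y; last first.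
    by case=> [[]//|]; case: pselect => // U0 /h0 /=; rewrite /preimage/= => ->.
  move=> Uy; have [Vy|nV] := pselect (V y); first by left.
  by right; case: pselect => // nU; apply: nU; rewrite -(h0 y nV).
apply: measurableU; last first.
  by case: pselect => h' //=; apply: measurableC; exact: open_borel.
apply: (open_borel (U := V `&` h @^-1` U)).
rewrite openE => x [Vx Ux]; rewrite /interior.
have /nbhs_ballP[e /= e0 eU] : nbhs (h x) U by move: oU; rewrite openE => /(_ _ Ux).
have e20 : 0 < e / 2 by rewrite divr_gt0.
have [r r0 hr] := hc x _ Vx e20.
have n1 := open_nbhs_nbhs (conj (qball_open hX x r0) (qball_center hX x r0)).
have n2 := open_nbhs_nbhs (conj oV Vx).
apply: filterS2 n1 n2 => y /hr h1 Vy; split => //.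
apply: eU; rewrite /ball/= distrC; apply: le_lt_trans h1 _; rewrite ltr_pdivrMr//.
by rewrite ltr_pMr// ltr1n.
Qed.

Lemma d_sym x y : d x y = d y x. Proof. by have [_ _ h _] := ht_quasi_metric hX. Qed.
Lemma d_gt0 x y : x <> y -> 0 < d x y.
Proof.
move=> xy; rewrite lt_neqAle (d_ge0 hX) andbT eq_sym; apply/eqP => h; apply: xy.
by have [_ h' _ _] := ht_quasi_metric hX; apply/h'.
Qed.
Lemma d_eq0 x : d x x = 0.
Proof. by have [_ h' _ _] := ht_quasi_metric hX; apply/h'. Qed.

Lemma mB_center x y r : 0 < r -> d x y < c * r -> mB x r <= K ^+ 2 * mB y r.
Proof.
move=> r0 xy; have cr0 := cmul_gt0 hX r0.
have sub : B x r `<=` B y (c * (c * r)).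
  apply: subset_trans (qball_sub hX r0 (ltW (cmul_gt hX r0))) _.
  by apply: (qball_engulf hX cr0 (lexx _) (qball_center hX y cr0)).
apply: (le_trans (mB_sub hX r0 (cmul_gt0 hX cr0) sub)).
by apply: le_trans (mB_c2 hX y r0); rewrite expr2 mulrA.
Qed.

Lemma mB_le x r s : 0 < r -> r <= s -> mB x r <= mB x s.
Proof. by move=> r0 rs; apply: (mB_sub hX r0 (lt_le_trans r0 rs)); exact: (qball_sub hX). Qed.

Lemma L2_L1 f z s : 0 < s -> LP 2 f -> (forall y, ~ B z s y -> f y = 0) -> LP 1 f /\ NR 1 f <= NR 2 f * mB z s `^ 2^-1.
Proof.
move=> s0 f2 f0; have [i1 i2] := nrm_indic hX z 1 (lt02 R) s0.
have [h1 h2] := hoelder_Lp (lt02 R) (lt02 R) (inv2D R) f2 i1.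
rewrite i2 normr1 mul1r in h2.
suff E : (fun y => f y * (1 * \1_(B z s) y)) = f by rewrite E in h1 h2.
apply/funext => y; rewrite mul1r indicE; have [h|h] := pselect (B z s y); first by rewrite mem_set// mulr1.
by rewrite f0// mul0r.
Qed.

(** The closure of the inner ball is removed, and not the ball, to obtain an open set: approximation
    by Hoelder functions supported in a set requires it to be open. *)
Definition ann x (s t : R) : set X := B x t `&` ~` closure (B x s).

Lemma closure_ball x s : 0 < s -> closure (B x s) `<=` B x (c * s).
Proof.
move=> s0 y /(_ (B y s)) h; have [|z [xz yz]] := h; first exact: (open_nbhs_nbhs (conj (qball_open hX y s0) (qball_center hX y s0))).
exact: (qball_engulf hX s0 (lexx _) xz yz) (qball_center hX y s0).
Qed.

Lemma ann_open x s t : 0 < t -> open (ann x s t).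
Proof. by move=> t0; apply: openI; [exact: (qball_open hX)|apply: closed_openC; exact: closed_closure]. Qed.

Lemma ann_far x s t y : ann x s t y -> s <= d x y.
Proof. by move=> [_ h]; rewrite leNgt; apply/negP => ys; apply: h; exact: subset_closure. Qed.

Lemma ann_off (f : X -> R) x s t : 0 < s -> (forall y, B x (c * s) y -> f y = 0) -> (forall y, ~ B x t y -> f y = 0) ->
  forall y, ~ ann x s t y -> f y = 0.
Proof.
move=> s0 fs ft y h; have [yt|nt] := pselect (B x t y); last exact: ft.
by apply: fs; apply: closure_ball => //; apply: contrapT => h'; apply: h.
Qed.

Lemma near_far x s y z : 0 < s -> B x s y -> c * s <= d x z -> s <= d y z.
Proof.
move=> s0 xy xz; rewrite leNgt; apply/negP => yz.
have := qball_engulf hX s0 (lexx _) xy (qball_center hX y s0) yz.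
by rewrite /qball/= ltNge xz.
Qed.

Section kernel.
Context (eps C0 : R) (eps0 : 0 < eps) (C00 : 0 < C0) (k : X -> X -> R).
Hypothesis ksize : forall x y, x <> y -> `|k x y| <= C0 / mB x (d x y).
Hypothesis kreg : forall x x' y, x <> y -> c * d x x' <= d x y ->
  `|k x y - k x' y| + `|k y x - k y x'| <= (d x x' / d x y) `^ eps * (C0 / mB x (d x y)).

(** A pair of open sets at positive distance, between which the kernel is bounded: the integrals
    against the kernel converge absolutely there. *)
Definition sep (U V : set X) (eta M : R) := [/\ open U, open V, 0 < eta, 0 <= M &
  forall x y, U x -> V y -> eta <= d x y /\ `|k x y| <= M].

Lemma sep_neq U V eta M x y : sep U V eta M -> U x -> V y -> x <> y.
Proof. by move=> [_ _ e0 _ h] Ux Vy xy; have [] := h x y Ux Vy; rewrite xy d_eq0 leNgt e0. Qed.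

Lemma reg_le eta x x' y t : 0 < eta -> eta <= d x y -> d x x' <= t -> 0 <= t ->
  (d x x' / d x y) `^ eps * (C0 / mB x (d x y)) <= (t / eta) `^ eps * (C0 / mB x eta).
Proof.
move=> e0 ed dt t0; have d0 : 0 < d x y := lt_le_trans e0 ed.
apply: ler_pM; rewrite ?powR_ge0//.
- by rewrite divr_ge0 ?(ltW C00)// ltW// (mB_gt0 hX).
- apply: ge0_ler_powR; rewrite ?nnegrE ?divr_ge0 ?(d_ge0 hX) ?(ltW eps0) ?(ltW e0)//.
  by apply: ler_pM; rewrite ?(d_ge0 hX) ?invr_ge0 ?(d_ge0 hX)// lef_pV2.
- apply: ler_wpM2l; first exact: ltW.
  by rewrite lef_pV2 ?posrE ?(mB_gt0 hX)// mB_le.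
Qed.

Lemma small_powR (M e : R) : 0 <= M -> 0 < e -> exists2 s, 0 < s & s `^ eps * M <= e.
Proof.
move=> M0 e0; have M1 : 0 < M + 1 by rewrite ltr_wpDl.
exists ((e / (M + 1)) `^ eps^-1); first by rewrite powR_gt0// divr_gt0.
rewrite -powRrM mulVf ?gt_eqF// powRr1 ?divr_ge0 ?(ltW e0) ?(ltW M1)//.
by rewrite mulrAC ler_pdivrMr// ler_wpM2l ?(ltW e0)// lerDl.
Qed.

(** Regularity makes the kernel continuous in the second variable off the diagonal: separate
    measurability is thus derived, and joint measurability is never called upon. *)
Lemma k_measurable U V eta M x : sep U V eta M -> U x -> mfun (fun y => k x y * \1_V y).
Proof.
move=> hs Ux; have [oU oV e0 M0 h] := hs; have mx : 0 < mB x eta by exact: (mB_gt0 hX).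
apply: (continuous_on_measurable oV) => [y e Vy e'0|y nV]; last by rewrite indicE memNset// mulr0.
have xy := sep_neq hs Ux Vy; have yx : y <> x by move=> h'; exact: xy.
have [r1 r10 hr1] : exists2 r, 0 < r & B y r `<=` V.
  by apply: (ht_basis hX); exact: open_nbhs_nbhs.
have dyx : 0 < d y x by exact: d_gt0.
have M1 : 0 <= C0 / mB y (d y x) by rewrite divr_ge0 ?(ltW C00)// ltW// (mB_gt0 hX).
have [s s0 hs'] := small_powR M1 e'0.
exists (Num.min r1 (Num.min (s * d y x) (d y x / c))).
  by rewrite !lt_min r10 mulr_gt0//= divr_gt0// (c_gt0 hX).
move=> z; rewrite /qball/= !lt_min => /and3P[z1 z2 z3].
rewrite !indicE !mem_set ?mulr1//; last exact: hr1.
have := kreg yx (x' := z); rewrite mulrC -ler_pdivlMr ?(c_gt0 hX)// => /(_ (ltW z3)) hk.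
apply: le_trans hs'; apply: le_trans (le_trans _ hk) _; first by rewrite [in leRHS]distrC (distrC (k x y)) lerDr.
apply: le_trans (reg_le dyx (lexx _) (ltW z2) _) _; first by rewrite mulr_ge0 ?ltW.
by rewrite mulfK// gt_eqF.
Qed.

Definition kernel_int (f : X -> R) x := \int[mu]_y (k x y * f y).

Lemma kernel_mul_L1 U V eta M x f : sep U V eta M -> U x -> LP 1 f -> (forall y, ~ V y -> f y = 0) ->
  LP 1 (fun y => k x y * f y) /\ NR 1 (fun y => k x y * f y) <= M * NR 1 f.
Proof.
move=> hs Ux f1 f0; have [oU oV e0 M0 h] := hs; have mf : mfun f by case: f1.
have [MF MFn] := LpZ M ltr01 f1; rewrite (ger0_norm M0) in MFn; rewrite -MFn.
have E : (fun y => k x y * f y) = (fun y => k x y * \1_V y * f y).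
  apply/funext => y; have [Vy|nV] := pselect (V y); first by rewrite indicE mem_set// mulr1.
  by rewrite f0// !mulr0.
apply: Lp_le => //.
  by rewrite E; apply: measurable_funM => //; exact: k_measurable hs Ux.
move=> y; have [Vy|nV] := pselect (V y); last by rewrite f0// !mulr0 normr0.
by rewrite !normrM (ger0_norm M0) ler_wpM2r//; have [] := h x y Ux Vy.
Qed.

Lemma kernel_int_bound U V eta M x f : sep U V eta M -> U x -> LP 1 f -> (forall y, ~ V y -> f y = 0) ->
  `|kernel_int f x| <= M * NR 1 f.
Proof. by move=> hs Ux f1 f0; have [h1 h2] := kernel_mul_L1 hs Ux f1 f0; apply: le_trans h2; exact: normr_int_le. Qed.

Lemma kernel_int_measurable U V eta M f : sep U V eta M -> LP 1 f -> (forall y, ~ V y -> f y = 0) ->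
  mfun (fun x => kernel_int f x * \1_U x).
Proof.
move=> hs f1 f0; have [oU oV e0 M0 h] := hs.
apply: (continuous_on_measurable oU) => [x e Ux e'0|y nV]; last by rewrite indicE memNset// mulr0.
have [r1 r10 hr1] : exists2 r, 0 < r & B x r `<=` U.
  by apply: (ht_basis hX); exact: open_nbhs_nbhs.
have M1 : 0 <= C0 / mB x eta * NR 1 f by rewrite mulr_ge0 ?nrm_ge0// divr_ge0 ?(ltW C00)// ltW// (mB_gt0 hX).
have [s s0 hs'] := small_powR M1 e'0.
exists (Num.min r1 (Num.min (s * eta) (eta / c))).
  by rewrite !lt_min r10 mulr_gt0//= divr_gt0// (c_gt0 hX).
move=> z; rewrite /qball/= !lt_min => /and3P[z1 z2 z3]; have Uz := hr1 z z1.
rewrite !indicE !mem_set ?mulr1//.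
have [kz _] := kernel_mul_L1 hs Uz f1 f0; have [kx _] := kernel_mul_L1 hs Ux f1 f0.
rewrite distrC /kernel_int -(int1B kx kz).
have [kd _] := LpB (lexx 1) kx kz; apply: (le_trans (normr_int_le kd)).
set D := s `^ eps * (C0 / mB x eta).
have D0 : 0 <= D by rewrite mulr_ge0 ?powR_ge0// divr_ge0 ?(ltW C00)// ltW// (mB_gt0 hX).
have [DF DFn] := LpZ D ltr01 f1; rewrite (ger0_norm D0) in DFn.
apply: (@le_trans _ _ (NR 1 (fun y => D * f y))); last by rewrite DFn -mulrA.
apply: (Lp_le ltr01 kd.1 DF _).2 => y.
have [Vy|nV] := pselect (V y); last by rewrite f0// !mulr0 subr0 normr0.
rewrite -mulrBl normrM (normrM D) (ger0_norm D0) ler_wpM2r//.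
have [hd _] := h x y Ux Vy; have xy := sep_neq hs Ux Vy.
have := kreg xy (x' := z); have cz : c * d x z <= d x y.
  by apply: le_trans hd; rewrite mulrC -ler_pdivlMr ?(c_gt0 hX)// ltW.
move=> /(_ cz) hk; apply: (le_trans (le_trans _ hk)); first by rewrite lerDl.
apply: le_trans (reg_le e0 hd (ltW z2) _) _; first by rewrite mulr_ge0 ?ltW.
by rewrite mulfK// gt_eqF.
Qed.

Lemma kernel_int_L2 U V eta M f z s : sep U V eta M -> LP 1 f -> (forall y, ~ V y -> f y = 0) -> 0 < s -> U `<=` B z s ->
  LP 2 (fun x => kernel_int f x * \1_U x).
Proof.
move=> hs f1 f0 s0 Us; apply: (bounded_Lp hX (M := M * NR 1 f) (x := z) (r := s)) => //.
- exact: kernel_int_measurable hs f1 f0.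
- move=> x; rewrite indicE; have [Ux|nU] := pselect (U x); first by rewrite mem_set// mulr1 (kernel_int_bound hs).
  by rewrite memNset// mulr0 normr0 mulr_ge0 ?nrm_ge0//; case: hs.
- by move=> y nB; rewrite indicE memNset ?mulr0// => /Us.
Qed.

Lemma Lam_approx U f : open U -> LP 2 f -> (forall y, ~ U y -> f y = 0) ->
  exists2 fn, forall n, Lam (fn n) /\ (forall y, ~ U y -> fn n y = 0) & cvgLp mu 2 fn f.
Proof.
move=> oU f2 f0.
have /choice[fn H] n : exists g, [/\ Lam g, forall y, ~ U y -> g y = 0 & NR 2 (fun y => f y - g y) <= n.+1%:R^-1].
  have n0 : (0 : R) < n.+1%:R^-1 by rewrite invr_gt0.
  by have [g [g1 g2 g3]] := Lam_dense hX del0 A1 cutoff (le12 R) oU f2 f0 n0; exists g.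
exists fn => [n|e e0]; first by case: (H n).
exists (Num.bound e^-1) => n nN; rewrite nrm_subC; have [_ _ h] := H n; apply: (le_trans h).
rewrite -[e]invrK lef_pV2 ?posrE ?invr_gt0//; apply: (@le_trans _ _ (Num.bound e^-1)%:R).
  by apply/ltW/archi_boundP; rewrite invr_ge0 ltW.
by rewrite ler_nat ltnW.
Qed.

Context (tau : (X -> R) -> (X -> R) -> R) (S S' : (X -> R) -> X -> R) (CL : R) (CL0 : 0 <= CL).
Hypothesis S_L2 : forall f, LP 2 f -> LP 2 (S f) /\ NR 2 (S f) <= CL * NR 2 f.
Hypothesis S'_L2 : forall f, LP 2 f -> LP 2 (S' f) /\ NR 2 (S' f) <= CL * NR 2 f.
Hypothesis S_adj : forall f g, LP 2 f -> LP 2 g -> \int[mu]_y (S f y * g y) = \int[mu]_y (f y * S' g y).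
Hypothesis S_tau : forall f g, Lam f -> Lam g -> tau f g = \int[mu]_y (S f y * g y).
Hypothesis tau_assoc : forall f g, Lam f -> Lam g ->
  (exists2 eta : R, 0 < eta & forall x y, f x <> 0 -> g y <> 0 -> eta <= d x y) ->
  tau f g = \int[mu]_x (kernel_int f x * g x).

(** The kernel representation is known for Hoelder functions. Density extends it first in the second
    argument, using that S u is in L^2, then in the first, using that S' g is; the limits on the
    kernel side are controlled by the bound [M]. *)
Lemma assoc_L2 U V eta M f g z s : sep U V eta M -> 0 < s -> U `<=` B z s -> V `<=` B z s ->
  LP 2 f -> LP 2 g -> (forall y, ~ V y -> f y = 0) -> (forall y, ~ U y -> g y = 0) ->
  LP 1 (fun x => kernel_int f x * g x) /\ \int[mu]_x (S f x * g x) = \int[mu]_x (kernel_int f x * g x).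
Proof.
move=> hs s0 Us Vs f2 g2 f0 g0; have [oU oV e0 M0 h] := hs.
have offV (u : X -> R) : (forall y, ~ V y -> u y = 0) -> forall y, ~ B z s y -> u y = 0.
  by move=> u0 y nB; apply: u0 => /Vs.
have L1V (u : X -> R) : LP 2 u -> (forall y, ~ V y -> u y = 0) -> LP 1 u.
  by move=> u2 u0; have [] := L2_L1 s0 u2 (offV u u0).
have KFU (u w : X -> R) : (forall y, ~ U y -> w y = 0) -> (fun x => kernel_int u x * w x) = (fun x => kernel_int u x * \1_U x * w x).
  move=> w0; apply/funext => y; have [Uy|nU] := pselect (U y); first by rewrite indicE mem_set// mulr1.
  by rewrite w0// !mulr0.
have KL (u w : X -> R) : LP 2 u -> LP 2 w -> (forall y, ~ V y -> u y = 0) -> (forall y, ~ U y -> w y = 0) ->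
    LP 1 (fun x => kernel_int u x * w x).
  by move=> u2 w2 u0 w0; rewrite KFU//; apply: hoelder_L2 => //; apply: (kernel_int_L2 hs _ u0 s0 Us); exact: L1V.
split; first exact: KL.
have stA (u w : X -> R) : Lam u -> Lam w -> (forall y, ~ V y -> u y = 0) -> (forall y, ~ U y -> w y = 0) ->
    \int[mu]_x (S u x * w x) = \int[mu]_x (kernel_int u x * w x).
  move=> lu lw u0 w0; rewrite -S_tau// tau_assoc//; exists eta => // x y ux wy.
  rewrite d_sym; have [] // := h y x.
    by apply: contrapT => nU; apply: wy; exact: w0.
  by apply: contrapT => nV; apply: ux; exact: u0.
have stB (u w : X -> R) : Lam u -> LP 2 w -> (forall y, ~ V y -> u y = 0) -> (forall y, ~ U y -> w y = 0) ->
    \int[mu]_x (S u x * w x) = \int[mu]_x (kernel_int u x * w x).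
  move=> lu w2 u0 w0; have [wn Hw cw] := Lam_approx oU w2 w0.
  have u2 := Lam_Lp hX del0 (le12 R) lu; have [Su _] := S_L2 u2.
  have wn2 n := Lam_Lp hX del0 (le12 R) (Hw n).1.
  have c1 := pair_cvg (le12 R) (lt02 R) (inv2D R) wn2 w2 Su cw.
  have c2 := pair_cvg (le12 R) (lt02 R) (inv2D R) wn2 w2 (kernel_int_L2 hs (L1V u u2 u0) u0 s0 Us) cw.
  have E1 : (fun n => \int[mu]_x (wn n x * S u x)) = (fun n => \int[mu]_x (wn n x * (kernel_int u x * \1_U x))).
    by apply/funext => n; rewrite intC stA//; [|exact: (Hw n).1|exact: (Hw n).2]; rewrite intC -KFU//; exact: (Hw n).2.
  rewrite E1 in c1; rewrite intC KFU// [RHS]intC.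
  exact: (@cvg_unique _ (@Rhausdorff R) _ _ _ _ c1 c2).
have [fn Hf cf] := Lam_approx oV f2 f0.
have fn2 n := Lam_Lp hX del0 (le12 R) (Hf n).1.
have [S'g _] := S'_L2 g2.
have c1 := pair_cvg (le12 R) (lt02 R) (inv2D R) fn2 f2 S'g cf.
have c2 : (fun n => \int[mu]_x (fn n x * S' g x)) @ \oo --> \int[mu]_x (kernel_int f x * g x).
  apply/cvgrPdist_le => e e'0.
  have D0 : 0 <= M * mB z s `^ 2^-1 * NR 1 g by rewrite !mulr_ge0 ?nrm_ge0 ?powR_ge0.
  have [g1 _] : LP 1 g /\ NR 1 g <= NR 2 g * mB z s `^ 2^-1 by apply: L2_L1 => // y nB; apply: g0 => /Us.
  have D1 : 0 < M * mB z s `^ 2^-1 * NR 1 g + 1 by rewrite ltr_wpDl.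
  have [N HN] := cf _ (divr_gt0 e'0 D1).
  exists N => // n /= /HN hn; have [ln fn0] := Hf n.
  rewrite -S_adj// stB// -int1B; [|exact: KL|exact: KL].
  have [d2 _] := LpB (le12 R) f2 (fn2 n).
  have d0 y : ~ V y -> f y - fn n y = 0 by move=> nV; rewrite f0// fn0// subr0.
  have [d1 d1n] := L2_L1 s0 d2 (offV _ d0).
  have Kd x : U x -> kernel_int f x - kernel_int (fn n) x = kernel_int (fun y => f y - fn n y) x.
    move=> Ux; have [a1 _] := kernel_mul_L1 hs Ux (L1V _ f2 f0) f0; have [a2 _] := kernel_mul_L1 hs Ux (L1V _ (fn2 n) fn0) fn0.
    by rewrite /kernel_int -int1B//; apply: eq_Rintegral => y _; ring.
  have [k1 _] := LpB (lexx 1) (KL _ _ f2 g2 f0 g0) (KL _ _ (fn2 n) g2 fn0 g0).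
  apply: (le_trans (normr_int_le k1)).
  set D := M * NR 1 (fun y => f y - fn n y); have DD : 0 <= D by rewrite mulr_ge0 ?nrm_ge0.
  have [Dg Dgn] := LpZ D ltr01 g1; rewrite (ger0_norm DD) in Dgn.
  apply: (@le_trans _ _ (NR 1 (fun y => D * g y))).
    apply: (Lp_le ltr01 k1.1 Dg _).2 => y; have [Uy|nU] := pselect (U y); last by rewrite g0// !mulr0 subr0 normr0.
    by rewrite -mulrBl normrM (normrM D) (ger0_norm DD) ler_wpM2r// Kd//; exact: kernel_int_bound hs Uy d1 d0.
  rewrite Dgn /D; apply: (@le_trans _ _ (M * (e / (M * mB z s `^ 2^-1 * NR 1 g + 1) * mB z s `^ 2^-1) * NR 1 g)).
    apply: ler_wpM2r; first exact: nrm_ge0.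
    apply: ler_wpM2l => //; apply: (le_trans d1n); apply: ler_wpM2r; first exact: powR_ge0.
    by rewrite nrm_subC.
  rewrite (_ : _ * NR 1 g = e * ((M * mB z s `^ 2^-1 * NR 1 g) / (M * mB z s `^ 2^-1 * NR 1 g + 1))); last by ring.
  by rewrite ger_pMr// ler_pdivrMr// mul1r lerDl.
rewrite S_adj//; exact: (@cvg_unique _ (@Rhausdorff R) _ _ _ _ c1 c2).
Qed.

Lemma pairing_le U V eta M f g z s : sep U V eta M -> 0 < s -> U `<=` B z s -> V `<=` B z s ->
  LP 2 f -> LP 2 g -> (forall y, ~ V y -> f y = 0) -> (forall y, ~ U y -> g y = 0) ->
  `|\int[mu]_x (S f x * g x)| <= M * NR 1 f * NR 1 g.
Proof.
move=> hs s0 Us Vs f2 g2 f0 g0; have [i1 ->] := assoc_L2 hs s0 Us Vs f2 g2 f0 g0.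
have M0 : 0 <= M by case: hs.
have [f1 _] : LP 1 f /\ NR 1 f <= NR 2 f * mB z s `^ 2^-1 by apply: L2_L1 => // y nB; apply: f0 => /Vs.
have [g1 _] : LP 1 g /\ NR 1 g <= NR 2 g * mB z s `^ 2^-1 by apply: L2_L1 => // y nB; apply: g0 => /Us.
apply: (le_trans (normr_int_le i1)); set D := M * NR 1 f.
have D0 : 0 <= D by rewrite mulr_ge0 ?nrm_ge0.
have [Dg Dgn] := LpZ D ltr01 g1; rewrite (ger0_norm D0) in Dgn; rewrite -Dgn.
apply: (Lp_le ltr01 i1.1 Dg _).2 => y; have [Uy|nU] := pselect (U y); last by rewrite g0// !mulr0 normr0.
by rewrite normrM (normrM D) (ger0_norm D0) ler_wpM2r//; exact: kernel_int_bound hs Uy f1 f0.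
Qed.

(** For [y] in the ball and [z] far away, the ball B(y, d(y, z)) is at least as large as B(y, s),
    comparable to B(x, s). The constant is the one of the reversed case, so that the two can be used
    alike. *)
Lemma sepA x s t : 0 < s -> 0 < t -> sep (B x s) (ann x (c * s) t) s (C0 * K ^+ 4 / mB x s).
Proof.
move=> s0 t0; have m0 := mB_gt0 hX x s0; have K0 := K_gt0 hX; have K1 := K_gt1 hX.
split; [exact: (qball_open hX)|exact: ann_open|by []|by rewrite divr_ge0 ?mulr_ge0 ?exprn_ge0 ?(ltW C00) ?(ltW K0) ?(ltW m0)|].
move=> y z By /ann_far zf; have sd := near_far s0 By zf; split => //.
have yz : y <> z by move=> yz; move: sd; rewrite yz d_eq0 leNgt s0.
apply: (le_trans (ksize yz)); rewrite -mulrA; apply: ler_wpM2l; first exact: ltW.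
have my : 0 < mB y (d y z) by apply: (mB_gt0 hX); exact: d_gt0.
rewrite -[_^-1]mul1r ler_pdivrMr// mulrAC ler_pdivlMr// mul1r.
have h1 : mB x s <= K ^+ 2 * mB y s by apply: mB_center => //; apply: (lt_trans By); exact: (cmul_gt hX).
apply: (le_trans h1); apply: ler_pM; rewrite ?exprn_ge0 ?(ltW K0)//; first by rewrite ltW// (mB_gt0 hX).
  by apply: ler_weXn2l => //; exact: ltW.
exact: mB_le.
Qed.

(** The size is now measured by a ball centred at the far point; moving its centre to the near point
    costs K^2, and moving to [x] costs another K^2. *)
Lemma sepB x s t : 0 < s -> 0 < t -> sep (ann x (c * s) t) (B x s) s (C0 * K ^+ 4 / mB x s).
Proof.
move=> s0 t0; have m0 := mB_gt0 hX x s0; have K0 := K_gt0 hX; have K1 := K_gt1 hX.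
split; [exact: ann_open|exact: (qball_open hX)|by []|by rewrite divr_ge0 ?mulr_ge0 ?exprn_ge0 ?(ltW C00) ?(ltW K0) ?(ltW m0)|].
move=> z y /ann_far zf By; have sd := near_far s0 By zf; rewrite d_sym; split => //.
have yz : z <> y by move=> yz; move: sd; rewrite yz d_eq0 leNgt s0.
apply: (le_trans (ksize yz)); rewrite -mulrA; apply: ler_wpM2l; first exact: ltW.
have d0 := d_gt0 yz.
have mz : 0 < mB z (d z y) by exact: (mB_gt0 hX).
rewrite -[_^-1]mul1r ler_pdivrMr// mulrAC ler_pdivlMr// mul1r.
have h1 : mB x s <= K ^+ 2 * mB y s by apply: mB_center => //; apply: (lt_trans By); exact: (cmul_gt hX).
have h2 : mB y (d z y) <= K ^+ 2 * mB z (d z y) by apply: mB_center => //; rewrite (d_sym y z); exact: (cmul_gt hX).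
have h3 : mB y s <= mB y (d z y) by apply: mB_le => //; rewrite d_sym.
apply: (le_trans h1); rewrite (exprD K 2 2) -[leRHS]mulrA; apply: ler_wpM2l; first by rewrite exprn_ge0 ?(ltW K0).
exact: le_trans h2.
Qed.

Lemma cXle i j r : 0 < r -> (i <= j)%N -> c ^+ i * r <= c ^+ j * r.
Proof. by move=> r0 ij; rewrite ler_wpM2r ?(ltW r0)// ler_weXn2l// ltW// (c_gt1 hX). Qed.

(* [S] and [S'] are handled together: the pairing is [\int S f g] with [f] near and [g] far, or the converse. *)
Lemma decay_aux x r j f g : 0 < r -> (2 <= j)%N -> LP 2 f -> LP 2 g ->
  (forall y, ~ B x r y -> f y = 0) -> (forall y, ~ B x (c ^+ j.+1 * r) y -> g y = 0) ->
  (forall y, B x (c ^+ j * r) y -> g y = 0) ->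
  `|\int[mu]_y (S f y * g y)| <= C0 * K ^+ 6 / mB x (c ^+ j * r) * NR 1 f * NR 1 g /\
  `|\int[mu]_y (S g y * f y)| <= C0 * K ^+ 6 / mB x (c ^+ j * r) * NR 1 f * NR 1 g.
Proof.
case: j => [|[|j]]// r0 _ f2 g2 f0 gt_ gs.
have s0 := cX_gt0 hX j r0; have t0 := cX_gt0 hX j.+3 r0; set s := c ^+ j * r in s0.
have E1 : c ^+ j.+2 * r = c * (c * s) by rewrite /s !exprS !mulrA.
have fs y : ~ B x s y -> f y = 0.
  move=> h; apply: f0 => h'; apply: h; apply: (qball_sub hX r0 _ h').
  by rewrite /s -{1}(mul1r r) ler_wpM2r ?(ltW r0)// exprn_ege1// ltW// (c_gt1 hX).
have ga : forall y, ~ ann x (c * s) (c ^+ j.+3 * r) y -> g y = 0.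
  by apply: ann_off => //; [exact: (cmul_gt0 hX)|rewrite -E1].
have Bst : B x s `<=` B x (c ^+ j.+3 * r) by apply: (qball_sub hX s0); apply: cXle => //; rewrite -addn3 leq_addr.
have Ant : ann x (c * s) (c ^+ j.+3 * r) `<=` B x (c ^+ j.+3 * r) by move=> y [].
(* The two dilations lost to separate the supports are paid by doubling: K^6 = K^4 K^2. *)
have hC : C0 * K ^+ 4 / mB x s <= C0 * K ^+ 6 / mB x (c ^+ j.+2 * r).
  have ms := mB_gt0 hX x s0; have mt := mB_gt0 hX x (cX_gt0 hX j.+2 r0).
  rewrite -[C0 * K ^+ 4 / _]mulrA -[C0 * K ^+ 6 / _]mulrA; apply: ler_wpM2l; first exact: ltW.
  rewrite (exprD K 4 2) -[leRHS]mulrA; apply: ler_wpM2l; first by rewrite exprn_ge0// ltW// (K_gt0 hX).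
  rewrite -[_^-1]mul1r ler_pdivrMr// mulrAC ler_pdivlMr// mul1r.
  by rewrite E1 mulrA -expr2; exact: (mB_c2 hX).
split.
  apply: (le_trans (pairing_le (sepB x s0 t0) t0 Ant Bst f2 g2 fs ga)).
  by apply: ler_wpM2r; [exact: nrm_ge0|apply: ler_wpM2r; [exact: nrm_ge0|exact: hC]].
apply: (le_trans (pairing_le (sepA x s0 t0) t0 Bst Ant g2 f2 ga fs)); rewrite [leLHS]mulrAC.
by apply: ler_wpM2r; [exact: nrm_ge0|apply: ler_wpM2r; [exact: nrm_ge0|exact: hC]].
Qed.

(** On the shell where d(x, y) is between c^i r and c^(i + 1) r, the kernel factor is at most a
    constant times th^i divided by the measure of the outer ball: the integral of u is dominated by
    the sum of averages. Bounded support makes the sum finite. *)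
Lemma kernel_sum x r (f u : X -> R) T D : 0 < r -> 0 <= T -> 0 <= D -> LP 1 f -> bsupp f ->
  (forall y, B x (c * r) y -> f y = 0) ->
  (\sum_(0 <= j <oo) ((c `^ (- eps)) ^+ j)%:E * avg (fun y => `|f y|%:E) x (c ^+ j * r) <= T%:E)%E ->
  mfun u -> (forall y, f y = 0 -> u y = 0) ->
  (forall y, c * r <= d x y -> `|u y| <= D * ((r / d x y) `^ eps * (C0 / mB x (d x y))) * `|f y|) ->
  LP 1 u /\ NR 1 u <= C0 * K / c `^ (- eps) * T * D.
Proof.
move=> r0 T0 D0 f1 bf f0 fT mu_ u0 ub; set th := c `^ (- eps) in fT *.
have c0 := c_gt0 hX; have c1 := c_gt1 hX; have K0 := K_gt0 hX.
have th0 : 0 < th by rewrite powR_gt0.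
have mf : mfun f by case: f1.
have rj j := cX_gt0 hX j r0.
have [J HJ] : exists J, forall y, f y <> 0 -> d x y < c ^+ J * r.
  have [z [s [s0 hz]]] := bf; have [t _ sub] := balls_in_ball hX x z s0.
  have [J hJ] := expr_unbounded (t / r) c1; exists J => y fy.
  have : B z s y by apply: contrapT => /hz.
  by move=> /sub; rewrite /qball/= => h; apply: (lt_trans h); rewrite -ltr_pdivrMr.
pose a i := D * C0 * K * th ^+ i / mB x (c ^+ i.+1 * r).
have a0 i : 0 <= a i by rewrite /a divr_ge0 ?mulr_ge0 ?exprn_ge0 ?(ltW C00) ?(ltW K0) ?(ltW th0)// ltW// (mB_gt0 hX).
have E0 : 0 <= C0 * K / th * T * D by rewrite !mulr_ge0 ?invr_ge0 ?(ltW C00) ?(ltW K0) ?(ltW th0).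
apply: LpP => //; rewrite powRr1//.
have mfa : mfun (fun y => `|f y|%:E) by apply/measurable_EFinP; exact: measurableT_comp.
have mBj i := qball_measurable hX x (rj i).
pose dom i y : \bar R := ((a i)%:E * (`|f y| * \1_(B x (c ^+ i.+1 * r)) y)%:E)%E.
have dom0 i y : (0 <= dom i y)%E.
  by rewrite /dom -EFinM lee_fin; apply: mulr_ge0 => //; rewrite mulr_ge0// indicE ler0n.
have mI i : mfun (fun y => (`|f y| * \1_(B x (c ^+ i.+1 * r)) y)%:E).
  by apply/measurable_EFinP; apply: measurable_funM; [exact: measurableT_comp|exact: measurable_indic].
have mdom i : mfun (dom i) by apply: measurable_funeM.
apply: (@le_trans _ _ (\int[mu]_y (\sum_(i < J) dom i y))%E).
  apply: ge0_le_integral => //.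
  - exact: measurable_powRn.
  - by apply: emeasurable_sum.
  move=> y _; rewrite powRr1//.
  have [fy|/eqP fy] := eqVneq (f y) 0; first by rewrite u0// normr0 sume_ge0.
  have cd : c * r <= d x y by rewrite leNgt; apply/negP => /f0.
  have d0 : 0 < d x y by apply: lt_le_trans cd; exact: (cmul_gt0 hX).
  have exn : exists n, d x y < c ^+ n * r by exists J; exact: HJ.
  (* The least n with d(x, y) < c^n r locates the shell; n is at least 2 because f vanishes on the
     c-dilate of the ball. *)
  case: (ex_minnP exn) => n hn minn.
  have nJ : (n <= J)%N by apply: minn; exact: HJ.
  case: n hn minn nJ => [|[|i]] hn minn nJ.
  - by move: hn; rewrite expr0 mul1r ltNge (le_trans _ cd)// ltW// (cmul_gt hX).
  - by move: hn; rewrite expr1 ltNge cd.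
  have hi : c ^+ i.+1 * r <= d x y by rewrite leNgt; apply/negP => /minn; rewrite ltnn.
  rewrite (bigD1 (Ordinal nJ))//=; apply: (@le_trans _ _ (dom i.+1 y)); last first.
    by rewrite leeDl// sume_ge0.
  rewrite /dom -EFinM lee_fin indicE mem_set// mulr1; apply: (le_trans (ub y cd)).
  have m1 := mB_gt0 hX x (rj i.+2).
  have h1 : mB x (c ^+ i.+2 * r) <= K * mB x (c ^+ i.+1 * r) by rewrite exprS -mulrA (mB_doubling hX).
  apply: ler_wpM2r => //; rewrite /a; move: (mB x (c ^+ i.+2 * r)) m1 h1 => m2 m1 h1.
  rewrite -!mulrA; apply: ler_wpM2l => //.
  rewrite mulrCA; apply: ler_wpM2l; first exact: ltW.
  rewrite mulrCA; apply: ler_pM; rewrite ?powR_ge0 ?invr_ge0 ?(ltW (mB_gt0 hX _ d0))//.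
    have -> : th ^+ i.+1 = (r / (c ^+ i.+1 * r)) `^ eps.
      rewrite /th -powR_mulrn ?powR_ge0// -powRrM mulNr mulrC -mulNr powRrM.
      congr (_ `^ _); rewrite powRN powR_mulrn ?(ltW c0)//.
      by rewrite invfM mulrCA mulfV ?mulr1// gt_eqF.
    apply: ge0_ler_powR; rewrite ?nnegrE ?(ltW eps0) ?divr_ge0 ?(ltW r0) ?(ltW d0)//; first exact: ltW.
    by apply: ler_wpM2l; [exact: ltW|rewrite lef_pV2 ?posrE].
  rewrite -[_^-1]mul1r ler_pdivrMr ?(mB_gt0 hX)// mulrAC ler_pdivlMr// mul1r.
  by apply: (le_trans h1); apply: ler_wpM2l; [exact: ltW|exact: mB_le].
rewrite ge0_integral_sum//.
have -> : (\sum_(i < J) \int[mu]_y dom i y = (D * C0 * K / th)%:E * \sum_(i < J) (th ^+ i.+1)%:E * avg (fun y => `|f y|%:E) x (c ^+ i.+1 * r))%E.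
  rewrite ge0_sume_distrr; last first.
    move=> i _; rewrite mule_ge0 ?lee_fin ?exprn_ge0 ?(ltW th0)//.
    by apply: (avg_ge0 hX).
  apply: eq_bigr => i _; rewrite ge0_integralZl ?lee_fin//.
  rewrite /avg !muleA -!EFinM; congr (_%:E * _)%E.
    by rewrite /a (exprS th); congr (_ / _); field; rewrite gt_eqF.
  rewrite [RHS]integral_mkcond; apply: eq_integral => y _; rewrite patchE indicE.
  by case: ifP; rewrite ?mulr1 ?mulr0.
have pos : 0 <= D * C0 * K / th by rewrite divr_ge0 ?mulr_ge0 ?(ltW C00) ?(ltW K0) ?(ltW th0).
apply: (@le_trans _ _ ((D * C0 * K / th)%:E * T%:E)%E); last first.
  by rewrite -EFinM lee_fin le_eqVlt; apply/orP; left; apply/eqP; ring.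
apply: lee_wpmul2l; first by rewrite lee_fin.
apply: le_trans fT.
set v := fun j => ((th ^+ j)%:E * avg (fun y => `|f y|%:E) x (c ^+ j * r))%E.
have v0 j : (0 <= v j)%E.
  rewrite mule_ge0 ?lee_fin ?exprn_ge0 ?(ltW th0)//; exact: (avg_ge0 hX).
apply: (@le_trans _ _ (\sum_(0 <= j < J.+1) v j)%E).
  by rewrite big_nat_recl// big_mkord leeDr.
exact: nneseries_lim_ge.
Qed.

Lemma th_lt1 : 0 <= c `^ (- eps) < 1.
Proof.
by rewrite powR_ge0/= powRN invf_lt1 ?powR_gt0 ?(c_gt0 hX)// powR_gt1// (c_gt1 hX).
Qed.

(** The expression does not change when a multiple of the integrals of g and g' is subtracted: any
    constant [a] close to the image of f on the ball may be inserted. *)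
Lemma half_tail x r f T a g g' E : LP 1 (fun y => kernel_int f y * g y) -> LP 1 (fun y => kernel_int f y * g' y) -> LP 1 g -> LP 1 g' ->
  0 <= E -> (forall y, ~ B x r y -> g y = 0) -> (forall y, ~ B x r y -> g' y = 0) ->
  (forall y, B x r y -> `|kernel_int f y - a| <= E * T) ->
  `|(\int[mu]_y (kernel_int f y * g y)) * (\int[mu]_y g' y) - (\int[mu]_y (kernel_int f y * g' y)) * (\int[mu]_y g y)|
    <= 2 * E * T * NR 1 g * NR 1 g'.
Proof.
move=> kg kg' g1 g'1 E0 g0 g'0 h.
have dev (u : X -> R) : LP 1 (fun y => kernel_int f y * u y) -> LP 1 u -> (forall y, ~ B x r y -> u y = 0) ->
    `|\int[mu]_y (kernel_int f y * u y) - a * \int[mu]_y u y| <= E * T * NR 1 u.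
  move=> ku u1 u0; have [au _] := LpZ a ltr01 u1.
  rewrite -(int1Z _ u1) -(int1B ku au); have [l1 _] := LpB (lexx 1) ku au.
  apply: (le_trans (normr_int_le l1)); have [eu eun] := LpZ (E * T) ltr01 u1.
  have [[y By]|nB] := pselect (exists y, B x r y); last first.
    have -> : u = fun=> 0 by apply/funext => y; apply: u0 => By; apply: nB; exists y.
    rewrite (_ : (fun x => kernel_int f x * 0 - a * 0) = fun=> 0) ?(nrm0 mu ltr01).2 ?mulr0//.
    by apply/funext => y; rewrite !mulr0 subr0.
  have ET : 0 <= E * T := le_trans (normr_ge0 _) (h y By).
  rewrite (ger0_norm ET) in eun; rewrite -eun; apply: (Lp_le ltr01 l1.1 eu _).2 => z.
  have [Bz|nBz] := pselect (B x r z); last by rewrite u0// !mulr0 subr0 normr0.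
  by rewrite -mulrBl !normrM -(normrM E T) (ger0_norm ET) ler_wpM2r// h.
have h1 := dev g kg g1 g0; have h2 := dev g' kg' g'1 g'0.
have n1 : `|\int[mu]_y g y| <= NR 1 g := normr_int_le g1.
have n2 : `|\int[mu]_y g' y| <= NR 1 g' := normr_int_le g'1.
move: h1 h2 n1 n2; set I := \int[mu]_y (kernel_int f y * g y); set I' := \int[mu]_y (kernel_int f y * g' y).
set G := \int[mu]_y g y; set G' := \int[mu]_y g' y; set N := NR 1 g; set N' := NR 1 g' => h1 h2 n1 n2.
rewrite (_ : I * G' - I' * G = (I - a * G) * G' - (I' - a * G') * G); last by ring.
apply: (le_trans (ler_normB _ _)); rewrite !normrM.
rewrite (_ : 2 * E * T * N * N' = E * T * N * N' + E * T * N' * N); last by ring.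
by apply: lerD; apply: ler_pM.
Qed.

(** The image of f is compared on the ball with its value at the centre; the difference of kernels
    is bounded by regularity and summed over shells. *)
Lemma cz_half_op : czhalf S.
Proof.
have K0 := K_gt0 hX; have c0 := c_gt0 hX; have th1 := th_lt1.
split; first by exists CL.
  have E0 : 0 <= C0 * K / c `^ (- eps) by rewrite divr_ge0 ?mulr_ge0 ?(ltW C00) ?(ltW K0) ?powR_ge0.
  exists (2 * (C0 * K / c `^ (- eps))), (c `^ (- eps)); split => //; first by rewrite mulr_ge0.
  move=> x r f T r0 T0 f2 bf fs fT g g' g2 g'2 g0 g'0.
  have [z [s [s0 hz]]] := bf; have [t st sub] := balls_in_ball hX x z s0.
  pose t' := Num.max t r; have t0 : 0 < t' by rewrite lt_max r0 orbT.
  have ft y : ~ B x t' y -> f y = 0.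
    move=> h; apply: hz => /sub h'; apply: h; apply: (qball_sub hX (lt_le_trans s0 st) _ h').
    by rewrite le_max lexx.
  have cr0 := cmul_gt0 hX r0.
  have fa : forall y, ~ ann x (c * r) t' y -> f y = 0.
    by apply: ann_off => // y; rewrite mulrA -expr2; exact: fs.
  have Br : B x r `<=` B x t' by apply: (qball_sub hX r0); rewrite le_max lexx orbT.
  have At : ann x (c * r) t' `<=` B x t' by move=> y [].
  have hs := sepA x r0 t0.
  have [kg ->] := assoc_L2 hs t0 Br At f2 g2 fa g0.
  have [kg' ->] := assoc_L2 hs t0 Br At f2 g'2 fa g'0.
  have [g1 _] := L2_L1 r0 g2 g0; have [g'1 _] := L2_L1 r0 g'2 g'0.
  have [f1 _] := L2_L1 t0 f2 ft.
  apply: (half_tail (x := x) (r := r) (a := kernel_int f x)) => // y By.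
  have [ky _] := kernel_mul_L1 hs By f1 fa.
  have [kx _] := kernel_mul_L1 hs (qball_center hX x r0) f1 fa.
  rewrite /kernel_int -(int1B ky kx); have [kd _] := LpB (lexx 1) ky kx; apply: (le_trans (normr_int_le kd)).
  rewrite -[leRHS]mulr1.
  have fcr w : B x (c * r) w -> f w = 0.
    move=> h; apply: fs; apply: (qball_sub hX cr0 _ h); rewrite expr2 -mulrA; exact/ltW/(cmul_gt hX).
  apply: (kernel_sum r0 T0 ler01 f1 bf fcr fT kd.1 _ _).2 => [w ->|w cw]; first by rewrite !mulr0 subr0.
  have d0 : 0 < d x w := lt_le_trans cr0 cw.
  have xw : x <> w by move=> xw; move: d0; rewrite -xw d_eq0 ltxx.
  rewrite -mulrBl normrM mul1r; apply: ler_wpM2r => //.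
  have cy : c * d x y <= d x w by apply: le_trans cw; rewrite ler_wpM2l ?(ltW c0)// ltW.
  have := kreg xw cy; rewrite distrC => hk; apply: (le_trans (le_trans _ hk)); first by rewrite lerDl.
  apply: ler_wpM2r; first by rewrite divr_ge0 ?(ltW C00)// ltW// (mB_gt0 hX).
  apply: ge0_ler_powR; rewrite ?nnegrE ?divr_ge0 ?(ltW eps0) ?(d_ge0 hX) ?(ltW r0)//.
  by rewrite ler_wpM2r ?invr_ge0 ?(d_ge0 hX)// ltW.
exists (C0 * K ^+ 6); first by rewrite mulr_ge0 ?exprn_ge0 ?(ltW C00) ?(ltW K0).
by move=> x r j f g r0 j2 f2 g2 f0 g0 gs; have [] := decay_aux r0 j2 f2 g2 f0 g0 gs.
Qed.

(** By adjunction the two pairings combine into that of f with the image of one function supported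
    in the ball, and regularity is used through the cancellation of the latter. *)
Lemma cz_half_transpose : czhalf S'.
Proof.
have K0 := K_gt0 hX; have c0 := c_gt0 hX; have th1 := th_lt1.
split; first by exists CL.
  have E0 : 0 <= C0 * K / c `^ (- eps) by rewrite divr_ge0 ?mulr_ge0 ?(ltW C00) ?(ltW K0) ?powR_ge0.
  exists (2 * (C0 * K / c `^ (- eps))), (c `^ (- eps)); split => //; first by rewrite mulr_ge0.
  move=> x r f T r0 T0 f2 bf fs fT g g' g2 g'2 g0 g'0.
  have [z [s [s0 hz]]] := bf; have [t st sub] := balls_in_ball hX x z s0.
  pose t' := Num.max t r; have t0 : 0 < t' by rewrite lt_max r0 orbT.
  have ft y : ~ B x t' y -> f y = 0.
    move=> h; apply: hz => /sub h'; apply: h; apply: (qball_sub hX (lt_le_trans s0 st) _ h').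
    by rewrite le_max lexx.
  have cr0 := cmul_gt0 hX r0.
  have fa : forall y, ~ ann x (c * r) t' y -> f y = 0.
    by apply: ann_off => // y; rewrite mulrA -expr2; exact: fs.
  have Br : B x r `<=` B x t' by apply: (qball_sub hX r0); rewrite le_max lexx orbT.
  have At : ann x (c * r) t' `<=` B x t' by move=> y [].
  have hs := sepB x r0 t0.
  have [g1 _] := L2_L1 r0 g2 g0; have [g'1 _] := L2_L1 r0 g'2 g'0.
  have [f1 _] := L2_L1 t0 f2 ft.
  set G := \int[mu]_y g y; set G' := \int[mu]_y g' y.
  (* This combination has integral 0, so the value k w x, constant in the variable of integration,
     can be subtracted from the kernel. *)
  pose a y := G' * g y + (- G) * g' y.
  have a2 : LP 2 a by exact: L2lin.
  have a0 y : ~ B x r y -> a y = 0 by move=> h; rewrite /a g0// g'0// !mulr0 addr0.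
  have [a1 _] := L2_L1 r0 a2 a0.
  have [S'f _] := S'_L2 f2.
  have -> : (\int[mu]_y (S' f y * g y)) * G' - (\int[mu]_y (S' f y * g' y)) * G = \int[mu]_y (S a y * f y).
    rewrite S_adj//; have := ip_lin G' (- G) g2 g'2 S'f; rewrite /ip => ->.
    by rewrite (intC mu g) (intC mu g'); ring.
  have [ka ->] := assoc_L2 hs t0 At Br a2 f2 a0 fa.
  apply: (le_trans (normr_int_le ka)).
  have inta : \int[mu]_y a y = 0.
    have [Gg _] := LpZ G' ltr01 g1; have [Gg' _] := LpZ (- G) ltr01 g'1.
    by rewrite /a int1D// !int1Z// -/G -/G'; ring.
  have na : NR 1 a <= 2 * (NR 1 g * NR 1 g').
    have [Gg Ggn] := LpZ G' ltr01 g1; have [Gg' Ggn'] := LpZ (- G) ltr01 g'1.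
    have [_ h] := LpD (lexx 1) Gg Gg'; apply: (le_trans h); rewrite Ggn Ggn' normrN mulrDl mul1r.
    apply: lerD; last by apply: ler_wpM2r; [exact: nrm_ge0|exact: normr_int_le].
    by rewrite mulrC; apply: ler_wpM2l; [exact: nrm_ge0|exact: normr_int_le].
  have fcr w : B x (c * r) w -> f w = 0.
    move=> h; apply: fs; apply: (qball_sub hX cr0 _ h); rewrite expr2 -mulrA; exact/ltW/(cmul_gt hX).
  have NA : 0 <= NR 1 a := nrm_ge0 _ _ _.
  apply: (le_trans (kernel_sum r0 T0 NA f1 bf fcr fT ka.1 _ _).2) => [w ->|w cw|]; first by rewrite mulr0.
    have [fw|fw] := eqVneq (f w) 0; first by rewrite fw !mulr0 normr0 mulr0.
    have Aw : ann x (c * r) t' w by apply: contrapT => h; move: fw; rewrite fa// eqxx.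
    have d0 : 0 < d x w := lt_le_trans cr0 cw.
    have xw : x <> w by move=> xw; move: d0; rewrite -xw d_eq0 ltxx.
    rewrite normrM; apply: ler_wpM2r => //.
    have [kw _] := kernel_mul_L1 hs Aw a1 a0; have [ca _] := LpZ (k w x) ltr01 a1.
    have -> : kernel_int a w = \int[mu]_y (k w y * a y - k w x * a y).
      by rewrite int1B// int1Z// inta mulr0 subr0.
    have [kd _] := LpB (lexx 1) kw ca; apply: (le_trans (normr_int_le kd)).
    set D := _ `^ eps * _.
    have D0 : 0 <= D by rewrite mulr_ge0 ?powR_ge0// divr_ge0 ?(ltW C00)// ltW// (mB_gt0 hX).
    have [Da Dan] := LpZ D ltr01 a1; rewrite (ger0_norm D0) in Dan; rewrite mulrC -Dan.
    apply: (Lp_le ltr01 kd.1 Da _).2 => y.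
    have [By|nB] := pselect (B x r y); last by rewrite a0// !mulr0 subr0 normr0.
    rewrite -mulrBl normrM (normrM D) (ger0_norm D0); apply: ler_wpM2r => //.
    have cy : c * d x y <= d x w by apply: le_trans cw; rewrite ler_wpM2l ?(ltW c0)// ltW.
    have := kreg xw cy => hk; rewrite distrC; apply: (le_trans (le_trans _ hk)); first by rewrite lerDr.
    apply: ler_wpM2r; first by rewrite divr_ge0 ?(ltW C00)// ltW// (mB_gt0 hX).
    apply: ge0_ler_powR; rewrite ?nnegrE ?divr_ge0 ?(ltW eps0) ?(d_ge0 hX) ?(ltW r0)//.
    by rewrite ler_wpM2r ?invr_ge0 ?(d_ge0 hX)// ltW.
  have ET : 0 <= C0 * K / c `^ (- eps) * T by rewrite mulr_ge0.
  apply: (le_trans (ler_wpM2l ET na)).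
  by rewrite le_eqVlt; apply/orP; left; apply/eqP; ring.
exists (C0 * K ^+ 6); first by rewrite mulr_ge0 ?exprn_ge0 ?(ltW C00) ?(ltW K0).
move=> x r j f g r0 j2 f2 g2 f0 g0 gs; have [_] := decay_aux r0 j2 f2 g2 f0 g0 gs.
by rewrite S_adj// intC.
Qed.

Lemma cz_pair_op : czpair S S'.
Proof. by split; [exact: cz_half_op|exact: cz_half_transpose|exact: S_adj]. Qed.

End kernel.

End kernels.

(** * Pairs of transposed operators built from a form on Hoelder functions *)

Section operators_of_forms.
Context (R : realType) (X : ptopologicalType) (d : X -> X -> R)
  (mu : {measure set (borel X) -> \bar R}) (c K : R) (hX : homogeneous_type d mu c K).
Context (q0 : R) (q0_gt1 : 1 < q0)
  (growth : forall x t j, 0 < t -> q0 ^+ j * mB d mu x t <= mB d mu x (c ^+ j * t)).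
Context (del : R) (del0 : 0 < del).
Context (A : R) (A1 : 1 <= A) (cutoff : forall x r, 0 < r -> exists phi, [/\ Lam d del phi,
   forall y, 0 <= phi y, forall y, qball d x r y -> phi y = 1 & forall y, ~ qball d x (A * r) y -> phi y = 0]).

Notation mB := (mB d mu).
Notation LP q f := (Lp mu q (f : borel X -> R)).
Notation NR q f := (nrm mu q (f : borel X -> R)).
Notation Lam := (Lam d del).

Notation czpair := (czpair d mu c).

(** [S0] is defined on Hoelder functions only, by a choice of representatives, so it is linear only
    almost everywhere. Two applications of the Riesz representation, to [S0] and then to its
    transpose, give a pair of operators on L^2 adjoint to each other. *)
Lemma czpair_of_form (eps C0 : R) (k : X -> X -> R) (tau : (X -> R) -> (X -> R) -> R) (S0 : (X -> R) -> X -> R) (CL : R) :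
  0 < eps -> 0 < C0 -> (forall x y, x <> y -> `|k x y| <= C0 / mB x (d x y)) ->
  (forall x x' y, x <> y -> c * d x x' <= d x y ->
    `|k x y - k x' y| + `|k y x - k y x'| <= (d x x' / d x y) `^ eps * (C0 / mB x (d x y))) ->
  0 <= CL ->
  (forall f, Lam f -> [/\ LP 2 (S0 f), NR 2 (S0 f) <= CL * NR 2 f & forall g, Lam g -> tau f g = \int[mu]_y (S0 f y * g y)]) ->
  (forall a f f' g, Lam f -> Lam f' -> Lam g -> tau (fun x => a * f x + f' x) g = a * tau f g + tau f' g) ->
  (forall f g, Lam f -> Lam g ->
    (exists2 eta : R, 0 < eta & forall x y, f x <> 0 -> g y <> 0 -> eta <= d x y) ->
    tau f g = \int[mu]_x ((\int[mu]_y (k x y * f y)) * g x)) ->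
  exists S S', czpair S S' /\ forall f g, Lam f -> Lam g -> tau f g = \int[mu]_y (S f y * g y).
Proof.
move=> eps0 C00 ksize kreg CL0 HS0 tlin tassoc.
have L2 f : Lam f -> LP 2 f by exact: (Lam_Lp hX del0 (le12 R)).
have tau0 g : Lam g -> tau (fun=> 0) g = 0.
  move=> lg; have := tlin 1 _ _ g (Lam0 d del) (Lam0 d del) lg.
  rewrite mulr0 addr0 mul1r.
  by rewrite -{1}[tau _ g]addr0 => /addrI.
have tlin2 a b f f' g : Lam f -> Lam f' -> Lam g ->
    tau (fun x => a * f x + b * f' x) g = a * tau f g + b * tau f' g.
  move=> lf lf' lg; rewrite tlin//; last exact: LamZ.
  have := tlin b _ _ g lf' (Lam0 d del) lg; rewrite tau0// addr0 => <-.
  by congr (_ + tau _ _); apply/funext => x; rewrite addr0.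
have Llin a b f f' : Lam f -> Lam f' -> Lam (fun x => a * f x + b * f' x).
  by move=> lf lf'; exact: (LamD hX (LamZ a lf) (LamZ b lf')).
have S0lin a b f f' : Lam f -> Lam f' ->
    {ae mu, forall x, S0 (fun y => a * f y + b * f' y) x = a * S0 f x + b * S0 f' x}.
  move=> lf lf'; have [s1 _ t1] := HS0 _ (Llin a b _ _ lf lf').
  have [s2 _ t2] := HS0 _ lf; have [s3 _ t3] := HS0 _ lf'.
  apply: (ae_eq_Lam hX del0 A1 cutoff (le12 R) s1 (L2lin a b s2 s3)) => phi lphi.
  have := ip_lin a b s2 s3 (L2 _ lphi); rewrite /ip => ->.
  by rewrite -t1// -t2// -t3// tlin2.
have int_ae (u v w : X -> R) : LP 2 u -> LP 2 v -> LP 2 w -> {ae mu, forall x, u x = v x} ->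
    \int[mu]_x (u x * w x) = \int[mu]_x (v x * w x).
  move=> u2 v2 w2 uv; have [d2 _] := LpB (le12 R) u2 v2.
  have uv0 : {ae mu, forall x, u x - v x = 0}.
    by apply: (@filterS (borel X) _ (ae_filter_ringOfSetsType mu) _ _ _ uv) => x ->; rewrite subrr.
  have [z2 z0] := nrm0 mu (lt02 R).
  have [_ nd] := nrm_ae_eq (lt02 R) z2 d2.1 uv0; rewrite z0 in nd.
  apply/eqP; rewrite -subr_eq0 -normr_le0 -(int1B (hoelder_L2 u2 w2) (hoelder_L2 v2 w2)).
  under eq_Rintegral do rewrite -mulrBl.
  by apply: le_trans (ip_le d2 w2) _; rewrite nd mul0r.
(* The functional is defined on Hoelder functions alone, a subspace to which [riesz] applies as it
   stands. *)
have /choice[S' HS'] g : exists u, LP 2 g -> [/\ LP 2 u, NR 2 u <= CL * NR 2 g &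
    forall f, Lam f -> \int[mu]_y (S0 f y * g y) = ip mu (u : borel X -> R) f].
  have [g2|] := pselect (LP 2 g); last by exists g.
  have M0 : 0 <= CL * NR 2 g by rewrite mulr_ge0 ?nrm_ge0.
  have [u h] := @riesz _ _ _ mu Lam (fun f => \int[mu]_y (S0 f y * g y)) (CL * NR 2 g) (Lam0 d del) L2 Llin
    (fun a b f f' lf lf' => etrans (int_ae _ _ _ (let: And3 h _ _ := HS0 _ (Llin a b _ _ lf lf') in h)
      (L2lin a b (let: And3 h _ _ := HS0 _ lf in h) (let: And3 h _ _ := HS0 _ lf' in h)) g2 (S0lin a b _ _ lf lf'))
      (ip_lin a b (let: And3 h _ _ := HS0 _ lf in h) (let: And3 h _ _ := HS0 _ lf' in h) g2)) M0
    (fun f lf => let: And3 h1 h2 _ := HS0 _ lf in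
       le_trans (le_trans (ip_le h1 g2) (ler_wpM2r (nrm_ge0 _ _ _) h2))
         (eq_ind_r (fun z => z <= _) (lexx _) (mulrAC CL _ _))).
  by exists u.
have S'lin a b g g' : LP 2 g -> LP 2 g' ->
    {ae mu, forall x, S' (fun y => a * g y + b * g' y) x = a * S' g x + b * S' g' x}.
  move=> g2 g'2; have [s1 _ t1] := HS' _ (L2lin a b g2 g'2).
  have [s2 _ t2] := HS' _ g2; have [s3 _ t3] := HS' _ g'2.
  apply: (ae_eq_Lam hX del0 A1 cutoff (le12 R) s1 (L2lin a b s2 s3)) => phi lphi.
  have := ip_lin a b s2 s3 (L2 _ lphi); rewrite {1}/ip => ->.
  have [s0 _ _] := HS0 _ lphi.
  have := t1 _ lphi; rewrite {1}/ip => <-; rewrite -t2// -t3//.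
  rewrite intC; have := ip_lin a b g2 g'2 s0; rewrite /ip => ->.
  by rewrite !(intC mu _ (S0 phi)).
(* Transposing again, now with all of L^2 as domain: this is the extension of [S0] by continuity. *)
have /choice[S HS] f : exists u, LP 2 f -> [/\ LP 2 u, NR 2 u <= CL * NR 2 f &
    forall g, LP 2 g -> \int[mu]_y (f y * S' g y) = ip mu (u : borel X -> R) g].
  have [f2|] := pselect (LP 2 f); last by exists f.
  have M0 : 0 <= CL * NR 2 f by rewrite mulr_ge0 ?nrm_ge0.
  have z2 := (nrm0 mu (lt02 R)).1.
  have lin a b g g' : LP 2 g -> LP 2 g' -> \int[mu]_y (f y * S' (fun x => a * g x + b * g' x) y) =
      a * \int[mu]_y (f y * S' g y) + b * \int[mu]_y (f y * S' g' y).
    move=> g2 g'2; have [s1 _ _] := HS' _ (L2lin a b g2 g'2).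
    have [s2 _ _] := HS' _ g2; have [s3 _ _] := HS' _ g'2.
    rewrite intC (int_ae _ _ _ s1 (L2lin a b s2 s3) f2 (S'lin a b _ _ g2 g'2)).
    by rewrite (intC mu f) (intC mu f); exact: (ip_lin a b s2 s3 f2).
  have bd g : LP 2 g -> `|\int[mu]_y (f y * S' g y)| <= CL * NR 2 f * NR 2 g.
    move=> g2; have [s2 sn _] := HS' _ g2; apply: (le_trans (ip_le f2 s2)).
    by rewrite mulrC mulrAC ler_wpM2r ?nrm_ge0.
  have [u h] := @riesz _ _ _ mu (fun g => LP 2 g) (fun g => \int[mu]_y (f y * S' g y)) (CL * NR 2 f) z2 (fun g h => h)
    (fun a b f f' h h' => L2lin a b h h') lin M0 bd.
  by exists u.
have adj f g : LP 2 f -> LP 2 g -> \int[mu]_y (S f y * g y) = \int[mu]_y (f y * S' g y).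
  by move=> f2 g2; have [_ _ ->] := HS _ f2.
have Stau f g : Lam f -> Lam g -> tau f g = \int[mu]_y (S f y * g y).
  move=> lf lg; have [_ _ ->//] := HS0 _ lf; rewrite adj; [|exact: L2..].
  by have [_ _ ->//] := HS' _ (L2 _ lg); rewrite ipC.
exists S, S'; split => //.
apply: (cz_pair_op hX del0 A1 cutoff eps0 C00 ksize kreg CL0 _ _ adj Stau tassoc).
  by move=> f f2; have [] := HS _ f2.
by move=> f f2; have [] := HS' _ f2.
Qed.

End operators_of_forms.

(** * Complex operators *)

Section complex_numbers.
Variable R : realType.
Implicit Types a b z : R[i].
Notation Re := complex.Re.
Notation Im := complex.Im.

Lemma cmplxP a b : Re a = Re b -> Im a = Im b -> a = b.
Proof. by case: a b => [? ?] [? ?] /= -> ->. Qed.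
Lemma cReD a b : Re (a + b) = Re a + Re b. Proof. by case: a b => [? ?] [? ?]. Qed.
Lemma cImD a b : Im (a + b) = Im a + Im b. Proof. by case: a b => [? ?] [? ?]. Qed.
Lemma cReB a b : Re (a - b) = Re a - Re b. Proof. by case: a b => [? ?] [? ?]. Qed.
Lemma cImB a b : Im (a - b) = Im a - Im b. Proof. by case: a b => [? ?] [? ?]. Qed.
Lemma cReM a b : Re (a * b) = Re a * Re b - Im a * Im b. Proof. by case: a b => [? ?] [? ?]. Qed.
Lemma cImM a b : Im (a * b) = Re a * Im b + Im a * Re b. Proof. by case: a b => [? ?] [? ?]. Qed.

Lemma normcE2 z : Normc.normc z = Num.sqrt (Re z ^+ 2 + Im z ^+ 2). Proof. by case: z. Qed.
Lemma normc_ge0 z : 0 <= Normc.normc z. Proof. by rewrite normcE2 sqrtr_ge0. Qed.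
Lemma Re_le_normc z : `|Re z| <= Normc.normc z.
Proof. by rewrite normcE2 -sqrtr_sqr ler_wsqrtr// lerDl sqr_ge0. Qed.
Lemma Im_le_normc z : `|Im z| <= Normc.normc z.
Proof. by rewrite normcE2 -sqrtr_sqr ler_wsqrtr// lerDr sqr_ge0. Qed.
Lemma normc_le z : Normc.normc z <= `|Re z| + `|Im z|.
Proof.
rewrite normcE2 -[leRHS]ger0_norm ?addr_ge0// -sqrtr_sqr ler_wsqrtr//.
by rewrite sqrrD !real_normK ?num_real// lerD2r lerDl mulrn_wge0// mulr_ge0.
Qed.
Lemma normc_real (t : R) : Normc.normc (t%:C)%C = `|t|.
Proof. by rewrite normcE2 /= expr0n /= addr0 sqrtr_sqr. Qed.

End complex_numbers.

Section complex_functions.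
Context (dd : measure_display) (T : measurableType dd) (R : realType) (mu : {measure set T -> \bar R}).
Notation Re := complex.Re.
Notation Im := complex.Im.
Implicit Types f g : T -> R[i].
Notation RE f := (fun x => Re (f x)).
Notation IM f := (fun x => Im (f x)).

Definition CN p f := nrm mu p (fun x => Normc.normc (f x)).

Lemma measurable_normc f : cmeasurable setT f -> measurable_fun setT (fun x => Normc.normc (f x)).
Proof.
move=> [m1 m2]; rewrite (_ : (fun x => _) = fun x => (Re (f x) ^+ 2 + Im (f x) ^+ 2) `^ 2^-1); last first.
  by apply/funext => x; rewrite normcE2 powR12_sqrt// addr_ge0// sqr_ge0.
apply: (measurableT_comp (measurable_powR _)).
by apply: measurable_funD; exact: measurable_funX.
Qed.

Lemma inLpP p f : 1 <= p -> inLp mu p f <-> Lp mu p (RE f) /\ Lp mu p (IM f).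
Proof.
move=> p1; have p0 : 0 < p := lt_le_trans ltr01 p1; split.
  move=> [mf h]; have [m1 m2] := mf; have nf : Lp mu p (fun x => Normc.normc (f x)) by split => //; exact: measurable_normc.
  split; apply: (Lp_le p0 _ nf _).1 => // x; rewrite [leRHS]ger0_norm ?normc_ge0//; [exact: Re_le_normc|exact: Im_le_normc].
move=> [f1 f2]; have mf : cmeasurable setT f by split; [case: f1|case: f2].
have L0 (g : T -> R) : Lp mu p g -> Lp mu p (fun x => `|g x|).
  move=> gp; apply: (Lp_le p0 _ gp _).1 => [|x]; first by apply: measurableT_comp => //; case: gp.
  by rewrite normr_id.
have [s1 _] := LpD p1 (L0 _ f1) (L0 _ f2).
have [[_ h] _] := Lp_le p0 (measurable_normc mf) s1 (fun x => le_trans (le_trans (eq_ind_r (fun z => z <= _) (lexx _) (ger0_norm (normc_ge0 (f x)))) (normc_le (f x))) (ler_norm _)).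
by split.
Qed.

Lemma CN_Lp p f : 1 <= p -> inLp mu p f -> Lp mu p (fun x => Normc.normc (f x)).
Proof. by move=> p1 [mf h]; split => //; exact: measurable_normc. Qed.

Lemma cLnormE p f : inLp mu p f -> cLnorm mu p f = (CN p f)%:E.
Proof. by move=> [mf h]; rewrite /CN nrm_fin//; split => //; exact: measurable_normc. Qed.

Lemma CN_ge0 p f : 0 <= CN p f. Proof. exact: nrm_ge0. Qed.

Lemma CN_Re p f : 1 <= p -> inLp mu p f -> nrm mu p (RE f) <= CN p f.
Proof.
move=> p1 fp; have p0 : 0 < p := lt_le_trans ltr01 p1.
apply: (Lp_le p0 _ (CN_Lp p1 fp) _).2 => [|x]; first by case: fp => -[].
by rewrite [leRHS]ger0_norm ?normc_ge0//; exact: Re_le_normc.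
Qed.

Lemma CN_Im p f : 1 <= p -> inLp mu p f -> nrm mu p (IM f) <= CN p f.
Proof.
move=> p1 fp; have p0 : 0 < p := lt_le_trans ltr01 p1.
apply: (Lp_le p0 _ (CN_Lp p1 fp) _).2 => [|x]; first by case: fp => -[].
by rewrite [leRHS]ger0_norm ?normc_ge0//; exact: Im_le_normc.
Qed.

Lemma CN_le p f : 1 <= p -> Lp mu p (RE f) -> Lp mu p (IM f) ->
  inLp mu p f /\ CN p f <= nrm mu p (RE f) + nrm mu p (IM f).
Proof.
move=> p1 f1 f2; have p0 : 0 < p := lt_le_trans ltr01 p1.
have fp : inLp mu p f by apply/inLpP.
have L0 (g : T -> R) : Lp mu p g -> Lp mu p (fun x => `|g x|) /\ nrm mu p (fun x => `|g x|) <= nrm mu p g.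
  move=> gp; apply: (Lp_le p0 _ gp _) => [|x]; first by apply: measurableT_comp => //; case: gp.
  by rewrite normr_id.
have [[a1 a2] [b1 b2]] := (L0 _ f1, L0 _ f2).
have [s1 s2] := LpD p1 a1 b1.
split=> //; apply: le_trans (lerD a2 b2); apply: le_trans s2.
apply: (Lp_le p0 _ s1 _).2 => [|x]; first by have [h _] := CN_Lp p1 fp.
by rewrite ger0_norm ?normc_ge0// [leRHS]ger0_norm ?addr_ge0//; exact: normc_le.
Qed.

Lemma inLp_ae p f g : 1 <= p -> inLp mu p g -> cmeasurable setT f -> {ae mu, forall x, f x = g x} ->
  inLp mu p f /\ CN p f = CN p g.
Proof.
move=> p1 gp mf fg; have p0 : 0 < p := lt_le_trans ltr01 p1.
have [h1 h2] := @nrm_ae_eq _ _ _ mu p (fun x => Normc.normc (f x)) _ p0 (CN_Lp p1 gp) (measurable_normc mf)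
  (filterS (fun x (e : f x = g x) => congr1 (@Normc.normc R) e) fg).
by split => //; split => //; case: h1.
Qed.

Lemma cintegrableP f : cintegrable mu setT f <-> Lp mu 1 (RE f) /\ Lp mu 1 (IM f).
Proof. by split=> -[h1 h2]; split; apply/Lp1P. Qed.

Lemma cint_ae f g : {ae mu, forall x, f x = g x} -> cmeasurable setT f -> cmeasurable setT g -> cint mu setT f = cint mu setT g.
Proof.
move=> fg [m1 m2] [n1 n2]; rewrite /cint; congr (_ +i* _)%C; rewrite /Rintegral; congr fine.
  apply: ae_eq_integral => //; [exact/measurable_EFinP|exact/measurable_EFinP|].
  by apply: filterS fg => x -> _.
apply: ae_eq_integral => //; [exact/measurable_EFinP|exact/measurable_EFinP|].
by apply: filterS fg => x -> _.
Qed.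

Lemma cintegrable_ae f g : {ae mu, forall x, f x = g x} -> cmeasurable setT f -> cintegrable mu setT g -> cintegrable mu setT f.
Proof.
move=> fg [m1 m2] /cintegrableP[g1 g2]; apply/cintegrableP; split.
  by have [] := nrm_ae_eq ltr01 g1 m1 (filterS (fun x (e : f x = g x) => congr1 (@complex.Re R) e) fg).
by have [] := nrm_ae_eq ltr01 g2 m2 (filterS (fun x (e : f x = g x) => congr1 (@complex.Im R) e) fg).
Qed.

(** Complex functions are decomposed as ii f + g with f, g real, the shape in which the linearity of
    forms is stated. *)
Definition ii : R[i] := (0 +i* 1)%C.

Lemma Re_ii (a b : R[i]) : Re (ii * a + b) = Re b - Im a.
Proof. by case: a b => [? ?] [? ?] /=; ring. Qed.
Lemma Im_ii (a b : R[i]) : Im (ii * a + b) = Im b + Re a.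
Proof. by case: a b => [? ?] [? ?] /=; ring. Qed.

Lemma cint_ii f g : cintegrable mu setT f -> cintegrable mu setT g ->
  cintegrable mu setT (fun x => ii * f x + g x) /\
  cint mu setT (fun x => ii * f x + g x) = ii * cint mu setT f + cint mu setT g.
Proof.
move=> /cintegrableP[f1 f2] /cintegrableP[g1 g2]; split.
  apply/cintegrableP; split; under eq_fun do rewrite ?Re_ii ?Im_ii.
    by have [] := LpB (lexx 1) g1 f2.
  by have [] := LpD (lexx 1) g2 f1.
apply: cmplxP; rewrite ?Re_ii ?Im_ii /=.
  by rewrite -(int1B g1 f2); apply: eq_Rintegral => x _; rewrite Re_ii.
by rewrite -(int1D g2 f1); apply: eq_Rintegral => x _; rewrite Im_ii.
Qed.

End complex_functions.

Section linear_combinations.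
Context (dd : measure_display) (T : measurableType dd) (R : realType) (mu : {measure set T -> \bar R}).

(** The real and the imaginary part of the image of a product b h each have four terms, with
    coefficients 1 or -1. *)
Lemma Lp_lin4 p (a1 a2 a3 a4 : R) (f1 f2 f3 f4 : T -> R) : 1 <= p ->
  `|a1| = 1 -> `|a2| = 1 -> `|a3| = 1 -> `|a4| = 1 ->
  Lp mu p f1 -> Lp mu p f2 -> Lp mu p f3 -> Lp mu p f4 ->
  Lp mu p (fun x => a1 * f1 x + a2 * f2 x + (a3 * f3 x + a4 * f4 x)) /\
  nrm mu p (fun x => a1 * f1 x + a2 * f2 x + (a3 * f3 x + a4 * f4 x)) <=
    nrm mu p f1 + nrm mu p f2 + (nrm mu p f3 + nrm mu p f4).
Proof.
move=> p1 e1 e2 e3 e4 h1 h2 h3 h4; have p0 : 0 < p := lt_le_trans ltr01 p1.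
have [g1 n1] := LpZ a1 p0 h1; have [g2 n2] := LpZ a2 p0 h2.
have [g3 n3] := LpZ a3 p0 h3; have [g4 n4] := LpZ a4 p0 h4.
rewrite e1 mul1r in n1; rewrite e2 mul1r in n2; rewrite e3 mul1r in n3; rewrite e4 mul1r in n4.
have [k1 l1] := LpD p1 g1 g2; have [k2 l2] := LpD p1 g3 g4; have [k3 l3] := LpD p1 k1 k2.
split => //; apply: (le_trans l3); rewrite -n1 -n2 -n3 -n4; exact: lerD.
Qed.

Lemma int_lin4 (a1 a2 a3 a4 : R) (f1 f2 f3 f4 : T -> R) :
  Lp mu 1 f1 -> Lp mu 1 f2 -> Lp mu 1 f3 -> Lp mu 1 f4 ->
  \int[mu]_x (a1 * f1 x + a2 * f2 x + (a3 * f3 x + a4 * f4 x)) =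
  a1 * \int[mu]_x f1 x + a2 * \int[mu]_x f2 x + (a3 * \int[mu]_x f3 x + a4 * \int[mu]_x f4 x).
Proof.
move=> h1 h2 h3 h4; have z a f (h : Lp mu 1 f) := (LpZ a ltr01 h).1.
rewrite -!int1Z// int1D; [|by have [] := LpD (lexx 1) (z a1 _ h1) (z a2 _ h2)|by have [] := LpD (lexx 1) (z a3 _ h3) (z a4 _ h4)].
by rewrite !int1D//; exact: z.
Qed.

End linear_combinations.

Section real_parts.
Context (R : realType) (X : ptopologicalType) (d : X -> X -> R)
  (mu : {measure set (borel X) -> \bar R}) (c K : R) (hX : homogeneous_type d mu c K).
Context (q0 : R) (q0_gt1 : 1 < q0)
  (growth : forall x t j, 0 < t -> q0 ^+ j * mB d mu x t <= mB d mu x (c ^+ j * t)).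
Notation B := (qball d).
Notation mB := (mB d mu).
Notation mfun f := (measurable_fun setT (f : borel X -> _)).
Notation LP q f := (Lp mu q (f : borel X -> R)).
Notation NR q f := (nrm mu q (f : borel X -> R)).

Notation czpair := (czpair d mu c).
Notation Re := complex.Re.
Notation Im := complex.Im.

Definition emb (f : X -> R) : X -> R[i] := fun x => (f x)%:C%C.

Lemma Re_emb (z : R[i]) f x : Re (z * emb f x) = Re z * f x.
Proof. by rewrite cReM /emb /= mulr0 subr0. Qed.
Lemma Im_emb (z : R[i]) f x : Im (z * emb f x) = Im z * f x.
Proof. by rewrite cImM /emb /= mulr0 add0r. Qed.

Lemma cint_emb (u : X -> R[i]) f : cint mu setT (fun x : borel X => u x * emb f x) =
  ((\int[mu]_y (Re (u y) * f y)) +i* (\int[mu]_y (Im (u y) * f y)))%C.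
Proof. by rewrite /cint; congr (_ +i* _)%C; apply: eq_Rintegral => y _; rewrite (Re_emb, Im_emb). Qed.

Lemma Lambda_emb del f : Lam d del f -> Lambda d del (emb f).
Proof.
move=> [[M hM] [x [r [r0 fs]]]]; split.
  exists M => y z; have -> : emb f y - emb f z = ((f y - f z)%:C)%C.
    by apply: cmplxP; rewrite ?cReB ?cImB /= ?subr0.
  by rewrite normc_real.
by exists x, r => y h; rewrite /emb fs.
Qed.

Lemma Lambda_parts del f : Lambda d del f -> Lam d del (fun x => Re (f x)) /\ Lam d del (fun x => Im (f x)).
Proof.
move=> [[M hM] [x [r fs]]].
have fs' y : ~ B x (Num.max r 1) y -> f y = 0.
  by move=> h; apply: fs; rewrite /qball/= => h'; apply: h; rewrite /qball/= lt_max h'.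
have r0 : 0 < Num.max r 1 by rewrite lt_max ltr01 orbT.
split; (split; [exists M => y z; apply: le_trans (hM y z)|exists x, (Num.max r 1); split => // y /fs' ->//]).
  by rewrite -cReB Re_le_normc.
by rewrite -cImB Im_le_normc.
Qed.

Lemma Lambda_split (f : X -> R[i]) : f = fun x => ii R * emb (fun x => Im (f x)) x + emb (fun x => Re (f x)) x.
Proof. by apply/funext => x; apply: cmplxP; rewrite ?Re_ii ?Im_ii /= ?subr0 ?add0r. Qed.

(** The positive part of the real part of a complex cut-off function is again Hoelder, and still
    equals 1 on the ball and 0 off the dilate. *)
Lemma real_cutoffs del : admissible_exponent d del -> exists2 A : R, 1 <= A &
  forall x r, 0 < r -> exists phi, [/\ Lam d del phi, forall y, 0 <= phi y, forall y, B x r y -> phi y = 1 &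
    forall y, ~ B x (A * r) y -> phi y = 0].
Proof.
move=> [del0 [A A1 H]]; exists A => // x r r0; have [phi lphi [h1 h0]] := H x r r0.
have [l1 _] := Lambda_parts lphi.
exists (fun y => Num.max (Re (phi y)) 0); split.
- by apply: (Lam_lip (g := fun t => Num.max t 0) _ _ l1); [exact: max_lip|rewrite maxxx].
- by move=> y; rewrite le_max lexx orbT.
- by move=> y /h1 ->; rewrite /= max_l.
- by move=> y /h0 ->; rewrite /= maxxx.
Qed.

(** On real functions, the real and the imaginary part of the form have the kernels Re k and Im k,
    which satisfy the estimates of k with the same constants. The absolute value of [CL] is taken
    because its sign is not prescribed. *)
Lemma cz_real_parts del T : calderon_zygmund d mu c del T -> bounded_L2 d mu del T ->
  exists S1 S1' S2 S2', [/\ czpair S1 S1', czpair S2 S2' & forall f g, Lam d del f -> Lam d del g ->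
    T (emb f) (emb g) = ((\int[mu]_y (S1 f y * g y)) +i* (\int[mu]_y (S2 f y * g y)))%C].
Proof.
move=> [adm [blin _] _ [k [[eps [C0 [eps0 C00 ks kr]]] _ assoc]]] [CL HL].
have [A A1 cutoff] := real_cutoffs adm; have del0 : 0 < del by case: adm.
have n2 := le12 R.
have /choice[u Hu] (f : X -> R) : exists u, Lam d del f -> [/\ inLp mu 2 u, represents d mu del T (emb f) u &
    CN mu 2 u <= `|CL| * NR 2 f].
  have [lf|] := pselect (Lam d del f); last by exists (fun=> 0).
  have [u [u1 u2 u3]] := HL _ (Lambda_emb lf); exists u => _; split => //.
  have f2 := Lam_Lp hX del0 n2 lf.
  have f2' : inLp mu 2 (emb f) by apply/inLpP => //; split => //=; exact: (nrm0 mu (lt02 R)).1.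
  rewrite -lee_fin -cLnormE//; apply: (le_trans u3); rewrite EFinM cLnormE//.
  apply: (@le_trans _ _ (`|CL|%:E * (CN mu 2 (emb f))%:E)%E).
    by rewrite lee_wpmul2r ?lee_fin ?CN_ge0// ler_norm.
  rewrite -!EFinM lee_fin ler_wpM2l//.
  have [_ h] := @CN_le _ _ _ mu 2 (emb f) n2 f2 (nrm0 mu (lt02 R)).1; apply: (le_trans h).
  by rewrite (nrm0 mu (lt02 R)).2 addr0.
have CL0 : 0 <= `|CL| by [].
have embL a f f' : (fun x => (a%:C)%C * emb f x + emb f' x) = emb (fun x => a * f x + f' x).
  by apply/funext => x; apply: cmplxP; rewrite ?cReD ?cImD ?cReM ?cImM /=; ring.
have Tlin a f f' g : Lam d del f -> Lam d del f' -> Lam d del g ->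
    T (emb (fun x => a * f x + f' x)) (emb g) = (a%:C)%C * T (emb f) (emb g) + T (emb f') (emb g).
  by move=> lf lf' lg; rewrite -embL; apply: blin; exact: Lambda_emb.
have Tl1 a f f' g : Lam d del f -> Lam d del f' -> Lam d del g ->
    Re (T (emb (fun x => a * f x + f' x)) (emb g)) = a * Re (T (emb f) (emb g)) + Re (T (emb f') (emb g)).
  by move=> lf lf' lg; rewrite Tlin// cReD cReM /= mul0r subr0.
have Tl2 a f f' g : Lam d del f -> Lam d del f' -> Lam d del g ->
    Im (T (emb (fun x => a * f x + f' x)) (emb g)) = a * Im (T (emb f) (emb g)) + Im (T (emb f') (emb g)).
  by move=> lf lf' lg; rewrite Tlin// cImD cImM /= mul0r addr0.
have Trep f g : Lam d del f -> Lam d del g ->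
    T (emb f) (emb g) = ((\int[mu]_y (Re (u f y) * g y)) +i* (\int[mu]_y (Im (u f y) * g y)))%C.
  move=> lf lg; have [_ rep _] := Hu f lf; rewrite (rep _ (Lambda_emb lg)).
  exact: cint_emb.
have Tass f g : Lam d del f -> Lam d del g ->
    (exists2 eta : R, 0 < eta & forall x y, f x <> 0 -> g y <> 0 -> eta <= d x y) ->
    T (emb f) (emb g) = ((\int[mu]_x ((\int[mu]_y (Re (k x y) * f y)) * g x)) +i*
                         (\int[mu]_x ((\int[mu]_y (Im (k x y) * f y)) * g x)))%C.
  move=> lf lg [eta e0 h]; rewrite (assoc _ _ (Lambda_emb lf) (Lambda_emb lg)); last first.
    exists eta => // x y fx gy; apply: h => h0; [apply: fx|apply: gy]; by rewrite /emb h0.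
  rewrite cint_emb; congr (_ +i* _)%C; apply: eq_Rintegral => x _; congr (_ * _);
  by apply: eq_Rintegral => y _; rewrite (Re_emb, Im_emb).
have [S1 [S1' [p1 t1]]] := @czpair_of_form R X d mu c K hX del del0 A A1 cutoff eps C0 (fun x y => Re (k x y))
  (fun f g => Re (T (emb f) (emb g))) (fun f x => Re (u f x)) `|CL| eps0 C00
  (fun x y xy => le_trans (Re_le_normc _) (ks x y xy))
  (fun x x' y xy cxy => le_trans (lerD (eq_ind _ (fun z => `|z| <= _) (Re_le_normc _) _ (cReB _ _))
     (eq_ind _ (fun z => `|z| <= _) (Re_le_normc _) _ (cReB _ _))) (kr x x' y xy cxy)) CL0
  (fun f lf => let: And3 h1 h2 h3 := Hu f lf in And3 (((inLpP mu _ n2).1 h1).1) (le_trans (CN_Re n2 h1) h3)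
     (fun g lg => congr1 (@complex.Re R) (Trep f g lf lg)))
  Tl1
  (fun f g lf lg h => congr1 (@complex.Re R) (Tass f g lf lg h)).
have [S2 [S2' [p2 t2]]] := @czpair_of_form R X d mu c K hX del del0 A A1 cutoff eps C0 (fun x y => Im (k x y))
  (fun f g => Im (T (emb f) (emb g))) (fun f x => Im (u f x)) `|CL| eps0 C00
  (fun x y xy => le_trans (Im_le_normc _) (ks x y xy))
  (fun x x' y xy cxy => le_trans (lerD (eq_ind _ (fun z => `|z| <= _) (Im_le_normc _) _ (cImB _ _))
     (eq_ind _ (fun z => `|z| <= _) (Im_le_normc _) _ (cImB _ _))) (kr x x' y xy cxy)) CL0
  (fun f lf => let: And3 h1 h2 h3 := Hu f lf in And3 (((inLpP mu _ n2).1 h1).2) (le_trans (CN_Im n2 h1) h3)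
     (fun g lg => congr1 (@complex.Im R) (Trep f g lf lg)))
  Tl2
  (fun f g lf lg h => congr1 (@complex.Im R) (Tass f g lf lg h)).
exists S1, S1', S2, S2'; split => // f g lf lg; apply: cmplxP => /=; [exact: t1|exact: t2].
Qed.

Lemma loc_L1 del (u phi : X -> R) : 0 < del -> Lam d del phi -> (forall x r, 0 < r -> LP 1 (fun y => u y * \1_(B x r) y)) ->
  LP 1 (fun y => u y * phi y).
Proof.
move=> del0 lphi hu; have [M HM] := Lam_bounded hX del0 lphi; have [[z [s [s0 hs]]] _] := Lam_test_fun hX del0 lphi.
have mphi := Lam_measurable hX del0 lphi.
have [h _] := Lp_bdM ltr01 mphi HM (hu z s s0).
suff -> : (fun y => u y * phi y) = (fun y => phi y * (u y * \1_(B z s) y)) by [].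
by rewrite (mulr_supp u hs); apply/funext => y; rewrite mulrC.
Qed.

Lemma ae_eq_loc del A (u v : X -> R) : 0 < del -> 1 <= A -> (forall x r, 0 < r -> exists phi, [/\ Lam d del phi,
   forall y, 0 <= phi y, forall y, B x r y -> phi y = 1 & forall y, ~ B x (A * r) y -> phi y = 0]) ->
  mfun u -> mfun v -> (forall x r, 0 < r -> LP 1 (fun y => u y * \1_(B x r) y)) ->
  (forall x r, 0 < r -> LP 1 (fun y => v y * \1_(B x r) y)) ->
  (forall phi, Lam d del phi -> \int[mu]_y (u y * phi y) = \int[mu]_y (v y * phi y)) -> {ae mu, forall y, u y = v y}.
Proof.
move=> del0 A1 cutoff mu_ mv lu lv H.
have h : {ae mu, forall y, u y - v y = 0}.
  apply: (Lam_separates hX del0 A1 cutoff) => [|x r r0|phi lphi]; first exact: measurable_funB.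
    apply: (ball_integrable hX) => //; have [w _] := LpB (lexx 1) (lu x r r0) (lv x r r0).
    by under eq_fun do rewrite mulrBl.
  under eq_Rintegral do rewrite mulrBl.
  by rewrite int1B ?H ?subrr//; exact: (loc_L1 del0 lphi).
by apply: (@filterS (borel X) _ (ae_filter_ringOfSetsType mu) _ _ _ h) => y /eqP; rewrite subr_eq0 => /eqP.
Qed.

Lemma loc_measurable (u : X -> R) : (forall x r, 0 < r -> mu.-integrable (B x r) (EFin \o u)) -> mfun u.
Proof.
move=> H; have E : \bigcup_n (ballN d n : set (borel X)) = setT.
  by apply/seteqP; split => // x _; have [N HN] := ballN_cover hX x; exists N => //; exact: HN.
rewrite -E; apply/measurable_fun_bigcup => n; first exact: (measurable_ballN hX).
by have /integrableP[/measurable_EFinP h _] := H point n.+1%:R (ltr0Sn _ _).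
Qed.

End real_parts.

(** * Images described by their integrals against Hoelder functions *)

Section weak_formulation.
Context (R : realType) (X : ptopologicalType) (d : X -> X -> R)
  (mu : {measure set (borel X) -> \bar R}) (c K : R) (hX : homogeneous_type d mu c K).
Context (q0 : R) (q0_gt1 : 1 < q0)
  (growth : forall x t j, 0 < t -> q0 ^+ j * mB d mu x t <= mB d mu x (c ^+ j * t)).
Notation mB := (mB d mu).
Notation test_fun := (test_fun d mu).
Notation LP q f := (Lp mu q (f : borel X -> R)).
Notation bmoR := (bmoR d mu).

Notation czpair := (czpair d mu c).
Notation Re := complex.Re.
Notation Im := complex.Im.

Context (del : R) (T : cz_form R X) (hT : calderon_zygmund d mu c del T).
Notation Lam := (Lam d del).
Context (A : R) (A1 : 1 <= A) (cutoff : forall x r, 0 < r -> exists phi, [/\ Lam phi,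
   forall y, 0 <= phi y, forall y, qball d x r y -> phi y = 1 & forall y, ~ qball d x (A * r) y -> phi y = 0]).
Variables (S1 S1' S2 S2' : (X -> R) -> X -> R).
Hypothesis hS1 : czpair S1 S1'.
Hypothesis hS2 : czpair S2 S2'.
Hypothesis HT : forall f g, Lam f -> Lam g ->
  T (emb f) (emb g) = ((\int[mu]_y (S1 f y * g y)) +i* (\int[mu]_y (S2 f y * g y)))%C.

Let del0 : 0 < del. Proof. by case: hT => -[]. Qed.
Let Tlin1 (a : R[i]) f f' g : Lambda d del f -> Lambda d del f' -> Lambda d del g ->
  T (fun x => a * f x + f' x) g = a * T f g + T f' g.
Proof. by case: hT => _ [h _] _ _; exact: h. Qed.
Let Tlin2 (a : R[i]) f g g' : Lambda d del f -> Lambda d del g -> Lambda d del g' ->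
  T f (fun x => a * g x + g' x) = a * T f g + T f g'.
Proof. by case: hT => _ [_ h] _ _; exact: h. Qed.
Let L2 f : Lam f -> LP 2 f. Proof. exact: (Lam_Lp hX del0 (le12 R)). Qed.
Let S'2 S S' f : czpair S S' -> LP 2 f -> LP 2 (S' f).
Proof. by move=> h f2; have [C _ H] := cz_L2 (cz_r h); case: (H f f2). Qed.

(** The transpose of T applied to a real function; [PR] and [PI] are the real and imaginary parts of
    the integral of F against it. *)
Definition transp (phi : X -> R) : X -> R[i] := fun x => (S1' phi x +i* S2' phi x)%C.
Definition PR (F : X -> R[i]) phi := \int[mu]_y (Re (F y) * S1' phi y - Im (F y) * S2' phi y).
Definition PI (F : X -> R[i]) phi := \int[mu]_y (Re (F y) * S2' phi y + Im (F y) * S1' phi y).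

Lemma cint_TT F phi : cint mu setT (fun x : borel X => F x * transp phi x) = (PR F phi +i* PI F phi)%C.
Proof.
by rewrite /cint; congr (_ +i* _)%C; apply: eq_Rintegral => y _; rewrite (cReM, cImM).
Qed.

Lemma inLp_TT phi : LP 2 phi -> inLp mu 2 (transp phi).
Proof. by move=> p2; apply/(inLpP mu _ (le12 R)); split; [exact: (S'2 hS1)|exact: (S'2 hS2)]. Qed.

Lemma T_emb f phi : Lambda d del f -> Lam phi ->
  cintegrable mu setT (fun x : borel X => f x * transp phi x) /\ T f (emb phi) = cint mu setT (fun x : borel X => f x * transp phi x).
Proof.
move=> lf lphi; have [lr li] := Lambda_parts lf; have p2 := L2 lphi; have r2 := L2 lr; have i2 := L2 li.
have s1 := S'2 hS1 p2; have s2 := S'2 hS2 p2.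
have a1 := hoelder_L2 r2 s1; have a2 := hoelder_L2 i2 s2; have a3 := hoelder_L2 r2 s2; have a4 := hoelder_L2 i2 s1.
split.
  apply/cintegrableP; split; [under eq_fun do rewrite cReM|under eq_fun do rewrite cImM] => /=.
    by have [] := LpB (lexx 1) a1 a2.
  by have [] := LpD (lexx 1) a3 a4.
rewrite cint_TT [in LHS](Lambda_split f) Tlin1; [|exact: Lambda_emb..].
rewrite !HT// /PR /PI (int1B a1 a2) (int1D a3 a4).
by apply: cmplxP; rewrite ?Re_ii ?Im_ii /= !(cz_adj hS1, cz_adj hS2).
Qed.

Definition transpc (phi : X -> R[i]) : X -> R[i] := fun x => ii R * transp (fun y => Im (phi y)) x + transp (fun y => Re (phi y)) x.

Lemma transpose_TTc phi : Lambda d del phi -> transpose_image d mu del T phi (transpc phi).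
Proof.
move=> lphi; have [lr li] := Lambda_parts lphi; split.
  have [[a1 a2] [b1 b2]] := ((inLpP mu (transp (fun y => Re (phi y))) (le12 R)).1 (inLp_TT (L2 lr)),
    (inLpP mu (transp (fun y => Im (phi y))) (le12 R)).1 (inLp_TT (L2 li))).
  apply/(inLpP mu _ (le12 R)); split; [under eq_fun do rewrite Re_ii|under eq_fun do rewrite Im_ii].
    by have [] := LpB (le12 R) a1 b2.
  by have [] := LpD (le12 R) a2 b1.
move=> f lf; have [ir er] := T_emb lf lr; have [ii_ ei] := T_emb lf li.
rewrite [in LHS](Lambda_split phi) Tlin2//; [|exact: Lambda_emb..].
have [_ h] := cint_ii ii_ ir; rewrite er ei -h; congr cint; apply/funext => x.
by rewrite /transpc; ring.
Qed.

(** [dual_image] only asserts that some transposed image exists; as it is unique up to null sets, it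
    can be computed with [S1'] and [S2']. *)
Lemma transpose_unique phi psi : Lam phi -> transpose_image d mu del T (emb phi) psi ->
  {ae mu, forall x, psi x = transp phi x}.
Proof.
move=> lphi [psi2 H]; have [r2 i2] := (inLpP mu _ (le12 R)).1 psi2; have p2 := L2 lphi.
have key f : Lam f -> \int[mu]_y (S1' phi y * f y) = \int[mu]_y (Re (psi y) * f y) /\
    \int[mu]_y (S2' phi y * f y) = \int[mu]_y (Im (psi y) * f y).
  move=> lf; have := H _ (Lambda_emb lf); rewrite HT// (cz_adj hS1 (L2 lf) p2) (cz_adj hS2 (L2 lf) p2).
  rewrite (intC mu f) (intC mu f); rewrite (_ : (fun x => emb f x * psi x) = fun x => psi x * emb f x) ?cint_emb; last by apply/funext => x; rewrite mulrC.
  by move=> -[-> ->].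
have h1 := ae_eq_Lam hX del0 A1 cutoff (le12 R) (S'2 hS1 p2) r2 (fun f lf => (key f lf).1).
have h2 := ae_eq_Lam hX del0 A1 cutoff (le12 R) (S'2 hS2 p2) i2 (fun f lf => (key f lf).2).
apply: (@filterS2 (borel X) _ (ae_filter_ringOfSetsType mu) _ _ _ _ h1 h2) => y e1 e2.
by apply: cmplxP; rewrite -?e1 -?e2.
Qed.

Lemma dual_weak F u phi : cmeasurable (setT : set (borel X)) F -> dual_image d mu del T F u -> Lam phi ->
  \int[mu]_y (Re (u y) * phi y) = PR F phi /\ \int[mu]_y (Im (u y) * phi y) = PI F phi.
Proof.
move=> [m1 m2] [_ H] lphi; have [psi tpsi [ipsi epsi]] := H _ (Lambda_emb lphi).
have hae := transpose_unique lphi tpsi.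
have E : cint mu setT (fun x : borel X => F x * psi x) = cint mu setT (fun x : borel X => F x * transp phi x).
  apply: cint_ae.
  - by apply: (@filterS (borel X) _ (ae_filter_ringOfSetsType mu) _ _ _ hae) => y ->.
  - by move/cintegrableP: ipsi => [[] ? _ [] ? _].
  - have p2 := L2 lphi; have [s1 _] := S'2 hS1 p2; have [s2 _] := S'2 hS2 p2.
    split; [under eq_fun do rewrite cReM|under eq_fun do rewrite cImM].
      by apply: measurable_funB; apply: measurable_funM.
    by apply: measurable_funD; apply: measurable_funM.
by move: epsi; rewrite E cint_TT cint_emb => -[-> ->].
Qed.

(** The identity holds along the approximating sequence, and passes to the limit because the
    transposes send [phi] into the dual Lebesgue space. *)
Lemma Lp_image_weak p f u phi : 1 < p -> Lp_image d mu p del T f u -> Lam phi ->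
  \int[mu]_y (Re (u y) * phi y) = PR f phi /\ \int[mu]_y (Im (u y) * phi y) = PI f phi.
Proof.
move=> p1 [fp up [fn [un [lfn rep cf cu]]]] lphi.
have p1' := ltW p1; have [e1 e2 e3] := dual_exp p1.
have bphi := Lam_test_fun hX del0 lphi; have pq := bphi.2 _ (ltW e1).
have [C1 _ H1] := cz_Lp hX q0_gt1 growth del0 A1 cutoff (czpair_sym hS1) e1.
have [C2 _ H2] := cz_Lp hX q0_gt1 growth del0 A1 cutoff (czpair_sym hS2) e1.
have [s1 _] := H1 _ bphi; have [s2 _] := H2 _ bphi.
have fnp n : inLp mu p (fn n).
  have [lr li] := Lambda_parts (lfn n); apply/(inLpP mu _ p1'); split; exact: (Lam_Lp hX del0 p1').
have unp n := (rep n).1.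
have parts (v : nat -> X -> R[i]) (w : X -> R[i]) : (forall n, inLp mu p (v n)) -> inLp mu p w ->
    cLnorm mu p (fun x => v n x - w x) @[n --> \oo] --> 0%E ->
    cvgLp mu p (fun n x => Re (v n x)) (fun x => Re (w x)) /\ cvgLp mu p (fun n x => Im (v n x)) (fun x => Im (w x)).
  move=> vp wp cv.
  have dp n : inLp mu p (fun x => v n x - w x).
    have [a1 a2] := (inLpP mu _ p1').1 (vp n); have [b1 b2] := (inLpP mu _ p1').1 wp.
    apply/(inLpP mu _ p1'); split; [under eq_fun do rewrite cReB|under eq_fun do rewrite cImB].
      by have [] := LpB p1' a1 b1.
    by have [] := LpB p1' a2 b2.
  have cn e : 0 < e -> exists N, forall n, (N <= n)%N -> CN mu p (fun x => v n x - w x) <= e.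
    move=> ep; have /fine_cvgP[_ /cvgrPdist_le/(_ e ep)[N _ HN]] := cv.
    exists N => n nN; have := HN n nN; by rewrite /= sub0r normrN cLnormE//= ger0_norm// CN_ge0.
  have nr n := CN_Re p1' (dp n); have ni n := CN_Im p1' (dp n).
  have rB n : (fun x => Re (v n x - w x)) = fun x => Re (v n x) - Re (w x) by apply/funext => x; rewrite cReB.
  have iB n : (fun x => Im (v n x - w x)) = fun x => Im (v n x) - Im (w x) by apply/funext => x; rewrite cImB.
  split=> e ep; have [N HN] := cn e ep; exists N => k /HN hk; apply: le_trans hk.
    by have := nr k; rewrite rB.
  by have := ni k; rewrite iB.
have [cfr cfi] := parts _ _ fnp fp cf; have [cur cui] := parts _ _ unp up cu.
have frp n := ((inLpP mu _ p1').1 (fnp n)).1; have fip n := ((inLpP mu _ p1').1 (fnp n)).2.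
have [frl fil] := (inLpP mu _ p1').1 fp.
have urp n := ((inLpP mu _ p1').1 (unp n)).1; have uip n := ((inLpP mu _ p1').1 (unp n)).2.
have [url uil] := (inLpP mu _ p1').1 up.
have a1 := pair_cvg p1' e3 e2 frp frl s1 cfr; have a2 := pair_cvg p1' e3 e2 fip fil s2 cfi.
have a3 := pair_cvg p1' e3 e2 frp frl s2 cfr; have a4 := pair_cvg p1' e3 e2 fip fil s1 cfi.
have b1 := pair_cvg p1' e3 e2 urp url pq cur; have b2 := pair_cvg p1' e3 e2 uip uil pq cui.
have hh g h := (hoelder_Lp (lt_trans ltr01 p1) e3 e2 : Lp mu p g -> Lp mu _ h -> _).
have En n : \int[mu]_y (Re (un n y) * phi y) = \int[mu]_y (Re (fn n y) * S1' phi y) - \int[mu]_y (Im (fn n y) * S2' phi y) /\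
    \int[mu]_y (Im (un n y) * phi y) = \int[mu]_y (Re (fn n y) * S2' phi y) + \int[mu]_y (Im (fn n y) * S1' phi y).
  have [_ e] := T_emb (lfn n) lphi; have := (rep n).2 _ (Lambda_emb lphi); rewrite e cint_TT cint_emb => -[r1 r2].
  rewrite -int1B; [|by have [] := hh _ _ (frp n) s1|by have [] := hh _ _ (fip n) s2].
  rewrite -int1D; [|by have [] := hh _ _ (frp n) s2|by have [] := hh _ _ (fip n) s1].
  by rewrite -/(PR (fn n) phi) -/(PI (fn n) phi) r1 r2.
rewrite /PR /PI.
rewrite int1B; [|by have [] := hh _ _ frl s1|by have [] := hh _ _ fil s2].
rewrite int1D; [|by have [] := hh _ _ frl s2|by have [] := hh _ _ fil s1].
rewrite (funext (fun n => (En n).1)) in b1; rewrite (funext (fun n => (En n).2)) in b2.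
split; [exact: (@cvg_unique _ (@Rhausdorff R) _ _ _ _ b1 (cvgB a1 a2))|].
exact: (@cvg_unique _ (@Rhausdorff R) _ _ _ _ b2 (cvgD a3 a4)).
Qed.

(** The real extension applied to [S1] and [S2], to both parts of h and to both parts of b. Eight
    commutators result, four for each operator, whence the factor 4. *)
Lemma complex_extension p : 1 < p -> exists2 C, 0 < C & forall h, inLp mu p h -> exists V,
  [/\ inLp mu p V, CN mu p V <= C * CN mu p h,
   forall phi, test_fun phi -> \int[mu]_y (Re (V y) * phi y) = PR h phi /\ \int[mu]_y (Im (V y) * phi y) = PI h phi &
   forall (b : X -> R[i]) beta, 0 < beta -> bmoR beta (fun y => Re (b y)) -> bmoR beta (fun y => Im (b y)) ->
   exists W, [/\ inLp mu p W, CN mu p W <= C * beta * CN mu p h &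
   forall phi, test_fun phi -> [/\
     [/\ LP 1 (fun y => Re (b y * h y) * S1' phi y), LP 1 (fun y => Im (b y * h y) * S2' phi y),
         LP 1 (fun y => Re (b y * h y) * S2' phi y) & LP 1 (fun y => Im (b y * h y) * S1' phi y)],
     LP 1 (fun y => Re (b y * V y) * phi y), LP 1 (fun y => Im (b y * V y) * phi y),
     \int[mu]_y (Re (W y) * phi y) = PR (fun y => b y * h y) phi - \int[mu]_y (Re (b y * V y) * phi y) &
     \int[mu]_y (Im (W y) * phi y) = PI (fun y => b y * h y) phi - \int[mu]_y (Im (b y * V y) * phi y)]]].
Proof.
move=> p1; have p1' := ltW p1; have p0 : 0 < p := lt_trans ltr01 p1; have [e1 e2 e3] := dual_exp p1.
have [C1 C10 H1] := cz_extension hX q0_gt1 growth del0 A1 cutoff hS1 p1.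
have [C2 C20 H2] := cz_extension hX q0_gt1 growth del0 A1 cutoff hS2 p1.
have [D1 _ G1] := cz_Lp hX q0_gt1 growth del0 A1 cutoff (czpair_sym hS1) e1.
have [D2 _ G2] := cz_Lp hX q0_gt1 growth del0 A1 cutoff (czpair_sym hS2) e1.
exists (4 * (C1 + C2)); first by rewrite mulr_gt0// addr_gt0.
move=> h hp; have [hr hi] := (inLpP mu _ p1').1 hp.
have nr := CN_Re p1' hp; have ni := CN_Im p1' hp; set N := CN mu p h in nr ni *.
have N0 : 0 <= N := CN_ge0 _ _ _.
have [v1r [l1r n1r w1r W1r]] := H1 _ hr; have [v1i [l1i n1i w1i W1i]] := H1 _ hi.
have [v2r [l2r n2r w2r W2r]] := H2 _ hr; have [v2i [l2i n2i w2i W2i]] := H2 _ hi.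
have o1 : `|1 : R| = 1 by rewrite normr1.
have om : `|- 1 : R| = 1 by rewrite normrN normr1.
pose V y := ((v1r y - v2i y) +i* (v2r y + v1i y))%C.
have [a1 a2] := LpB p1' l1r l2i; have [b1 b2] := LpD p1' l2r l1i.
have [Vp Vn] := @CN_le _ _ _ mu p V p1' a1 b1.
have bdn (C x y : R) : 0 < C -> x <= C * y -> y <= N -> x <= C * N.
  by move=> C0 xy yN; apply: (le_trans xy); rewrite ler_wpM2l// ltW.
have hh g k := (hoelder_Lp p0 e3 e2 : Lp mu p g -> Lp mu _ k -> _).
exists V; split => //.
- apply: (le_trans Vn); apply: (le_trans (lerD a2 b2)).
  have := bdn _ _ _ C10 n1r nr; have := bdn _ _ _ C10 n1i ni; have := bdn _ _ _ C20 n2r nr; have := bdn _ _ _ C20 n2i ni.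
  have : 0 <= C1 * N by rewrite mulr_ge0// ltW.
  have : 0 <= C2 * N by rewrite mulr_ge0// ltW.
  lra.
- move=> phi bphi; have pq := bphi.2 _ (ltW e1); have [s1 _] := G1 _ bphi; have [s2 _] := G2 _ bphi.
  rewrite /PR /PI (int1B (hh _ _ hr s1).1 (hh _ _ hi s2).1) (int1D (hh _ _ hr s2).1 (hh _ _ hi s1).1).
  rewrite -w1r// -w1i// -w2r// -w2i// -(int1B (hh _ _ l1r pq).1 (hh _ _ l2i pq).1) -(int1D (hh _ _ l2r pq).1 (hh _ _ l1i pq).1).
  by split; apply: eq_Rintegral => y _ /=; [rewrite mulrBl|rewrite mulrDl].
move=> b beta beta0 hb1 hb2.
(* In the names, the first digit is the operator [S1] or [S2], the letter is the real or imaginary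
   part of h, the last digit the real (1) or imaginary (2) part of b. *)
have [x1r1 [k1r1 m1r1 q1r1]] := W1r _ _ beta0 hb1; have [x1r2 [k1r2 m1r2 q1r2]] := W1r _ _ beta0 hb2.
have [x1i1 [k1i1 m1i1 q1i1]] := W1i _ _ beta0 hb1; have [x1i2 [k1i2 m1i2 q1i2]] := W1i _ _ beta0 hb2.
have [x2r1 [k2r1 m2r1 q2r1]] := W2r _ _ beta0 hb1; have [x2r2 [k2r2 m2r2 q2r2]] := W2r _ _ beta0 hb2.
have [x2i1 [k2i1 m2i1 q2i1]] := W2i _ _ beta0 hb1; have [x2i2 [k2i2 m2i2 q2i2]] := W2i _ _ beta0 hb2.
pose Wr y := 1 * x1r1 y + (- 1) * x1i2 y + ((- 1) * x2i1 y + (- 1) * x2r2 y).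
pose Wi y := 1 * x2r1 y + (- 1) * x2i2 y + (1 * x1i1 y + 1 * x1r2 y).
have [Wr1 Wr2] := Lp_lin4 p1' o1 om om om k1r1 k1i2 k2i1 k2r2.
have [Wi1 Wi2] := Lp_lin4 p1' o1 om o1 o1 k2r1 k2i2 k1i1 k1r2.
have [Wp Wn] := @CN_le _ _ _ mu p (fun y => (Wr y +i* Wi y)%C) p1' Wr1 Wi1.
exists (fun y => (Wr y +i* Wi y)%C); split => //.
  apply: (le_trans Wn); apply: (le_trans (lerD Wr2 Wi2)).
  have cb1 : 0 < C1 * beta by rewrite mulr_gt0.
  have cb2 : 0 < C2 * beta by rewrite mulr_gt0.
  have := bdn _ _ _ cb1 m1r1 nr; have := bdn _ _ _ cb1 m1r2 nr; have := bdn _ _ _ cb1 m1i1 ni; have := bdn _ _ _ cb1 m1i2 ni.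
  have := bdn _ _ _ cb2 m2r1 nr; have := bdn _ _ _ cb2 m2r2 nr; have := bdn _ _ _ cb2 m2i1 ni; have := bdn _ _ _ cb2 m2i2 ni.
  lra.
move=> phi bphi; have pq := bphi.2 _ (ltW e1).
have [f1r1 g1r1 t1r1] := q1r1 _ bphi; have [f1r2 g1r2 t1r2] := q1r2 _ bphi.
have [f1i1 g1i1 t1i1] := q1i1 _ bphi; have [f1i2 g1i2 t1i2] := q1i2 _ bphi.
have [f2r1 g2r1 t2r1] := q2r1 _ bphi; have [f2r2 g2r2 t2r2] := q2r2 _ bphi.
have [f2i1 g2i1 t2i1] := q2i1 _ bphi; have [f2i2 g2i2 t2i2] := q2i2 _ bphi.
have L1 f := (hh f phi ^~ pq).
have ER : (fun y => Re (b y * h y) * S1' phi y - Im (b y * h y) * S2' phi y) =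
   fun y => 1 * (Re (b y) * Re (h y) * S1' phi y) + (- 1) * (Im (b y) * Im (h y) * S1' phi y) +
     ((- 1) * (Re (b y) * Im (h y) * S2' phi y) + (- 1) * (Im (b y) * Re (h y) * S2' phi y)).
  by apply/funext => y; rewrite cReM cImM; ring.
have EI : (fun y => Re (b y * h y) * S2' phi y + Im (b y * h y) * S1' phi y) =
   fun y => 1 * (Re (b y) * Re (h y) * S2' phi y) + (- 1) * (Im (b y) * Im (h y) * S2' phi y) +
     (1 * (Re (b y) * Im (h y) * S1' phi y) + 1 * (Im (b y) * Re (h y) * S1' phi y)).
  by apply/funext => y; rewrite cReM cImM; ring.
have VR : (fun y => Re (b y * V y) * phi y) =
   fun y => 1 * (Re (b y) * v1r y * phi y) + (- 1) * (Im (b y) * v1i y * phi y) +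
     ((- 1) * (Re (b y) * v2i y * phi y) + (- 1) * (Im (b y) * v2r y * phi y)).
  by apply/funext => y; rewrite cReM /=; ring.
have VI : (fun y => Im (b y * V y) * phi y) =
   fun y => 1 * (Re (b y) * v2r y * phi y) + (- 1) * (Im (b y) * v2i y * phi y) +
     (1 * (Re (b y) * v1i y * phi y) + 1 * (Im (b y) * v1r y * phi y)).
  by apply/funext => y; rewrite cImM /=; ring.
have n1 := lexx (1 : R).
have WR : (fun y => Wr y * phi y) = fun y => 1 * (x1r1 y * phi y) + (- 1) * (x1i2 y * phi y) +
     ((- 1) * (x2i1 y * phi y) + (- 1) * (x2r2 y * phi y)) by apply/funext => y; rewrite /Wr; ring.
have WI : (fun y => Wi y * phi y) = fun y => 1 * (x2r1 y * phi y) + (- 1) * (x2i2 y * phi y) +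
     (1 * (x1i1 y * phi y) + 1 * (x1r2 y * phi y)) by apply/funext => y; rewrite /Wi; ring.
split.
- split.
  + rewrite (_ : (fun y => _) = fun y => Re (b y) * Re (h y) * S1' phi y - Im (b y) * Im (h y) * S1' phi y); last first.
      by apply/funext => y; rewrite cReM mulrBl.
    by have [] := LpB n1 f1r1 f1i2.
  + rewrite (_ : (fun y => _) = fun y => Re (b y) * Im (h y) * S2' phi y + Im (b y) * Re (h y) * S2' phi y); last first.
      by apply/funext => y; rewrite cImM mulrDl.
    by have [] := LpD n1 f2i1 f2r2.
  + rewrite (_ : (fun y => _) = fun y => Re (b y) * Re (h y) * S2' phi y - Im (b y) * Im (h y) * S2' phi y); last first.
      by apply/funext => y; rewrite cReM mulrBl.
    by have [] := LpB n1 f2r1 f2i2.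
  + rewrite (_ : (fun y => _) = fun y => Re (b y) * Im (h y) * S1' phi y + Im (b y) * Re (h y) * S1' phi y); last first.
      by apply/funext => y; rewrite cImM mulrDl.
    by have [] := LpD n1 f1i1 f1r2.
- by rewrite VR; have [] := Lp_lin4 n1 o1 om om om g1r1 g1i2 g2i1 g2r2.
- by rewrite VI; have [] := Lp_lin4 n1 o1 om o1 o1 g2r1 g2i2 g1i1 g1r2.
- rewrite /PR ER VR /= WR.
  rewrite (int_lin4 _ _ _ _ (L1 _ k1r1).1 (L1 _ k1i2).1 (L1 _ k2i1).1 (L1 _ k2r2).1).
  rewrite (int_lin4 _ _ _ _ f1r1 f1i2 f2i1 f2r2) (int_lin4 _ _ _ _ g1r1 g1i2 g2i1 g2r2).
  by rewrite t1r1 t1i2 t2i1 t2r2; ring.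
- rewrite /PI EI VI /= WI.
  rewrite (int_lin4 _ _ _ _ (L1 _ k2r1).1 (L1 _ k2i2).1 (L1 _ k1i1).1 (L1 _ k1r2).1).
  rewrite (int_lin4 _ _ _ _ f2r1 f2i2 f1i1 f1r2) (int_lin4 _ _ _ _ g2r1 g2i2 g1i1 g1r2).
  by rewrite t2r1 t2i2 t1i1 t1r2; ring.
Qed.

End weak_formulation.

Section complex_scaling.
Context (dd : measure_display) (T : measurableType dd) (R : realType) (mu : {measure set T -> \bar R}).

Lemma inLpZ p (t : R) (f : T -> R[i]) : 1 <= p -> 0 <= t -> inLp mu p f ->
  inLp mu p (fun x => (t%:C)%C * f x) /\ CN mu p (fun x => (t%:C)%C * f x) = t * CN mu p f.
Proof.
move=> p1 t0 fp; have p0 : 0 < p := lt_le_trans ltr01 p1; have [f1 f2] := (inLpP mu _ p1).1 fp; split.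
  apply/(inLpP mu _ p1); split; [under eq_fun do rewrite cReM /= mul0r subr0|under eq_fun do rewrite cImM /= mul0r addr0].
    by have [] := LpZ t p0 f1.
  by have [] := LpZ t p0 f2.
have [_ h] := LpZ t p0 (CN_Lp p1 fp); rewrite (ger0_norm t0) in h; rewrite -h; congr nrm; apply/funext => x.
by rewrite Normc.normcM normc_real ger0_norm.
Qed.

Lemma cintZ (t : R) (F : T -> R[i]) : cintegrable mu setT F ->
  cint mu setT (fun x => (t%:C)%C * F x) = (t%:C)%C * cint mu setT F.
Proof.
move=> /cintegrableP[f1 f2]; apply: cmplxP; rewrite ?cReM ?cImM /= mul0r ?subr0 ?addr0 -int1Z//.
  by apply: eq_Rintegral => x _; rewrite cReM /= mul0r subr0.
by apply: eq_Rintegral => x _; rewrite cImM /= mul0r addr0.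
Qed.

End complex_scaling.

(** * Uniqueness of images, and the case of zero operator norm *)

Section dual_images.
Context (R : realType) (X : ptopologicalType) (d : X -> X -> R)
  (mu : {measure set (borel X) -> \bar R}) (c K : R) (hX : homogeneous_type d mu c K).
Context (q0 : R) (q0_gt1 : 1 < q0)
  (growth : forall x t j, 0 < t -> q0 ^+ j * mB d mu x t <= mB d mu x (c ^+ j * t)).
Notation B := (qball d).
Notation mB := (mB d mu).
Notation mfun f := (measurable_fun setT (f : borel X -> _)).
Notation test_fun := (test_fun d mu).
Notation LP q f := (Lp mu q (f : borel X -> R)).
Notation NR q f := (nrm mu q (f : borel X -> R)).
Notation bmoR := (bmoR d mu).

Notation czpair := (czpair d mu c).
Notation Re := complex.Re.
Notation Im := complex.Im.

Context (del : R) (T : cz_form R X) (hT : calderon_zygmund d mu c del T).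
Notation Lam := (Lam d del).
Context (A : R) (A1 : 1 <= A) (cutoff : forall x r, 0 < r -> exists phi, [/\ Lam phi,
   forall y, 0 <= phi y, forall y, qball d x r y -> phi y = 1 & forall y, ~ qball d x (A * r) y -> phi y = 0]).
Variables (S1 S1' S2 S2' : (X -> R) -> X -> R).
Hypothesis hS1 : czpair S1 S1'.
Hypothesis hS2 : czpair S2 S2'.
Hypothesis HT : forall f g, Lam f -> Lam g ->
  T (emb f) (emb g) = ((\int[mu]_y (S1 f y * g y)) +i* (\int[mu]_y (S2 f y * g y)))%C.

Let del0 : 0 < del. Proof. by case: hT => -[]. Qed.
Let Tlin1 (a : R[i]) f f' g : Lambda d del f -> Lambda d del f' -> Lambda d del g ->
  T (fun x => a * f x + f' x) g = a * T f g + T f' g.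
Proof. by case: hT => _ [h _] _ _; exact: h. Qed.
Let Tlin2 (a : R[i]) f g g' : Lambda d del f -> Lambda d del g -> Lambda d del g' ->
  T f (fun x => a * g x + g' x) = a * T f g + T f g'.
Proof. by case: hT => _ [_ h] _ _; exact: h. Qed.
Let L2 f : Lam f -> LP 2 f. Proof. exact: (Lam_Lp hX del0 (le12 R)). Qed.
Let S'2 S S' f : czpair S S' -> LP 2 f -> LP 2 (S' f).
Proof. by move=> h f2; have [C _ H] := cz_L2 (cz_r h); case: (H f f2). Qed.

Notation TT := (transp S1' S2').
Notation TTc := (transpc S1' S2').
Notation PR := (PR mu S1' S2').
Notation PI := (PI mu S1' S2').

Lemma loc_parts u : loc_integrable d mu u -> [/\ mfun (fun x => Re (u x)), mfun (fun x => Im (u x)),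
  forall x r, 0 < r -> LP 1 (fun y => Re (u y) * \1_(B x r) y) & forall x r, 0 < r -> LP 1 (fun y => Im (u y) * \1_(B x r) y)].
Proof.
move=> hu; have m1 : mfun (fun x => Re (u x)) by apply: (loc_measurable hX) => x r r0; exact: (hu x r r0).1.
have m2 : mfun (fun x => Im (u x)) by apply: (loc_measurable hX) => x r r0; exact: (hu x r r0).2.
by split => // x r r0; apply: (Lp1_ball hX) => //; [exact: (hu x r r0).1|exact: (hu x r r0).2].
Qed.

Lemma ae_cmplx (u v : X -> R[i]) : {ae mu, forall x, Re (u x) = Re (v x)} -> {ae mu, forall x, Im (u x) = Im (v x)} ->
  {ae mu, forall x, u x = v x}.
Proof.
move=> h1 h2; apply: (@filterS2 (borel X) _ (ae_filter_ringOfSetsType mu) _ _ _ _ h1 h2) => y e1 e2.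
exact: cmplxP.
Qed.

Lemma Lp_image_weak_ae p f u v : 1 < p -> Lp_image d mu p del T f u -> inLp mu p v ->
  (forall phi, Lam phi -> \int[mu]_y (Re (v y) * phi y) = PR f phi /\ \int[mu]_y (Im (v y) * phi y) = PI f phi) ->
  {ae mu, forall x, u x = v x}.
Proof.
move=> p1 hu vp hv; have [_ up _] := hu; have p1' := ltW p1.
have [u1 u2] := (inLpP mu _ p1').1 up; have [v1 v2] := (inLpP mu _ p1').1 vp.
have W phi lphi := @Lp_image_weak R X d mu c K hX q0 q0_gt1 growth del T hT A A1 cutoff S1 S1' S2 S2' hS1 hS2 HT p f u phi p1 hu lphi.
apply: ae_cmplx; apply: (ae_eq_Lam hX del0 A1 cutoff p1') => // phi lphi.
  by rewrite (W _ lphi).1 (hv _ lphi).1.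
by rewrite (W _ lphi).2 (hv _ lphi).2.
Qed.

Lemma Lp_image_unique p f u v : 1 < p -> Lp_image d mu p del T f u -> Lp_image d mu p del T f v -> {ae mu, forall x, u x = v x}.
Proof.
move=> p1 hu hv; apply: (Lp_image_weak_ae p1 hu); first by case: hv.
by move=> phi lphi; exact: (@Lp_image_weak R X d mu c K hX q0 q0_gt1 growth del T hT A A1 cutoff S1 S1' S2 S2' hS1 hS2 HT p f v phi p1 hv lphi).
Qed.

Lemma Lp_image_le p : 1 < p -> exists2 C, 0 < C & forall f u, Lp_image d mu p del T f u -> CN mu p u <= C * CN mu p f.
Proof.
move=> p1; have [C C0 H] := @complex_extension R X d mu c K hX q0 q0_gt1 growth del T hT A A1 cutoff S1 S1' S2 S2' hS1 hS2 p p1.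
exists C => // f u hu; have [fp up _] := hu; have [V [Vp Vn Vw _]] := H f fp.
have h := Lp_image_weak_ae p1 hu Vp (fun phi lphi => Vw phi (Lam_test_fun hX del0 lphi)).
by have [_ ->] := inLp_ae (ltW p1) Vp up.1 h.
Qed.

Lemma dual_unique F u v : cmeasurable (setT : set (borel X)) F -> dual_image d mu del T F u -> loc_integrable d mu v ->
  (forall phi, Lam phi -> \int[mu]_y (Re (v y) * phi y) = PR F phi /\ \int[mu]_y (Im (v y) * phi y) = PI F phi) ->
  {ae mu, forall x, u x = v x}.
Proof.
move=> mF hu lv Hv; have [lu _] := hu; have [mu1 mu2 u1 u2] := loc_parts lu; have [mv1 mv2 v1 v2] := loc_parts lv.
have W phi lphi := @dual_weak R X d mu c K hX del T hT A A1 cutoff S1 S1' S2 S2' hS1 hS2 HT F u phi mF hu lphi.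
apply: ae_cmplx; apply: (ae_eq_loc hX del0 A1 cutoff) => // phi lphi.
  by rewrite (W _ lphi).1 (Hv _ lphi).1.
by rewrite (W _ lphi).2 (Hv _ lphi).2.
Qed.

Lemma inLp_loc p u : 1 <= p -> inLp mu p u -> loc_integrable d mu u.
Proof.
move=> p1 up x r r0; have [h1 h2] := (inLpP mu _ p1).1 up.
by split; apply: (ball_integrable hX) => //; exact: (Lp_loc hX _ p1).
Qed.

(** The weak identities identify W + b V as an image of b h, and the only one up to null sets. This
    separates the commutator, which is in L^p, from b V, which in general is not but will disappear
    after summation over j. *)
Lemma dual_summary p : 1 < p -> exists2 C, 0 < C & forall h, inLp mu p h -> exists V, [/\ inLp mu p V,
  forall u, dual_image d mu del T h u -> {ae mu, forall x, u x = V x} &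
  forall (b : X -> R[i]) beta, 0 < beta -> bmoR beta (fun y => Re (b y)) -> bmoR beta (fun y => Im (b y)) ->
  exists W, [/\ inLp mu p W, CN mu p W <= C * beta * CN mu p h,
    dual_image d mu del T (fun y => b y * h y) (fun y => W y + b y * V y) &
    forall u, dual_image d mu del T (fun y => b y * h y) u -> {ae mu, forall x, u x = W x + b x * V x}]].
Proof.
move=> p1; have p1' := ltW p1; have [e1 e2 e3] := dual_exp p1; have p0 : 0 < p := lt_trans ltr01 p1.
have [C C0 H] := @complex_extension R X d mu c K hX q0 q0_gt1 growth del T hT A A1 cutoff S1 S1' S2 S2' hS1 hS2 p p1.
exists C => // h hp; have [V [Vp _ Vw VW]] := H h hp; exists V; split => //.
  move=> u hu; apply: (dual_unique _ hu); [by case: hp|exact: inLp_loc Vp|].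
  by move=> phi lphi; apply: Vw; exact: (Lam_test_fun hX del0 lphi).
move=> b beta beta0 hb1 hb2; have [W [Wp Wn Ww]] := VW b beta beta0 hb1 hb2; exists W.
have [W1 W2] := (inLpP mu _ p1').1 Wp.
set u := fun y => W y + b y * V y.
(* Indicators of balls are test functions; against them the extension lemma shows that b V is
   locally integrable. *)
have BI x r : 0 < r -> test_fun (\1_(B x r)).
  move=> r0; apply: (bounded_test_fun hX (M := 1)).
  - by apply: measurable_indic; exact: (qball_measurable hX).
  - by move=> y; rewrite indicE; case: (_ \in _); rewrite ?normr1// normr0.
  - by exists x, r; split => // y nB; rewrite indicE memNset.
have n1 := lexx (1 : R).
have lu1 x r : 0 < r -> LP 1 (fun y => Re (u y) * \1_(B x r) y).
  move=> r0; have [_ g _ _ _] := Ww _ (BI x r r0); have [] := LpD n1 (Lp_loc hX x p1' r0 W1) g.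
  by rewrite (_ : (fun y => Re (u y) * _) = fun y => Re (W y) * \1_(B x r) y + Re (b y * V y) * \1_(B x r) y)//; apply/funext => y; rewrite /u cReD mulrDl.
have lu2 x r : 0 < r -> LP 1 (fun y => Im (u y) * \1_(B x r) y).
  move=> r0; have [_ _ g _ _] := Ww _ (BI x r r0); have [] := LpD n1 (Lp_loc hX x p1' r0 W2) g.
  by rewrite (_ : (fun y => Im (u y) * _) = fun y => Im (W y) * \1_(B x r) y + Im (b y * V y) * \1_(B x r) y)//; apply/funext => y; rewrite /u cImD mulrDl.
have lu : loc_integrable d mu u by move=> x r r0; split; apply: (ball_integrable hX) => //; [exact: lu1|exact: lu2].
have key phi : Lam phi -> [/\ cintegrable mu setT (fun x : borel X => u x * emb phi x),
    cintegrable mu setT (fun x : borel X => b x * h x * TT phi x),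
    \int[mu]_y (Re (u y) * phi y) = PR (fun y => b y * h y) phi & \int[mu]_y (Im (u y) * phi y) = PI (fun y => b y * h y) phi].
  move=> lphi; have bphi := Lam_test_fun hX del0 lphi; have pq := bphi.2 _ (ltW e1).
  have [[f1 f2 f3 f4] g1 g2 t1 t2] := Ww _ bphi.
  have [w1 _] := hoelder_Lp p0 e3 e2 W1 pq; have [w2 _] := hoelder_Lp p0 e3 e2 W2 pq.
  have E1 : (fun y => Re (u y) * phi y) = fun y => Re (W y) * phi y + Re (b y * V y) * phi y.
    by apply/funext => y; rewrite /u cReD mulrDl.
  have E2 : (fun y => Im (u y) * phi y) = fun y => Im (W y) * phi y + Im (b y * V y) * phi y.
    by apply/funext => y; rewrite /u cImD mulrDl.
  split.
  - apply/cintegrableP; split; [under eq_fun do rewrite Re_emb|under eq_fun do rewrite Im_emb].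
      by rewrite E1; have [] := LpD n1 w1 g1.
    by rewrite E2; have [] := LpD n1 w2 g2.
  - apply/cintegrableP; split; [under eq_fun do rewrite (cReM (b _ * h _))|under eq_fun do rewrite (cImM (b _ * h _))].
      by have [] := LpB n1 f1 f2.
    by have [] := LpD n1 f3 f4.
  - by rewrite E1 int1D// t1 subrK.
  - by rewrite E2 int1D// t2 subrK.
have du : dual_image d mu del T (fun y => b y * h y) u.
  split => // phi lphi; have [lr li] := Lambda_parts lphi.
  exists (TTc phi); first exact: (@transpose_TTc R X d mu c K hX del T hT S1 S1' S2 S2' hS1 hS2 HT).
  have [ur fr er1 er2] := key _ lr; have [ui fi ei1 ei2] := key _ li.
  have [a1 a2] := cint_ii fi fr; have [b1 b2] := cint_ii ui ur.
  have EF : (fun x => b x * h x * TTc phi x) = fun x => ii R * (b x * h x * TT (fun y => Im (phi y)) x) + b x * h x * TT (fun y => Re (phi y)) x.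
    by apply/funext => x; rewrite /transpc; ring.
  have EU : (fun x => u x * phi x) = fun x => ii R * (u x * emb (fun y => Im (phi y)) x) + u x * emb (fun y => Re (phi y)) x.
    by rewrite [in LHS](Lambda_split phi); apply/funext => x; ring.
  rewrite EF EU; split => //; rewrite a2 b2 !cint_emb !cint_TT.
  by rewrite er1 er2 ei1 ei2.
split => // v hv; apply: (dual_unique _ hv lu).
  have [m1 m2] : cmeasurable (setT : set (borel X)) h by case: hp.
  have [n1' _ _] := hb1; have [n2' _ _] := hb2.
  split; [under eq_fun do rewrite cReM|under eq_fun do rewrite cImM].
    by apply: measurable_funB; apply: measurable_funM.
  by apply: measurable_funD; apply: measurable_funM.
by move=> phi lphi; have [_ _ -> ->] := key _ lphi.
Qed.

Lemma cLnorm0 p : 1 <= p -> inLp mu p (fun=> 0 : R[i]) /\ cLnorm mu p (fun=> 0 : R[i]) = 0%E.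
Proof.
move=> p1; have p0 : 0 < p := lt_le_trans ltr01 p1; have [z1 z2] := nrm0 mu p0.
have h : inLp mu p (fun=> 0 : R[i]) by apply/(inLpP mu _ p1).
split => //; rewrite cLnormE// /CN; congr EFin; rewrite -[RHS]z2; congr nrm; apply/funext => x.
exact: Normc.normc0.
Qed.

Lemma Lp_image_emb p f : 1 < p -> Lam f -> Lp_image d mu p del T (emb f) (fun x => (S1 f x +i* S2 f x)%C).
Proof.
move=> p1 lf; have p1' := ltW p1; have p0 : 0 < p := lt_trans ltr01 p1; have bf := Lam_test_fun hX del0 lf.
have [C1 _ H1] := cz_Lp hX q0_gt1 growth del0 A1 cutoff hS1 p1.
have [C2 _ H2] := cz_Lp hX q0_gt1 growth del0 A1 cutoff hS2 p1.
have [s1 _] := H1 _ bf; have [s2 _] := H2 _ bf.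
have fp : inLp mu p (emb f) by apply/(inLpP mu _ p1'); split => /=; [exact: (Lam_Lp hX del0 p1')|exact: (nrm0 mu p0).1].
have up : inLp mu p (fun x => (S1 f x +i* S2 f x)%C) by apply/(inLpP mu _ p1').
have z0 g : cLnorm mu p (fun x : borel X => g x - g x : R[i]) @[n --> \oo] --> 0%E.
  rewrite (_ : (fun x => g x - g x) = fun=> 0); last by apply/funext => x; rewrite subrr.
  by rewrite (cLnorm0 p1').2; exact: cvg_cst.
split => //; exists (fun=> emb f), (fun=> (fun x => (S1 f x +i* S2 f x)%C)).
split => [n|n||]; [exact: Lambda_emb| |exact: z0|exact: z0].
split => // g lg; have [lr li] := Lambda_parts lg.
have [D1 _ G1] := cz_L2 (cz_l hS1); have [D2 _ G2] := cz_L2 (cz_l hS2).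
have [t1 _] := G1 _ (L2 lf); have [t2 _] := G2 _ (L2 lf).
have ie k : Lam k -> cintegrable mu setT (fun x : borel X => (S1 f x +i* S2 f x)%C * emb k x).
  move=> lk; apply/cintegrableP; split; [under eq_fun do rewrite Re_emb|under eq_fun do rewrite Im_emb].
    exact: (hoelder_L2 t1 (L2 lk)).
  exact: (hoelder_L2 t2 (L2 lk)).
have [_ h] := cint_ii (ie _ li) (ie _ lr).
rewrite [in LHS](Lambda_split g) Tlin2//; [|exact: Lambda_emb..].
rewrite (HT lf li) (HT lf lr); rewrite !cint_emb /= in h; rewrite -h; congr cint; apply/funext => x.
by rewrite [in RHS](Lambda_split g); ring.
Qed.

(** The supremum of an empty set would be -oo; the image of the zero function shows that the set is
    not empty. *)
Lemma Lp_opnorm_ge0 p : 1 < p -> (0 <= Lp_opnorm d mu p del T)%E.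
Proof.
move=> p1; have h := Lp_image_emb p1 (Lam0 d del); have [_ [_ u0] _] := h.
apply: (@le_trans _ _ (cLnorm mu p (fun x => (S1 (fun=> 0) x +i* S2 (fun=> 0) x)%C))); first exact: Lnorm_ge0.
apply: ereal_sup_ubound; exists (emb (fun=> 0), fun x => (S1 (fun=> 0) x +i* S2 (fun=> 0) x)%C) => //; split => //=.
by rewrite (_ : emb _ = fun=> 0) ?(cLnorm0 (ltW p1)).2//; exact: lee01.
Qed.

Lemma Lp_imageZ p (t : R) f u : 1 < p -> 0 <= t -> Lp_image d mu p del T f u ->
  Lp_image d mu p del T (fun x => (t%:C)%C * f x) (fun x => (t%:C)%C * u x).
Proof.
move=> p1 t0 [fp up [fn [un [lfn rep cf cu]]]]; have p1' := ltW p1.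
have LZ (w : X -> R[i]) : Lambda d del w -> Lambda d del (fun x => (t%:C)%C * w x).
  move=> [[M HM] [x [r w0]]]; split; last by exists x, r => y /w0 ->; rewrite mulr0.
  exists (t * M) => y z; rewrite -mulrBr Normc.normcM normc_real ger0_norm// -mulrA.
  exact: ler_wpM2l.
have cZ (w : nat -> X -> R[i]) (v : X -> R[i]) : (forall n, inLp mu p (w n)) -> inLp mu p v ->
    cLnorm mu p (fun x => w n x - v x) @[n --> \oo] --> 0%E ->
    cLnorm mu p (fun x => (t%:C)%C * w n x - (t%:C)%C * v x) @[n --> \oo] --> 0%E.
  move=> wp vp cv.
  have dp n : inLp mu p (fun x => w n x - v x).
    have [a1 a2] := (inLpP mu _ p1').1 (wp n); have [b1 b2] := (inLpP mu _ p1').1 vp.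
    apply/(inLpP mu _ p1'); split; [under eq_fun do rewrite cReB|under eq_fun do rewrite cImB].
      by have [] := LpB p1' a1 b1.
    by have [] := LpB p1' a2 b2.
  have := @cvgeZl _ _ _ _ _ (t%:E) isT cv; rewrite mule0; apply: cvg_trans; apply: near_eq_cvg; apply: nearW => n /=.
  have [h1 h2] := inLpZ p1' t0 (dp n).
  rewrite [RHS](_ : _ = cLnorm mu p (fun x => (t%:C)%C * (w n x - v x))); last first.
    by congr cLnorm; apply/funext => x; rewrite mulrBr.
  by rewrite !cLnormE// h2.
have fnp n : inLp mu p (fn n).
  have [lr li] := Lambda_parts (lfn n); apply/(inLpP mu _ p1'); split; exact: (Lam_Lp hX del0 p1').
split; [by have [] := inLpZ p1' t0 fp|by have [] := inLpZ p1' t0 up|].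
exists (fun n x => (t%:C)%C * fn n x), (fun n x => (t%:C)%C * un n x); split.
- by move=> n; exact: LZ.
- move=> n; have [unp rn] := rep n; split; first by have [] := inLpZ p1' t0 unp.
  move=> g lg; have L0' := Lambda_emb (Lam0 d del).
  have T0 : T (emb (fun=> 0)) g = 0.
    have := Tlin1 1 L0' L0' lg; rewrite (_ : (fun x => 1 * emb (fun=> 0) x + emb (fun=> 0) x) = emb (fun=> 0)); last first.
      by apply/funext => x; rewrite mul1r /emb; apply: cmplxP => /=; rewrite addr0.
    by rewrite mul1r -{1}[T _ _]addr0 => /addrI.
  have -> : (fun x => (t%:C)%C * fn n x) = fun x => (t%:C)%C * fn n x + emb (fun=> 0) x.
    by apply/funext => x; rewrite /emb; apply: cmplxP; rewrite ?cReD ?cImD /= addr0.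
  rewrite Tlin1// T0 addr0 rn//.
  have [lr li] := Lambda_parts lg; have [e1 e2 e3] := dual_exp p1; have p0 : 0 < p := lt_trans ltr01 p1.
  have [u1 u2] := (inLpP mu _ p1').1 unp.
  have gr := Lam_Lp hX del0 (ltW e1) lr; have gi := Lam_Lp hX del0 (ltW e1) li.
  rewrite -cintZ; last first.
    apply/cintegrableP; split; [under eq_fun do rewrite cReM|under eq_fun do rewrite cImM].
      by have [] := LpB (lexx 1) (hoelder_Lp p0 e3 e2 u1 gr).1 (hoelder_Lp p0 e3 e2 u2 gi).1.
    by have [] := LpD (lexx 1) (hoelder_Lp p0 e3 e2 u1 gi).1 (hoelder_Lp p0 e3 e2 u2 gr).1.
  by congr cint; apply/funext => x; rewrite mulrA.
- by apply: cZ => // n; case: (rep n).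
- by apply: cZ => // n; case: (rep n).
Qed.

(** The function is divided by its norm plus 1, which is allowed even when the norm is 0 and brings
    it into the unit ball. *)
Lemma Lp_image_opnorm0 p f u : 1 < p -> Lp_opnorm d mu p del T = 0%E -> Lp_image d mu p del T f u -> CN mu p u = 0.
Proof.
move=> p1 op0 hu; have p1' := ltW p1; have [fp up _] := hu; have f0 := CN_ge0 mu p f.
pose t := (CN mu p f + 1)^-1; have t1 : 0 < CN mu p f + 1 by rewrite ltr_wpDl.
have t0 : 0 < t by rewrite invr_gt0.
have [ft ftn] := inLpZ p1' (ltW t0) fp; have [ut utn] := inLpZ p1' (ltW t0) up.
have : (cLnorm mu p (fun x : borel X => (t%:C%C * u x)%R) <= Lp_opnorm d mu p del T)%E.
  apply: ereal_sup_ubound; exists (fun x => (t%:C)%C * f x, fun x => (t%:C)%C * u x) => //=; split => /=.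
    exact: (Lp_imageZ p1 (ltW t0) hu).
  by rewrite cLnormE// ftn lee_fin mulrC ler_pdivrMr// mul1r lerDl.
rewrite op0 cLnormE// utn lee_fin pmulr_rle0// => h.
by apply/eqP; rewrite eq_le h CN_ge0.
Qed.

(** Zero norm on L^p kills [S1] and [S2] on Hoelder functions, hence their transposes by adjunction;
    every transposed image is then 0 almost everywhere, and u is orthogonal to all Hoelder
    functions. *)
Lemma dual_opnorm0 p F u : 1 < p -> Lp_opnorm d mu p del T = 0%E -> dual_image d mu del T F u -> {ae mu, forall x, u x = 0}.
Proof.
move=> p1 op0 hu; have p1' := ltW p1; have p0 : 0 < p := lt_trans ltr01 p1; have [e1 e2 e3] := dual_exp p1.
have z2 := (nrm0 mu (lt02 R)).1.
have S0 f : Lam f -> forall phi, Lam phi -> \int[mu]_y (S1 f y * phi y) = 0 /\ \int[mu]_y (S2 f y * phi y) = 0.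
  move=> lf phi lphi; have hf := Lp_image_emb p1 lf; have := Lp_image_opnorm0 p1 op0 hf.
  have [_ up _] := hf; have [u1 u2] := (inLpP mu _ p1').1 up; have r1 := CN_Re p1' up; have r2 := CN_Im p1' up.
  move=> n0; rewrite n0 /= in r1 r2; have pq := Lam_Lp hX del0 (ltW e1) lphi.
  split; apply/eqP; rewrite -normr_le0.
    apply: (le_trans (hoelder_int p0 e3 e2 u1 pq)); rewrite -[leRHS](mul0r (NR (p / (p - 1)) phi)).
    by apply: ler_wpM2r r1; exact: nrm_ge0.
  apply: (le_trans (hoelder_int p0 e3 e2 u2 pq)); rewrite -[leRHS](mul0r (NR (p / (p - 1)) phi)).
  by apply: ler_wpM2r r2; exact: nrm_ge0.
have Sz S S' phi : czpair S S' -> (forall f, Lam f -> \int[mu]_y (S f y * phi y) = 0) -> Lam phi -> {ae mu, forall y, S' phi y = 0}.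
  move=> h H lphi; apply: (ae_eq_Lam hX del0 A1 cutoff (le12 R) (S'2 h (L2 lphi)) z2) => f lf.
  rewrite intC -(cz_adj h (L2 lf) (L2 lphi)) H// (_ : (fun y : borel X => 0 * f y) = fun=> 0).
    by rewrite /Rintegral integral0.
  by apply/funext => y; rewrite mul0r.
have [lu HD] := hu; have [mu1 mu2 u1 u2] := loc_parts lu.
have key phi : Lam phi -> \int[mu]_y (Re (u y) * phi y) = 0 /\ \int[mu]_y (Im (u y) * phi y) = 0.
  move=> lphi; have [psi tpsi [ipsi]] := HD _ (Lambda_emb lphi).
  have h1 := @transpose_unique R X d mu c K hX del T hT A A1 cutoff S1 S1' S2 S2' hS1 hS2 HT phi psi lphi tpsi.
  have h2 := Sz _ _ phi hS1 (fun f lf => (S0 f lf phi lphi).1) lphi.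
  have h3 := Sz _ _ phi hS2 (fun f lf => (S0 f lf phi lphi).2) lphi.
  have h4 : {ae mu, forall x : borel X, F x * psi x = 0}.
    have h23 := @filterS2 (borel X) _ (ae_filter_ringOfSetsType mu) _ _ _ (fun x a b => conj a b) h2 h3.
    apply: (@filterS2 (borel X) _ (ae_filter_ringOfSetsType mu) _ _ _ _ h1 h23) => x -> [e e'].
    by rewrite /transp e e' (_ : (0 +i* 0)%C = 0)// mulr0.
  rewrite cint_emb (@cint_ae _ _ _ mu _ (fun=> 0) h4); last 2 first.
  - by move/cintegrableP: ipsi => [[] ? _ [] ? _].
  - by split; exact: measurable_cst.
  by rewrite /cint /Rintegral !integral0 => -[-> ->].
have zl x r : 0 < r -> LP 1 (fun y => (0 : R) * \1_(B x r) y).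
  by move=> r0; have [] := nrm_indic hX x 0 ltr01 r0.
have z0 (phi : X -> R) : \int[mu]_y (0 * phi y) = 0.
  by rewrite (_ : (fun y : borel X => 0 * phi y) = fun=> 0) ?/Rintegral ?integral0//; apply/funext => y; rewrite mul0r.
apply: ae_cmplx; apply: (ae_eq_loc hX del0 A1 cutoff (v := fun=> 0)) => // phi lphi; rewrite z0.
  exact: (key _ lphi).1.
exact: (key _ lphi).2.
Qed.

End dual_images.

Section summary.
Context (R : realType) (X : ptopologicalType) (d : X -> X -> R)
  (mu : {measure set (borel X) -> \bar R}) (c K : R) (hX : homogeneous_type d mu c K).
Context (q0 : R) (q0_gt1 : 1 < q0)
  (growth : forall x t j, 0 < t -> q0 ^+ j * mB d mu x t <= mB d mu x (c ^+ j * t)).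
Notation Re := complex.Re.
Notation Im := complex.Im.

(* In [cb_dual], [V] is the image of [h], and [W] the commutator of the operator and [b] applied to [h]. *)
Record cz_bounds (p del : R) (T : cz_form R X) (C : R) : Prop := {
  cb_image_le : forall f u, Lp_image d mu p del T f u -> CN mu p (u : borel X -> R[i]) <= C * CN mu p (f : borel X -> R[i]);
  cb_image_unique : forall f u v, Lp_image d mu p del T f u -> Lp_image d mu p del T f v ->
    {ae mu, forall x, u x = v x};
  cb_opnorm_ge0 : (0 <= Lp_opnorm d mu p del T)%E;
  cb_image_opnorm0 : Lp_opnorm d mu p del T = 0%E -> forall f u, Lp_image d mu p del T f u ->
    CN mu p (u : borel X -> R[i]) = 0;
  cb_dual_opnorm0 : Lp_opnorm d mu p del T = 0%E -> forall F u, dual_image d mu del T F u ->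
    {ae mu, forall x, u x = 0};
  cb_dual : forall h, inLp mu p h -> exists V, [/\ inLp mu p V,
    forall u, dual_image d mu del T h u -> {ae mu, forall x, u x = V x} &
    forall (b : X -> R[i]) beta, 0 < beta -> bmoR d mu beta (fun y => Re (b y)) -> bmoR d mu beta (fun y => Im (b y)) ->
    exists W, [/\ inLp mu p W, CN mu p W <= C * beta * CN mu p h,
      dual_image d mu del T (fun y => b y * h y) (fun y => W y + b y * V y) &
      forall u, dual_image d mu del T (fun y => b y * h y) u -> {ae mu, forall x, u x = W x + b x * V x}]] }.

Lemma cz_bounds_exist p del T : 1 < p -> calderon_zygmund d mu c del T -> bounded_L2 d mu del T ->
  exists2 C, 0 < C & cz_bounds p del T C.
Proof.
move=> p1 hT hT2; have [A A1 cutoff] : exists2 A, 1 <= A & forall x r, 0 < r -> exists phi, [/\ Lam d del phi,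
   forall y, 0 <= phi y, forall y, qball d x r y -> phi y = 1 & forall y, ~ qball d x (A * r) y -> phi y = 0].
  by case: hT => adm _ _ _; exact: real_cutoffs.
have [S1 [S1' [S2 [S2' [h1 h2 HT]]]]] := cz_real_parts hX hT hT2.
have [C1 C10 H1] := Lp_image_le hX q0_gt1 growth hT A1 cutoff h1 h2 HT p1.
have [C2 C20 H2] := dual_summary hX q0_gt1 growth hT A1 cutoff h1 h2 HT p1.
exists (C1 + C2); first by rewrite addr_gt0.
split.
- by move=> f u hu; apply: (le_trans (H1 f u hu)); rewrite ler_wpM2r ?CN_ge0// lerDl ltW.
- by move=> f u v; exact: (Lp_image_unique hX q0_gt1 growth hT A1 cutoff h1 h2 HT p1).
- exact: (Lp_opnorm_ge0 hX q0_gt1 growth hT A1 cutoff h1 h2 HT p1).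
- by move=> op0 f u; exact: (Lp_image_opnorm0 hX hT p1 op0).
- by move=> op0 F u; exact: (dual_opnorm0 hX q0_gt1 growth hT A1 cutoff h1 h2 HT p1 op0).
move=> h hp; have [V [V1 V2 V3]] := H2 h hp; exists V; split => // b beta b0 hb1 hb2.
have [W [W1 W2 W3 W4]] := V3 b beta b0 hb1 hb2; exists W; split => //; apply: (le_trans W2).
by rewrite !ler_wpM2r ?CN_ge0 ?(ltW b0)// lerDr ltW.
Qed.

End summary.

(** * The theorem *)

Section assembly.
Context (R : realType) (X : ptopologicalType) (d : X -> X -> R)
  (mu : {measure set (borel X) -> \bar R}) (c K : R) (hX : homogeneous_type d mu c K).
Notation Re := complex.Re.
Notation Im := complex.Im.
Notation CM f := (cmeasurable (setT : set (borel X)) f).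

Lemma cmeasurableD (f g : X -> R[i]) : CM f -> CM g -> CM (fun x => f x + g x).
Proof.
move=> [f1 f2] [g1 g2]; split; [under eq_fun do rewrite cReD|under eq_fun do rewrite cImD]; exact: measurable_funD.
Qed.

Lemma cmeasurableM (f g : X -> R[i]) : CM f -> CM g -> CM (fun x => f x * g x).
Proof.
move=> [f1 f2] [g1 g2]; split; [under eq_fun do rewrite cReM|under eq_fun do rewrite cImM].
  by apply: measurable_funB; exact: measurable_funM.
by apply: measurable_funD; exact: measurable_funM.
Qed.

Lemma cmeasurable_sum (I : Type) (r : seq I) (f : I -> X -> R[i]) : (forall i, CM (f i)) -> CM (fun x => \sum_(i <- r) f i x).
Proof.
move=> mf; elim: r => [|i r IH].
  by under eq_fun do rewrite big_nil; split; exact: measurable_cst.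
by under eq_fun do rewrite big_cons; exact: cmeasurableD.
Qed.

Lemma CN_sum p (I : Type) (r : seq I) (f : I -> X -> R[i]) : 1 <= p -> (forall i, inLp mu p (f i)) ->
  inLp mu p (fun x => \sum_(i <- r) f i x) /\ CN mu p (fun x : borel X => \sum_(i <- r) f i x) <= \sum_(i <- r) CN mu p (f i).
Proof.
move=> p1 fp; have p0 : 0 < p := lt_le_trans ltr01 p1; elim: r => [|i r [IH1 IH2]].
  under eq_fun do rewrite big_nil; rewrite big_nil; have [z1 z2] := cLnorm0 mu p1; split => //.
  by move: z2; rewrite cLnormE// => -[->].
under eq_fun do rewrite big_cons; rewrite big_cons.
set g := fun x => \sum_(j <- r) f j x in IH1 IH2 *.
have h : inLp mu p (fun x => f i x + g x).
  have [a1 a2] := (inLpP mu _ p1).1 (fp i); have [b1 b2] := (inLpP mu _ p1).1 IH1.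
  apply/(inLpP mu _ p1); split; [under eq_fun do rewrite cReD|under eq_fun do rewrite cImD].
    by have [] := LpD p1 a1 b1.
  by have [] := LpD p1 a2 b2.
split => //; apply: le_trans (lerD (lexx _) IH2).
have [s1 s2] := LpD p1 (CN_Lp p1 (fp i)) (CN_Lp p1 IH1); apply: le_trans s2.
apply: (Lp_le p0 _ s1 _).2 => [|x]; first by have [] := CN_Lp p1 h.
by rewrite !ger0_norm ?addr_ge0 ?normc_ge0//; exact: le_normcD.
Qed.

Lemma dual_image_ae del (T : cz_form R X) F F' u : CM F' -> {ae mu, forall x : borel X, F' x = F x} ->
  dual_image d mu del T F u -> dual_image d mu del T F' u.
Proof.
move=> mF' hF [lu H]; split => // phi lphi; have [psi tpsi [i1 e1]] := H phi lphi; exists psi => //.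
have [[mpsi _] _] := tpsi.
have m1 := cmeasurableM mF' mpsi.
have h : {ae mu, forall x : borel X, F' x * psi x = F x * psi x}.
  by apply: (@filterS (borel X) _ (ae_filter_ringOfSetsType mu) _ _ _ hF) => x ->.
split; first exact: (cintegrable_ae h).
rewrite e1; apply/esym/cint_ae => //.
by move/cintegrableP: i1 => [[] ? _ [] ? _].
Qed.

Lemma bmo_parts (b : X -> R[i]) beta : loc_integrable d mu b -> (bmo_norm d mu b <= beta%:E)%E ->
  bmoR d mu beta (fun y => Re (b y)) /\ bmoR d mu beta (fun y => Im (b y)).
Proof.
move=> lb hb; have [m1 m2 _ _] := loc_parts hX lb.
have osc x r : 0 < r -> (oscillation d mu b x r <= beta%:E)%E.
  by move=> r0; apply: le_trans hb; apply: ereal_sup_ubound; exists (x, r).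
have mean x r : 0 < r -> Re (ball_mean d mu b x r) = ball_avg d mu (fun y => Re (b y)) x r /\
    Im (ball_mean d mu b x r) = ball_avg d mu (fun y => Im (b y)) x r.
  by move=> r0; rewrite /ball_mean -fmorphV cReM cImM /= !mulr0 subr0 add0r /ball_avg /mB !(mulrC (fine _)^-1).
have mn (z : R[i]) : measurable_fun setT (fun y : borel X => (Normc.normc (b y - z))%:E).
  apply/measurable_EFinP; apply: measurable_normc.
  split; [under eq_fun do rewrite cReB|under eq_fun do rewrite cImB]; exact: measurable_funB.
have avgle (f : X -> R) x r a : 0 < r -> measurable_fun setT (f : borel X -> R) ->
    (forall y, `|f y - a| <= Normc.normc (b y - ball_mean d mu b x r)) -> (avg d mu (fun y => `|f y - a|%:E) x r <= beta%:E)%E.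
  move=> r0 mf h; apply: le_trans (osc x r r0); apply: lee_wpmul2l.
    by rewrite lee_fin invr_ge0 ltW// (mB_gt0 hX).
  apply: ge0_le_integral => //; first exact: (qball_measurable hX).
  - by apply: measurable_funTS; exact: mfun_bmo.
  - exact: measurable_funTS.
  by move=> y _; rewrite lee_fin.
split; (split => //; [by move=> x r r0; have [] := lb x r r0|move=> x r r0; apply: avgle => // y]).
  by have [<- _] := mean x r r0; rewrite -cReB Re_le_normc.
by have [_ <-] := mean x r r0; rewrite -cImB Im_le_normc.
Qed.

End assembly.

Unset Implicit Arguments.

Local Open Scope complex_scope.

Theorem theorem6p1 (R : realType) (X : ptopologicalType) (d : X -> X -> R)
  (mu : {measure set (borel X) -> \bar R}) (c K : R)
  (hX : homogeneous_type d mu c K)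
  (eps0 CcK : R) (heps0 : 0 < eps0)
  (hgrowth : forall (t : R) (x : X) (j : nat), 0 < t ->
     ((c `^ (j%:R * eps0))%:E * mu (qball d x t)
        <= mu (qball d x (c ^+ j * t)%R))%E /\
     (mu (qball d x (c ^+ j * t)%R) <= (CcK ^+ j)%:E * mu (qball d x t))%E)
  (m : nat) (delta1 delta2 : 'I_m -> R) (T1 T2 : 'I_m -> cz_form R X)
  (hT1 : forall j, calderon_zygmund d mu c (delta1 j) (T1 j))
  (hT2 : forall j, calderon_zygmund d mu c (delta2 j) (T2 j))
  (hT1L2 : forall j, bounded_L2 d mu (delta1 j) (T1 j))
  (hT2L2 : forall j, bounded_L2 d mu (delta2 j) (T2 j))
  (p : R) (hp : 1 < p) :
  exists Cp : R, forall g b : X -> R[i],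
    inLp mu p g ->
    (exists2 F0, Tb_image d mu p delta1 delta2 T1 T2 (fun=> 1) g F0 &
       {ae mu, forall x, F0 x = 0}) ->
    bmo d mu b ->
    (exists F, Tb_image d mu p delta1 delta2 T1 T2 b g F) /\
    (forall F, Tb_image d mu p delta1 delta2 T1 T2 b g F ->
       inLp mu p F /\
       (cLnorm mu p F <=
          Cp%:E * (\sum_(j < m) Lp_opnorm d mu p (delta1 j) (T1 j))
                * (\sum_(j < m) Lp_opnorm d mu p (delta2 j) (T2 j))
                * cLnorm mu p g * bmo_norm d mu b)%E).
Proof.
have [c1 K1] := (c_gt1 hX, K_gt1 hX); have p1 := ltW hp; have p0 : 0 < p := lt_trans ltr01 hp.
(* The ratio of the lower growth bound, greater than 1 since c > 1 and eps0 > 0. *)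
pose q0 := c `^ eps0; have q0_gt1 : 1 < q0 by exact: powR_gt1.
have growth x t j : 0 < t -> q0 ^+ j * mB d mu x t <= mB d mu x (c ^+ j * t).
  move=> t0; have [h _] := hgrowth t x j t0; move: h.
  rewrite !(qball_mE hX) ?(cX_gt0 hX)// -EFinM lee_fin (mulrC j%:R) powRrM.
  by rewrite powR_mulrn ?powR_ge0.
have ge1 := fun j => cz_bounds_exist hX q0_gt1 growth hp (hT1 j) (hT1L2 j).
have ge2 := fun j => cz_bounds_exist hX q0_gt1 growth hp (hT2 j) (hT2L2 j).
have /choice[C1 HC1] j : exists C, 0 < C /\ cz_bounds d mu p (delta1 j) (T1 j) C by have [C ? ?] := ge1 j; exists C.
have /choice[C2 HC2] j : exists C, 0 < C /\ cz_bounds d mu p (delta2 j) (T2 j) C by have [C ? ?] := ge2 j; exists C.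
pose N1 := (\sum_(j < m) Lp_opnorm d mu p (delta1 j) (T1 j))%E.
pose N2 := (\sum_(j < m) Lp_opnorm d mu p (delta2 j) (T2 j))%E.
have o1 j : (0 <= Lp_opnorm d mu p (delta1 j) (T1 j))%E := cb_opnorm_ge0 (HC1 j).2.
have o2 j : (0 <= Lp_opnorm d mu p (delta2 j) (T2 j))%E := cb_opnorm_ge0 (HC2 j).2.
have N10 : (0 <= N1)%E by exact: sume_ge0.
have N20 : (0 <= N2)%E by exact: sume_ge0.
pose C := \sum_(j < m) C1 j * C2 j.
have C0 : 0 <= C by apply: sumr_ge0 => j _; rewrite mulr_ge0// ltW//; [case: (HC1 j)|case: (HC2 j)].
pose n1 := fine (mine N1 1%E); pose n2 := fine (mine N2 1%E).
have fmin (N : \bar R) : (0 <= N)%E -> [/\ 0 <= fine (mine N 1%E), ((fine (mine N 1%E))%:E <= N)%E & N != 0%E -> 0 < fine (mine N 1%E)].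
  move=> N0; have mf : mine N 1%E \is a fin_num.
    rewrite ge0_fin_numE; last by rewrite le_min N0 lee01.
    by apply: (@le_lt_trans _ _ 1%E); [rewrite ge_min lexx orbT|exact: ltry].
  split; [by rewrite fine_ge0// le_min N0 lee01|by rewrite fineK// ge_min lexx|move=> Nn].
  by rewrite -lte_fin fineK// lt_min lte01 andbT lt_neqAle eq_sym Nn N0.
have [n10 n1N n1p] := fmin N1 N10; have [n20 n2N n2p] := fmin N2 N20.
(* Operator norms could be +oo or 0: the minima with 1 make [n1] and [n2] finite, and when one of them is 0 (so that
   the constant is 0 by the convention on division) the operators vanish and F = 0 almost everywhere. *)
exists (C / (n1 * n2)) => g b gp [F0 [h' [u' [h'g u'h F0E]]] F00] [lb bmob].
have B0 : (0 <= bmo_norm d mu b)%E.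
  apply: (@le_trans _ _ (oscillation d mu b point 1)).
    by apply: mule_ge0; [rewrite lee_fin invr_ge0 fine_ge0|apply: integral_ge0 => y _; rewrite lee_fin normc_ge0].
  by apply: ereal_sup_ubound; exists (point, 1) => //=.
have Bfin : bmo_norm d mu b \is a fin_num by rewrite ge0_fin_numE.
pose Bn := fine (bmo_norm d mu b); have Bn0 : 0 <= Bn by exact: fine_ge0.
have bparts e : 0 < e -> bmoR d mu (Bn + e) (fun y => complex.Re (b y)) /\ bmoR d mu (Bn + e) (fun y => complex.Im (b y)).
  by move=> e0; apply: (bmo_parts hX lb); rewrite -(fineK Bfin) lee_fin lerDl ltW.
(* The h_j of an arbitrary image need not be those of the hypothesis on g: the vanishing of the sum
   is transferred to the V_j, which are attached to the h_j at hand. *)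
have sum_V h : (forall j, Lp_image d mu p (delta2 j) (T2 j) g (h j)) -> exists V : 'I_m -> X -> R[i],
   {ae mu, forall x : borel X, \sum_j V j x = 0} /\
   forall e, 0 < e -> exists W : 'I_m -> X -> R[i], forall j, [/\ inLp mu p (W j),
     CN mu p (W j : borel X -> R[i]) <= C1 j * (Bn + e) * CN mu p (h j : borel X -> R[i]),
     dual_image d mu (delta1 j) (T1 j) (fun y => b y * h j y) (fun y => W j y + b y * V j y) &
     forall u, dual_image d mu (delta1 j) (T1 j) (fun y => b y * h j y) u -> {ae mu, forall x : borel X, u x = W j x + b x * V j x}].
  move=> hg; have hp' j : inLp mu p (h j) by case: (hg j).
  have /choice[V HV] j := cb_dual (HC1 j).2 (hp' j).
  exists V; split.
    (* Uniqueness of the L^p image identifies h_j with the function of the hypothesis, and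
       uniqueness of the dual image, with b = 1, identifies u'_j with V_j. *)
    have uV j : {ae mu, forall x : borel X, u' j x = V j x}.
      have [_ H _] := HV j; apply: H; apply: dual_image_ae (u'h j); first by case: (hp' j).
      have := cb_image_unique (HC2 j).2 (hg j) (h'g j).
      by apply: (@filterS (borel X) _ (ae_filter_ringOfSetsType mu)) => x ->; rewrite mul1r.
    have h1 : {ae mu, forall x : borel X, forall j, u' j x = V j x}.
      exact: (@filter_forall (borel X) _ _ _ (ae_filter_ringOfSetsType mu)).
    apply: (@filterS2 (borel X) _ (ae_filter_ringOfSetsType mu) _ _ _ _ h1 F00) => x hx.
    by rewrite F0E => e; rewrite -[RHS]e; apply: eq_bigr => j _; rewrite hx.
  move=> e e0; have [b1 b2] := bparts e e0; have be0 : 0 < Bn + e by rewrite ltr_wpDl.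
  have /choice[W HW] j : exists W, [/\ inLp mu p W,
     CN mu p (W : borel X -> R[i]) <= C1 j * (Bn + e) * CN mu p (h j : borel X -> R[i]),
     dual_image d mu (delta1 j) (T1 j) (fun y => b y * h j y) (fun y => W y + b y * V j y) &
     forall u, dual_image d mu (delta1 j) (T1 j) (fun y => b y * h j y) u -> {ae mu, forall x : borel X, u x = W x + b x * V j x}].
    by have [_ _ H] := HV j; exact: H.
  by exists W.
split.
  have [V [_ HW]] := sum_V h' h'g; have [W HW'] := HW 1 ltr01.
  exists (fun x => \sum_j (W j x + b x * V j x)), h', (fun j x => W j x + b x * V j x); split => // j.
  by have [] := HW' j.
move=> F [h [u [hg uh FE]]]; have [V [V0 HW]] := sum_V h hg.
have FE' : F = fun x => \sum_j u j x by apply/funext.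
have mF : cmeasurable (setT : set (borel X)) F.
  by rewrite FE'; apply: cmeasurable_sum => j; have [lu _] := uh j; have [] := loc_parts hX lu.
have est e : 0 < e -> inLp mu p F /\ CN mu p (F : borel X -> R[i]) <= \sum_j C1 j * (Bn + e) * CN mu p (h j : borel X -> R[i]).
  move=> e0; have [W HW'] := HW e e0.
  have [s1 s2] := CN_sum (index_enum 'I_m) p1 (fun j => let: And4 h _ _ _ := HW' j in h).
  (* The terms b V_j add up to b times the sum of the V_j, which is 0: only the commutators W_j
     remain. *)
  have hF : {ae mu, forall x : borel X, F x = \sum_j W j x}.
    have h1 : {ae mu, forall x : borel X, forall j, u j x = W j x + b x * V j x}.
      apply: (@filter_forall (borel X) _ _ _ (ae_filter_ringOfSetsType mu)) => j.
      by have [_ _ _ H] := HW' j; apply: H.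
    apply: (@filterS2 (borel X) _ (ae_filter_ringOfSetsType mu) _ _ _ _ h1 V0) => x hx Vx.
    by rewrite FE (eq_bigr _ (fun j _ => hx j)) big_split/= -mulr_sumr Vx mulr0 addr0.
  have [F1 ->] := inLp_ae p1 s1 mF hF; split => //; apply: (le_trans s2).
  by apply: ler_sum => j _; have [] := HW' j.
have [Fp _] := est 1 ltr01; split => //.
rewrite -/N1 -/N2 !cLnormE// -(fineK Bfin) -/Bn.
have G0 := CN_ge0 mu p (g : borel X -> R[i]).
have rhs0 : (0 <= (C / (n1 * n2))%:E * N1 * N2 * (CN mu p (g : borel X -> R[i]))%:E * Bn%:E)%E.
  by rewrite !mule_ge0// lee_fin ?divr_ge0 ?mulr_ge0.
(* The estimates hold with Bn + e, which is positive even if the BMO norm is 0; here e tends to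
   0. *)
have le_of_bound M : (forall e, 0 < e -> CN mu p (F : borel X -> R[i]) <= M * (Bn + e)) -> 0 <= M -> CN mu p (F : borel X -> R[i]) <= M * Bn.
  move=> H M0; apply/ler_addgt0Pr => e e0; have M1 : 0 < M + 1 by rewrite ltr_wpDl.
  apply: (le_trans (H _ (divr_gt0 e0 M1))); rewrite mulrDr lerD2l mulrCA ger_pMr// ler_pdivrMr// mul1r; lra.
have [N1z|N1n] := eqVneq N1 0%E.
  have z j : Lp_opnorm d mu p (delta1 j) (T1 j) = 0%E.
    apply/eqP; rewrite eq_le o1 andbT -N1z /N1 (bigD1 j)//= leeDl//; exact: sume_ge0.
  have hF : {ae mu, forall x : borel X, F x = 0}.
    have h1 : {ae mu, forall x : borel X, forall j, u j x = 0}.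
      apply: (@filter_forall (borel X) _ _ _ (ae_filter_ringOfSetsType mu)) => j.
      exact: (cb_dual_opnorm0 (HC1 j).2 (z j) (uh j)).
    apply: (@filterS (borel X) _ (ae_filter_ringOfSetsType mu) _ _ _ h1) => x hx.
    by rewrite FE big1.
  have [z1 z2] := cLnorm0 mu p1; have [_ ->] := inLp_ae p1 z1 mF hF.
  by rewrite -cLnormE// z2.
have [N2z|N2n] := eqVneq N2 0%E.
  have z j : Lp_opnorm d mu p (delta2 j) (T2 j) = 0%E.
    apply/eqP; rewrite eq_le o2 andbT -N2z /N2 (bigD1 j)//= leeDl//; exact: sume_ge0.
  apply: le_trans rhs0; rewrite lee_fin; have [_ h1] := est 1 ltr01; apply: (le_trans h1).
  rewrite big1// => j _; by rewrite (cb_image_opnorm0 (HC2 j).2 (z j) (hg j)) mulr0.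
have n1g := n1p N1n; have n2g := n2p N2n.
have bd : CN mu p (F : borel X -> R[i]) <= C * CN mu p (g : borel X -> R[i]) * Bn.
  apply: le_of_bound; last by rewrite mulr_ge0.
  move=> e e0; have [_ h1] := est e e0; apply: (le_trans h1).
  rewrite /C !mulr_suml; apply: ler_sum => j _.
  have := cb_image_le (HC2 j).2 (hg j) => hj.
  have c10 : 0 <= C1 j * (Bn + e) by rewrite mulr_ge0 ?addr_ge0// ltW//; case: (HC1 j).
  apply: (le_trans (ler_wpM2l c10 hj)); rewrite le_eqVlt; apply/orP; left; apply/eqP; ring.
apply: (@le_trans _ _ ((C * CN mu p (g : borel X -> R[i]) * Bn)%:E)); first by rewrite lee_fin.
rewrite !EFinM; apply: lee_wpmul2r; first by rewrite lee_fin.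
apply: lee_wpmul2r; first by rewrite lee_fin.
(* The division in the constant is undone, [n1] and [n2] being positive and at most the two sums of
   operator norms. *)
apply: (@le_trans _ _ ((C / (n1 * n2))%:E * n1%:E * n2%:E)%E).
  by rewrite -!EFinM lee_fin -mulrA divfK// gt_eqF// mulr_gt0.
have q0' : (0 <= (C / (n1 * n2))%:E)%E by rewrite lee_fin divr_ge0 ?mulr_ge0.
apply: lee_pmul => //; first by rewrite mule_ge0// lee_fin.
exact: lee_wpmul2l.
Qed.
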